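(* There exists a function $f:\mathbb{R}^+\to[0,1]$ satisfying $$f(d)=\frac{1}{2}de^{-d}+e^{-d}+\left(\frac{1}{12}d^6+\frac{1}{4}d^5+\frac{1}{4}d^4+\frac{1}{12}d^3\right)e^{-3d}+O\left(d^{12}e^{-4d}\right)$$ such that the following holds. Let $p=p(n)$ satisfy $20\le np\le 0.4\log n$, write $d=d(n):=np$, and let $G\sim G(n,p)$. Then with high probability (i.e. with probability tending to $1$ as $n\to\infty$), $\mu(G)=(1+o(1))\cdot f(d)\cdot n$.
   Context: $G(n,p)$ is the binomial random graph on $n$ vertices in which each pair is an edge independently with probability $p$. For a graph $G$, $\mu(G)$ (the completion number of $G$ with respect to Hamiltonicity) is the minimum number of edges whose addition to $G$ results in a Hamiltonian graph; equivalently, the minimum number of paths in a cover of $V(G)$ by vertex-disjoint paths (paths of length $0$ allowed). Logarithms are natural. *)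

(* Defs.v *)
From HB Require Import structures.
From mathcomp Require Import all_boot all_order all_algebra.
From mathcomp Require Import all_classical all_reals all_analysis.

Set Implicit Arguments.
Unset Strict Implicit.
Unset Printing Implicit Defensive.

Import Order.TTheory GRing.Theory Num.Theory.
Import numFieldNormedType.Exports.
Local Open Scope ring_scope.

Section Graphs.
Variable T : finType.

Definition vpairs : {set {set T}} := [set e : {set T} | #|e| == 2%N].

(* A simple graph with vertex set T is given by its edge set. *)
Record sgraph := SGraph {
  edges : {set {set T}};
  _ : edges \subset vpairs }.
HB.instance Definition _ := [isSub for edges].
HB.instance Definition _ := [Finite of sgraph by <:].

(* Adjacency: [set x; x] is a singleton, hence never an edge of an sgraph. *)
Definition adj (E : {set {set T}}) : rel T := [rel x y | [set x; y] \in E].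

(* A Hamilton cycle has at least 3 vertices, so K_1 and K_2 have none. *)
Definition hamiltonian (E : {set {set T}}) : bool :=
  (2 < #|T|)%N && [exists c : #|T|.-tuple T, uniq c && cycle (adj E) c].

Definition completes (G : sgraph) (F : {set {set T}}) : bool :=
  (F \subset vpairs :\: edges G) && hamiltonian (edges G :|: F).

(* When #|T| >= 3 the default [vpairs :\: edges G] is itself a completion (to
   the complete graph), so this is a true minimum; when #|T| < 3 there is no
   completion and the value is meaningless. *)
Definition completion_number (G : sgraph) : nat :=
  #|[arg min_(F < vpairs :\: edges G | completes G F) #|F| ]|.

End Graphs.

Section Gnp.
Variables (R : realType) (n : nat) (p : R).

Definition gnp_mass (G : sgraph 'I_n) : R :=
  \prod_(e in vpairs 'I_n) (if e \in edges G then p else 1 - p).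

(* Probability, under G(n,p), of a graph property; meaningful for 0 <= p <= 1. *)
Definition gnp_prob (A : pred (sgraph 'I_n)) : R :=
  \sum_(G : sgraph 'I_n | A G) gnp_mass G.

End Gnp.

(* Main.v *)
(* Write mu for the completion number. It is 1-Lipschitz in the edge set, so by the Efron-Stein
   inequality mu is concentrated around its mean, and everything reduces to E mu(G(n, d/n)) / n;
   f(d) is its limit as n grows with d fixed.

   Existence of the limit. After deleting one edge from every short cycle, n - mu is up to a small
   relative error the size of a maximum 2-matching, and, again up to a small error because the
   girth is large, 2-matching duality holds without parity terms. Hence n - mu is approximately the
   maximum of the concave function x |-> sum_e x_e - sum_v (x_v - 2)_+ over [0,1]^E, which boundedly
   many projected subgradient steps approximate. The iterates are local functions of the graph, so
   their mean converges.

   Expansion of f. By duality mu is about the maximum over vertex sets A of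
   sum_(a in A) (1 - deg a / 2) + sum_v (d_A(v) - 2)_+ / 2. The set of vertices of degree at most 2
   gives the lower bound: the terms e^-d and d e^-d / 2 come from degrees 0 and 1, and the e^-3d
   term from vertices with three neighbours of degree at most 2. A minimal optimal A splits into
   atoms, and those with at least four vertices contribute only O(d^12 e^-4d).

   Growing d. For d up to 0.4 log n the mean is (1 + o(1)) (d / 2) e^-d n: degree-one vertices give
   the lower bound. For the upper bound, route forced paths through the vertices of small degree,
   join the rest by Posa rotations, and close up with the boosters supplied by n^-2-sparse rounds of
   fresh edges. For bounded d the convergence is uniform because the mean is 1-Lipschitz in d. *)

Require Import Defs.
From HB Require Import structures.
From mathcomp Require Import all_boot all_order all_algebra.
From mathcomp Require boolp.
From mathcomp Require Import reals exp topology normedtype sequences.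
From mathcomp Require Import ring lra zify.

Set Implicit Arguments.
Unset Strict Implicit.
Unset Printing Implicit Defensive.

Import Order.TTheory GRing.Theory Num.Theory.

(** * Random subsets of a finite set *)

(** The local approximation of mu / n has an additive error, which is worthless once f(d) tends to
    0; this is why growing d needs a separate upper bound. There the sprinkled rounds need only
    succeed with a probability bounded below: mu has standard deviation at most sqrt(d n / 2), so a
    value taken with such a probability cannot lie far below the mean. The same deviation must be
    o(f(d) n), so n e^-2d must grow fast enough, which 0.4 < 1/2 ensures.

    The obstacle to the expansion is an upper bound valid for all dual sets at once. Passing to a
    smallest optimal set makes it sparse: each of its vertices has at most one neighbour that is not
    a hub, a hub being a vertex with at least three neighbours in the set. The set is then split
    along hubs into independent pieces, and only triples around a single hub reach the order e^-3d.
    Each such triple gains 1/2, and a vertex has on average d^3 / 3! triples of neighbours, each low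
    with weight (1 + d)^3 e^-3d, whence the coefficient 1/12. *)

Section Expectation.
Local Open Scope ring_scope.
Variables (R : realType) (E : finType).
Implicit Types (p q : R) (A B D S : {set E}) (f g h : {set E} -> R).

(** Expectation over a random subset of [D] that keeps each element independently with probability
    [p]. Keeping the ground set explicit turns independence into identities on disjoint ground sets
    and allows induction by deleting one element. *)
Definition Ex p D h : R :=
  \sum_(A : {set E} | A \subset D) p ^+ #|A| * (1 - p) ^+ #|D :\: A| * h A.

Definition Pr p D (P : {set E} -> bool) : R := Ex p D (fun A => (P A)%:R).

Lemma Ex_set0 p h : Ex p set0 h = h set0.
Proof.
rewrite /Ex (big_pred1 set0) => [|A]; last by rewrite subset0.
by rewrite set0D cards0 !expr0 !mul1r.
Qed.

Lemma eq_Ex p D g h : (forall A, A \subset D -> g A = h A) -> Ex p D g = Ex p D h.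
Proof. by move=> gh; apply: eq_bigr => A /gh ->. Qed.

(** Conditioning on whether [e] is kept; with [setD1_ind] this is the induction behind most of the
    identities below. *)
Lemma ExD1 p D h e : e \in D ->
  Ex p D h = p * Ex p (D :\ e) (fun A => h (e |: A)) + (1 - p) * Ex p (D :\ e) h.
Proof.
move=> eD; rewrite /Ex (bigID (fun A => e \in A)) /= !mulr_sumr; congr (_ + _).
  rewrite (reindex_onto (fun A => e |: A) (fun A => A :\ e)) /=; last first.
    by move=> A /andP[_ eA]; rewrite setD1K.
  apply: eq_big => [A|A].
    rewrite subUset sub1set eD setU11 andbT /= subsetD1.
    case: (boolP (e \in A)) => eA /=.
      by rewrite andbF; apply/negbTE/nandP; right; apply/eqP => /setP/(_ e);
        rewrite !inE eqxx eA.
    by rewrite setU1K // eqxx !andbT.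
  case/andP=> /andP[_ _] /eqP AE.
  have eA : e \notin A by rewrite -AE !inE eqxx.
  have -> : D :\: (e |: A) = (D :\ e) :\: A.
    by apply/setP => x; rewrite !inE; case: (x == e); rewrite ?andbF.
  by rewrite cardsU1 eA exprS !mulrA.
apply: eq_big => [A|A]; first by rewrite subsetD1.
case/andP=> AD eA.
have -> : D :\: A = e |: ((D :\ e) :\: A).
  by apply/setP => x; rewrite !inE; have [->|] := eqVneq x e; rewrite ?eA ?eD.
by rewrite cardsU1 !inE eqxx andbF /= exprS; ring.
Qed.

Lemma setD1_ind (P : {set E} -> Prop) : P set0 ->
  (forall D e, e \in D -> P (D :\ e) -> P D) -> forall D, P D.
Proof.
move=> P0 PS D; have [n] := ubnP #|D|; elim: n D => // n IH D.
have [->//|[e eD]] := set_0Vmem D.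
by rewrite (cardsD1 e) eD ltnS => Dn; apply: (PS _ e) => //; apply: IH.
Qed.

Lemma Ex_cst p D (c : R) : Ex p D (fun=> c) = c.
Proof.
elim/setD1_ind: D => [|D e eD IH]; first by rewrite Ex_set0.
by rewrite (ExD1 _ _ eD) IH; ring.
Qed.

Lemma ExDf p D g h : Ex p D (fun A => g A + h A) = Ex p D g + Ex p D h.
Proof. by rewrite /Ex -big_split; apply: eq_bigr => A _; rewrite mulrDr. Qed.

Lemma ExZl p D (c : R) h : Ex p D (fun A => c * h A) = c * Ex p D h.
Proof. by rewrite /Ex mulr_sumr; apply: eq_bigr => A _; rewrite mulrCA. Qed.

Lemma ExN p D h : Ex p D (fun A => - h A) = - Ex p D h.
Proof. by rewrite -mulN1r -ExZl; apply: eq_Ex => A _; rewrite mulN1r. Qed.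

Lemma ExB p D g h : Ex p D (fun A => g A - h A) = Ex p D g - Ex p D h.
Proof. by rewrite ExDf ExN. Qed.

Lemma Ex_sum p D (I : Type) (r : seq I) (Q : pred I) (F : I -> {set E} -> R) :
  Ex p D (fun A => \sum_(i <- r | Q i) F i A) = \sum_(i <- r | Q i) Ex p D (F i).
Proof.
rewrite /Ex exchange_big /=; apply: eq_bigr => A _.
by rewrite mulr_sumr.
Qed.

Lemma le_Ex p D g h : 0 <= p <= 1 -> (forall A, A \subset D -> g A <= h A) ->
  Ex p D g <= Ex p D h.
Proof.
move=> /andP[p0 p1] gh; apply: ler_sum => A AD.
by rewrite ler_wpM2l ?gh // mulr_ge0 // exprn_ge0 // subr_ge0.
Qed.

Lemma Ex_ge0 p D h : 0 <= p <= 1 -> (forall A, A \subset D -> 0 <= h A) ->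
  0 <= Ex p D h.
Proof. by move=> p01 h0; rewrite -(Ex_cst p D 0); apply: le_Ex. Qed.

Lemma Ex_split p D1 D2 h : [disjoint D1 & D2] ->
  Ex p (D1 :|: D2) h = Ex p D1 (fun A => Ex p D2 (fun B => h (A :|: B))).
Proof.
elim/setD1_ind: D1 h => [|D1 e eD IH] h dis.
  by rewrite set0U Ex_set0; apply: eq_Ex => B _; rewrite set0U.
have eD2 : e \notin D2 by rewrite (disjointFr dis).
rewrite (@ExD1 _ (D1 :|: D2) _ e) ?inE ?eD // (ExD1 _ _ eD).
have -> : (D1 :|: D2) :\ e = D1 :\ e :|: D2.
  by apply/setP => x; rewrite !inE; have [->|] := eqVneq x e; rewrite ?(negbTE eD2).
have dis' : [disjoint D1 :\ e & D2] by apply: disjointWl dis; rewrite subsetDl.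
rewrite !IH //; congr (_ * _ + _).
by apply: eq_Ex => A _; apply: eq_Ex => B _; rewrite setUA.
Qed.

(** In the union of two independent random subsets an element is missed with probability (1 - p)(1 -
    q). This serves both for sprinkling fresh edges and for the monotone coupling of two
    densities. *)
Lemma Ex_union p q D h :
  Ex q D (fun B => Ex p D (fun A => h (A :|: B))) = Ex (1 - (1 - p) * (1 - q)) D h.
Proof.
elim/setD1_ind: D h => [|D e eD IH] h; first by rewrite !Ex_set0 setU0.
rewrite (ExD1 _ _ eD) [RHS](ExD1 _ _ eD) -!IH.
set a := Ex q _ _; set b := Ex q _ _; set c := Ex q _ _; set d := Ex q _ _.
have -> : a = c.
  apply: eq_Ex => B BD; rewrite (ExD1 _ _ eD).
  under eq_Ex => A _ do rewrite setUACA setUid.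
  under [X in _ + _ * X]eq_Ex => A _ do rewrite setUCA.
  by rewrite -mulrDl addrC subrK mul1r.
have -> : b = p * c + (1 - p) * d.
  rewrite /b; under eq_Ex => B _ do rewrite (ExD1 _ _ eD).
  rewrite ExDf !ExZl; congr (_ * _ + _); apply: eq_Ex => B _; apply: eq_Ex => A _.
  by rewrite setUA.
ring.
Qed.

Lemma Ex_restrict p D S f : S \subset D -> Ex p D (fun A => f (A :&: S)) = Ex p S f.
Proof.
move=> SD; rewrite -{1}(setID D S) (setIidPr SD) Ex_split; last first.
  by rewrite -setI_eq0; apply/eqP/setP => x; rewrite !inE; case: (x \in S).
apply: eq_Ex => A AS; under eq_Ex => B BD.
  have -> : (A :|: B) :&: S = A.
    rewrite setIUl (setIidPl AS) (_ : B :&: S = set0) ?setU0 //.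
    apply/eqP; rewrite setI_eq0; apply: (disjointWl BD).
    by rewrite -setI_eq0; apply/eqP/setP => x; rewrite !inE; case: (x \in S); rewrite ?andbF.
  over.
by rewrite Ex_cst.
Qed.

Lemma Ex_prod p D S1 S2 f g : S1 \subset D -> S2 \subset D -> [disjoint S1 & S2] ->
  Ex p D (fun A => f (A :&: S1) * g (A :&: S2)) = Ex p S1 f * Ex p S2 g.
Proof.
move=> S1D S2D dis.
transitivity (Ex p (S1 :|: S2) (fun A => f (A :&: S1) * g (A :&: S2))).
  rewrite -(@Ex_restrict _ D (S1 :|: S2)) ?subUset ?S1D //.
  apply: eq_Ex => A _; congr (f _ * g _); apply/setP => x; rewrite !inE.
    by case: (x \in A); case: (x \in S1); case: (x \in S2).
  by case: (x \in A); case: (x \in S1); case: (x \in S2).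
rewrite Ex_split // mulrC -ExZl; apply: eq_Ex => A AS.
rewrite mulrC -ExZl; apply: eq_Ex => B BS.
have /eqP AS2 : A :&: S2 == set0 by rewrite setI_eq0; apply: (disjointWl AS).
have /eqP BS1 : B :&: S1 == set0.
  by rewrite setI_eq0; apply: (disjointWl BS); rewrite disjoint_sym.
by rewrite !setIUl (setIidPl AS) (setIidPl BS) AS2 BS1 setU0 set0U.
Qed.

Lemma Ex_bigprod p D (I : eqType) (s : seq I) (S : I -> {set E}) (f : I -> {set E} -> R) :
  uniq s -> (forall i, i \in s -> S i \subset D) ->
  (forall i j, i \in s -> j \in s -> i != j -> [disjoint S i & S j]) ->
  Ex p D (fun A => \prod_(i <- s) f i (A :&: S i)) = \prod_(i <- s) Ex p (S i) (f i).
Proof.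
elim: s => [|i s IH] /=; first by move=> _ _ _; under eq_Ex do rewrite big_nil;
  rewrite Ex_cst big_nil.
case/andP=> is_ us SD dis; rewrite big_cons -IH //; first last.
- by move=> j k js ks; apply: dis; rewrite inE ?js ?ks orbT.
- by move=> j js; apply: SD; rewrite inE js orbT.
have SUD : \bigcup_(j <- s) S j \subset D.
  rewrite big_tnth; apply/bigcupsP => k _; apply: SD.
  by rewrite inE mem_tnth orbT.
have sub j : j \in s -> S j \subset \bigcup_(j <- s) S j.
  by move=> js; rewrite (big_rem j) //= subsetUl.
have di : [disjoint S i & \bigcup_(j <- s) S j].
  rewrite big_tnth -setI_eq0; apply/eqP/setP => x; rewrite !inE.
  apply/negbTE/negP => /andP[xi /bigcupP[k _ xk]].
  have ks := mem_tnth k (in_tuple s).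
  have ik : i != tnth (in_tuple s) k by apply: contraNneq is_ => ->.
  have := dis i (tnth (in_tuple s) k); rewrite !inE eqxx ks orbT => /(_ isT isT ik) /disjointFr.
  by move=> /(_ _ xi); rewrite xk.
pose F A := \prod_(j <- s) f j (A :&: S j).
have FE A : F (A :&: \bigcup_(j <- s) S j) = F A.
  rewrite /F; apply: eq_big_seq => j js; congr (f j _).
  by rewrite -setIA (setIidPr (sub j js)).
have -> : Ex p D F = Ex p (\bigcup_(j <- s) S j) F.
  by rewrite -(Ex_restrict p F SUD); apply: eq_Ex => A _; rewrite FE.
rewrite -(Ex_prod p (f i) F (SD _ (mem_head _ _)) SUD di).
by apply: eq_Ex => A _; rewrite big_cons FE.
Qed.

Lemma Ex_point p S B : B \subset S ->
  Ex p S (fun A => (A == B)%:R) = p ^+ #|B| * (1 - p) ^+ #|S :\: B|.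
Proof.
move=> BS; rewrite /Ex (bigD1 B) //= eqxx mulr1 big1 ?addr0 // => A /andP[_ /negbTE ->].
by rewrite mulr0.
Qed.

Lemma Pr_subset p D B : B \subset D -> Pr p D (fun A => B \subset A) = p ^+ #|B|.
Proof.
move=> BD; transitivity (Ex p B (fun A => (A == B)%:R)); last first.
  by rewrite Ex_point // setDv cards0 expr0 mulr1.
rewrite /Pr -(Ex_restrict p (fun A => (A == B)%:R) BD); apply: eq_Ex => A _.
by rewrite (sameP setIidPr eqP).
Qed.

Lemma Pr_card p S i : Pr p S (fun A => #|A| == i) =
  'C(#|S|, i)%:R * p ^+ i * (1 - p) ^+ (#|S| - i).
Proof.
rewrite /Pr /Ex (eq_bigr (fun A => if #|A| == i then p ^+ i * (1 - p) ^+ (#|S| - i) else 0)).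
  rewrite -big_mkcondr /= big_const.
  rewrite (_ : #|_| = #|[set A : {set E} | A \subset S & #|A| == i]|); last first.
    by apply: eq_card => A; rewrite !inE.
  by rewrite cards_draws iter_addr addr0 -mulrA mulr_natl.
move=> A AS; case: eqP => [Ai|]; last by rewrite mulr0.
by rewrite mulr1 cardsD (setIidPr AS) Ai.
Qed.

Lemma le_Pr p D (P Q : {set E} -> bool) : 0 <= p <= 1 ->
  (forall A, A \subset D -> P A -> Q A) -> Pr p D P <= Pr p D Q.
Proof.
move=> p01 PQ; apply: le_Ex => // A AD; rewrite ler_nat.
by case: (P A) (PQ A AD) => // ->.
Qed.

Lemma Pr_ge0 p D P : 0 <= p <= 1 -> 0 <= Pr p D P.
Proof. by move=> p01; apply: Ex_ge0 => // A _; rewrite ler0n. Qed.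

Lemma Pr_le1 p D P : 0 <= p <= 1 -> Pr p D P <= 1.
Proof. by move=> p01; rewrite -(Ex_cst p D 1); apply: le_Ex => // A _; rewrite lern1 leq_b1. Qed.

Lemma PrC p D (P : {set E} -> bool) : Pr p D (fun A => ~~ P A) = 1 - Pr p D P.
Proof.
rewrite -[X in X - _](Ex_cst p D 1) /Pr -ExB; apply: eq_Ex => A _.
by case: (P A); rewrite /= ?subrr ?subr0.
Qed.

Lemma Pr_or p D (P Q : {set E} -> bool) : 0 <= p <= 1 ->
  Pr p D (fun A => P A || Q A) <= Pr p D P + Pr p D Q.
Proof.
move=> p01; rewrite /Pr -ExDf; apply: le_Ex => // A _; rewrite -natrD ler_nat.
by case: (P A); case: (Q A).
Qed.

Lemma Pr_exists p D (I : finType) (Q : pred I) (P : I -> {set E} -> bool) : 0 <= p <= 1 ->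
  Pr p D (fun A => [exists (i | Q i), P i A]) <= \sum_(i | Q i) Pr p D (P i).
Proof.
move=> p01; rewrite /Pr -Ex_sum; apply: le_Ex => // A _.
case: existsP => [[i /andP[Qi Pi]]|_]; last by apply: sumr_ge0 => i _; rewrite ler0n.
by rewrite (bigD1 i) //= Pi lerDl; apply: sumr_ge0 => j _; rewrite ler0n.
Qed.

Lemma markov_Pr p D h (c : R) : 0 <= p <= 1 -> 0 < c ->
  (forall A, A \subset D -> 0 <= h A) ->
  Pr p D (fun A => c <= h A) <= Ex p D h / c.
Proof.
move=> p01 c0 h0; rewrite ler_pdivlMr // mulrC -ExZl; apply: le_Ex => // A AD.
by case: (leP c (h A)) => ch; rewrite ?mulr1 // mulr0 h0.
Qed.

(** Each element of [D] contributes at most the variance p (1 - p) of its indicator times [L ^+ 2];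
    the factor 1 - p is dropped. *)
Lemma efron_stein p D h (L : R) : 0 <= p <= 1 ->
  (forall A e, A \subset D -> e \in D -> `|h (e |: A) - h A| <= L) ->
  Ex p D (fun A => h A ^+ 2) - Ex p D h ^+ 2 <= #|D|%:R * (p * L ^+ 2).
Proof.
move=> p01; elim/setD1_ind: D h => [|D e eD IH] h hL.
  by rewrite !Ex_set0 subrr cards0 mul0r.
have sub A : A \subset D :\ e -> A \subset D by move/subset_trans; apply; rewrite subsetDl.
have H0 := IH h (fun A e' AD e'D => hL A e' (sub _ AD) (subsetP (subsetDl _ _) _ e'D)).
have H1 : Ex p (D :\ e) (fun A => h (e |: A) ^+ 2) - Ex p (D :\ e) (fun A => h (e |: A)) ^+ 2
   <= #|D :\ e|%:R * (p * L ^+ 2).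
  apply: IH => A e' AD; rewrite inE => /andP[_ e'D].
  by rewrite setUCA; apply: hL => //; rewrite subUset sub1set eD sub.
have H2 : `|Ex p (D :\ e) (fun A => h (e |: A)) - Ex p (D :\ e) h| <= L.
  rewrite -ExB ler_norml; apply/andP; split.
    by rewrite -(Ex_cst p (D :\ e) (- L)); apply: le_Ex => // A /sub AD;
      have := hL A e AD eD; rewrite ler_norml => /andP[].
  by rewrite -(Ex_cst p (D :\ e) L); apply: le_Ex => // A /sub AD;
      have := hL A e AD eD; rewrite ler_norml => /andP[].
rewrite (ExD1 _ _ eD) (ExD1 p h eD) (cardsD1 e D) eD /= natrD.
move: H0 H1 H2; set v0 := Ex _ _ _; set m0 := Ex _ _ _; set v1 := Ex _ _ _; set m1 := Ex _ _ _.
set k := _%:R; move=> H0 H1 H2.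
have H3 : (m1 - m0) ^+ 2 <= L ^+ 2.
  by rewrite -real_normK ?num_real // ler_sqr ?nnegrE // (le_trans _ H2).
case/andP: p01 => p0 p1.
have q0 : 0 <= 1 - p by rewrite subr_ge0.
have H4 := ler_wpM2l p0 H1; have H5 := ler_wpM2l q0 H0.
have H6 := ler_wpM2l p0 (ler_wpM2l q0 H3).
have H7 : 0 <= p * (p * L ^+ 2) by rewrite mulr_ge0 // mulr_ge0 // sqr_ge0.
(* Law of total variance when [e] is exposed: the mean of the conditional variances plus p (1 - p)
   times the squared gap between the conditional means. *)
have -> : p * v1 + (1 - p) * v0 - (p * m1 + (1 - p) * m0) ^+ 2 =
  p * (v1 - m1 ^+ 2) + (1 - p) * (v0 - m0 ^+ 2) + p * ((1 - p) * (m1 - m0) ^+ 2) by ring.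
have -> : (1 + k) * (p * L ^+ 2) =
  p * (k * (p * L ^+ 2)) + (1 - p) * (k * (p * L ^+ 2)) + p * ((1 - p) * L ^+ 2)
  + p * (p * L ^+ 2) by ring.
by apply: ler_wpDr => //; apply: lerD => //; apply: lerD.
Qed.

Lemma chebyshev_Pr p D h (L t : R) : 0 <= p <= 1 -> 0 < t ->
  (forall A e, A \subset D -> e \in D -> `|h (e |: A) - h A| <= L) ->
  Pr p D (fun A => t <= `|h A - Ex p D h|) <= #|D|%:R * (p * L ^+ 2) / t ^+ 2.
Proof.
move=> p01 t0 hL; set m := Ex p D h.
apply: le_trans (_ : Pr p D (fun A => t ^+ 2 <= (h A - m) ^+ 2) <= _).
  apply: le_Pr => // A _ tm; rewrite -[(h A - m) ^+ 2]real_normK ?num_real //.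
  by rewrite ler_sqr ?nnegrE // ltW.
apply: le_trans (markov_Pr p01 (exprn_gt0 2 t0) (fun A _ => sqr_ge0 _)) _.
rewrite ler_pM2r ?invr_gt0 ?exprn_gt0 //; apply: le_trans (efron_stein p01 hL).
rewrite le_eqVlt; apply/orP; left; apply/eqP.
transitivity (Ex p D (fun A => (h A ^+ 2 + - (2 * m) * h A) + m ^+ 2)).
  by apply: eq_Ex => A _; ring.
by rewrite !ExDf ExZl Ex_cst -/m; ring.
Qed.

End Expectation.

(** * The completion number *)

Section Pairs.
Variable T : eqType.
Implicit Types (e : rel T) (s : seq T).

(** Cutting a nonempty [s] at its breaks leaves paths, one more than there are breaks; linear orders
    of the vertices encode path covers in this way. *)
Definition breaks e s : nat := count (fun ab => ~~ e ab.1 ab.2) (zip s (behead s)).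

Definition cbreaks e s : nat := count (fun ab => ~~ e ab.1 ab.2) (zip s (rot 1 s)).

Lemma breaks_cons e x y s : breaks e [:: x, y & s] = (~~ e x y + breaks e (y :: s))%N.
Proof. by []. Qed.

Lemma breaks_cat e x s y s' :
  breaks e (rcons s x ++ y :: s') = (breaks e (rcons s x) + ~~ e x y + breaks e (y :: s'))%N.
Proof.
elim: s => [|a s IH] /=; first by rewrite breaks_cons.
case: s IH => [|b s] IH /=; rewrite !breaks_cons.
  by rewrite [breaks e [:: x]]/breaks /= addn0 addnA.
by move: IH; rewrite /= => ->; rewrite !addnA.
Qed.

Lemma breaks_rev e s : symmetric e -> breaks e (rev s) = breaks e s.
Proof.
move=> es; elim: s => // x [|y s] IH //.
rewrite breaks_cons -IH !rev_cons -cats1 breaks_cat /= {3}/breaks /= addn0 es.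
by rewrite addnC.
Qed.

Lemma cbreaks_cons e x s : cbreaks e (x :: s) = breaks e (x :: rcons s x).
Proof.
rewrite /cbreaks /breaks /rot /= drop0 take0 cats1.
suff H (y z : T) t : zip (y :: t) (rcons t z) = zip (y :: rcons t z) (rcons t z) by rewrite H.
by elim: t y => //= a t IH y; rewrite IH.
Qed.

Lemma cbreaks_le e s : (cbreaks e s <= (breaks e s).+1)%N.
Proof.
case: s => // x s; rewrite cbreaks_cons -rcons_cons.
case/lastP: s => [|s y]; first by rewrite /breaks /=; case: (e x x).
rewrite -!rcons_cons -[rcons (rcons _ _) _]cats1 breaks_cat addn0 -addn1.
by rewrite leq_add2l leq_b1.
Qed.

Lemma all_zip_cycle e s : all (fun ab => e ab.1 ab.2) (zip s (rot 1 s)) = cycle e s.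
Proof.
case: s => // x s; rewrite /rot /= drop0 take0 cats1.
suff H (y z : T) t : all (fun ab => e ab.1 ab.2) (zip (y :: t) (rcons t z)) = path e y (rcons t z).
  exact: H.
by elim: t y => //= a t IH y; rewrite IH.
Qed.

Lemma uniq_cycle_neq s : (1 < size s)%N -> uniq s -> cycle [rel x y | x != y] s.
Proof.
case: s => // x s s1; rewrite uniq_pairwise => Hp /=.
rewrite rcons_path; apply/andP; split.
  by have := pairwise_sorted Hp.
case/lastP: s s1 Hp => // s y _; rewrite last_rcons /= => /andP[/allP/(_ y)].
by rewrite mem_rcons mem_head eq_sym => /(_ isT).
Qed.

End Pairs.

Section CycleEdges.
Variables (T : finType) (c : seq T).
Hypotheses (uc : uniq c) (cT : forall v, v \in c) (T3 : 2 < #|T|).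

(** On at least three vertices the two cycle neighbours of a vertex are distinct and so are the
    pairs [[set v; next c v]]; the degree counts below rest on this. *)
Lemma next_next_neq v : next c (next c v) != v.
Proof.
have szc : size c = #|T|.
  by rewrite -(card_uniqP uc); apply: eq_card => x; rewrite cT.
have [i s cs] := rot_to (cT v).
rewrite -!(next_rot i uc) cs.
have : size (v :: s) = #|T| by rewrite -cs size_rot.
have : uniq (v :: s) by rewrite -cs rot_uniq.
case: s {cs} => [|a [|b s]] /= us sz; [by move: T3; rewrite -sz..|].
rewrite eqxx; case/and3P: us; rewrite !inE !negb_or => /and3P[va vb _] _ _.
by rewrite eqxx [a == v]eq_sym (negbTE va) eq_sym.
Qed.

Lemma next_prev_neq v : next c v != prev c v.
Proof. by apply: contra_neq (next_next_neq v) => ->; rewrite next_prev. Qed.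

Lemma sum_next_edge (F : {set {set T}}) : \sum_v ([set v; next c v] \in F : nat) <= #|F|.
Proof.
rewrite (_ : \sum_v _ = #|[set v | [set v; next c v] \in F]|); last first.
  by rewrite -sum1_card [RHS]big_mkcond /=; apply: eq_bigr => v _; rewrite inE; case: (_ \in F).
rewrite -(card_in_imset (f := fun v => [set v; next c v])).
  by apply/subset_leq_card/subsetP => f /imsetP[v]; rewrite inE => vF ->.
move=> v w _ _ /setP vw; have := vw v; have := vw w; rewrite !inE !eqxx /=.
rewrite [w == v]eq_sym; case: (eqVneq v w) => //= vw' /eqP wv /esym/eqP; rewrite wv => vn.
by have := next_next_neq v; rewrite -vn eqxx.
Qed.

Lemma sum_prev_edge (F : {set {set T}}) : \sum_v ([set v; prev c v] \in F : nat) <= #|F|.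
Proof.
rewrite (reindex_inj (can_inj (prev_next uc))) /=; apply: leq_trans (sum_next_edge F).
by apply/eq_leq/eq_bigr => v _; rewrite prev_next // setUC.
Qed.

End CycleEdges.

Section CompletionNumber.
Variable T : finType.
Implicit Types (E F : {set {set T}}) (A : {set T}) (v u : T).

Definition nbr E v : {set T} := [set u | adj E v u].

Definition degree E v : nat := #|nbr E v|.

Lemma adj_sym E : symmetric (adj E).
Proof. by move=> x y; rewrite /adj /= setUC. Qed.

Lemma adj_neq E x y : E \subset vpairs T -> adj E x y -> x != y.
Proof.
move=> /subsetP sE /sE; rewrite inE; apply: contraTneq => ->.
by rewrite setUid cards1.
Qed.

Lemma pair_vpairs x y : ([set x; y] \in vpairs T) = (x != y).
Proof. by rewrite inE cards2; case: (x == y). Qed.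

(* The completion number as a function of the edge set; 0 on sets which are not graphs. *)
Definition mu E : nat := if insub E is Some G then @completion_number T G else 0%N.

Hypothesis T3 : (2 < #|T|)%N.

Lemma complete_hamiltonian : hamiltonian (vpairs T).
Proof.
rewrite /hamiltonian T3; apply/existsP.
have /eqP sz : size (enum T) == #|T| by rewrite -cardE.
exists (Tuple (introT eqP sz)); rewrite /= enum_uniq /=.
have := @uniq_cycle_neq _ (enum T); rewrite sz enum_uniq => /(_ (ltnW T3) isT).
case: (enum T) => //= x s; apply: sub_path => a b /=.
by rewrite /adj /= pair_vpairs.
Qed.

(** The minimality clause admits sets [F'] that meet [E], since removing [E] from [F'] only shrinks
    it; this spares disjointness proofs in later upper bounds. *)
Lemma mu_spec E : E \subset vpairs T ->
  exists F, [/\ F \subset vpairs T :\: E, hamiltonian (E :|: F), #|F| = mu E &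
    forall F', F' \subset vpairs T -> hamiltonian (E :|: F') -> (mu E <= #|F'|)%N].
Proof.
move=> sE; rewrite /mu; case: insubP => [G _ GE|]; last by rewrite sE.
rewrite /completion_number; case: arg_minnP.
  rewrite /completes subxx /=; have -> : edges G :|: (vpairs T :\: edges G) = vpairs T.
    by rewrite setDE setUIr setUCr setIT; apply/setUidPr; rewrite -[edges G]/(val G) GE.
  exact: complete_hamiltonian.
move=> F /andP[]; rewrite -[edges G]/(val G) GE => FE hF minF; exists F; split=> // F' sF' hF'.
apply: leq_trans (minF (F' :\: E) _) _; last by rewrite subset_leq_card // subsetDl.
rewrite /completes -[edges G]/(val G) GE setSD //=.
suff -> : E :|: (F' :\: E) = E :|: F' by [].
by apply/setP => x; rewrite !inE; case: (x \in E).
Qed.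

Lemma mu_le_cbreaks E (s : seq T) : E \subset vpairs T -> uniq s -> size s = #|T| ->
  (mu E <= cbreaks (adj E) s)%N.
Proof.
move=> sE us szs; have [F0 [_ _ _ minF]] := mu_spec sE.
pose ps := [seq ab <- zip s (rot 1 s) | ~~ adj E ab.1 ab.2].
pose F := [set:: [seq [set ab.1; ab.2] | ab <- ps]].
have neq ab : ab \in zip s (rot 1 s) -> ab.1 != ab.2.
  have := @uniq_cycle_neq _ s; rewrite szs us -all_zip_cycle => /(_ (ltnW T3) isT) /allP.
  exact.
have FF : (#|F| <= cbreaks (adj E) s)%N.
  apply: leq_trans (_ : size [seq [set ab.1; ab.2] | ab <- ps] <= _)%N.
    by rewrite /F cardsE; apply: card_size.
  by rewrite size_map size_filter.
apply: leq_trans FF; apply: minF.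
  apply/subsetP => f; rewrite inE => /mapP[ab]; rewrite mem_filter => /andP[_ /neq ab12] ->.
  by rewrite pair_vpairs.
rewrite /hamiltonian T3; apply/existsP; exists (Tuple (introT eqP szs)).
rewrite /= us -all_zip_cycle; apply/allP => ab abz; rewrite /adj /= inE.
case: (boolP ([set ab.1; ab.2] \in E)) => //= nE; rewrite inE; apply/mapP; exists ab => //.
by rewrite mem_filter abz andbT.
Qed.

Lemma mu_le_breaks E (s : seq T) : E \subset vpairs T -> uniq s -> size s = #|T| ->
  (mu E <= (breaks (adj E) s).+1)%N.
Proof. by move=> sE us sz; apply: leq_trans (mu_le_cbreaks sE us sz) (cbreaks_le _ _). Qed.

Lemma mu_le_card E : E \subset vpairs T -> (mu E <= #|T|)%N.
Proof.
move=> sE; apply: leq_trans (mu_le_cbreaks sE (enum_uniq T) _) _; first by rewrite -cardE.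
by rewrite /cbreaks (leq_trans (count_size _ _)) // size_zip size_rot minnn -cardE.
Qed.

(** A completion of [f |: E] together with [f] completes [E]. The concentration of the completion
    number rests on this Lipschitz property. *)
Lemma mu_setU1 E f : E \subset vpairs T -> f \in vpairs T ->
  (mu (f |: E) <= mu E)%N && (mu E <= (mu (f |: E)).+1)%N.
Proof.
move=> sE fv; have sfE : f |: E \subset vpairs T by rewrite subUset sub1set fv.
have [F1 [sF1 h1 c1 min1]] := mu_spec sE; have [F2 [sF2 h2 c2 min2]] := mu_spec sfE.
have s1 : F1 \subset vpairs T by apply: subset_trans sF1 (subsetDl _ _).
have s2 : F2 \subset vpairs T by apply: subset_trans sF2 (subsetDl _ _).
apply/andP; split.
  rewrite -c1; apply: min2 => //; move: h1; rewrite /hamiltonian T3 /=.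
  case/existsP=> c /andP[uc cc]; apply/existsP; exists c; rewrite uc /=.
  by apply: sub_cycle cc => x y; rewrite /adj /= !inE => /orP[] ->; rewrite ?orbT.
apply: leq_trans (_ : #|f |: F2| <= _)%N; last by rewrite -c2 cardsU1; case: (f \in F2).
apply: min1; first by rewrite subUset sub1set fv.
by rewrite setUCA setUA.
Qed.

(** Weak duality by counting, at each vertex, its cycle neighbours in [A]. The total is 2 * #|A|;
    neighbours along [E] give at most min(2, degree into [A]) per vertex, and each added edge is
    counted at most twice. *)
Lemma mu_dual E A : E \subset vpairs T ->
  (2 * #|A| <= \sum_v minn 2 #|nbr E v :&: A| + 2 * mu E)%N.
Proof.
move=> sE; have [F [sF /andP[_ /existsP[c /andP[uc cc]]] <- _]] := mu_spec sE.
have cT v : v \in c.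
  have cT : #|c| = #|T| by rewrite (card_uniqP uc) size_tuple.
  by have /(subset_cardP cT) -> : c \subset T by apply/subsetP.
have nK : cancel (next c) (prev c) by apply: prev_next.
have pK : cancel (prev c) (next c) by apply: next_prev.
have np v : next c v != prev c v by apply: next_prev_neq.
have sumA : \sum_v (next c v \in A : nat) = #|A|.
  rewrite -(@reindex_inj _ _ _ _ _ predT (fun v => v \in A : nat) (can_inj nK)) /=.
  by rewrite -sum1_card [RHS]big_mkcond /=; apply: eq_bigr => v _; case: (v \in A).
have sumA' : \sum_v (prev c v \in A : nat) = #|A|.
  rewrite -(@reindex_inj _ _ _ _ _ predT (fun v => v \in A : nat) (can_inj pK)) /=.
  by rewrite -sum1_card [RHS]big_mkcond /=; apply: eq_bigr => v _; case: (v \in A).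
have sumF := sum_next_edge uc cT T3 F; have sumF' := sum_prev_edge uc cT T3 F.
have key v : ((next c v \in A) + (prev c v \in A) <=
   minn 2 #|nbr E v :&: A| + ([set v; next c v] \in F) + ([set v; prev c v] \in F))%N.
  have : adj (E :|: F) v (next c v) by apply: next_cycle.
  have : adj (E :|: F) v (prev c v) by rewrite adj_sym; apply: prev_cycle.
  rewrite {1 2}/adj /= !inE => e1 e2.
  have H : ((next c v \in nbr E v :&: A) + (prev c v \in nbr E v :&: A) <=
     minn 2 #|nbr E v :&: A|)%N.
    case: (boolP (next c v \in _)) => n1; case: (boolP (prev c v \in _)) => n2 //=.
    - rewrite leq_min /=; apply: leq_trans (_ : #|[set next c v; prev c v]| <= _)%N.
        by rewrite cards2 np.
      by apply/subset_leq_card; rewrite subUset !sub1set n1.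
    - by rewrite leq_min /= card_gt0; apply/set0Pn; exists (next c v).
    - by rewrite leq_min /= card_gt0; apply/set0Pn; exists (prev c v).
  move: H; rewrite !inE /adj /=.
  case/orP: e1 => ->; case/orP: e2 => ->; rewrite ?andTb /=; move: (minn _ _) => m;
   case: (_ \in A); case: (_ \in A) => /=; rewrite ?andbT ?andbF; lia.
have := leq_sum (index_enum T) (fun v (_ : true) => key v).
by rewrite !big_split /= sumA sumA'; move: sumF sumF'; set a := \sum_v _; set b := \sum_v _; set c' := \sum_v _;
  move: #|A| #|F| => x y; lia.
Qed.

End CompletionNumber.

Section RandomGraph.
Local Open Scope ring_scope.

(** Moves from graphs to bare edge sets, where unions and deletions of edges carry no proof of
    simplicity. *)
Lemma gnp_prob_Pr (R : realType) (n : nat) (p : R) (P : pred (sgraph 'I_n)) :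
  gnp_prob p P =
  Pr p (vpairs 'I_n) (fun E => if insub E is Some G then P G else false).
Proof.
rewrite /gnp_prob /Pr /Ex.
have s0 : set0 \subset vpairs 'I_n by rewrite sub0set.
pose G0 := SGraph s0.
rewrite (reindex_onto (fun G : sgraph 'I_n => val G) (fun E => insubd G0 E)) /=; last first.
  by move=> E sE; rewrite val_insubd sE.
rewrite [LHS]big_mkcond /=; apply: eq_big => [G|G _].
  by rewrite (valP G) valKd eqxx.
rewrite valK; case: (P G); last by rewrite mulr0.
rewrite mulr1 /gnp_mass (big_setID (val G)) /= (setIidPr (valP G)).
rewrite -!prodr_const; congr (_ * _); apply: eq_bigr => e; first by move=> ->.
by rewrite inE => /andP[/negbTE ->].
Qed.

End RandomGraph.

(** * Two-matchings in graphs of large girth *)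

Section TwoMatching.
Variable T : finType.
Implicit Types (E Z : {set {set T}}) (A : {set T}) (v u x y : T).

Lemma degree_incident E v : E \subset vpairs T ->
  degree E v = #|[set e in E | v \in e]|.
Proof.
move=> /subsetP sE; rewrite /degree.
rewrite -(card_in_imset (f := fun u => [set v; u])); last first.
  move=> x y; rewrite !inE => vx vy /setP/(_ x); rewrite !inE eqxx orbT => /esym/orP[]/eqP // xv.
  by have := sE _ vx; rewrite pair_vpairs xv eqxx.
apply: eq_card => e; rewrite !inE; apply/imsetP/andP => [[u]|[eE ve]].
  by rewrite inE => vu ->; rewrite !inE eqxx.
have : e \in vpairs T by apply: sE.
rewrite inE => /cards2P[a [b [ab eab]]].
move: ve; rewrite eab !inE => /orP[]/eqP vE; [exists b|exists a]; rewrite ?inE /adj /= vE -?eab //.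
  by rewrite setUC -eab.
by rewrite eab setUC.
Qed.

Lemma handshake E : E \subset vpairs T -> \sum_v degree E v = 2 * #|E|.
Proof.
move=> sE; under eq_bigr => v _ do rewrite degree_incident // -sum1_card.
transitivity (\sum_v \sum_(e in E) (v \in e : nat)).
  apply: eq_bigr => v _; rewrite big_mkcond [RHS]big_mkcond /=; apply: eq_bigr => e _.
  by rewrite inE; case: (e \in E) => //=; case: (v \in e).
rewrite exchange_big /= mulnC -sum_nat_const; apply: eq_bigr => e eE.
have := subsetP sE e eE; rewrite inE => /eqP <-.
by rewrite -sum1_card [RHS]big_mkcond /=; apply: eq_bigr => v _; case: (v \in e).
Qed.

Lemma subgraph_degree Z E v : Z \subset E -> degree Z v <= degree E v.
Proof. by move/subsetP => ZE; apply/subset_leq_card/subsetP => u; rewrite !inE; apply: ZE. Qed.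

Definition girth_gt L E : Prop :=
  forall s : seq T, uniq s -> 2 < size s <= L -> ~~ cycle (adj E) s.

Fixpoint nonbacktracking (s : seq T) : bool :=
  if s is x :: ((y :: z :: _) as s') then (x != z) && nonbacktracking s' else true.

(** The first return to [x] would close a cycle of length at most [L]: the walk in between is a path
    by induction, length one is excluded because there are no loops, and length two because the walk
    does not backtrack. *)
Lemma nonbacktracking_uniq E L x s : E \subset vpairs T -> girth_gt L E ->
  size s <= L -> path (adj E) x s -> nonbacktracking (x :: s) -> uniq (x :: s).
Proof.
move=> sE gE; elim: s x => // y s IH x szs /= /andP[xy ps] nb.
have nb' : nonbacktracking (y :: s) by case: (s) nb => // z s' /andP[].
have us : uniq (y :: s) by apply: IH => //; exact: ltnW.
rewrite -/(uniq (y :: s)) us andbT; apply/negP => xs.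
case/splitPr def_s : _ / xs => [s1 s2].
have xs1 : x \notin s1 by move: us; rewrite def_s cat_uniq => /and3P[_ /hasPn/(_ x)];
  rewrite mem_head => /(_ isT).
have us1 : uniq (x :: s1) by rewrite /= xs1; move: us; rewrite def_s cat_uniq => /and3P[].
have ps1 : path (adj E) x (rcons s1 x).
  have : path (adj E) x (y :: s) by rewrite /= xy.
  by rewrite def_s -cat_rcons cat_path => /andP[].
have := gE (x :: s1) us1; rewrite /= ps1 => /(_ _)/negP; apply => //.
apply/andP; split; last first.
  have : size (y :: s) = (size s1 + (size s2).+1)%N by rewrite def_s size_cat.
  by rewrite /=; move: szs => /=; lia.
case: s1 def_s ps1 {us1 xs1} => [|a [|b s1]] //= [ya ss].
  by move=> /andP[xx _]; have := adj_neq sE xx; rewrite eqxx.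
by move: nb; rewrite ss /= => /andP[]; rewrite eqxx.
Qed.

Definition two_matching Z := [forall v, degree Z v <= 2].

Lemma two_matchingP Z : reflect (forall v, degree Z v <= 2) (two_matching Z).
Proof. exact: forallP. Qed.

Lemma nbr_setU1 Z a y v : nbr ([set a; y] |: Z) v =
  nbr Z v :|: (if v == a then [set y] else set0) :|: (if v == y then [set a] else set0).
Proof.
apply/setP => u; rewrite !inE /adj /= !inE.
have -> : ([set v; u] == [set a; y]) = ((v == a) && (u == y)) || ((v == y) && (u == a)).
  apply/eqP/idP => [/setP H|/orP[]/andP[/eqP-> /eqP->]] //; last by rewrite setUC.
  have := H v; have := H u; have := H a; have := H y; rewrite !inE !eqxx !orbT /=.
  rewrite ![_ == v]eq_sym ![_ == u]eq_sym.
  by case: (v == a) (v == y) (u == a) (u == y) => [] [] [] [].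
by case: (v == a); case: (v == y); rewrite !inE ?andbF ?orbF //=;
  case: (u == y); case: (u == a); case: (_ \in Z).
Qed.

Lemma degree_setU1 Z a y v : degree ([set a; y] |: Z) v <= degree Z v + (v \in [set a; y]).
Proof.
rewrite /degree nbr_setU1 !inE; case: (eqVneq v a) => [->|va] /=.
  case: (eqVneq a y) => [->|ay] /=.
    by rewrite -setUA setUid; apply: leq_trans (leq_card_setU _ _) _; rewrite cards1.
  by rewrite setU0; apply: leq_trans (leq_card_setU _ _) _; rewrite cards1.
case: (eqVneq v y) => [->|vy] /=; last by rewrite !setU0 addn0.
by rewrite setU0; apply: leq_trans (leq_card_setU _ _) _; rewrite cards1.
Qed.

Lemma degree_setD1 Z a y v : [set a; y] \in Z -> a != y ->
  degree (Z :\ [set a; y]) v + (v \in [set a; y]) <= degree Z v.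
Proof.
move=> ayZ ay; have [vay|vay] := boolP (v \in [set a; y]); last first.
  by rewrite addn0; apply: subgraph_degree; rewrite subsetDl.
have [w wv aE] : exists2 w, adj Z v w & [set v; w] = [set a; y].
  move: vay; rewrite !inE => /orP[]/eqP->; [exists y|exists a] => //=.
  - by rewrite /adj /= setUC.
  - by rewrite setUC.
rewrite addn1 /degree; apply: proper_card; apply/properP; split.
  by apply/subsetP => u; rewrite !inE /adj /= !inE => /andP[].
by exists w; rewrite ?inE // /adj /= !inE aE eqxx.
Qed.

Section Alternating.
Variable E : {set {set T}}.
Hypothesis sE : E \subset vpairs T.

Definition free Z a y := adj E a y && ~~ adj Z a y.

(** An alternating walk from [a] to [y] that begins and ends with a free edge, so that exchanging
    its edges gains one. Each pair [(b, c)] of [ps] is a free step to [b] followed by a step of [Z]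
    to [c]. *)
Fixpoint alt Z a (ps : seq (T * T)) y : bool :=
  if ps is (b, c) :: ps' then [&& free Z a b, adj Z b c & alt Z c ps' y] else free Z a y.

Fixpoint alt_verts (ps : seq (T * T)) y : seq T :=
  if ps is (b, c) :: ps' then [:: b, c & alt_verts ps' y] else [:: y].

Lemma alt_rcons Z a ps b c y : alt Z a (rcons ps (b, c)) y =
  [&& alt Z a ps b, adj Z b c & free Z c y].
Proof. by elim: ps a => [|[b' c'] ps IH] a //=; rewrite IH -!andbA. Qed.

Lemma size_alt_verts ps y : size (alt_verts ps y) = (2 * size ps).+1.
Proof. by elim: ps => [|[b c] ps IH] //=; rewrite IH; lia. Qed.

Lemma last_alt_verts ps y x : last x (alt_verts ps y) = y.
Proof. by elim: ps x => [|[b c] ps IH] x /=. Qed.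

(** Consecutive edges of the walk differ in membership in [Z], so it never turns back along an
    edge. *)
Lemma alt_path Z a ps y : Z \subset E -> alt Z a ps y ->
  path (adj E) a (alt_verts ps y) && nonbacktracking (a :: alt_verts ps y).
Proof.
move=> /subsetP ZE; elim: ps a => [|[b c] ps IH] a /=; first by case/andP=> ->.
case/and3P=> /andP[Eab Zab] Zbc altc; have /andP[-> nb] := IH _ altc.
have /= Ebc : adj E b c by apply: ZE.
rewrite Eab Ebc /=; have -> /= : a != c.
  by apply: contraNneq Zab => ->; rewrite adj_sym.
case: ps altc nb {IH} => [|[b' c'] ps] /=.
  by case/andP=> H1 H2 _; rewrite andbT; apply: contraNneq H2 => <-; rewrite adj_sym.
by case/and3P=> /andP[H1 H2] _ _ nb; rewrite nb andbT; apply: contraNneq H2 => <-; rewrite adj_sym.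
Qed.

Lemma alt_eq Z Z' a ps y :
  (forall u v, u \in a :: alt_verts ps y -> v \in a :: alt_verts ps y -> adj Z u v = adj Z' u v) ->
  alt Z a ps y = alt Z' a ps y.
Proof.
elim: ps a => [|[b c] ps IH] a H /=; first by rewrite /free H ?inE ?eqxx ?orbT.
rewrite /free (H a b) ?(H b c) ?inE ?eqxx ?orbT //; congr [&& _, _ & _].
by apply: IH => u v uv vv; apply: H; rewrite inE /= inE ?uv ?vv !orbT.
Qed.

(** The exchange is made one pair at a time: adding [[set a; b]] and removing [[set b; c]] keeps the
    size and moves the unsaturated end from [a] to [c]. Distinctness of the vertices keeps the rest
    of the walk alternating. *)
Lemma augment Z a ps y : Z \subset E -> two_matching Z -> uniq (a :: alt_verts ps y) ->
  alt Z a ps y -> degree Z a < 2 -> degree Z y < 2 ->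
  exists Z', [/\ Z' \subset E, two_matching Z' & #|Z'| = #|Z|.+1].
Proof.
elim: ps Z a => [|[b c] ps IH] Z a ZE mZ.
  rewrite /= inE andbT => ay /andP[Eay Zay] da dy.
  exists ([set a; y] |: Z); split.
  - by rewrite subUset sub1set ZE andbT.
  - apply/two_matchingP => v; apply: leq_trans (degree_setU1 _ _ _ _) _.
    have := two_matchingP _ mZ v; rewrite !inE.
    by case: (eqVneq v a) => [->|_] /=; [lia|]; case: (eqVneq v y) => [->|_] /=; lia.
  - by rewrite cardsU1 Zay.
move=> us /=; case/and3P=> /andP[Eab Zab] Zbc altc da dy.
have bc : b != c by apply: adj_neq Zbc; apply: subset_trans ZE sE.
pose Z1 := [set a; b] |: Z :\ [set b; c].
have abbc : [set a; b] != [set b; c] by apply: contraNneq Zab; rewrite /adj /= => ->.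
have usc : uniq (c :: alt_verts ps y) by case/and3P: us.
have aout v : v \in c :: alt_verts ps y -> v != a /\ v != b.
  move=> vin; case/and3P: us; rewrite !inE !negb_or => /and3P[ab ac an] /andP[_ bn] _.
  move: vin; rewrite inE => /orP[/eqP->|vin]; first by rewrite eq_sym ac eq_sym bc.
  by split; [apply: contraNneq an => <-|apply: contraNneq bn => <-].
have Z1E u v : u \in c :: alt_verts ps y -> v \in c :: alt_verts ps y -> adj Z1 u v = adj Z u v.
  move=> /aout[ua ub] /aout[va vb]; rewrite /adj /= !inE.
  have -> : ([set u; v] == [set a; b]) = false.
    by apply/negbTE/eqP => /setP/(_ a); rewrite !inE eqxx eq_sym (negbTE ua) eq_sym (negbTE va).
  have -> : ([set u; v] == [set b; c]) = false.
    by apply/negbTE/eqP => /setP/(_ b); rewrite !inE eqxx eq_sym (negbTE ub) eq_sym (negbTE vb).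
  by [].
have dZ1 v : degree Z1 v + (v \in [set b; c]) <= degree Z v + (v \in [set a; b]).
  apply: leq_trans (leq_add (degree_setU1 _ _ _ _) (leqnn _)) _.
  by rewrite addnAC leq_add2r; apply: degree_setD1.
have := IH Z1 c _ _ usc _ _ _; rewrite (_ : #|Z1| = #|Z|); last first.
  have nab : [set a; b] \in Z = false by apply: negbTE.
  have bcZ : [set b; c] \in Z by [].
  by rewrite cardsU1 !inE nab andbF add1n [in RHS](cardsD1 [set b; c] Z) bcZ add1n.
apply.
- by rewrite subUset sub1set (subset_trans (subsetDl _ _) ZE) andbT.
- apply/two_matchingP => v; have := dZ1 v; have := two_matchingP _ mZ v; rewrite !inE.
  case: (eqVneq v a) => [->|_] /=; last first.
    by case: (v == b); case: (v == c); rewrite /= ?addn0; move: (degree Z v) (degree Z1 v) => x z; clear; lia.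
  by move: da; move: (degree Z a) (degree Z1 a) (nat_of_bool _) => x z w; clear; lia.
- by rewrite -(alt_eq (Z := Z)) // => u v uu vv; rewrite Z1E.
- have /aout[ca cb] : c \in c :: alt_verts ps y by rewrite mem_head.
  have := dZ1 c; rewrite !inE eqxx (negbTE ca) (negbTE cb) orbT /=.
  by have := two_matchingP _ mZ c; clear; lia.
- have yin : y \in alt_verts ps y.
    by case: (alt_verts ps y) (last_alt_verts ps y y) (size_alt_verts ps y) => //= x s <- _;
      rewrite mem_last.
  have /aout[ya yb] : y \in c :: alt_verts ps y by rewrite inE yin orbT.
  have yc : y != c by case/andP: usc => cn _; apply: contraNneq cn => <-.
  by have := dZ1 y; rewrite !inE (negbTE ya) (negbTE yb) (negbTE yc) /= !addn0; move: dy; clear; lia.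
Qed.

(** Breadth-first search from the unsaturated vertices: [layerR] collects the ends of free edges
    leaving [layerA], and the next [layerA] adds their [Z]-neighbours. *)
Fixpoint layerA Z i : {set T} :=
  if i is i'.+1 then layerA Z i' :|: [set u | [exists y, [exists a in layerA Z i', free Z a y] && adj Z y u]]
  else [set v | degree Z v < 2].

Definition layerR Z i : {set T} := [set y | [exists a in layerA Z i, free Z a y]].

Lemma layerR_alt Z i y : y \in layerR Z i ->
  exists a ps, [/\ size ps <= i, degree Z a < 2 & alt Z a ps y].
Proof.
have HA j u : (forall y, y \in layerR Z j -> exists a ps, [/\ size ps <= j, degree Z a < 2 & alt Z a ps y]) ->
   u \in layerA Z j.+1 -> u \in layerA Z j \/
     exists a ps y, [/\ size ps <= j, degree Z a < 2, alt Z a ps y & adj Z y u].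
  move=> IH /=; rewrite inE => /orP[|]; first by left.
  rewrite inE => /existsP[z /andP[zR zu]]; right.
  have [|a [ps [H1 H2 H3]]] := IH z; first by rewrite inE.
  by exists a, ps, z.
elim: i y => [|i IH] y.
  rewrite inE => /existsP[a /andP[]]; rewrite inE => da fay.
  by exists a, [::].
rewrite inE => /existsP[u /andP[uA fuy]].
case: (HA i u IH uA) => [uAi|[a [ps [z [H1 H2 H3 H4]]]]].
  have [|a [ps [H1 H2 H3]]] := IH y; first by rewrite inE; apply/existsP; exists u; rewrite uAi.
  by exists a, ps; split=> //; apply: leqW.
by exists a, (rcons ps (z, u)); rewrite size_rcons ltnS alt_rcons H3 H4 fuy.
Qed.

Lemma layerA_mono Z i : layerA Z i \subset layerA Z i.+1.
Proof. exact: subsetUl. Qed.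

Lemma layerR_mono Z i : layerR Z i \subset layerR Z i.+1.
Proof.
apply/subsetP => y; rewrite !inE => /existsP[a /andP[aA fa]]; apply/existsP; exists a.
by rewrite (subsetP (layerA_mono Z i)).
Qed.

Lemma layerA0 Z i : layerA Z 0 \subset layerA Z i.
Proof. by elim: i => // i IH; apply: subset_trans IH (layerA_mono Z i). Qed.

(* A is a layer of the alternating search from the unsaturated vertices. Large girth makes all short
   alternating walks paths, and by pigeonhole one of the first r layers barely grows. *)
Lemma approx_duality Z r L : girth_gt L E -> 2 * r <= L.+1 -> 0 < r ->
  Z \subset E -> two_matching Z ->
  (forall Z', Z' \subset E -> two_matching Z' -> #|Z'| <= #|Z|) ->
  exists A, r * (2 * #|T| + \sum_v minn 2 #|nbr E v :&: A|) <= r * (2 * #|A| + 2 * #|Z|) + 2 * #|T|.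
Proof.
move=> gE rL r0 ZE mZ maxZ.
(* An unsaturated vertex of [layerR] would end an augmenting path, against the maximality of [Z]. *)
have sat i y : i < r -> y \in layerR Z i -> degree Z y = 2.
  move=> ir /layerR_alt[a [ps [sps da al]]]; apply/eqP; rewrite eqn_leq (two_matchingP _ mZ) /=.
  rewrite leqNgt; apply/negP => dy.
  have /andP[pa nb] := alt_path ZE al.
  have ua : uniq (a :: alt_verts ps y).
    by apply: (nonbacktracking_uniq sE gE) pa nb => //; rewrite size_alt_verts; lia.
  have [Z' [Z'E mZ' cZ']] := augment ZE mZ ua al da dy.
  by have := maxZ _ Z'E mZ'; rewrite cZ' ltnn.
pose Rp i := if i is i'.+1 then #|layerR Z i'| else 0.
have [i ir small] : exists2 i, i < r & r * (#|layerR Z i| - Rp i) <= #|T|.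
  have [/existsP[i Hi]|/existsPn Hn] := boolP [exists i : 'I_r, r * (#|layerR Z i| - Rp i) <= #|T|].
    by exists i.
  have Hk k : k <= r -> k * #|T|.+1 <= r * Rp k.
    elim: k => // k IH kr; have := Hn (Ordinal kr); rewrite -ltnNge /= mulnBr.
    have := IH (ltnW kr); rewrite mulSn; move: (k * _) (r * Rp k) (r * _) => x y z; lia.
  have := Hk r (leqnn r); have : Rp r <= #|T| by rewrite /Rp; case: (r) => // k; apply: max_card.
  by move=> Rr /(leq_trans)/(_ (leq_mul (leqnn r) Rr)); rewrite leq_pmul2l // ltnn.
exists (layerA Z i); set A := layerA Z i.
(* All vertices outside [A] have degree 2 in [Z], because [layerA Z 0] already holds the unsaturated
   ones. *)
have zsum : \sum_v #|nbr Z v :&: A| + 2 * #|T| = 2 * #|A| + 2 * #|Z|.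
  have -> : \sum_v #|nbr Z v :&: A| = \sum_(a in A) degree Z a.
    under eq_bigr => v _ do rewrite -sum1_card big_mkcond.
    rewrite exchange_big [RHS]big_mkcond /=; apply: eq_bigr => a _.
    case aA: (a \in A).
      rewrite /degree -sum1_card [RHS]big_mkcond /=; apply: eq_bigr => v _.
      by rewrite !inE aA andbT adj_sym.
    by rewrite big1 // => v _; rewrite !inE aA andbF.
  have := handshake (subset_trans ZE sE); rewrite (bigID (mem A)) /= => <-.
  rewrite (_ : \sum_(v | v \notin A) degree Z v = \sum_(v in ~: A) 2); last first.
    apply: eq_big => v; first by rewrite !inE.
    move=> vA; apply/eqP; rewrite eqn_leq (two_matchingP _ mZ) /= leqNgt; apply: contra vA => dv.
    by apply: (subsetP (layerA0 Z i)); rewrite inE.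
  rewrite sum_nat_const; have := cardsC A.
  by move: (\sum_(_ in _) _) #|A| #|~: A| #|T| => x y z w; lia.
(* Outside [layerR Z i] every [E]-neighbour in [A] is a [Z]-neighbour, for otherwise the edge would
   be free. *)
have H1 : \sum_v minn 2 #|nbr E v :&: A| <= \sum_(v in layerR Z i) 2 + \sum_(v in ~: layerR Z i) #|nbr Z v :&: A|.
  rewrite (bigID (mem (layerR Z i))) /=; apply: leq_add.
    by apply: leq_sum => v _; rewrite geq_minl.
  rewrite [X in _ <= X](eq_bigl (fun v => v \notin layerR Z i)); last by move=> v; rewrite inE.
  apply: leq_sum => v vR; rewrite geq_min; apply/orP; right.
  apply/subset_leq_card/subsetP => u; rewrite !inE => /andP[Evu uA]; rewrite uA andbT.
  apply: contraR vR => Zvu; rewrite inE; apply/existsP; exists u.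
  by rewrite uA /free adj_sym Evu adj_sym.
(* Vertices of the previous layer have both [Z]-neighbours in [A], so only the few vertices new in
   [layerR Z i] can lose in the comparison. *)
have H2 : \sum_(v in layerR Z i) #|nbr Z v :&: A| >= 2 * Rp i.
  rewrite /Rp; case: i ir small @A zsum H1 => [|j] ir small A zsum H1; first by rewrite muln0.
  rewrite mulnC -sum_nat_const [X in _ <= X](big_setID (layerR Z j)) /=.
  rewrite (setIidPr (layerR_mono Z j)); apply: leq_trans (leq_addr _ _).
  apply: leq_sum => v vR; rewrite -(sat j v (ltnW ir) vR).
  apply/subset_leq_card/subsetP => u; rewrite inE => vu; rewrite in_setI inE vu /=.
  rewrite inE; apply/orP; right; rewrite inE; apply/existsP; exists v; rewrite vu andbT.
  by move: vR; rewrite inE.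
have H3 : \sum_v #|nbr Z v :&: A| = \sum_(v in layerR Z i) #|nbr Z v :&: A| + \sum_(v in ~: layerR Z i) #|nbr Z v :&: A|.
  by rewrite (bigID (mem (layerR Z i))) /=; congr (_ + _); apply: eq_bigl => v; rewrite !inE.
rewrite sum_nat_const in H1.
have Rle : Rp i <= #|layerR Z i|.
  by rewrite /Rp; case: (i) => // j; apply/subset_leq_card/layerR_mono.
have : 2 * #|T| + \sum_v minn 2 #|nbr E v :&: A| <= 2 * #|A| + 2 * #|Z| + 2 * (#|layerR Z i| - Rp i).
  lia.
by move/(leq_mul (leqnn r)); rewrite mulnDr [X in _ <= X]mulnDr; lia.
Qed.

End Alternating.

Lemma ex_min (X : Type) (P : X -> Prop) (f : X -> nat) : (exists z, P z) ->
  exists2 z, P z & forall w, P w -> f z <= f w.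
Proof.
case=> z Pz; have [m] := ubnP (f z); elim: m z Pz => // m IH z Pz fz.
have [[w [Pw wz]]|H] := boolp.EM (exists w, P w /\ f w < f z).
  by apply: (IH w Pw); apply: leq_trans wz _.
exists z => // w Pw; rewrite leqNgt; apply/negP => wz.
by apply: H; exists w.
Qed.

Section SegmentCover.
Variable Z : {set {set T}}.
Hypotheses (sZ : Z \subset vpairs T) (mZ : two_matching Z).

Definition cover (ss : seq (seq T)) : Prop :=
  [/\ perm_eq (flatten ss) (enum T), all (fun s => s != [::]) ss & all (sorted (adj Z)) ss].

Definition cyclic_seg (s : seq T) := (2 < size s) && cycle (adj Z) s.

Lemma cover_perm ss ss' : perm_eq ss ss' -> cover ss -> cover ss'.
Proof.
move=> pss [H1 H2 H3]; split; rewrite -?(perm_all _ pss) //.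
by apply: perm_trans H1; rewrite perm_sym perm_flatten.
Qed.

Lemma cover_rev s ss : cover (s :: ss) -> cover (rev s :: ss).
Proof.
case=> /= H1 /andP[H2 H2'] /andP[H3 H3']; split.
- by apply: perm_trans H1; rewrite /= perm_cat2r perm_rev.
- by rewrite /= H2' andbT -size_eq0 size_rev size_eq0.
- rewrite /= H3' andbT rev_sorted; congr (_ _) : H3.
  by rewrite (eq_sorted (e' := adj Z)) // => x y; rewrite adj_sym.
Qed.

Lemma cover_cat s s' ss : cover (s :: s' :: ss) ->
  sorted (adj Z) (s ++ s') -> cover ((s ++ s') :: ss).
Proof.
case=> /= H1 /and3P[H2 _ H2'] /and3P[_ _ H3'] H; split.
- by rewrite /= -catA.
- by rewrite /= H2' andbT; case: (s) H2.
- by rewrite /= H3' H.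
Qed.

Lemma three_nbrs u a b c : uniq [:: a; b; c] -> adj Z u a -> adj Z u b -> ~~ adj Z u c.
Proof.
move=> uabc ua ub; apply/negP => uc; have := two_matchingP _ mZ u.
rewrite /degree leqNgt => /negP; apply.
have <- : #|[:: a; b; c]| = 3 by apply/card_uniqP.
by apply/subset_leq_card/subsetP => x; rewrite !inE => /or3P[]/eqP->.
Qed.

Lemma sorted_join s x y s' : sorted (adj Z) (rcons s x) -> sorted (adj Z) (y :: s') ->
  adj Z x y -> sorted (adj Z) (rcons s x ++ y :: s').
Proof.
case: s => [|z s] /=; first by move=> _ -> ->.
by rewrite cat_path last_rcons /= => -> -> ->.
Qed.

Lemma interior_nbr t1 a u b t2 c : uniq (rcons t1 a ++ [:: u, b & t2]) ->
  sorted (adj Z) (rcons t1 a ++ [:: u, b & t2]) -> adj Z u c -> c \in [:: a; b].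
Proof.
rewrite cat_rcons => ut /cat_sorted2[_ /= /and3P[au ub _]] uc.
have ab : a != b.
  move: ut; rewrite cat_uniq => /and3P[_ _] /= /andP[]; rewrite !inE !negb_or.
  by case/and3P.
apply: contraLR uc; rewrite !inE negb_or => /andP[ca cb].
apply: (@three_nbrs u a b c) => //; last by rewrite adj_sym.
by rewrite /= !inE negb_or ab ![_ == c]eq_sym ca cb.
Qed.

(** In a cover with the fewest segments no other [Z]-neighbour [u] of the head is possible: an
    interior [u] would have three neighbours in [Z], an end of another segment would allow a merge,
    and the far end of the same segment would make it cyclic. *)
Lemma head_nbr h t rest u : cover ((h :: t) :: rest) ->
  (forall ss', cover ss' -> (size rest).+1 <= size ss') ->
  ~~ cyclic_seg (h :: t) -> adj Z h u -> u \in take 1 t.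
Proof.
move=> cov minc ncyc hu; have [H1 _ H3] := cov.
have uf : uniq (flatten ((h :: t) :: rest)) by rewrite (perm_uniq H1) enum_uniq.
have uh : adj Z u h by rewrite adj_sym.
have : u \in flatten ((h :: t) :: rest) by rewrite (perm_mem H1) mem_enum.
have st : sorted (adj Z) (h :: t) by case/andP: H3.
have ut0 : uniq (h :: t).
  by have := uf : uniq ((h :: t) ++ flatten rest); rewrite cat_uniq => /andP[].
rewrite [flatten _]/= -/(flatten _) -/((h :: t) ++ flatten rest) inE mem_cat => /or3P[/eqP uE|ut|].
- by have := adj_neq sZ hu; rewrite uE eqxx.
- have [t1 [t2 tE]] : exists t1 t2, t = t1 ++ u :: t2 by case/splitPr: ut => t1 t2; exists t1, t2.
  case/lastP: t1 tE => [|t1 a] tE; first by rewrite tE /= take0 inE.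
  case: t2 tE => [|b t2] tE.
    move: ncyc; rewrite /cyclic_seg tE cats1 /= !size_rcons /= rcons_path last_rcons uh andbT.
    by move: st; rewrite tE cats1 /= => ->.
  have := interior_nbr (t1 := h :: t1) (a := a) (u := u) (b := b) (t2 := t2) (c := h).
  rewrite /= -tE => /(_ ut0 st uh) hab; move: ut0; rewrite /= tE => /andP[/negP hn _].
  exfalso; apply: hn; move: hab; rewrite mem_cat mem_rcons !inE => /orP[]/eqP ->.
    by rewrite eqxx.
  by rewrite eqxx !orbT.
- case/flattenP=> s' s'rest us'.
  have prest := perm_to_rem s'rest.
  have cov' : cover ((h :: t) :: s' :: rem s' rest).
    by apply: cover_perm cov; rewrite perm_cons.
  have szr : size rest = (size (rem s' rest)).+1 by rewrite (perm_size prest).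
  have ss' : sorted (adj Z) s' by case: cov' => _ _ /and3P[].
  have uf' : uniq ((h :: t) ++ s' ++ flatten (rem s' rest)).
    by case: cov' => H _ _; rewrite (perm_uniq H) enum_uniq.
  have hs' : h \notin s'.
    move: uf'; rewrite cat_uniq => /and3P[_ /hasPn H _]; apply/negP => hs.
    by have := H h; rewrite mem_cat hs mem_head => /(_ isT).
  have us'u : uniq s' by move: uf'; rewrite cat_uniq cat_uniq => /and5P[].
  have [t1 [t2 sE']] : exists t1 t2, s' = t1 ++ u :: t2 by case/splitPr: us' => t1 t2; exists t1, t2.
  exfalso; case/lastP: t1 sE' => [|t1 a] sE'.
    have /(cover_cat (cover_rev cov'))/minc : sorted (adj Z) (rev (h :: t) ++ s'); last first.
      by rewrite /= szr ltnn.
    have rs : sorted (adj Z) (rcons (rev t) h).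
      by rewrite -rev_cons; case: (cover_rev cov') => _ _ /andP[].
    by rewrite sE' rev_cons; apply: sorted_join => //; rewrite -[_ :: _]cat0s -sE'.
  case: t2 sE' => [|b t2] sE'; last first.
    have := interior_nbr (t1 := t1) (a := a) (u := u) (b := b) (t2 := t2) (c := h).
    rewrite -sE' => /(_ us'u ss' uh) hab; move/negP: hs'; apply; rewrite sE'.
    move: hab; rewrite mem_cat mem_rcons !inE => /orP[]/eqP ->; first by rewrite eqxx.
    by rewrite eqxx !orbT.
  have cov2 : cover (s' :: (h :: t) :: rem s' rest).
    by apply: cover_perm cov'; rewrite (perm_catCA [:: h :: t] [:: s']).
  have /(cover_cat cov2)/minc : sorted (adj Z) (s' ++ h :: t); last by rewrite /= szr ltnn.
  rewrite sE' cats1; apply: sorted_join => //.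
  by rewrite -cats1 -sE'.
Qed.

Lemma cyclic_seg_rev s : cyclic_seg (rev s) = cyclic_seg s.
Proof.
rewrite /cyclic_seg size_rev rev_cycle; congr (_ && _).
by apply: eq_cycle => x y; rewrite adj_sym.
Qed.

Lemma head_degree h t rest : cover ((h :: t) :: rest) ->
  (forall ss', cover ss' -> (size rest).+1 <= size ss') ->
  ~~ cyclic_seg (h :: t) -> degree Z h <= minn 1 (size t).
Proof.
move=> cov minc ncyc.
apply: leq_trans (_ : #|take 1 t| <= _).
  by apply/subset_leq_card/subsetP => u; rewrite inE; apply: (head_nbr cov).
by apply: leq_trans (card_size _) _; rewrite size_take_min.
Qed.

Lemma seg_degree_sum s rest : cover (s :: rest) ->
  (forall ss', cover ss' -> (size rest).+1 <= size ss') ->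
  \sum_(v <- s) degree Z v <= 2 * (size s).-1 + 2 * cyclic_seg s.
Proof.
move=> cov minc; have sum2 s' : \sum_(v <- s') degree Z v <= 2 * size s'.
  elim: s' => [|x s' IH]; first by rewrite big_nil.
  by rewrite big_cons /= mulnS; apply: leq_add => //; apply: two_matchingP.
case: (boolP (cyclic_seg s)) => [cyc|ncyc].
  by apply: leq_trans (sum2 s) _; case: (s) => //= x s'; rewrite -mulnDr leq_mul2l /=; lia.
case: s cov ncyc => [|h t] cov ncyc; first by rewrite big_nil.
have dh := head_degree cov minc ncyc; rewrite big_cons /= muln0 addn0.
case/lastP: t cov ncyc dh => [|t l] cov ncyc dh.
  by rewrite big_nil addn0 /= in dh *.
have := head_degree (h := l) (t := rev (h :: t)) (rest := rest).
have -> : l :: rev (h :: t) = rev (h :: rcons t l) by rewrite -rcons_cons rev_rcons.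
move=> /(_ (cover_rev cov) minc); rewrite cyclic_seg_rev => /(_ ncyc) dl.
rewrite -cats1 big_cat big_seq1 /= cats1 size_rcons.
move: dh dl (sum2 t) => /leq_trans/(_ (geq_minl _ _)) dh /leq_trans/(_ (geq_minl _ _)) dl.
by move: (\sum_(_ <- _) _) (degree Z h) (degree Z l) dh dl => x y z; lia.
Qed.

Lemma sum_degree_cover ss : cover ss -> (forall ss', cover ss' -> size ss <= size ss') ->
  2 * #|Z| + 2 * size ss <= 2 * #|T| + 2 * count cyclic_seg ss.
Proof.
move=> cov minc; rewrite -(handshake sZ).
have -> : \sum_v degree Z v = \sum_(s <- ss) \sum_(v <- s) degree Z v.
  rewrite -big_flatten; case: cov => H _ _; rewrite (perm_big _ H) /=.
  by rewrite big_enum.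
have szE : #|T| = \sum_(s <- ss) size s.
  by case: cov => /perm_size; rewrite -cardE size_flatten sumnE big_map => ->.
have L1 : 2 * size ss = \sum_(s <- ss) 2 by rewrite big_const_seq count_predT iter_addn_0 mulnC.
have L2 : 2 * #|T| = \sum_(s <- ss) 2 * size s by rewrite szE big_distrr.
have L3 : 2 * count cyclic_seg ss = \sum_(s <- ss) 2 * cyclic_seg s.
  rewrite -sum1_count big_mkcond /= big_distrr /=.
  by apply: eq_bigr => s _; case: (cyclic_seg s).
rewrite L1 L2 L3 -!big_split /= !big_seq; apply: leq_sum => s sss.
have ps := perm_to_rem sss.
have cov' := cover_perm ps cov.
have minc' ss' : cover ss' -> (size (rem s ss)).+1 <= size ss'.
  by move/minc; rewrite (perm_size ps).
have := seg_degree_sum cov' minc'.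
have : s != [::] by case: cov' => _ /andP[].
case: s {sss ps cov' minc'} => //= x s _; case: (cyclic_seg _) => /=;
  move: (\sum_(_ <- _) _) => y; lia.
Qed.

(** The segments of a smallest cover are concatenated. Degree sums bound their number by #|T| - #|Z|
    plus the number of cyclic ones, and each cyclic segment has more than [L] vertices. *)
Lemma order_of_two_matching L : girth_gt L Z ->
  exists s, [/\ uniq s, size s = #|T| &
    L * (breaks (adj Z) s + #|Z|) <= L * #|T| + #|T|].
Proof.
move=> gL; have [|ss cov minc] := @ex_min _ cover size.
  exists [seq [:: x] | x <- enum T]; split.
  - by rewrite flatten_seq1 perm_refl.
  - by apply/allP => s /mapP[x _ ->].
  - by apply/allP => s /mapP[x _ ->].
have deg_sum := sum_degree_cover cov minc.
have [Hp Hn Hs] := cov.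
have uf : uniq (flatten ss) by rewrite (perm_uniq Hp) enum_uniq.
exists (flatten ss); split=> //; first by rewrite (perm_size Hp) -cardE.
have brk : breaks (adj Z) (flatten ss) <= size ss.
  have sb s : sorted (adj Z) s -> breaks (adj Z) s = 0.
    elim: s => // x [|y s] IH //= /andP[xy ps].
    by rewrite breaks_cons xy add0n; apply: IH.
  elim: ss Hs {cov minc deg_sum Hp Hn uf} => [|s ss IH] //= /andP[Hs Hss].
  case/lastP: s Hs => [|s x] Hs; first by rewrite /= ltnW // ltnS IH.
  case E : (flatten ss) (IH Hss) => [|y s'] Hy; first by rewrite cats0 sb.
  by rewrite breaks_cat sb // add0n -add1n leq_add // leq_b1.
have cyc : L * count cyclic_seg ss <= #|T|.
  have -> : #|T| = \sum_(s <- ss) size s.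
    by move: (perm_size Hp); rewrite -cardE size_flatten sumnE big_map => ->.
  rewrite -sum1_count big_distrr /= big_mkcond /= !big_seq; apply: leq_sum => s sss.
  case: ifP => // cs; rewrite muln1 ltnW // ltnNge; apply/negP => sL.
  have us : uniq s.
    have ps := perm_flatten (perm_to_rem sss).
    by move: uf; rewrite (perm_uniq ps) /= cat_uniq => /andP[].
  by case/andP: cs => s2 cs; have := gL s us; rewrite s2 sL cs => /(_ isT).
have : breaks (adj Z) (flatten ss) + #|Z| <= #|T| + count cyclic_seg ss.
  move: brk deg_sum; move: (breaks _ _) (#|Z|) (#|T|) (size ss) (count _ _) => a b c d e; lia.
move=> H; apply: leq_trans (leq_mul (leqnn L) H) _.
by rewrite mulnDr leq_add2l.
Qed.

End SegmentCover.
End TwoMatching.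

Section ShortCycles.
Variable T : finType.
Implicit Types (E Z : {set {set T}}) (A : {set T}) (v u x y : T).

Definition cycles k E : {set k.-tuple T} := [set t : k.-tuple T | uniq t & cycle (adj E) t].

Definition short_cycles L E : nat := \sum_(k < L.+1 | 2 < k) #|cycles k E|.

Definition first_edge (s : seq T) : {set T} := if s is x :: y :: _ then [set x; y] else set0.

Lemma high_girth_subgraph L E : exists E', [/\ E' \subset E, girth_gt L E' &
  #|E :\: E'| <= short_cycles L E].
Proof.
pose D := \bigcup_(k < L.+1 | 2 < k) [set first_edge (tval t) | t in cycles k E].
exists (E :\: D); split; first exact: subsetDl.
  move=> s us /andP[s2 sL]; apply/negP => cs.
  have sE : cycle (adj E) s by apply: sub_cycle cs => x y; rewrite /adj /= inE => /andP[].
  have sD : first_edge s \in D.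
    apply/bigcupP; exists (Ordinal (sL : size s < L.+1)) => //=.
    by apply/imsetP; exists (in_tuple s); rewrite // inE us.
  case: s s2 {us sL sE} cs sD => [|x [|y s]] //= _ /andP[xy _] sD.
  by move: xy; rewrite /adj /= inE sD.
rewrite setDDr setDv set0U; apply: leq_trans (_ : #|D| <= _).
  by rewrite subset_leq_card // subsetIr.
rewrite /D /short_cycles.
elim/big_rec2: _ => [|k m B _ IH]; first by rewrite cards0.
by apply: leq_trans (leq_card_setU _ _) _; rewrite leq_add // leq_imset_card.
Qed.

Lemma nbrD_card E E' A v : E' \subset E ->
  minn 2 #|nbr E v :&: A| <= minn 2 #|nbr E' v :&: A| + degree (E :\: E') v.
Proof.
move=> sE; apply: leq_trans (_ : minn 2 (#|nbr E' v :&: A| + degree (E :\: E') v) <= _); last first.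
  by move: #|_| (degree _ _) => x y; lia.
rewrite leq_min geq_minl /= (leq_trans (geq_minr _ _)) //.
apply: leq_trans (leq_card_setU _ _); apply/subset_leq_card/subsetP => u.
rewrite !inE /adj /= !inE => /andP[-> ->].
by case: (_ \in E').
Qed.

(** Approximate duality for a maximum 2-matching of a subgraph without cycles of length up to 2 * r.
    Of the 3 * #|T|, two parts come from [approx_duality] and one from cyclic segments; 2 * r pays
    for the extra break of [mu_le_breaks], and each deleted edge is paid for at both ends. *)
Lemma mu_approx E r : 2 < #|T| -> E \subset vpairs T -> 0 < r ->
  exists A, r * (2 * mu E + \sum_v minn 2 #|nbr E v :&: A|) <=
    r * (2 * #|A|) + 3 * #|T| + 2 * r + 2 * r * short_cycles (2 * r) E.
Proof.
move=> T3 sE r0; have [E' [E'E gE' cD]] := high_girth_subgraph (2 * r) E.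
have sE' : E' \subset vpairs T by apply: subset_trans E'E sE.
have [|Z [ZE' mZ] maxZ] := @ex_min _ (fun Z => Z \subset E' /\ two_matching Z) (fun Z => #|E'| - #|Z|).
  exists set0; split; first exact: sub0set.
  by apply/forallP => v; rewrite /degree (_ : nbr _ _ = set0) ?cards0 //;
    apply/setP => u; rewrite !inE /adj /= inE.
have sZ : Z \subset vpairs T by apply: subset_trans ZE' sE'.
have gZ : girth_gt (2 * r) Z.
  move=> s us sz; apply: contra (gE' s us sz); apply: sub_cycle => x y.
  by rewrite /adj /=; apply: (subsetP ZE').
have maxZ' Z' : Z' \subset E' -> two_matching Z' -> #|Z'| <= #|Z|.
  move=> sZ' mZ'; have := maxZ Z' (conj sZ' mZ').
  have := subset_leq_card sZ'; have := subset_leq_card ZE'.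
  by move: #|Z| #|Z'| #|E'| => a b c; lia.
have [s [us szs Hs]] := order_of_two_matching sZ mZ gZ.
have [A HA] := approx_duality sE' gE' (leqnSn (2 * r)) r0 ZE' mZ maxZ'.
exists A.
have Hmu : mu E <= (breaks (adj Z) s).+1.
  apply: leq_trans (mu_le_breaks T3 sE us szs) _; rewrite ltnS.
  apply: sub_count => ab; apply: contra; rewrite /adj /= => ?.
  by apply: (subsetP E'E); apply: (subsetP ZE').
have Hsum : \sum_v minn 2 #|nbr E v :&: A| <= \sum_v minn 2 #|nbr E' v :&: A| + 2 * short_cycles (2 * r) E.
  apply: leq_trans (_ : \sum_v (minn 2 #|nbr E' v :&: A| + degree (E :\: E') v) <= _).
    by apply: leq_sum => v _; apply: nbrD_card.
  rewrite big_split /= leq_add2l handshake ?leq_mul2l ?cD //.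
  by apply: subset_trans sE; apply: subsetDl.
move: Hs HA Hmu Hsum; move: (breaks _ _) #|Z| #|T| (mu E) #|A| (short_cycles _ _).
move: (\sum_v _) (\sum_v _) => S S' b z n m a c Hs HA Hmu Hsum.
have H1 := leq_mul (leqnn r) Hsum; have H2 := leq_mul (leqnn (2 * r)) Hmu.
move: Hs HA H1 H2; clear; nia.
Qed.

End ShortCycles.

(** * Fractional two-matchings *)

Section Subgradient.
Local Open Scope ring_scope.
Variables (R : realType) (T : finType) (E : {set {set T}}).
Implicit Types (x y : T -> T -> R) (A : {set T}) (u v : T).

Definition pos (z : R) : R := Num.max 0 z.

Definition load x v : R := \sum_(u in nbr E v) x v u.

(* The concave relaxation of the size of a maximum 2-matching; half of each edge is charged to either end. *)
Definition objective x : R := \sum_v (load x v / 2 - pos (load x v - 2)).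

Definition fractional x := (forall u v, x u v = x v u) /\ (forall u v, 0 <= x u v <= 1).

Lemma pos_ge0 z : 0 <= pos z.
Proof. by rewrite /pos le_max lexx. Qed.

Lemma pos_ge z : z <= pos z.
Proof. by rewrite /pos le_max lexx orbT. Qed.

Lemma sum_nbr_sym (F : T -> T -> R) :
  \sum_v \sum_(u in nbr E v) F v u = \sum_v \sum_(u in nbr E v) F u v.
Proof.
under eq_bigr => v _ do rewrite big_mkcond.
rewrite exchange_big /=; apply: eq_bigr => v _; rewrite [RHS]big_mkcond /=.
by apply: eq_bigr => u _; rewrite !inE adj_sym.
Qed.

(** Linear programming duality: the loads on [A] are counted from the other end, where they total at
    most min(2, degree into [A]) plus the penalty, and off [A] each load is at most 2 plus its
    penalty. *)
Lemma weak_duality x A : fractional x ->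
  2 * objective x <= 2 * #|T|%:R - 2 * #|A|%:R + (\sum_v minn 2 #|nbr E v :&: A|)%:R.
Proof.
case=> xs x01.
have H1 : \sum_(v in A) load x v <= \sum_u ((minn 2 #|nbr E u :&: A|)%:R + pos (load x u - 2)).
  have -> : \sum_(v in A) load x v = \sum_u \sum_(v in nbr E u :&: A) x u v.
    rewrite [LHS]big_mkcond /=; transitivity (\sum_v \sum_(u in nbr E v) (if v \in A then x v u else 0)).
      by apply: eq_bigr => v _; case: (v \in A) => //; rewrite big1.
    rewrite sum_nbr_sym; apply: eq_bigr => u _; rewrite [LHS]big_mkcond [RHS]big_mkcond /=.
    apply: eq_bigr => v _; rewrite !inE; case: (adj E u v) => //=.
    by rewrite xs.
  apply: ler_sum => u _; case: (leqP #|nbr E u :&: A| 2) => d2.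
    apply: le_trans (_ : #|nbr E u :&: A|%:R <= _); last by rewrite lerDl pos_ge0.
    rewrite -sum1_card natr_sum; apply: ler_sum => v _.
    by case/andP: (x01 u v).
  apply: le_trans (_ : load x u <= _).
    rewrite /load [leRHS](big_setID A) /= lerDl; apply: sumr_ge0 => v _.
    by case/andP: (x01 u v).
  by rewrite -lerBlDl pos_ge.
have H2 : \sum_(v in ~: A) (load x v - pos (load x v - 2)) <= 2 * #|~: A|%:R.
  rewrite mulr_natr -sumr_const; apply: ler_sum => v _.
  by rewrite lerBlDl addrC -lerBlDl pos_ge.
have H3 : 0 <= \sum_(v in A) pos (load x v - 2) by apply: sumr_ge0 => v _; apply: pos_ge0.
have E1 : 2 * objective x = \sum_v load x v - 2 * \sum_v pos (load x v - 2).
  rewrite /objective sumrB mulrBr; congr (_ - _).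
  by rewrite mulr_sumr; apply: eq_bigr => v _; rewrite mulrC divfK // pnatr_eq0.
have splitA F : \sum_v F v = \sum_(v in A) F v + \sum_(v in ~: A) F v :> R.
  by rewrite (bigID (mem A)) /=; congr (_ + _); apply: eq_bigl => v; rewrite inE.
have cA : #|T|%:R = #|A|%:R + #|~: A|%:R :> R by rewrite -natrD cardsC.
rewrite E1 natr_sum cA; move: H1 H2; rewrite big_split /= sumrB.
rewrite (splitA (load x)) (splitA (fun v => pos (load x v - 2))).
lra.
Qed.

Variable eta : R.

(* Projected subgradient ascent for [objective]; its value on an edge depends only on a ball of
   bounded radius. *)
Fixpoint iterate (t : nat) : T -> T -> R :=
  if t is t'.+1 then fun u v =>
    let x := iterate t' in
    Num.max 0 (Num.min 1 (x u v + eta * (1 - (2 < load x u)%R%:R - (2 < load x v)%R%:R)))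
  else fun _ _ => 0.

Lemma iterate_fractional t : fractional (iterate t).
Proof.
elim: t => [|t [IH _]]; first by split=> // u v; rewrite lexx ler01.
split=> u v /=; first by rewrite IH [1 - _ - _]addrAC.
by rewrite le_max lexx /= ge_max ler01 ge_min lexx.
Qed.

(** A supergradient of [objective]: an edge gains 1/2 at each end and loses 1 at each overloaded
    end. *)
Definition grad x u v : R := 1 - (2 < load x u)%R%:R - (2 < load x v)%R%:R.

(** The division by 2 is there because every edge appears as two ordered pairs. *)
Lemma objective_concave x y : fractional x -> fractional y ->
  objective y - objective x <= (\sum_v \sum_(u in nbr E v) grad x v u * (y v u - x v u)) / 2.
Proof.
move=> [xs _] [ys _].
have H v : load y v / 2 - pos (load y v - 2) - (load x v / 2 - pos (load x v - 2)) <=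
  (load y v - load x v) / 2 - (2 < load x v)%R%:R * (load y v - load x v).
  have := pos_ge (load y v - 2); have := pos_ge0 (load y v - 2).
  case: (ltP 2 (load x v)) => h; rewrite /= ?mul1r ?mul0r.
    have -> : pos (load x v - 2) = load x v - 2 by rewrite /pos max_r // subr_ge0 ltW.
    by lra.
  have -> : pos (load x v - 2) = 0 by rewrite /pos max_l // subr_le0.
  by lra.
rewrite /objective -sumrB; apply: le_trans (ler_sum _ (fun v _ => H v)) _.
have -> : \sum_v \sum_(u in nbr E v) grad x v u * (y v u - x v u) =
  \sum_v (load y v - load x v) - 2 * \sum_v (2 < load x v)%R%:R * (load y v - load x v).
  have E1 v : load y v - load x v = \sum_(u in nbr E v) (y v u - x v u) by rewrite sumrB.
  have E2 : \sum_v (2 < load x v)%R%:R * (load y v - load x v) =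
    \sum_v \sum_(u in nbr E v) (2 < load x v)%R%:R * (y v u - x v u).
    by apply: eq_bigr => v _; rewrite E1 mulr_sumr.
  have E3 : \sum_v (2 < load x v)%R%:R * (load y v - load x v) =
    \sum_v \sum_(u in nbr E v) (2 < load x u)%R%:R * (y v u - x v u).
    rewrite E2 sum_nbr_sym; apply: eq_bigr => v _; apply: eq_bigr => u _.
    by rewrite xs ys.
  rewrite mulrDl mul1r {1}E2 E3 opprD addrA.
  under [X in X - _ - _]eq_bigr => v _ do rewrite E1.
  rewrite -!sumrB; apply: eq_bigr => v _; rewrite -!sumrB; apply: eq_bigr => u _.
  by rewrite /grad; ring.
by rewrite sumrB -mulr_suml; lra.
Qed.

Definition sqdist x y : R := \sum_v \sum_(u in nbr E v) (x v u - y v u) ^+ 2.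

Lemma clip_contract (a b : R) : 0 <= b <= 1 ->
  (Num.max 0 (Num.min 1 a) - b) ^+ 2 <= (a - b) ^+ 2.
Proof.
case/andP=> b0 b1; rewrite /Num.max /Num.min.
case: (ltP 1 a) => h1; case: ltP => h2; nra.
Qed.

(** The usual analysis of projected subgradient ascent: clipping to [0, 1] does not increase the
    distance to [y], and [grad] takes values in {-1, 0, 1}, so a step adds at most eta^2 per ordered
    pair. *)
Lemma regret_step t y : 0 <= eta -> fractional y -> E \subset vpairs T ->
  4 * eta * (objective y - objective (iterate t)) <=
  sqdist (iterate t) y - sqdist (iterate t.+1) y + 2 * eta ^+ 2 * #|E|%:R.
Proof.
move=> e0 fy sE; have fx := iterate_fractional t.
have H := objective_concave fx fy.
set x := iterate t in fx H *; set G := \sum_v _ in H.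
have hs : 2 * #|E|%:R = \sum_v \sum_(u in nbr E v) 1 :> R.
  rewrite -natrM -handshake // natr_sum; apply: eq_bigr => v _.
  by rewrite sumr_const.
have H2 : sqdist (iterate t.+1) y <= sqdist x y - 2 * eta * G + eta ^+ 2 * (2 * #|E|%:R).
  rewrite hs /G /sqdist !mulr_sumr -sumrB -big_split /=; apply: ler_sum => v _.
  rewrite !mulr_sumr -sumrB -big_split /=; apply: ler_sum => u _.
  rewrite -/x; apply: le_trans (clip_contract _ (fy.2 v u)) _.
  rewrite -/(grad x v u).
  have : grad x v u ^+ 2 <= 1.
    by rewrite /grad; case: (2 < load x v)%R; case: (2 < load x u)%R; rewrite /=; lra.
  by move: (grad x v u) (x v u) (y v u) => g a b; nra.
have := ler_wpM2l e0 H; lra.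
Qed.

(** The squared distances telescope; the iteration starts at 0, at squared distance at most 2 * #|E|
    from any fractional [y]. *)
Lemma regret_bound N y : 0 <= eta -> fractional y -> E \subset vpairs T ->
  4 * eta * (\sum_(t < N) (objective y - objective (iterate t))) <=
  2 * #|E|%:R + 2 * N%:R * eta ^+ 2 * #|E|%:R.
Proof.
move=> e0 fy sE.
have H : 4 * eta * (\sum_(t < N) (objective y - objective (iterate t))) <=
  sqdist (iterate 0) y - sqdist (iterate N) y + 2 * N%:R * eta ^+ 2 * #|E|%:R.
  elim: N => [|N IH]; first by rewrite big_ord0 subrr !mulr0 !mul0r addr0.
  rewrite big_ord_recr mulrDr; apply: le_trans (lerD IH (regret_step N e0 fy sE)) _.
  rewrite -[N.+1%:R]natr1; lra.
apply: le_trans H _; rewrite lerD2r lerBlDr; apply: le_trans (_ : 2 * #|E|%:R <= _).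
  rewrite -natrM -handshake // natr_sum; apply: ler_sum => v _.
  rewrite /degree -sum1_card natr_sum; apply: ler_sum => u _ /=.
  by rewrite sub0r sqrrN; case/andP: (fy.2 v u) => h0 h1; nra.
rewrite lerDl; apply: sumr_ge0 => v _; apply: sumr_ge0 => u _; exact: sqr_ge0.
Qed.

(* The cycle of an optimal completion, restricted to the edges of the graph. *)
Lemma completion_fractional : (2 < #|T|)%N -> E \subset vpairs T ->
  exists2 y, fractional y & #|T|%:R - (mu E)%:R <= objective y.
Proof.
move=> T3 sE; have [F [sF /andP[_ /existsP[c /andP[uc cc]]] <- _]] := mu_spec T3 sE.
have cT v : v \in c.
  have cT : #|c| = #|T| by rewrite (card_uniqP uc) size_tuple.
  by have /(subset_cardP cT) -> : c \subset T by apply/subsetP.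
have nK : cancel (next c) (prev c) by apply: prev_next.
have pK : cancel (prev c) (next c) by apply: next_prev.
pose y u v : R := ((v == next c u) || (v == prev c u))%:R.
have fy : fractional y.
  split=> u v; last by rewrite /y; case: (_ || _); rewrite ler01 lexx.
  congr (_%:R); rewrite orbC.
  by congr (_ || _); apply/eqP/eqP => ->; rewrite ?nK ?pK.
exists y => //.
have ly v : load y v = #|[set next c v; prev c v] :&: nbr E v|%:R.
  rewrite -sum1_card natr_sum /load setIC [RHS]big_mkcond /= [LHS]big_mkcond /=.
  by apply: eq_bigr => u _; rewrite !inE /y; case: (adj E v u) => //=; case: (_ || _).
have ly2 v : load y v <= 2.
  rewrite ly ler_nat; apply: leq_trans (subset_leq_card (subsetIl _ _)) _.
  by rewrite cards2; case: (_ != _).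
have -> : objective y = \sum_v load y v / 2.
  by apply: eq_bigr => v _; rewrite /pos max_l ?subr0 // subr_le0.
rewrite -mulr_suml ler_pdivlMr //.
have key v : 2 - ([set v; next c v] \in F)%:R - ([set v; prev c v] \in F)%:R <= load y v.
  have : adj (E :|: F) v (next c v) by apply: next_cycle.
  have : adj (E :|: F) v (prev c v) by rewrite adj_sym; apply: prev_cycle.
  rewrite {1 2}/adj /= !inE => e1 e2.
  have H : (2 <= #|[set next c v; prev c v] :&: nbr E v| + ([set v; next c v] \in F) +
      ([set v; prev c v] \in F))%N.
    have H : ((next c v \in nbr E v) + (prev c v \in nbr E v) <=
       #|[set next c v; prev c v] :&: nbr E v|)%N.
      have np := next_prev_neq uc cT T3 v.
      case: (boolP (next c v \in _)) => n1; case: (boolP (prev c v \in _)) => n2 //=.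
      - apply: leq_trans (_ : #|[set next c v; prev c v]| <= _)%N; first by rewrite cards2 np.
        by apply/subset_leq_card; rewrite subsetI subxx subUset !sub1set n1.
      - by rewrite card_gt0; apply/set0Pn; exists (next c v); rewrite !inE eqxx; move: n1; rewrite inE.
      - by rewrite card_gt0; apply/set0Pn; exists (prev c v); rewrite !inE eqxx orbT; move: n2; rewrite inE.
    move: H; rewrite !inE /adj /=; set m := #|pred_of_set _|; move: m => m.
    by clear -e1 e2; case/orP: e1 => ->; case/orP: e2 => ->; rewrite /=; lia.
  by rewrite ly lerBlDr lerBlDr addrAC -!natrD ler_nat.
apply: le_trans (ler_sum _ (fun v _ => key v)); rewrite !sumrB sumr_const -!natr_sum.
have := sum_next_edge uc cT T3 F; have := sum_prev_edge uc cT T3 F; rewrite -!(ler_nat R) => h1 h2.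
move: h1 h2; set a := (\sum_v _)%:R; set b := (\sum_v _)%:R => h1 h2.
by rewrite -[X in 2 *+ X]/(#|T|) -mulr_natr; lra.
Qed.

End Subgradient.

(** * Local functionals of the random graph *)

Section PathEdges.
Variable T : finType.
Implicit Types (E Z : {set {set T}}) (A : {set T}) (v u x y : T) (s : seq T).

Fixpoint path_edges s : {set {set T}} :=
  if s is x :: ((y :: _) as s') then [set x; y] |: path_edges s' else set0.

Lemma sub_path_edges E s : (path_edges s \subset E) = sorted (adj E) s.
Proof.
elim: s => [|x [|y s] IH] //=; [exact: sub0set..|].
by rewrite subUset sub1set; congr (_ && _); apply: IH.
Qed.

Lemma path_edges_mem s e : e \in path_edges s -> e \subset s.
Proof.
elim: s => [|x [|y s] IH] //=; rewrite ?inE // => /orP[/eqP->|/IH H].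
  by apply/subsetP => z; rewrite !inE => /orP[]/eqP->; rewrite eqxx ?orbT.
by apply: subset_trans H _; apply/subsetP => z zs; rewrite inE zs orbT.
Qed.

Lemma path_edges_vpairs s : uniq s -> path_edges s \subset vpairs T.
Proof.
elim: s => [|x [|y s] IH] us; [exact: sub0set..|].
rewrite [path_edges _]/= subUset sub1set pair_vpairs IH ?andbT; last by case/andP: us.
by case/andP: us; rewrite inE negb_or => /andP[].
Qed.

Lemma card_path_edges s : uniq s -> #|path_edges s| = (size s).-1.
Proof.
elim: s => [|x [|y s] IH] us; rewrite /= ?cards0 //.
have xs : x \notin y :: s by case/andP: us.
rewrite cardsU1 -/(path_edges (y :: s)) IH; last by case/andP: us.
case: (boolP ([set x; y] \in _)) => // H; case/negP: xs.
by apply: (subsetP (path_edges_mem H)); rewrite set21.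
Qed.

Definition cycle_edges s : {set {set T}} :=
  if s is x :: s' then path_edges (x :: rcons s' x) else set0.

Lemma sub_cycle_edges E s : (cycle_edges s \subset E) = cycle (adj E) s.
Proof. by case: s => [|x s]; rewrite /cycle_edges ?sub0set // sub_path_edges. Qed.

Lemma cycle_edgesE s x : s != [::] -> cycle_edges (x :: s) = [set last x s; x] |: path_edges (x :: s).
Proof.
rewrite /cycle_edges => _.
suff H z : path_edges (z :: rcons s x) = [set last z s; x] |: path_edges (z :: s) by apply: H.
elim: s z => [|y s IH] z //=.
by rewrite -/(path_edges (y :: rcons s x)) -/(path_edges (y :: s)) IH setUCA.
Qed.

Lemma cycle_edges_vpairs s : 1 < size s -> uniq s -> cycle_edges s \subset vpairs T.
Proof.
case: s => [|x [|y s]] // _ us; rewrite cycle_edgesE // subUset sub1set path_edges_vpairs // andbT.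
rewrite pair_vpairs /=; case/andP: us => xs _.
by apply: contraNneq xs => <-; rewrite mem_last.
Qed.

Lemma card_cycle_edges s : 2 < size s -> uniq s -> #|cycle_edges s| = size s.
Proof.
case: s => [|x [|y [|z s]]] // _ us; rewrite cycle_edgesE // cardsU1 card_path_edges //.
case: (boolP ([set last _ _; x] \in _)) => // H; exfalso; move: H.
have xs : x \notin [:: y, z & s] by case/andP: us.
have ys : y \notin z :: s by case/and3P: us.
rewrite [path_edges _]/= in_setU1 => /orP[/eqP H|H].
  have : y \in [set last x [:: y, z & s]; x] by rewrite H set22.
  rewrite !inE => /orP[]/eqP yE.
    by move: ys; rewrite {1}yE /= mem_last.
  by move: xs; rewrite -yE mem_head.
by case/negP: xs; apply: (subsetP (path_edges_mem (s := [:: y, z & s]) H)); rewrite set22.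
Qed.

Definition paths m E : {set m.+1.-tuple T} := [set t : m.+1.-tuple T | uniq t & sorted (adj E) t].

End PathEdges.

Section PathCounts.
Local Open Scope ring_scope.
Variables (R : realType) (T : finType) (p : R).
Hypothesis p01 : 0 <= p <= 1.
Implicit Types (E Z : {set {set T}}) (A : {set T}) (v u x y : T) (s : seq T).

Lemma Pr_sorted s : uniq s -> Pr p (vpairs T) (fun E => sorted (adj E) s) = p ^+ (size s).-1.
Proof.
move=> us; rewrite -card_path_edges // -(@Pr_subset _ _ p (vpairs T)) ?path_edges_vpairs //.
by apply: eq_Ex => E _; rewrite sub_path_edges.
Qed.

Lemma Pr_cycle s : (2 < size s)%N -> uniq s ->
  Pr p (vpairs T) (fun E => cycle (adj E) s) = p ^+ size s.
Proof.
move=> s2 us; rewrite -card_cycle_edges // -(@Pr_subset _ _ p (vpairs T)) ?cycle_edges_vpairs ?(ltnW s2) //.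
by apply: eq_Ex => E _; rewrite sub_cycle_edges.
Qed.

Lemma Ex_card (I : finType) (P : I -> {set {set T}} -> bool) :
  Ex p (vpairs T) (fun E => #|[set i | P i E]|%:R) = \sum_i Pr p (vpairs T) (P i).
Proof.
rewrite /Pr -Ex_sum; apply: eq_Ex => E _; rewrite -sum1_card natr_sum big_mkcond /=.
by apply: eq_bigr => i _; rewrite inE; case: (P i E).
Qed.

Lemma Ex_paths m : Ex p (vpairs T) (fun E => #|paths m E|%:R) <= #|T|%:R * (#|T|%:R * p) ^+ m.
Proof.
rewrite Ex_card; apply: le_trans (_ : \sum_(t : m.+1.-tuple T) p ^+ m <= _).
  apply: ler_sum => t _; case: (boolP (uniq t)) => ut /=.
    by rewrite Pr_sorted // size_tuple.
  by rewrite /Pr Ex_cst exprn_ge0 //; case/andP: p01.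
by rewrite sumr_const card_tuple -[leLHS]mulr_natl natrX exprMn exprS mulrA.
Qed.

(** Cycles are counted as tuples, once for each start and direction; the overcount is harmless
    because this bound is later divided by the number of vertices. *)
Lemma Ex_short_cycles L :
  Ex p (vpairs T) (fun E => (short_cycles L E)%:R) <= \sum_(k < L.+1) (#|T|%:R * p) ^+ k.
Proof.
have p0 : 0 <= p by case/andP: p01.
under eq_Ex => E _ do rewrite /short_cycles natr_sum.
rewrite Ex_sum [leLHS]big_mkcond /=; apply: ler_sum => k _.
case: ifP => k2; last by rewrite exprn_ge0 // mulr_ge0.
rewrite Ex_card; apply: le_trans (_ : \sum_(t : k.-tuple T) p ^+ k <= _).
  apply: ler_sum => t _; case: (boolP (uniq t)) => ut /=.
    by rewrite Pr_cycle // size_tuple.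
  by rewrite /Pr Ex_cst exprn_ge0.
by rewrite sumr_const card_tuple -[leLHS]mulr_natl natrX exprMn.
Qed.

Lemma sum_degree_paths E : E \subset vpairs T -> (\sum_v degree E v)%N = #|paths 1 E|.
Proof.
move=> sE; under eq_bigr => v _ do rewrite /degree -sum1_card.
rewrite pair_big_dep /= sum1_card.
rewrite -(card_imset (f := fun t : T * T => ([tuple t.1; t.2] : 1.+1.-tuple T))) /=; last first.
  by move=> [a b] [c d] [] /= -> ->.
apply: eq_card => t; apply/imsetP/idP => [[[a b]]|].
  move=> H tE; have ab : adj E a b by have := (H : b \in nbr E a); rewrite inE.
  rewrite tE /paths in_set /= !andbT ab andbT.
  by rewrite inE (adj_neq sE ab).
rewrite /paths inE; case/tupleP: t => a t; case/tupleP: t => b t; rewrite (tuple0 t) /= !andbT => /andP[_ ab].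
exists (a, b); first by rewrite -[_ \in _]/(b \in nbr E a) inE.
by apply: val_inj.
Qed.

(** Write x^2 as x + x (x - 1): the second part counts paths of length two by their middle
    vertex. *)
Lemma sum_degree_sqr E : E \subset vpairs T ->
  (\sum_v degree E v ^ 2 <= #|paths 1 E| + #|paths 2 E|)%N.
Proof.
move=> sE; rewrite -sum_degree_paths //.
pose Q v := [set t in paths 2 E | tnth t (inord 1) == v].
have QP v (t : 2.+1.-tuple T) : (t \in Q v) = (t \in paths 2 E) && (tnth t (inord 1) == v).
  by rewrite inE.
have PP (t : 2.+1.-tuple T) : (t \in paths 2 E) = uniq t && sorted (adj E) t by rewrite inE.
have QE v : (degree E v * (degree E v).-1 <= #|Q v|)%N.
  pose S := [set t : T * T | [&& t.1 \in nbr E v, t.2 \in nbr E v & t.1 != t.2]].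
  have -> : (degree E v * (degree E v).-1)%N = #|S|.
    have -> : #|S| = (\sum_(u in nbr E v) \sum_(w in nbr E v :\ u) 1)%N.
      rewrite pair_big_dep sum1_card /=; apply: eq_card => -[a b]; rewrite !inE /= unfold_in /= !inE.
      by rewrite [b == a]eq_sym andbC; case: (adj E v a); case: (adj E v b); case: (a == b).
    rewrite /degree -[X in (X * _)%N]sum1_card big_distrl /=; apply: eq_bigr => u uv.
    by rewrite mul1n sum1_card (cardsD1 u (nbr E v)) uv.
  rewrite -(card_imset (f := fun t : T * T => ([tuple t.1; v; t.2] : 2.+1.-tuple T))) /=; last first.
    by move=> [a b] [c d] [] /= -> ->.
  apply/subset_leq_card/subsetP => t /imsetP[[a b] Hab ->]; rewrite QP PP /=.
  move: Hab; rewrite [_ \in S]inE /= => /and3P[]; rewrite [a \in _]inE [b \in _]inE => va vb ab.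
  rewrite (tnth_nth v) /= inordK //= eqxx !andbT !inE negb_or ab !andbT.
  by rewrite adj_sym va vb eq_sym (adj_neq sE va) (adj_neq sE vb).
have -> : (#|paths 2 E| = \sum_v #|Q v|)%N.
  rewrite -sum1_card (partition_big (fun t => tnth t (inord 1)) predT) //=; apply: eq_bigr => v _.
  by rewrite -sum1_card; apply: eq_bigl => t; rewrite /Q inE.
rewrite -big_split /=; apply: leq_sum => v _; apply: leq_trans (leq_add (leqnn _) (QE v)).
by case: (degree E v) => //= m; rewrite -mulnn; clear; lia.
Qed.

End PathCounts.

Section Balls.
Local Open Scope ring_scope.
Variable T : finType.
Implicit Types (E Z : {set {set T}}) (A : {set T}) (v u x y : T) (s : seq T).

Fixpoint gball E r v : {set T} :=
  if r is r'.+1 then gball E r' v :|: \bigcup_(u in gball E r' v) nbr E u else [set v].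

Lemma gball_mono E r v : gball E r v \subset gball E r.+1 v.
Proof. exact: subsetUl. Qed.

Lemma gball_le E r r' v : (r <= r')%N -> gball E r v \subset gball E r' v.
Proof.
elim: r' => [|r' IH]; first by rewrite leqn0 => /eqP ->.
by rewrite leq_eqVlt => /orP[/eqP->//|/IH H]; apply: subset_trans H (gball_mono _ _ _).
Qed.

Lemma gball_center E r v : v \in gball E r v.
Proof. by apply: (subsetP (gball_le E v (leq0n r))); rewrite /= inE. Qed.

Lemma gball_nbr E r v u w : u \in gball E r v -> adj E u w -> w \in gball E r.+1 v.
Proof. by move=> uB uw; rewrite /= inE; apply/orP; right; apply/bigcupP; exists u; rewrite ?inE. Qed.

Lemma gball_path E r v w : w \in gball E r v ->
  exists s, [/\ path (adj E) v s, last v s = w, uniq (v :: s) & (size s <= r)%N].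
Proof.
elim: r w => [|r IH] w; first by rewrite /= inE => /eqP ->; exists [::].
rewrite /= inE => /orP[/IH[s [? ? ? sr]]|/bigcupP[u /IH[s [ps ls us sr]]]].
  by exists s; split=> //; apply: leqW.
rewrite inE => uw.
have : path (adj E) v (rcons s w) by rewrite rcons_path ps ls.
have : last v (rcons s w) = w by rewrite last_rcons.
have sz : (size (rcons s w) <= r.+1)%N by rewrite size_rcons.
move=> lw pw; case/shortenP: pw lw => s' ps' us' ss' lw; exists s'; split=> //.
by apply: leq_trans (uniq_leq_size _ ss') sz; case/andP: us'.
Qed.

Lemma sum_ball E r : (\sum_v #|gball E r v| <= \sum_(m < r.+1) #|paths m E|)%N.
Proof.
apply: leq_trans (_ : \sum_(m < r.+1) \sum_v #|[set t in paths m E | thead t == v]| <= _)%N; last first.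
  apply: leq_sum => m _; rewrite -[leqRHS]sum1_card (partition_big (fun t => thead t) predT) //=.
  by apply: leq_sum => v _; rewrite -sum1_card; apply: eq_leq; apply: eq_bigl => t; rewrite inE.
rewrite exchange_big /=; apply: leq_sum => v _.
apply: leq_trans (_ : #|\bigcup_(m < r.+1) [set last v (tval t) | t in [set t in paths m E | thead t == v]]| <= _)%N.
  apply/subset_leq_card/subsetP => w /gball_path[s [ps ls us sr]].
  apply/bigcupP; exists (Ordinal (sr : (size s < r.+1)%N)) => //.
  apply/imsetP; exists [tuple of v :: in_tuple s]; last by rewrite /= ls.
  by rewrite inE theadE eqxx /paths inE us /= ps.
elim/big_rec2: _ => [|m B b _ IH]; first by rewrite cards0.
by apply: leq_trans (leq_card_setU _ _) _; rewrite leq_add // leq_imset_card.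
Qed.

End Balls.

Section LocalImage.
Local Open Scope ring_scope.
Variables (T1 T2 : finType) (i : T1 -> T2) (E : {set {set T2}}).
Hypotheses (inj_i : injective i).

(** The graph induced by [E] on the image of [i], with the labels of [T1]; for [T1 := 'I_k] it
    records the shape of a ball. *)
Definition pull : {set {set T1}} := [set e in vpairs T1 | i @: e \in E].

Hypothesis sE : E \subset vpairs T2.

Lemma adj_pull a b : adj pull a b = adj E (i a) (i b).
Proof.
rewrite /adj /= !inE cards2 imsetU1 imset_set1.
case: (boolP ([set i a; i b] \in E)) => [H|]; last by rewrite andbF.
have := adj_neq sE (H : adj E (i a) (i b)); rewrite andbT.
by case: (eqVneq a b) => // ->; rewrite eqxx.
Qed.

Lemma nbr_pull a : (forall w, adj E (i a) w -> w \in codom i) ->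
  nbr E (i a) = i @: nbr pull a.
Proof.
move=> H; apply/setP => w; rewrite inE; apply/idP/imsetP => [aw|[b]].
  have /codomP[b wE] := H w aw; exists b => //.
  by rewrite inE adj_pull -wE.
by rewrite inE adj_pull => ? ->.
Qed.

Lemma gball_pull s a : (forall u w, u \in gball pull s a -> adj E (i u) w -> w \in codom i) ->
  gball E s.+1 (i a) = i @: gball pull s.+1 a.
Proof.
elim: s => [|s IH] H.
  rewrite /= !big_set1 imsetU imset_set1 nbr_pull //.
  by move=> w; apply: H; rewrite /= inE.
have IH' := IH (fun u w us => H u w (subsetP (gball_mono _ _ _) _ us)).
rewrite [gball E s.+2 _]/= -/(gball E s.+1 (i a)) IH'.
rewrite [gball pull s.+2 _]/= -/(gball pull s.+1 a) imsetU; congr (_ :|: _).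
apply/setP => w; apply/bigcupP/imsetP => [[u /imsetP[b bB ->]]|[b /bigcupP[c cB]]].
  rewrite nbr_pull; last by move=> z; apply: H.
  case/imsetP => c cb ->; exists c => //; apply/bigcupP; by exists b.
move=> bc ->; exists (i c); first by rewrite imset_f.
by rewrite nbr_pull ?imset_f // => z; apply: H.
Qed.

(** Turns the event that a ball has a given vertex set into conditions on two disjoint families of
    pairs: those inside the image, and those from the ball of radius [r] to the outside. Vertices at
    distance [r.+1] may have neighbours outside. *)
Lemma gball_pull_full r a :
  (gball E r.+1 (i a) == i @: setT) =
  (gball pull r.+1 a == setT) && [forall u in gball pull r a, forall w, adj E (i u) w ==> (w \in codom i)].
Proof.
apply/eqP/andP => [H|[/eqP H1 /forall_inP H2]].
  have Hs s : (s <= r)%N -> forall u w, u \in gball pull s a -> adj E (i u) w -> w \in codom i.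
    elim: s => [|s IH] sr u w.
      rewrite /= inE => /eqP-> aw; have : w \in gball E r.+1 (i a).
        by apply: (subsetP (gball_le _ _ (_ : 1 <= r.+1)%N)) => //; apply: gball_nbr aw; rewrite /= inE.
      by rewrite H => /imsetP[c _ ->]; apply: codom_f.
    move=> us uw; have : i u \in gball E s.+1 (i a).
      by rewrite (gball_pull (IH (ltnW sr))) imset_f.
    move=> /gball_nbr/(_ uw)/(subsetP (gball_le _ _ (_ : s.+2 <= r.+1)%N)).
    by rewrite H => /(_ sr)/imsetP[c _ ->]; apply: codom_f.
  split; last first.
    by apply/forall_inP => u ur; apply/forallP => w; apply/implyP; apply: Hs ur.
  by move: H; rewrite (gball_pull (Hs r (leqnn r))) => /imset_inj -> //.
rewrite gball_pull ?H1 // => u w /H2/forallP/(_ w)/implyP; exact.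
Qed.

Variables (R : realType) (eta : R).

Lemma load_pull (x1 : T1 -> T1 -> R) (x2 : T2 -> T2 -> R) a :
  (forall w, adj E (i a) w -> w \in codom i) ->
  (forall b, adj pull a b -> x1 a b = x2 (i a) (i b)) ->
  load pull x1 a = load E x2 (i a).
Proof.
move=> H Hx; rewrite /load nbr_pull // big_imset /=; last by move=> ? ? _ _; apply: inj_i.
by apply: eq_bigr => b; rewrite inE => /Hx.
Qed.

Lemma gball_step (E' : {set {set T2}}) s u v : adj E' u v -> gball E' s v \subset gball E' s.+1 u.
Proof.
move=> uv; elim: s => [|s IHs].
  by rewrite [X in X \subset _]/= sub1set; apply: gball_nbr uv; apply: gball_center.
rewrite [X in X \subset _]/= subUset; apply/andP; split; last first.
  by apply/bigcupsP => z zs; apply/subsetP => w; rewrite inE; apply: gball_nbr; apply: (subsetP IHs).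
by apply: subset_trans IHs _; apply: gball_mono.
Qed.

(** Locality by induction: one more iteration reads the loads at the two ends, hence one more layer
    around each of them. *)
Lemma iterate_pull t a b : gball E t (i a) \subset codom i -> gball E t (i b) \subset codom i ->
  iterate pull eta t a b = iterate E eta t (i a) (i b).
Proof.
elim: t a b => // t IH a b Ha Hb /=.
have HL c : gball E t.+1 (i c) \subset codom i ->
    load pull (iterate pull eta t) c = load E (iterate E eta t) (i c).
  move=> Hc; apply: load_pull => [w cw|c' cc'].
    by apply: (subsetP Hc); apply: gball_nbr cw; apply: gball_center.
  apply: IH; first by apply: subset_trans Hc; apply: gball_mono.
  apply: subset_trans Hc; move: cc'; rewrite adj_pull => cc'.
  exact: gball_step.
by rewrite !HL // IH //; [apply: subset_trans Ha|apply: subset_trans Hb]; apply: gball_mono.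
Qed.

Lemma load_iterate_pull t a : gball E t.+1 (i a) = i @: setT ->
  load pull (iterate pull eta t) a = load E (iterate E eta t) (i a).
Proof.
move=> H; have Hc : gball E t.+1 (i a) \subset codom i.
  by rewrite H; apply/subsetP => w /imsetP[c _ ->]; apply: codom_f.
apply: load_pull => [w cw|c' cc'].
  by apply: (subsetP Hc); apply: gball_nbr cw; apply: gball_center.
apply: iterate_pull; first by apply: subset_trans Hc; apply: gball_mono.
apply: subset_trans Hc; move: cc'; rewrite adj_pull => cc'.
exact: gball_step.
Qed.

End LocalImage.

Section LocalFormula.
Local Open Scope ring_scope.
Variables (R : realType) (T : finType) (k : nat) (p eta : R) (t : nat).
Hypothesis p01 : 0 <= p <= 1.

Definition excess (T' : finType) (E : {set {set T'}}) (v : T') : R :=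
  let l := load E (iterate E eta t) v in l / 2 - pos (l - 2).

(** Contribution of a labelled ball [tau] with root [a]. The exponent of 1 - p counts the absent
    pairs inside it and those between its ball of radius [t] and the #|T| - k other vertices. *)
Definition local_term (tau : {set {set 'I_k}}) (a : 'I_k) : R :=
  (gball tau t.+1 a == setT)%:R * excess tau a * p ^+ #|tau| *
  (1 - p) ^+ (#|vpairs 'I_k :\: tau| + #|gball tau t a| * (#|T| - k)).

Lemma Pr_pull (i : 'I_k -> T) (tau : {set {set 'I_k}}) (a : 'I_k) : injective i -> tau \subset vpairs 'I_k ->
  Pr p (vpairs T) (fun E => (pull i E == tau) &&
    [forall u in gball tau t a, forall w, adj E (i u) w ==> (w \in codom i)]) =
  p ^+ #|tau| * (1 - p) ^+ (#|vpairs 'I_k :\: tau| + #|gball tau t a| * (#|T| - k)).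
Proof.
move=> inj_i stau; pose B := gball tau t a.
have injI : injective (fun e : {set 'I_k} => i @: e) by apply: imset_inj.
pose S1 : {set {set T}} := (fun e : {set 'I_k} => i @: e) @: vpairs 'I_k.
pose pairs := setX B (~: (i @: setT)).
pose S2 : {set {set T}} := (fun bw : 'I_k * T => [set i bw.1; bw.2]) @: pairs.
have outP w : (w \in ~: (i @: setT)) = (w \notin codom i).
  rewrite inE; congr (~~ _); apply/imsetP/codomP => [[x _ ->]|[x ->]]; first by exists x.
  by exists x.
have S1v : S1 \subset vpairs T.
  by apply/subsetP => e /imsetP[f fv ->]; move: fv; rewrite !inE card_imset.
have S2v : S2 \subset vpairs T.
  apply/subsetP => e /imsetP[[b w]]; rewrite inE /= outP => /andP[_ wc] ->.
  by rewrite pair_vpairs; apply: contraNneq wc => <-; apply: codom_f.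
have dis : [disjoint S1 & S2].
  rewrite -setI_eq0; apply/eqP/setP => e; rewrite !inE; apply/negbTE/negP.
  case/andP=> /imsetP[f _ ->] /imsetP[[b w]]; rewrite inE /= outP => /andP[_ wc] /setP/(_ w).
  rewrite set22 => /imsetP[c _ wE]; move: wc; rewrite wE codom_f //.
have cS2 : #|S2| = (#|B| * (#|T| - k))%N.
  rewrite card_in_imset ?cardsX.
    by rewrite [#|~: _|]cardsCs setCK card_imset // cardsT card_ord.
  move=> [b w] [b' w']; rewrite /pairs !in_setX /= !outP => /andP[_ wc] /andP[_ wc'] /setP H.
  have := H (i b); have := H w; rewrite !inE !eqxx orbT /=.
  rewrite (_ : (w == i b') = false) /=; last by apply: contraNF wc => /eqP->; apply: codom_f.
  rewrite (_ : (i b == w') = false) ?orbF; last by apply: contraNF wc' => /eqP<-; apply: codom_f.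
  by move=> /esym/eqP -> /esym/eqP/inj_i ->.
pose f (A : {set {set T}}) : R := (A == (fun e : {set 'I_k} => i @: e) @: tau)%:R.
pose g (A : {set {set T}}) : R := (A == set0)%:R.
transitivity (Ex p (vpairs T) (fun E => f (E :&: S1) * g (E :&: S2))).
  apply: eq_Ex => E sE; rewrite -natrM mulnb; congr (nat_of_bool (_ && _))%:R.
    apply/eqP/eqP => [<-|H].
      apply/setP => e; rewrite inE; apply/andP/imsetP => [[eE /imsetP[e' ev ee]]|[e']].
        by exists e'; rewrite // inE ev -ee.
      by rewrite inE => /andP[ev eE] ->; rewrite eE; split=> //; apply/imsetP; exists e'.
    apply/setP => e; rewrite inE; apply/andP/idP => [[ev eE]|et].
      have : i @: e \in E :&: S1 by rewrite inE eE imset_f.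
      by rewrite H => /imsetP[e' e't /injI ->].
    have ev := subsetP stau e et; split=> //.
    have : i @: e \in (fun e : {set 'I_k} => i @: e) @: tau by apply/imsetP; exists e.
    by rewrite -H inE => /andP[].
  apply/forall_inP/eqP => [H|/setP H u uB].
    apply/setP => e; rewrite !inE; apply/negbTE/negP => /andP[eE /imsetP[[b w]]].
    rewrite inE /= outP => /andP[bB wc] ee; move: wc; apply/negP; rewrite negbK.
    by have /forallP/(_ w)/implyP := H b bB; apply; rewrite /adj /= -ee.
  apply/forallP => w; apply/implyP => uw; apply/negPn/negP => wc.
  have := H [set i u; w]; rewrite !inE (uw : [set i u; w] \in E) /= => /negP; apply.
  by apply/imsetP; exists (u, w); rewrite // inE /= outP uB.
rewrite Ex_prod // /f /g !Ex_point ?sub0set //; last exact: imsetS.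
rewrite cards0 expr0 mul1r setD0 cS2 card_imset // exprD -!mulrA; congr (_ * (_ * _)).
congr (_ ^+ _); rewrite !cardsD card_imset //; congr (_ - _)%N.
by rewrite -imsetI ?card_imset // => ? ? _ _; apply: injI.
Qed.

(** Summing over the injections of ['I_k] counts each vertex set of size [k] exactly k! times, so a
    ball can be recorded by a labelled graph instead of an isomorphism class. *)
Lemma ball_sum_formula : (0 < k)%N ->
  \sum_v Ex p (vpairs T) (fun E => (#|gball E t.+1 v| == k)%:R * excess E v) =
  (#|T| ^_ k)%:R / k`!%:R * \sum_(tau : {set {set 'I_k}} | tau \subset vpairs 'I_k) \sum_a local_term tau a.
Proof.
move=> k0; have kf0 : (k`!%:R : R) != 0 by rewrite pnatr_eq0 -lt0n fact_gt0.
apply: (mulfI kf0); rewrite mulrA mulrCA divff // mulr1.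
pose injs := [set f : {ffun 'I_k -> T} | injectiveb f].
have count (B : {set T}) : #|B| = k -> #|[set f in injs | f @: setT == B]| = k`!.
  move=> cB; have kE : k ^_ k = #|B| ^_ #|'I_k| by rewrite cB card_ord.
  rewrite -ffactnn kE -card_inj_ffuns_on.
  apply: eq_card => f; rewrite [LHS]inE [f \in injs]inE [RHS]inE.
  case: (boolP (injectiveb f)) => [/injectiveP fi|_] /=; last by rewrite andbF.
  rewrite andbT; apply/eqP/ffun_onP => [<- x|H]; first exact: imset_f.
  apply/eqP; rewrite eqEcard card_imset // cardsT card_ord cB leqnn andbT.
  by apply/subsetP => y /imsetP[x _ ->].
transitivity (\sum_(f in injs) \sum_a Ex p (vpairs T)
    (fun E => (gball E t.+1 (f a) == f @: setT)%:R * excess (pull f E) a)).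
  rewrite -Ex_sum -ExZl; under [RHS]eq_bigr => f _ do rewrite -Ex_sum.
  rewrite -Ex_sum; apply: eq_Ex => E sE; rewrite mulr_sumr.
  transitivity (\sum_v \sum_(f in injs) (gball E t.+1 v == f @: setT)%:R * excess E v).
    apply: eq_bigr => v _; rewrite -mulr_suml -natr_sum mulrA; congr (_ * _).
    rewrite -natrM; congr (_%:R); case: eqP => [/count <-|cB].
      rewrite muln1 -sum1_card [RHS]big_mkcond [LHS]big_mkcond /=; apply: eq_bigr => f _.
      by rewrite inE eq_sym; case: (f \in injs) => //=; case: (_ == _).
    rewrite muln0 big1 // => f; rewrite inE => /injectiveP fi; case: eqP => // H.
    by case: cB; rewrite H card_imset // cardsT card_ord.
  rewrite exchange_big /=; apply: eq_bigr => f; rewrite inE => /injectiveP fi.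
  rewrite (bigID (mem (f @: setT))) /= [X in _ + X]big1 ?addr0; last first.
    move=> v vf; case: (gball E t.+1 v =P f @: setT) => [H|]; last by rewrite mul0r.
    by move: vf; rewrite -H gball_center.
  rewrite big_imset /=; last by move=> ? ? _ _; apply: fi.
  apply: eq_big => [a|a _]; first by rewrite inE.
  case: eqP => [H|]; rewrite ?mul0r // /excess.
  by rewrite (load_iterate_pull fi sE eta H).
have cinj : #|injs| = (#|T| ^_ k)%N.
  have kE : #|T| ^_ k = #|T| ^_ #|'I_k| by rewrite card_ord.
  by rewrite kE -card_inj_ffuns.
rewrite -cinj -[X in X%:R]sum1_card natr_sum mulr_suml; apply: eq_bigr => f; rewrite inE => /injectiveP fi.
rewrite mul1r [RHS]exchange_big /=; apply: eq_bigr => a _.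
transitivity (Ex p (vpairs T) (fun E => \sum_(tau : {set {set 'I_k}} | tau \subset vpairs 'I_k)
   (gball tau t.+1 a == setT)%:R * excess tau a * ((pull f E == tau) &&
    [forall u in gball tau t a, forall w, adj E (f u) w ==> (w \in codom f)])%:R)).
  apply: eq_Ex => E sE.
  pose F (tau : {set {set 'I_k}}) : R := (gball tau t.+1 a == setT)%:R * excess tau a * ((pull f E == tau) &&
    [forall u in gball tau t a, forall w, adj E (f u) w ==> (w \in codom f)])%:R.
  transitivity (\sum_(tau : {set {set 'I_k}} | tau \subset vpairs 'I_k) F tau); last by [].
  rewrite (bigD1 (pull f E)) /=; last by apply/subsetP => e; rewrite inE => /andP[].
  rewrite [X in _ + X]big1 ?addr0; last first.
    by move=> tau /andP[_ /negbTE tE]; rewrite /F [pull f E == tau]eq_sym tE mulr0.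
  by rewrite /F eqxx andTb -[_ :|: _]/(gball E t.+1 (f a)) gball_pull_full // -mulnb natrM mulrAC.
rewrite Ex_sum; apply: eq_bigr => tau stau; rewrite ExZl /local_term -[RHS]mulrA; congr (_ * _).
exact: Pr_pull.
Qed.

End LocalFormula.

Section BallEdges.
Local Open Scope ring_scope.
Variable T : finType.
Implicit Types (E : {set {set T}}) (v : T).

(** Every vertex of a new layer has its own edge back to the previous ball. Hence a ball with k
    vertices has at least k - 1 edges, the number that balances the roughly n^k / n choices of its
    vertices. *)
Lemma card_ball_edges E r v : (#|gball E r v| <= #|[set e in E | e \subset gball E r v]|.+1)%N.
Proof.
elim: r => [|r IH]; first by rewrite /= cards1.
set B := gball E r v in IH *; set B' := gball E r.+1 v.
have BB' : B \subset B' by apply: gball_mono.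
pose f w := odflt w [pick u in B | adj E u w].
have fP w : w \in B' :\: B -> f w \in B /\ adj E (f w) w.
  rewrite inE [w \in B']inE => /andP[wB]; rewrite (negbTE wB) /= => /bigcupP[u uB]; rewrite inE => uw.
  by rewrite /f; case: pickP => [z /andP[]//|/(_ u)]; rewrite uB uw.
have H : (#|B' :\: B| <= #|[set e in E | e \subset B'] :\: [set e in E | e \subset B]|)%N.
  rewrite -(card_in_imset (f := fun w => [set f w; w])).
    apply/subset_leq_card/subsetP => e /imsetP[w wB ->]; have [fB fw] := fP w wB.
    move: wB; rewrite inE => /andP[wB wB'].
    rewrite !inE (fw : [set f w; w] \in E) /= !subUset !sub1set (subsetP BB' _ fB) wB' fB.
    by rewrite (negbTE wB).
  move=> w w' wB wB' /setP H; have := H w; rewrite set22 => /esym; rewrite !inE => /orP[]/eqP // wE.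
  by have [] := fP w' wB'; rewrite -wE => wBB; move: wB; rewrite inE wBB.
have sub : [set e in E | e \subset B] \subset [set e in E | e \subset B'].
  by apply/subsetP => e; rewrite !inE => /andP[-> eB] /=; apply: subset_trans eB BB'.
have := cardsID B B'; rewrite (setIidPr BB') => <-.
have := cardsID [set e in E | e \subset B] [set e in E | e \subset B']; rewrite (setIidPr sub) => <-.
by rewrite -addSn leq_add.
Qed.

Lemma full_ball_edges E r v : gball E r v = setT -> (#|T| <= #|E|.+1)%N.
Proof.
move=> H; rewrite -cardsT -H; apply: leq_trans (card_ball_edges E r v) _; rewrite ltnS.
by apply/subset_leq_card/subsetP => e; rewrite inE => /andP[].
Qed.

End BallEdges.

(** * Convergence of the normalised mean for fixed degree *)

Section RealLimits.
Import numFieldNormedType.Exports.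
Local Open Scope classical_set_scope.
Local Open Scope ring_scope.
Variable R : realType.
Implicit Types (d x p : R) (n k : nat).

Lemma near_infty_ge (P : nat -> Prop) (N : nat) : (forall n, (N <= n)%N -> P n) -> \forall n \near \oo, P n.
Proof. by move=> H; exists N => // n /=; apply: H. Qed.

(** Such a sequence is Cauchy. A different truncation may thus be used for each accuracy. *)
Lemma approx_cvg (a : nat -> R) :
  (forall e : R, 0 < e -> exists2 u : nat -> R, cvgn u & \forall n \near \oo, `|a n - u n| <= e) ->
  cvgn a.
Proof.
move=> H; apply: cauchy_cvg; apply/cauchy_ballP => e e0.
have e4 : 0 < e / 4 by rewrite divr_gt0.
have [u /cvg_cauchy/cauchy_ballP/(_ (e / 4) e4) [[A B] /= [A1 B1] AB] Hu] := H _ e4.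
exists ((fun x : R => exists2 n, A (u n) & a n = x /\ `|a n - u n| <= e / 4),
        (fun x : R => exists2 n, B (u n) & a n = x /\ `|a n - u n| <= e / 4)) => /=.
  split; rewrite /= /nbhs /=.
    by near=> n; exists n; [near: n; exact: A1|split=> //; near: n; exact: Hu].
  by near=> n; exists n; [near: n; exact: B1|split=> //; near: n; exact: Hu].
move=> [x y] /= [[n An [<- Hn]] [m Bm [<- Hm]]].
have := AB (u n, u m) (conj An Bm); rewrite /ball /= => nm.
rewrite (_ : a n - a m = (a n - u n) + (u n - u m) - (a m - u m)); last by ring.
apply: le_lt_trans (ler_normB _ _) _; apply: le_lt_trans (lerD (ler_normD _ _) (lexx _)) _.
lra.
Unshelve. all: by end_near. Qed.

Lemma expR_lower x : 0 <= x < 1 -> expR (- (x / (1 - x))) <= 1 - x.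
Proof.
case/andP=> x0 x1; have y0 : 0 < 1 - x by rewrite subr_gt0.
rewrite expRN -[leRHS]invrK lef_pV2 ?posrE ?expR_gt0 ?invr_gt0 //.
apply: le_trans (expR_ge1Dx _); rewrite le_eqVlt; apply/orP; left; apply/eqP.
by field; apply: lt0r_neq0.
Qed.

Lemma expR_upper x : 1 - x <= expR (- x).
Proof. by have := expR_ge1Dx (- x). Qed.

Lemma powr_expR_upper x n : x <= 1 -> (1 - x) ^+ n <= expR (- (n%:R * x)).
Proof.
move=> x1; rewrite -mulrN expRM_natl; apply: lerXn2r; rewrite ?nnegrE ?subr_ge0 ?expR_ge0 //.
exact: expR_upper.
Qed.

Lemma powr_expR_lower x n : 0 <= x < 1 -> expR (- (n%:R * (x / (1 - x)))) <= (1 - x) ^+ n.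
Proof.
move=> x01; rewrite -mulrN expRM_natl; apply: lerXn2r; rewrite ?nnegrE ?expR_ge0 //.
  by rewrite subr_ge0; case/andP: x01 => _ /ltW.
exact: expR_lower.
Qed.

Lemma cvg_over_n d : d / n%:R @[n --> \oo] --> (0 : R).
Proof.
rewrite -(mulr0 d); apply: cvgM; first exact: cvg_cst.
rewrite -(cvg_shiftS (fun n => n%:R^-1 : R)); exact: cvg_harmonic.
Qed.

Lemma cvg_one_minus d : 0 <= d -> (1 - d / n%:R) ^+ n @[n --> \oo] --> expR (- d).
Proof.
move=> d0.
have H0 := cvg_over_n d.
have nd : \forall n \near \oo, n%:R * (d / n%:R) = d :> R.
  by apply: (@near_infty_ge _ 1) => n n1; rewrite mulrC divfK // pnatr_eq0 -lt0n.
have nd1 : \forall n \near \oo, d / n%:R < 1.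
  by apply: (cvgr_lt _ H0); exact: ltr01.
apply: (@squeeze_cvgr _ _ _ _ (fun n => expR (- (d / (1 - d / n%:R)))) (fun=> expR (- d))).
- near=> n; have E : n%:R * (d / n%:R) = d by near: n.
  have n1 : d / n%:R < 1 by near: n.
  apply/andP; split.
    rewrite -[X in X / _]E -mulrA; apply: powr_expR_lower.
    by rewrite n1 divr_ge0.
  by rewrite -[X in _ <= expR (- X)]E; apply: powr_expR_upper; apply: ltW.
- apply: continuous_cvg; first exact: continuous_expR.
  apply: cvgN; rewrite -[X in _ --> X](divr1 d); apply: cvgM; first exact: cvg_cst.
  apply: cvgV; rewrite ?oner_eq0 //.
  by rewrite -[X in _ --> X](subr0 1); apply: cvgB => //; exact: cvg_cst.
- exact: cvg_cst.
Unshelve. all: by end_near. Qed.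

Lemma cvg_ffact k : (n ^_ k)%:R / n%:R ^+ k @[n --> \oo] --> (1 : R).
Proof.
elim: k => [|k IH].
  by apply: cvg_near_cst; apply: (@near_infty_ge _ 0) => n _; rewrite ffactn0 expr0 divr1.
have H : 1 - k%:R / n%:R @[n --> \oo] --> (1 - 0 : R).
  by apply: cvgB; [exact: cvg_cst|exact: cvg_over_n].
rewrite subr0 in H; rewrite -[X in _ --> X](mulr1 1).
apply: cvg_trans (cvgM IH H); apply: near_eq_cvg.
apply: (@near_infty_ge _ k.+1) => n kn.
rewrite ffactnSr natrM exprSr invfM mulrACA natrB ?(ltnW kn) //; congr (_ * _).
by rewrite mulrBl divff // pnatr_eq0 -lt0n; apply: leq_trans kn.
Qed.

End RealLimits.

Section LocalApproximation.
Import numFieldNormedType.Exports.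
Local Open Scope classical_set_scope.
Local Open Scope ring_scope.
Variables (R : realType) (T : finType).
Hypothesis T3 : (2 < #|T|)%N.
Implicit Types (E : {set {set T}}) (m r t : nat) (p : R).

(** With m^2 steps of size 1/m both terms of [regret_bound] equal 2 * #|E|, and the average falls
    short of the maximum by at most #|E| / m. *)
Definition avg_objective E m : R :=
  (\sum_(t < m ^ 2) objective E (iterate E m%:R^-1 t)) / (m ^ 2)%:R.

Lemma avg_objective_lower E m : E \subset vpairs T -> (0 < m)%N ->
  #|T|%:R - (mu E)%:R <= avg_objective E m + #|E|%:R / m%:R.
Proof.
move=> sE m0; have [y fy Fy] := @completion_fractional R T E T3 sE.
have m0' : 0 < m%:R :> R by rewrite ltr0n.
have mi0 : 0 <= m%:R^-1 :> R by rewrite invr_ge0 ltW.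
have := regret_bound (m ^ 2) mi0 fy sE.
rewrite sumrB sumr_const card_ord -[X in X - _]mulr_natr /avg_objective.
set S := \sum_(t < _) _; rewrite natrX => H.
apply: le_trans Fy _; rewrite -(ler_pM2r (exprn_gt0 2 m0')) mulrDl divfK ?expf_neq0 ?lt0r_neq0 //.
move: (ler_wpM2r (ltW m0') H).
have -> : 4 * m%:R^-1 * (objective E y * m%:R ^+ 2 - S) * m%:R = 4 * (objective E y * m%:R ^+ 2 - S).
  by field; apply: lt0r_neq0.
have -> : (2 * #|E|%:R + 2 * m%:R ^+ 2 * m%:R^-1 ^+ 2 * #|E|%:R) * m%:R = 4 * (m%:R * #|E|%:R) :> R.
  by field; apply: lt0r_neq0.
have -> : #|E|%:R / m%:R * m%:R ^+ 2 = m%:R * #|E|%:R :> R by field; apply: lt0r_neq0.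
lra.
Qed.

Lemma avg_objective_upper E m r : E \subset vpairs T -> (0 < m)%N -> (0 < r)%N ->
  avg_objective E m <= #|T|%:R - (mu E)%:R + (3 * #|T|%:R / (2 * r%:R) + 1 + (short_cycles (2 * r) E)%:R).
Proof.
move=> sE m0 r0; have [A HA] := mu_approx T3 sE r0.
have m0' : 0 < (m ^ 2)%:R :> R by rewrite ltr0n expn_gt0 m0.
have r0' : 0 < r%:R :> R by rewrite ltr0n.
rewrite /avg_objective ler_pdivrMr //.
apply: le_trans (_ : \sum_(t < m ^ 2) (#|T|%:R - (mu E)%:R + (3 * #|T|%:R / (2 * r%:R) + 1 +
   (short_cycles (2 * r) E)%:R)) <= _); last first.
  by rewrite sumr_const card_ord [leRHS]mulr_natr.
apply: ler_sum => t _; have H := weak_duality E A (iterate_fractional E (m%:R^-1 : R) t).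
move: HA; rewrite -(ler_nat R) !(natrD, natrM).
set n : R := #|T|%:R in H *; set a : R := #|A|%:R in H *; set c : R := (short_cycles _ _)%:R.
set s : R := (\sum_v _)%:R in H *; set u : R := (mu E)%:R; set F := objective _ _ in H *.
move=> HA; have H2 := ler_wpM2l (ltW r0') H.
rewrite -(ler_pM2r (_ : 0 < 2 * r%:R)) ?mulr_gt0 //.
have -> : (n - u + (3 * n / (2 * r%:R) + 1 + c)) * (2 * r%:R) = (n - u + 1 + c) * (2 * r%:R) + 3 * n.
  by field; apply: lt0r_neq0.
move: HA H2; clear; nra.
Qed.

Variable p : R.
Hypothesis p01 : 0 <= p <= 1.

Lemma Ex_card_edges : Ex p (vpairs T) (fun E => #|E|%:R) <= #|T|%:R * (#|T|%:R * p).
Proof.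
apply: le_trans (Ex_paths T p01 1); apply: le_Ex => // E sE.
by rewrite ler_nat -sum_degree_paths // handshake // mul2n -addnn leq_addr.
Qed.

Lemma mean_approx m r : (0 < m)%N -> (0 < r)%N ->
  `|Ex p (vpairs T) (fun E => (mu E)%:R) / #|T|%:R -
    (1 - Ex p (vpairs T) (fun E => avg_objective E m) / #|T|%:R)| <=
  #|T|%:R * p / m%:R + (3 / (2 * r%:R) + (1 + \sum_(k < (2 * r).+1) (#|T|%:R * p) ^+ k) / #|T|%:R).
Proof.
move=> m0 r0; have n0 : 0 < #|T|%:R :> R by rewrite ltr0n ltnW // ltnW.
have r0' : 0 < r%:R :> R by rewrite ltr0n.
have m0' : 0 < m%:R :> R by rewrite ltr0n.
set mE := Ex p _ _; set aE := Ex p _ _.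
have H1 : #|T|%:R - mE <= aE + #|T|%:R * (#|T|%:R * p) / m%:R.
  apply: le_trans (_ : aE + Ex p (vpairs T) (fun E => #|E|%:R) / m%:R <= _).
    rewrite -{1}(Ex_cst p (vpairs T) #|T|%:R) -ExB mulrC -ExZl -ExDf; apply: le_Ex => // E sE.
    by rewrite mulrC; apply: avg_objective_lower.
  by rewrite lerD2l ler_pM2r ?invr_gt0 // Ex_card_edges.
have H2 : aE <= #|T|%:R - mE + (3 * #|T|%:R / (2 * r%:R) + 1 + \sum_(k < (2 * r).+1) (#|T|%:R * p) ^+ k).
  apply: le_trans (_ : #|T|%:R - mE + (3 * #|T|%:R / (2 * r%:R) + 1 +
     Ex p (vpairs T) (fun E => (short_cycles (2 * r) E)%:R)) <= _); last first.
    by rewrite lerD2l lerD2l Ex_short_cycles.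
  rewrite -{1}(Ex_cst p (vpairs T) #|T|%:R) -ExB.
  rewrite -(Ex_cst p (vpairs T) (3 * #|T|%:R / (2 * r%:R) + 1)) -!ExDf.
  by apply: le_Ex => // E sE; apply: avg_objective_upper.
set n : R := #|T|%:R in n0 H1 H2 *.
set C := \sum_(k < _) _ in H2 *.
have -> : mE / n - (1 - aE / n) = (mE + aE - n) / n by field; apply: lt0r_neq0.
have -> : n * p / m%:R + (3 / (2 * r%:R) + (1 + C) / n) =
   (n * (n * p) / m%:R + (3 * n / (2 * r%:R) + 1 + C)) / n.
  by field; rewrite !lt0r_neq0.
rewrite normrM [`|n^-1|]ger0_norm ?invr_ge0 ?(ltW n0) // ler_pM2r ?invr_gt0 //.
have K1 : 0 <= n * (n * p) / m%:R.
  by case/andP: p01 => p0 _; rewrite divr_ge0 ?mulr_ge0 ?ler0n // ltW.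
have K2 : 0 <= 3 * n / (2 * r%:R) + 1 + C.
  rewrite addr_ge0 //; last first.
    by apply: sumr_ge0 => k _; rewrite exprn_ge0 // mulr_ge0 ?(ltW n0) //; case/andP: p01.
  by rewrite addr_ge0 // divr_ge0 ?mulr_ge0 ?(ltW n0) ?(ltW r0').
rewrite ler_norml; lra.
Qed.

Variable (eta : R) (t : nat).

Lemma excess_bound E v : `|excess eta t E v| <= 1 + (degree E v)%:R.
Proof.
have [_ x01] := iterate_fractional E eta t; rewrite /excess; set l := load _ _ _.
have l0 : 0 <= l by apply: sumr_ge0 => u _; case/andP: (x01 v u).
have l1 : l <= (degree E v)%:R.
  by rewrite /degree -sum1_card natr_sum; apply: ler_sum => u _; case/andP: (x01 v u).
have p0 := pos_ge0 (l - 2).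
have p1 : pos (l - 2) <= l by rewrite /pos ge_max l0 /=; lra.
have p2 : l - 2 <= pos (l - 2) := pos_ge _.
rewrite ler_norml; apply/andP; split; last first.
  lra.
have : pos (l - 2) <= l / 2 + (1 + (degree E v)%:R).
  by lra.
lra.
Qed.

Lemma objective_excess E : objective E (iterate E eta t) = \sum_v excess eta t E v.
Proof. by []. Qed.

(** A vertex whose ball has more than [K] vertices contributes at most 1 + M if its degree is at
    most [M], paid for by the ball size over [K], and otherwise at most 1 + degree, paid for by
    degree (1 + degree) / M. *)
Lemma truncation E (K M : nat) : E \subset vpairs T -> (0 < K)%N -> (0 < M)%N ->
  `|objective E (iterate E eta t) -
    \sum_(k < K) \sum_v (#|gball E t.+1 v| == k.+1)%:R * excess eta t E v| <=
  (1 + M%:R) / K%:R * \sum_(m < t.+2) #|paths m E|%:R + (2 * #|paths 1 E|%:R + #|paths 2 E|%:R) / M%:R.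
Proof.
move=> sE K0 M0; rewrite exchange_big /= objective_excess -sumrB.
have K0' : 0 < K%:R :> R by rewrite ltr0n.
have M0' : 0 < M%:R :> R by rewrite ltr0n.
apply: le_trans (ler_norm_sum _ _ _) _.
apply: le_trans (_ : \sum_v ((1 + M%:R) / K%:R * #|gball E t.+1 v|%:R +
   ((degree E v)%:R + (degree E v ^ 2)%:R) / M%:R) <= _).
  apply: ler_sum => v _; set b := #|gball E t.+1 v|; set x := excess _ _ _ _.
  have hx : `|x| <= 1 + (degree E v)%:R by apply: excess_bound.
  have b0 : (0 < b)%N by rewrite card_gt0; apply/set0Pn; exists v; apply: gball_center.
  have nn1 : 0 <= (1 + M%:R) / K%:R * b%:R :> R by rewrite mulr_ge0 ?divr_ge0 ?addr_ge0 ?ler0n ?ler01.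
  have nn2 : 0 <= ((degree E v)%:R + (degree E v ^ 2)%:R) / M%:R :> R.
    by rewrite divr_ge0 ?addr_ge0 ?ler0n.
  rewrite -mulr_suml -natr_sum; case: (leqP b K) => bK.
    have -> : (\sum_(k < K) (b == k.+1))%N = 1%N.
      have bK' : (b.-1 < K)%N by rewrite prednK.
      rewrite (bigD1 (Ordinal bK')) //= prednK // eqxx big1 // => k.
      rewrite -val_eqE /= => /negbTE kb.
      by have -> : (b == k.+1) = (k == b.-1 :> nat); rewrite ?kb // -[in LHS](prednK b0) eqSS eq_sym.
    by rewrite mul1r subrr normr0 addr_ge0.
  rewrite big1 ?mul0r ?subr0; last first.
    by move=> k _; case: eqP => // bk; move: bK; rewrite bk ltnNge ltn_ord.
  case: (leqP (degree E v) M) => dM.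
    apply: le_trans hx _; rewrite -[leLHS]addr0 lerD //.
    apply: le_trans (_ : 1 + M%:R <= _); first by rewrite lerD2l ler_nat.
    rewrite -mulrA ler_peMr ?addr_ge0 //.
    by rewrite mulrC ler_pdivlMr // mul1r ler_nat ltnW.
  apply: le_trans hx _; rewrite -[leLHS]add0r lerD //.
  rewrite ler_pdivlMr // natrX.
  have : M%:R <= (degree E v)%:R :> R by rewrite ler_nat ltnW.
  have : 0 <= (degree E v)%:R :> R by []. 
  nra.
rewrite big_split /= -mulr_sumr -mulr_suml big_split /= -!natr_sum.
apply: lerD.
  rewrite ler_wpM2l ?divr_ge0 ?addr_ge0 ?ler0n ?ler01 //.
  by rewrite ler_nat; apply: sum_ball.
rewrite ler_pM2r ?invr_gt0 // -!natrM -!natrD ler_nat.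
rewrite sum_degree_paths // mul2n -addnn -addnA leq_add2l.
exact: sum_degree_sqr.
Qed.

Lemma truncation_mean (K M : nat) : (0 < K)%N -> (0 < M)%N ->
  `|Ex p (vpairs T) (fun E => objective E (iterate E eta t)) / #|T|%:R -
    \sum_(k < K) (\sum_v Ex p (vpairs T) (fun E => (#|gball E t.+1 v| == k.+1)%:R * excess eta t E v)) / #|T|%:R| <=
  (1 + M%:R) / K%:R * (\sum_(m < t.+2) (#|T|%:R * p) ^+ m) + (2 * (#|T|%:R * p) + (#|T|%:R * p) ^+ 2) / M%:R.
Proof.
move=> K0 M0; have n0 : 0 < #|T|%:R :> R by rewrite ltr0n ltnW // ltnW.
have K0' : 0 < K%:R :> R by rewrite ltr0n.
have M0' : 0 < M%:R :> R by rewrite ltr0n.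
rewrite -mulr_suml -mulrBl normrM [`|_^-1|]ger0_norm ?invr_ge0 ?(ltW n0) // ler_pdivrMr //.
under eq_bigr => k _ do rewrite -Ex_sum.
rewrite -Ex_sum -ExB.
pose bd E : R := (1 + M%:R) / K%:R * \sum_(m < t.+2) #|paths m E|%:R + (2 * #|paths 1 E|%:R + #|paths 2 E|%:R) / M%:R.
apply: le_trans (_ : Ex p (vpairs T) bd <= _).
  rewrite ler_norml; apply/andP; split.
    by rewrite -ExN; apply: le_Ex => // E sE; have := truncation sE K0 M0; rewrite ler_norml => /andP[].
  by apply: le_Ex => // E sE; have := truncation sE K0 M0; rewrite ler_norml => /andP[].
rewrite /bd ExDf ExZl Ex_sum [X in _ + X <= _](_ : _ = M%:R^-1 *
   (2 * Ex p (vpairs T) (fun E => #|paths 1 E|%:R) + Ex p (vpairs T) (fun E => #|paths 2 E|%:R))); last first.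
  by rewrite -!ExZl -ExDf -ExZl; apply: eq_Ex => E _; rewrite mulrC.
rewrite [leRHS]mulrDl; apply: lerD.
  rewrite -[leRHS]mulrA ler_wpM2l ?divr_ge0 ?addr_ge0 ?ler0n ?ler01 // mulr_suml; apply: ler_sum => m _.
  by rewrite mulrC; apply: Ex_paths.
rewrite [leLHS]mulrC [leRHS]mulrAC ler_pM2r ?invr_gt0 // [leRHS]mulrDl; apply: lerD.
  rewrite -mulrA ler_pM2l //; apply: le_trans (Ex_paths T p01 1) _.
  by rewrite expr1 mulrC.
by apply: le_trans (Ex_paths T p01 2) _; rewrite mulrC.
Qed.

End LocalApproximation.

Section MeanLimit.
Import numFieldNormedType.Exports.
Local Open Scope classical_set_scope.
Local Open Scope ring_scope.
Variable R : realType.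
Implicit Types (d x p : R) (n k : nat).

Lemma ex_nat_ge x : exists2 M : nat, (0 < M)%N & x <= M%:R.
Proof.
exists (Num.bound `|x|).+1 => //; apply: le_trans (ler_norm x) _.
apply: ltW; apply: lt_trans (archi_boundP (normr_ge0 x)) _.
by rewrite ltr_nat.
Qed.

Lemma cvgn_sum (I : Type) (s : seq I) (P : pred I) (F : I -> nat -> R) :
  (forall i, P i -> cvgn (F i)) -> cvgn (fun n => \sum_(i <- s | P i) F i n).
Proof.
move=> HF; elim: s => [|i s IH].
  by under boolp.eq_fun do rewrite big_nil; apply: is_cvg_cst.
under boolp.eq_fun do rewrite big_cons; case: (boolP (P i)) => // Pi.
by apply: is_cvgD => //; apply: HF.
Qed.

Lemma cvgn_near_eq (u v : nat -> R) : (\forall n \near \oo, u n = v n) -> cvgn u -> cvgn v.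
Proof.
move=> uv /cvg_ex[l ul]; apply/cvg_ex; exists l; apply: cvg_trans ul.
by apply: near_eq_cvg.
Qed.

Lemma cvg_pow (u : nat -> R) (l : R) j : u n @[n --> \oo] --> l -> u n ^+ j @[n --> \oo] --> l ^+ j.
Proof.
move=> ul; elim: j => [|j IH]; first by under boolp.eq_fun do rewrite expr0; exact: cvg_cst.
by under boolp.eq_fun do rewrite exprS; rewrite exprS; apply: cvgM.
Qed.

Lemma near_over_lt1 d : \forall n \near \oo, d / n%:R < 1.
Proof. by apply: (cvgr_lt _ (cvg_over_n d)); exact: ltr01. Qed.

(** The falling factorial over n has order n^(k - 1) and the power of d / n brings [e] factors 1 /
    n, so [e] at least k - 1 is what boundedness requires; the last factor tends to e^(- b d). *)
Lemma cvg_local_term d k e c b : 0 <= d -> (0 < k)%N -> (k <= e.+1)%N ->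
  cvgn (fun n => (n ^_ k)%:R / n%:R * ((d / n%:R) ^+ e * (1 - d / n%:R) ^+ (c + b * (n - k)))).
Proof.
move=> d0 k0 ke.
have H1 : cvgn (fun n => (n ^_ k)%:R / n%:R ^+ k * (d ^+ e * (n%:R^-1 : R) ^+ (e.+1 - k))).
  apply: is_cvgM; first by apply: cvgP; apply: cvg_ffact.
  apply: is_cvgM; first exact: is_cvg_cst.
  apply: cvgP; apply: cvg_pow; have := cvg_over_n (1 : R).
  by under boolp.eq_fun do rewrite div1r; apply.
have L : 1 - d / n%:R @[n --> \oo] --> (1 : R).
  rewrite -[X in _ --> X]subr0; apply: cvgB; [exact: cvg_cst|exact: cvg_over_n].
have H2 : cvgn (fun n => (1 - d / n%:R) ^+ c * (((1 - d / n%:R) ^+ n) / (1 - d / n%:R) ^+ k) ^+ b).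
  apply: is_cvgM; first by apply: cvgP; apply: cvg_pow L.
  have LV : ((1 - d / n%:R) ^+ k)^-1 @[n --> \oo] --> ((1 : R) ^+ k)^-1.
    by apply: cvgV; [rewrite expr1n oner_eq0|exact: cvg_pow L].
  by apply: cvgP; apply: cvg_pow; apply: (cvgM (cvg_one_minus d0) LV).
apply: (cvgn_near_eq _ (is_cvgM H1 H2)).
near=> n; have n1 : d / n%:R < 1 by near: n; exact: near_over_lt1.
have kn : (k <= n)%N by near: n; apply: (@near_infty_ge _ k).
have n0 : n%:R != 0 :> R by rewrite pnatr_eq0 -lt0n (leq_trans k0).
have q0 : 1 - d / n%:R != 0 by rewrite subr_eq0 gt_eqF.
rewrite mulrA; congr (_ * _).
  rewrite -!mulrA; congr (_ * _); rewrite [(d / _) ^+ e]exprMn mulrCA [RHS]mulrCA; congr (_ * _).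
  rewrite -[n%:R ^- k]exprVn -exprD subnKC // -exprS //.
rewrite exprD; congr (_ * _); rewrite mulnC exprM; congr (_ ^+ _).
have -> : (1 - d / n%:R) ^+ n = (1 - d / n%:R) ^+ (n - k) * (1 - d / n%:R) ^+ k by rewrite -exprD subnK.
by rewrite mulfK // expf_neq0.
Unshelve. all: by end_near. Qed.

Lemma cvg_ball_sum d eta t k : 0 < d -> (0 < k)%N ->
  cvgn (fun n => (\sum_v Ex (d / n%:R) (vpairs 'I_n)
     (fun E => (#|gball E t.+1 v| == k)%:R * excess eta t E v)) / n%:R).
Proof.
move=> d0 k0.
have H : cvgn (fun n : nat => \sum_(tau : {set {set 'I_k}} | tau \subset vpairs 'I_k) \sum_a
   ((gball tau t.+1 a == setT)%:R * excess eta t tau a / k`!%:R * ((n ^_ k)%:R / n%:R *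
    ((d / n%:R) ^+ #|tau| * (1 - d / n%:R) ^+ (#|vpairs 'I_k :\: tau| + #|gball tau t a| * (n - k)))))).
  apply: cvgn_sum => tau _; apply: cvgn_sum => a _.
  case: (gball tau t.+1 a =P setT) => [full|_]; last first.
    by under boolp.eq_fun do rewrite !mul0r; apply: is_cvg_cst.
  apply: is_cvgM; first exact: is_cvg_cst.
  apply: cvg_local_term => //; first exact: ltW.
  by have := full_ball_edges full; rewrite card_ord.
apply: (cvgn_near_eq _ H).
near=> n.
have n1 : d / n%:R < 1 by near: n; exact: near_over_lt1.
have p01 : 0 <= d / n%:R <= 1 by rewrite divr_ge0 ?ler0n ?(ltW n1) ?(ltW d0).
symmetry; rewrite ball_sum_formula // card_ord mulrAC mulr_sumr; apply: eq_bigr => tau _.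
rewrite mulr_sumr; apply: eq_bigr => a _; rewrite /local_term card_ord.
set x := _%:R; set y := excess _ _ _ _; set f := (k`!)%:R; set z := _ ^+ _; set w := _ ^+ _.
by rewrite !mulrA; ring.
Unshelve. all: by end_near. Qed.

Lemma cvg_objective d eta t : 0 < d ->
  cvgn (fun n => Ex (d / n%:R) (vpairs 'I_n) (fun E => objective E (iterate E eta t)) / n%:R).
Proof.
move=> d0; apply: approx_cvg => e e0.
have [M M0 HM] := ex_nat_ge ((2 * d + d ^+ 2) / (e / 2)).
have [K K0 HK] := ex_nat_ge ((1 + M%:R) * (\sum_(m < t.+2) d ^+ m) / (e / 2)).
exists (fun n => \sum_(k < K) (\sum_v Ex (d / n%:R) (vpairs 'I_n)
   (fun E => (#|gball E t.+1 v| == k.+1)%:R * excess eta t E v)) / n%:R).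
  by apply: cvgn_sum => k _; apply: cvg_ball_sum.
near=> n.
have n1 : d / n%:R < 1 by near: n; exact: near_over_lt1.
have n3 : (2 < #|'I_n|)%N by rewrite card_ord; near: n; apply: (@near_infty_ge _ 3).
have p01 : 0 <= d / n%:R <= 1 by rewrite divr_ge0 ?ler0n ?(ltW n1) ?(ltW d0).
have nd : #|'I_n|%:R * (d / n%:R) = d :> R.
  by rewrite card_ord mulrC divfK // pnatr_eq0 -lt0n; move: n3; rewrite card_ord => /ltnW/ltnW.
have := truncation_mean n3 p01 eta t K0 M0; rewrite nd.
rewrite card_ord => /le_trans; apply.
have K0' : 0 < K%:R :> R by rewrite ltr0n.
have M0' : 0 < M%:R :> R by rewrite ltr0n.
have e2 : 0 < e / 2 by rewrite divr_gt0.
rewrite [e in X in _ <= X](splitr e); apply: lerD.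
  by rewrite mulrAC ler_pdivrMr // [leRHS]mulrC -ler_pdivrMr.
by rewrite ler_pdivrMr // [leRHS]mulrC -ler_pdivrMr.
Unshelve. all: by end_near. Qed.

(** The limit in [n] is the function f of the theorem. *)
Definition mean d n : R := Ex (d / n%:R) (vpairs 'I_n) (fun E => (mu E)%:R) / n%:R.

Lemma cvg_mean d : 0 < d -> cvgn (mean d).
Proof.
move=> d0; apply: approx_cvg => e e0.
(* One third of the error each for the subgradient steps, the girth, and the terms of order 1 /
   n. *)
have [m m0 Hm] := ex_nat_ge (d / (e / 3)).
have [r r0 Hr] := ex_nat_ge (2 / (e / 3)).
have [N N0 HN] := ex_nat_ge ((1 + \sum_(k < (2 * r).+1) d ^+ k) / (e / 3)).
exists (fun n => 1 - (\sum_(t < m ^ 2) (Ex (d / n%:R) (vpairs 'I_n)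
    (fun E => objective E (iterate E m%:R^-1 t)) / n%:R)) / (m ^ 2)%:R).
  apply: is_cvgB; first exact: is_cvg_cst.
  apply: is_cvgM; last exact: is_cvg_cst.
  by apply: cvgn_sum => t _; apply: cvg_objective.
near=> n.
have n1 : d / n%:R < 1 by near: n; exact: near_over_lt1.
have n3 : (2 < #|'I_n|)%N by rewrite card_ord; near: n; apply: (@near_infty_ge _ 3).
have nN : (N <= n)%N by near: n; apply: (@near_infty_ge _ N).
have p01 : 0 <= d / n%:R <= 1 by rewrite divr_ge0 ?ler0n ?(ltW n1) ?(ltW d0).
have n0 : (0 < n)%N by apply: leq_trans nN.
have nd : #|'I_n|%:R * (d / n%:R) = d :> R.
  by rewrite card_ord mulrC divfK // pnatr_eq0 -lt0n.
have := mean_approx n3 p01 m0 r0; rewrite nd card_ord -/(mean d n).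
have -> : Ex (d / n%:R) (vpairs 'I_n) (fun E => avg_objective R E m) / n%:R =
  (\sum_(t < m ^ 2) (Ex (d / n%:R) (vpairs 'I_n)
    (fun E => objective E (iterate E m%:R^-1 t)) / n%:R)) / (m ^ 2)%:R.
  rewrite -mulr_suml mulrAC; congr (_ / _).
  by rewrite -Ex_sum [RHS]mulrC -ExZl; apply: eq_Ex => E _; rewrite /avg_objective mulrC.
move=> /le_trans; apply.
have e3 : 0 < e / 3 by rewrite divr_gt0.
have m0' : 0 < m%:R :> R by rewrite ltr0n.
have r0' : 0 < r%:R :> R by rewrite ltr0n.
have n0' : 0 < n%:R :> R by rewrite ltr0n.
have H1 : d / m%:R <= e / 3 by rewrite ler_pdivrMr // mulrC -ler_pdivrMr.
have H2 : 3 / (2 * r%:R) <= e / 3.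
  rewrite ler_pdivrMr ?mulr_gt0 //; move: Hr; rewrite ler_pdivrMr //; nra.
have H3 : (1 + \sum_(k < (2 * r).+1) d ^+ k) / n%:R <= e / 3.
  rewrite ler_pdivrMr // mulrC -ler_pdivrMr //; apply: le_trans HN _.
  by rewrite ler_nat.
lra.
Unshelve. all: by end_near. Qed.

End MeanLimit.

(** * Vertices of low degree *)

Section StarSets.
Variable T : finType.
Implicit Types (E : {set {set T}}) (A C U : {set T}) (v u x y a : T).

Definition star U a : {set {set T}} := (fun w => [set a; w]) @: ~: U.

Lemma starP U a w : a \in U -> ([set a; w] \in star U a) = (w \notin U).
Proof.
move=> aU; apply/imsetP/idP => [[w' + /setP H]|wU]; last by exists w; rewrite ?inE.
rewrite inE => w'U; have := H w; rewrite !inE eqxx orbT => /esym/orP[]/eqP wa; last by rewrite wa.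
by move: (H w') w'U; rewrite !inE eqxx wa orbb orbT => /eqP ->; rewrite aU.
Qed.

Lemma star_vpairs U a : a \in U -> star U a \subset vpairs T.
Proof.
move=> aU; apply/subsetP => e /imsetP[w]; rewrite inE => wU ->.
by rewrite pair_vpairs; apply: contraNneq wU => <-.
Qed.

Lemma card_star U a : a \in U -> #|star U a| = (#|T| - #|U|)%N.
Proof.
move=> aU; rewrite card_in_imset; first by rewrite [#|~: U|]cardsCs setCK.
move=> w w'; rewrite !inE => wU w'U /setP/(_ w).
by rewrite !inE eqxx orbT => /esym/orP[]/eqP // wa; rewrite wa aU in wU.
Qed.

Lemma card_star_nbr E U a : a \in U -> #|E :&: star U a| = #|nbr E a :\: U|.
Proof.
move=> aU; rewrite -(card_in_imset (f := fun w => [set a; w])); last first.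
  move=> w w'; rewrite !inE => /andP[wU _] /andP[w'U _] /setP/(_ w).
  by rewrite !inE eqxx orbT => /esym/orP[]/eqP // wa; rewrite wa aU in wU.
apply: eq_card => e; rewrite inE; apply/andP/imsetP => [[eE /imsetP[w]]|[w]].
  by rewrite inE => wU ee; exists w; rewrite // !inE wU /adj /= -ee.
by rewrite !inE => /andP[wU aw] ->; split; [exact: aw|rewrite starP].
Qed.

Lemma star_disjoint U a b : a \in U -> b \in U -> a != b -> [disjoint star U a & star U b].
Proof.
move=> aU bU ab; rewrite -setI_eq0; apply/eqP/setP => e; rewrite !inE; apply/negbTE/negP.
case/andP=> /imsetP[w]; rewrite inE => wU -> /imsetP[w']; rewrite inE => w'U /setP/(_ a).
rewrite !inE eqxx /= (negbTE ab) => /esym/eqP aw; by rewrite -aw aU in w'U.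
Qed.

End StarSets.

Section Stars.
Local Open Scope ring_scope.
Variables (R : realType) (T : finType) (p : R).
Implicit Types (E : {set {set T}}) (A C U : {set T}) (v u x y a : T).

Definition binom_le (j m : nat) : R := \sum_(i < j.+1) 'C(m, i)%:R * p ^+ i * (1 - p) ^+ (m - i).

Lemma binom_le_ge0 j m : 0 <= p <= 1 -> 0 <= binom_le j m.
Proof.
case/andP=> p0 p1; apply: sumr_ge0 => i _; rewrite mulr_ge0 ?exprn_ge0 ?subr_ge0 //.
by rewrite mulr_ge0 ?exprn_ge0.
Qed.

Lemma Pr_binom_le j (S : {set {set T}}) :
  Pr p S (fun B : {set {set T}} => (#|B| <= j)%N) = binom_le j #|S|.
Proof.
rewrite /binom_le; under eq_bigr => i _ do rewrite -Pr_card.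
rewrite /Pr -Ex_sum; apply: eq_Ex => B _; rewrite -natr_sum; congr (_%:R).
case: (leqP #|B| j) => Bj.
  rewrite (bigD1 (Ordinal (Bj : (#|B| < j.+1)%N))) //= eqxx big1 // => i.
  by rewrite -val_eqE eq_sym /= => /negbTE ->.
by rewrite big1 // => i _; case: eqP => // Bi; move: Bj; rewrite Bi ltnNge -ltnS ltn_ord.
Qed.

(** Degree conditions are read outside [U] only: the stars leaving [U] from different vertices use
    disjoint pairs and none of these lies inside [U], so all the events are independent. *)
Lemma Pr_stars j (S0 : {set {set T}}) U (s : seq T) : uniq s -> {subset s <= U} ->
  S0 \subset vpairs T -> (forall e, e \in S0 -> e \subset U) ->
  Pr p (vpairs T) (fun E => (S0 \subset E) && all (fun a => (#|nbr E a :\: U| <= j)%N) s) =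
  p ^+ #|S0| * binom_le j (#|T| - #|U|) ^+ size s.
Proof.
move=> us sU S0v S0U.
pose D := \bigcup_(a in s) star U a.
have SD a : a \in s -> star U a \subset vpairs T by move=> /sU; apply: star_vpairs.
have Dv : D \subset vpairs T by apply/bigcupsP => a /SD.
have sD a : a \in s -> star U a \subset D.
  by move=> sa; apply/subsetP => e ea; apply/bigcupP; exists a.
have dis : [disjoint S0 & D].
  rewrite -setI_eq0; apply/eqP/setP => e; rewrite !inE; apply/negbTE/negP => /andP[/S0U eU].
  case/bigcupP=> a _ /imsetP[w]; rewrite inE => wU ee; move: eU; rewrite ee subUset !sub1set.
  by rewrite (negbTE wU) andbF.
pose f (B : {set {set T}}) : R := (S0 \subset B)%:R.
pose h (a : T) (B : {set {set T}}) : R := (#|B| <= j)%N%:R.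
pose g (B : {set {set T}}) : R := \prod_(a <- s) h a (B :&: star U a).
have allE (P : pred T) s' : (all P s')%:R = \prod_(a <- s') (P a)%:R :> R.
  by elim: s' => [|a s' IH]; rewrite ?big_nil // big_cons /= -mulnb natrM IH.
transitivity (Ex p (vpairs T) (fun E => f (E :&: S0) * g (E :&: D))).
  apply: eq_Ex => E _; rewrite /f subsetI subxx andbT -mulnb natrM; congr (_ * _).
  rewrite allE /g; apply: eq_big_seq => a sa; rewrite /h -(card_star_nbr E (sU a sa)) -setIA.
  by rewrite (setIidPr (sD a sa)).
rewrite Ex_prod //; congr (_ * _).
  by rewrite -(@Pr_subset _ _ p S0 S0 (subxx _)).
rewrite /g (@Ex_bigprod _ _ p D _ s (star U) h) //; first last.
- by move=> a b sa sb; apply: star_disjoint; apply: sU.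
rewrite (eq_big_seq (fun=> binom_le j (#|T| - #|U|))); last first.
  by move=> a /sU aU; rewrite -(card_star aU) -Pr_binom_le.
by rewrite big_const_seq count_predT iter_mulr_1.
Qed.

End Stars.

Section Gain.
Variable T : finType.
Implicit Types (E : {set {set T}}) (A C U B : {set T}) (v u x y a : T).

Definition degin E A v : nat := #|nbr E v :&: A|.

Lemma sum_degin E A : \sum_v degin E A v = \sum_(a in A) degree E a.
Proof.
rewrite /degin; under eq_bigr => v _ do rewrite -sum1_card big_mkcond.
rewrite exchange_big [RHS]big_mkcond /=; apply: eq_bigr => a _.
case aA: (a \in A).
  rewrite /degree -sum1_card [RHS]big_mkcond /=; apply: eq_bigr => v _.
  by rewrite !inE aA andbT adj_sym.
by rewrite big1 // => v _; rewrite !inE aA andbF.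
Qed.

Lemma sum_minn_degin E A :
  \sum_v minn 2 (degin E A v) + \sum_v (degin E A v - 2) = \sum_(a in A) degree E a.
Proof.
rewrite -sum_degin -big_split /=; apply: eq_bigr => v _; move: (degin E A v) => m.
by clear; lia.
Qed.

Definition low E j : {set T} := [set v | degree E v <= j].

Definition stars E j m : nat := \sum_v 'C(degin E (low E j) v, m).

Definition num_degree E j : nat := #|[set v | degree E v == j]|.

(** Truncated inclusion-exclusion: counting triples overshoots m - 2 only from four elements on, and
    then by at most twice the quadruples. *)
Lemma bin3_lower m : 'C(m, 3) <= (m - 2) + 2 * 'C(m, 4).
Proof.
elim: m => [|[|[|[|m]]] IH] //.
move: IH; rewrite (binS m.+3 2) (binS m.+3 3).
have : 'C(m.+3, 2) <= 1 + 2 * 'C(m.+3, 3).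
  have := mul_bin_left m.+3 2; rewrite (_ : m.+3 - 2 = m.+1); last by lia.
  by case: m => // m; move: 'C(_, 2) 'C(_, 3) => x y; nia.
move: 'C(_, 2) 'C(_, 3) 'C(_, 4) => x y z; lia.
Qed.

Lemma low2_deficit E : \sum_(a in low E 2) (2 - degree E a) = 2 * num_degree E 0 + num_degree E 1.
Proof.
rewrite /num_degree -!sum1_card big_distrr /= [LHS]big_mkcond [X in _ = X + _]big_mkcond.
rewrite [X in _ = _ + X]big_mkcond -big_split /=; apply: eq_bigr => a _; rewrite !inE.
by case: (degree E a) => [|[|[|d]]].
Qed.

(** In the dual set of all vertices of degree at most 2, the deficit 2 - degree counts isolated
    vertices twice and pendant ones once; a vertex with m >= 2 neighbours in the set gains m - 2,
    estimated through triples. *)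
Lemma mu_lower E : 2 < #|T| -> E \subset vpairs T ->
  2 * num_degree E 0 + num_degree E 1 + stars E 2 3 <= 2 * mu E + 2 * stars E 2 4.
Proof.
move=> T3 sE; have := mu_dual T3 (low E 2) sE.
have := sum_minn_degin E (low E 2); rewrite /degin -low2_deficit.
have H : \sum_(a in low E 2) degree E a + \sum_(a in low E 2) (2 - degree E a) = 2 * #|low E 2|.
  rewrite -big_split /= mulnC -sum_nat_const; apply: eq_bigr => a; rewrite inE.
  by move=> ?; rewrite subnKC.
have H2 : stars E 2 3 <= \sum_v (degin E (low E 2) v - 2) + 2 * stars E 2 4.
  rewrite /stars big_distrr -big_split /=; apply: leq_sum => v _; exact: bin3_lower.
move: H H2; rewrite /degin.
set a := \sum_(_ in _) _; set b := \sum_(_ in _) _; set c := \sum_v minn _ _; set d := \sum_v (_ - _).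
by move: (stars _ _ _) (stars _ _ _) (mu E) #|low E 2| => x y z w; clear; lia.
Qed.

(** Copies of K_{2,3} with ordered centres. Six edges on five vertices make their expected number
    O(1 / n) for fixed d. *)
Definition k23 E : nat :=
  #|[set t : {set T} * (T * T) | [&& #|t.1| == 3, t.2.1 != t.2.2, t.1 \subset nbr E t.2.1 & t.1 \subset nbr E t.2.2]]|.

End Gain.

Section StarExpectation.
Local Open Scope ring_scope.
Variables (R : realType) (T : finType) (p : R).
Hypothesis p01 : 0 <= p <= 1.
Implicit Types (E : {set {set T}}) (A C U B : {set T}) (v u x y a : T).

Local Notation n := #|T|.

Lemma Pr_degree v j : Pr p (vpairs T) (fun E => degree E v == j) =
  'C(n.-1, j)%:R * p ^+ j * (1 - p) ^+ (n.-1 - j).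
Proof.
have v1 : v \in [set v] by rewrite inE.
have sv : star [set v] v \subset vpairs T by apply: star_vpairs.
rewrite -subn1 -(cards1 v) -(card_star v1) -Pr_card /Pr.
rewrite -(Ex_restrict p (fun B : {set {set T}} => (#|B| == j)%:R) sv); apply: eq_Ex => E sE.
rewrite card_star_nbr // /degree; congr ((_ == _)%:R); apply: eq_card => u; rewrite !inE.
by case: (boolP (adj E v u)) => [/(adj_neq sE)|]; rewrite ?andbF // eq_sym => ->.
Qed.

Lemma Ex_num_degree j : Ex p (vpairs T) (fun E => (num_degree E j)%:R) =
  n%:R * ('C(n.-1, j)%:R * p ^+ j * (1 - p) ^+ (n.-1 - j)).
Proof.
rewrite /num_degree Ex_card; under eq_bigr => v _ do rewrite Pr_degree.
by rewrite sumr_const [RHS]mulr_natl.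
Qed.

Definition spokes v B : {set {set T}} := (fun b => [set v; b]) @: B.

Lemma sub_spokes E v B : (spokes v B \subset E) = (B \subset nbr E v).
Proof.
apply/subsetP/subsetP => H b bB; first by rewrite inE; apply: H; apply: imset_f.
by case/imsetP: bB => c /H; rewrite inE => vc ->.
Qed.

Lemma card_spokes v B : v \notin B -> #|spokes v B| = #|B|.
Proof.
move=> vB; apply: card_in_imset => b c bB cB /setP/(_ b); rewrite !inE eqxx orbT => /esym/orP[]/eqP //.
by move=> bv; rewrite bv (negbTE vB) in bB.
Qed.

Lemma spokes_vpairs v B : v \notin B -> spokes v B \subset vpairs T.
Proof.
by move=> vB; apply/subsetP => e /imsetP[b bB ->]; rewrite pair_vpairs; apply: contraNneq vB => ->.
Qed.

Lemma starsE E m : (stars E 2 m)%:R = \sum_v \sum_(B : {set T} | #|B| == m) ((B \subset nbr E v) && (B \subset low E 2))%:R :> R.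
Proof.
rewrite /stars natr_sum; apply: eq_bigr => v _; rewrite /degin -cards_draws -sum1_card natr_sum.
rewrite big_mkcond [RHS]big_mkcond /=; apply: eq_bigr => B _; rewrite inE subsetI.
by case: (B \subset nbr E v); case: (B \subset low E 2); case: (#|B| == m).
Qed.

Lemma Pr_spokes_low v B : (0 < #|B|)%N ->
  Pr p (vpairs T) (fun E => (B \subset nbr E v) && (B \subset low E 2)) <=
  p ^+ #|B| * binom_le p 1 (n - #|B|.+1) ^+ #|B|.
Proof.
move=> B0; case: (boolP (v \in B)) => vB.
  rewrite (_ : Pr _ _ _ = 0).
    case/andP: p01 => p0 p1; rewrite mulr_ge0 ?exprn_ge0 //.
    by rewrite binom_le_ge0 // p0.
  rewrite /Pr -[RHS](Ex_cst p (vpairs T) 0); apply: eq_Ex => E sE.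
  case: (boolP (B \subset nbr E v)) => //= /subsetP/(_ v vB); rewrite inE => /(adj_neq sE).
  by rewrite eqxx.
pose U := v |: B.
have cU : #|U| = #|B|.+1 by rewrite cardsU1 vB.
have := @Pr_stars R T p 1 (spokes v B) U (enum B) (enum_uniq _).
rewrite -cardE cU (card_spokes vB) => <-; first last.
- by move=> e /imsetP[b bB ->]; rewrite subUset !sub1set !inE eqxx bB orbT.
- exact: spokes_vpairs.
- by move=> b; rewrite mem_enum inE => ->; rewrite orbT.
apply: le_Pr => // E sE /andP[Bv Bl]; rewrite sub_spokes Bv; apply/allP => b; rewrite mem_enum => bB.
have := subsetP Bl b bB; rewrite inE /degree (cardsD1 v) inE adj_sym.
have := subsetP Bv b bB; rewrite inE => -> /=; rewrite add1n ltnS; apply: leq_trans.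
by apply/subset_leq_card/setDS; rewrite sub1set setU11.
Qed.

(** When [B] consists of neighbours of [v] and spans no edge, degree at most 2 means at most one
    neighbour outside [v |: B]. Each of the three inner pairs together with the three spokes costs
    p^4. *)
Lemma Pr_spokes_low_ge v B : v \notin B -> #|B| = 3 ->
  p ^+ 3 * binom_le p 1 (n - 4) ^+ 3 - 3 * p ^+ 4 <=
  Pr p (vpairs T) (fun E => (B \subset nbr E v) && (B \subset low E 2)).
Proof.
move=> vB B3; pose U := v |: B.
have cU : #|U| = 4 by rewrite cardsU1 vB B3.
pose inner := [set e in vpairs T | e \subset B].
have cin : #|inner| = 3.
  have -> : #|inner| = 'C(#|B|, 2) by rewrite -cards_draws; apply: eq_card => e; rewrite !inE andbC.
  by rewrite B3.
have := @Pr_stars R T p 1 (spokes v B) U (enum B) (enum_uniq _).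
rewrite -cardE B3 cU (card_spokes vB) B3 => <-; first last.
- by move=> e /imsetP[b bB ->]; rewrite subUset !sub1set !inE eqxx bB orbT.
- exact: spokes_vpairs.
- by move=> b; rewrite mem_enum inE => ->; rewrite orbT.
rewrite lerBlDr; apply: le_trans (_ : Pr p (vpairs T) (fun E => ((B \subset nbr E v) && (B \subset low E 2)) ||
   [exists (e | e \in inner), (e |: spokes v B) \subset E]) <= _).
  apply: le_Pr => // E sE /andP[]; rewrite sub_spokes => Bv /allP Hs; rewrite Bv /=.
  case: (boolP [exists (e | e \in inner), _]); rewrite ?orbT // orbF => /existsPn Hin.
  apply/subsetP => b bB; rewrite inE.
  have -> : degree E b = (1 + #|nbr E b :\: U|)%N.
    rewrite /degree (cardsD1 v) inE adj_sym; have := subsetP Bv b bB; rewrite inE => -> /=.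
    congr (_ + _)%N; apply: eq_card => w; rewrite !inE negb_or -andbA.
    case: (eqVneq w v) => //= wv; case: (boolP (w \in B)) => //= wB.
    apply/negbTE/negP => bw; have := Hin [set b; w].
    rewrite inE subUset !sub1set bB wB pair_vpairs (adj_neq sE bw) /=.
    by rewrite subUset sub1set sub_spokes Bv andbT => /negP; apply.
  by rewrite add1n ltnS; apply: Hs; rewrite mem_enum.
apply: le_trans (Pr_or _ _ _ p01) _; rewrite lerD2l.
apply: le_trans (Pr_exists _ _ _ p01) _.
rewrite (eq_bigr (fun=> p ^+ 4)); last first.
  move=> e; rewrite inE => /andP[ev eB]; rewrite Pr_subset.
    rewrite cardsU1 card_spokes // B3; case: (boolP (e \in _)) => // /imsetP[b bB ee].
    by move: eB; rewrite ee subUset !sub1set (negbTE vB).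
  by rewrite subUset sub1set ev spokes_vpairs.
by rewrite sumr_const cin mulr_natl.
Qed.

Lemma Ex_stars_le m : (0 < m)%N -> Ex p (vpairs T) (fun E => (stars E 2 m)%:R) <=
  n%:R * ('C(n, m)%:R * (p ^+ m * binom_le p 1 (n - m.+1) ^+ m)).
Proof.
move=> m0; under eq_Ex => E _ do rewrite starsE.
rewrite Ex_sum mulr_natl -sumr_const; apply: ler_sum => v _; rewrite Ex_sum.
rewrite -card_draws mulr_natl -sumr_const; rewrite [leRHS](eq_bigl (fun B : {set T} => #|B| == m)).
  by apply: ler_sum => B /eqP Bm; apply: le_trans (Pr_spokes_low v _) _; rewrite Bm.
by move=> B; rewrite inE.
Qed.

Lemma Ex_stars_ge : n%:R * ('C(n.-1, 3)%:R * (p ^+ 3 * binom_le p 1 (n - 4) ^+ 3 - 3 * p ^+ 4)) <=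
  Ex p (vpairs T) (fun E => (stars E 2 3)%:R).
Proof.
under eq_Ex => E _ do rewrite starsE.
rewrite Ex_sum mulr_natl -sumr_const; apply: ler_sum => v _; rewrite Ex_sum.
have -> : n.-1 = #|[set~ v]| by rewrite cardsC1.
rewrite -cards_draws mulr_natl -sumr_const.
rewrite [leRHS](bigID (fun B : {set T} => v \notin B)) /=.
apply: ler_wpDr; first by apply: sumr_ge0 => B _; apply: Pr_ge0.
rewrite [leRHS](eq_bigl (fun B : {set T} => B \in [set B : {set T} | B \subset [set~ v] & #|B| == 3])).
  apply: ler_sum => B; rewrite inE subsetC sub1set inE => /andP[vB /eqP B3].
  exact: Pr_spokes_low_ge.
by move=> B; rewrite inE subsetC sub1set inE andbC.
Qed.

Lemma Ex_k23 : Ex p (vpairs T) (fun E => (k23 E)%:R) <= n%:R ^+ 5 * p ^+ 6.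
Proof.
case/andP: (p01) => p0 p1; rewrite /k23 Ex_card.
apply: le_trans (_ : \sum_(t : {set T} * (T * T) | #|t.1| == 3) p ^+ 6 <= _).
  rewrite [leRHS]big_mkcond; apply: ler_sum => -[B [v w]] _ /=.
  case: (boolP (#|B| == 3)) => [/eqP B3|_] /=; last by rewrite /Pr Ex_cst.
  case: (eqVneq v w) => [_|vw] /=; first by rewrite /Pr Ex_cst exprn_ge0.
  case: (boolP ((v \in B) || (w \in B))) => [vwB|/norP[vB wB]].
    rewrite (_ : Pr _ _ _ = 0) ?exprn_ge0 // /Pr -[RHS](Ex_cst p (vpairs T) 0); apply: eq_Ex => E sE.
    case: (boolP (B \subset nbr E v)) => //= /subsetP Bv; case: (boolP (B \subset nbr E w)) => //= /subsetP Bw.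
    by case/orP: vwB => [/Bv|/Bw]; rewrite inE => /(adj_neq sE); rewrite eqxx.
  rewrite (_ : Pr _ _ _ = Pr p (vpairs T) (fun E => (spokes v B :|: spokes w B) \subset E)); last first.
    by apply: eq_Ex => E _; rewrite subUset !sub_spokes.
  rewrite Pr_subset ?subUset ?spokes_vpairs //.
  rewrite cardsU !card_spokes // B3.
  have -> : spokes v B :&: spokes w B = set0; last by rewrite cards0.
  apply/setP => e; rewrite !inE; apply/negbTE/negP => /andP[/imsetP[b bB ->] /imsetP[c cB /setP/(_ v)]].
  rewrite !inE eqxx /= (negbTE vw) => /esym/eqP vc; by rewrite vc cB in vB.
rewrite [leLHS]sumr_const -[leLHS]mulr_natl ler_wpM2r ?exprn_ge0 // -natrX ler_nat.
rewrite (_ : #|_| = #|setX [set B : {set T} | #|B| == 3] [set: T * T]|); last first.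
  by apply: eq_card => t; rewrite !inE andbT.
rewrite cardsX card_draws cardsT card_prod (_ : 5 = 3 + 2)%N // expnD -mulnn leq_mul //.
apply: leq_trans (leq_pmulr _ (fact_gt0 3)) _; rewrite bin_ffact.
by rewrite !ffactnSr ffactn0 !expnS expn0 mul1n muln1 mulnA !leq_mul // leq_subr.
Qed.

End StarExpectation.

(** * Atoms of optimal dual sets *)

Section Atoms.
Variables (T : finType) (E : {set {set T}}).
Implicit Types (A B C D F U X : {set T}) (v u x y a : T).

Definition inner U : {set {set T}} := [set e in E | e \subset U].

(** The cut condition says that the graph on [U] is connected; a subset is grown vertex by vertex,
    each step adding a new edge. *)
Lemma connected_edges U :
  (forall F, F \subset U -> F != set0 -> F != U ->
    exists x y, [/\ x \in F, y \in U :\: F & adj E x y]) -> #|U| <= #|inner U|.+1.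
Proof.
move=> conn; have [->|[r rU]] := set_0Vmem U; first by rewrite cards0.
suff [F [FU cF]] : exists F, [/\ F \subset U, #|F| = #|U| & #|F| <= #|inner F|.+1].
  have /eqP <- // : F == U by rewrite eqEcard FU cF leqnn.
have U0 : 0 < #|U| by apply/card_gt0P; exists r.
suff H m : m < #|U| -> exists F, [/\ F \subset U, #|F| = m.+1 & #|F| <= #|inner F|.+1].
  by have := H #|U|.-1; rewrite prednK //; apply.
elim: m => [_|m IH mU].
  by exists [set r]; rewrite sub1set cards1.
have [|F [FU cF eF]] := IH; first exact: ltnW.
have F0 : F != set0 by rewrite -card_gt0 cF.
have FU' : F != U by apply: contraTneq mU => <-; rewrite cF ltnn.
have [x [y [xF]]] := conn F FU F0 FU'; rewrite inE => /andP[yF yU] xy.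
exists (y |: F); split; first by rewrite subUset sub1set yU.
  by rewrite cardsU1 yF cF.
rewrite cardsU1 yF add1n ltnS; apply: leq_trans eF _.
have xyF : [set x; y] \notin inner F by rewrite inE subUset !sub1set (negbTE yF) !andbF.
have -> : #|inner F|.+1 = #|[set x; y] |: inner F| by rewrite cardsU1 xyF.
apply: subset_leq_card; rewrite subUset sub1set inE (xy : _ \in E) subUset !sub1set !inE eqxx xF orbT /=.
by apply/subsetP => e; rewrite !inE => /andP[-> /subset_trans]; apply; apply: subsetUr.
Qed.

(** The dual value of [A] is 2 * #|A| - coverage A, which is at most twice the completion number by
    [mu_dual]. *)
Definition coverage A : nat := \sum_v minn 2 (degin E A v).

(** The vertices at which the minimum with 2 truncates; elsewhere the coverage is additive. *)
Definition hubs A : {set T} := [set v | 2 < degin E A v].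

(** Unions of components of [A], two of its vertices being linked when they share a hub. *)
Definition closed A C := (C \subset A) &&
  [forall v, (v \in hubs A) ==> (degin E C v == 0) || (nbr E v :&: A \subset C)].

Definition poor A := [forall a, (a \in A) ==> (#|nbr E a :\: hubs A| <= 1)].

Lemma closedP A C : reflect (C \subset A /\
  forall v, v \in hubs A -> degin E C v = 0 \/ nbr E v :&: A \subset C) (closed A C).
Proof.
apply: (iffP andP) => -[CA H]; split=> //.
  by move=> v vA; have := forallP H v; rewrite vA => /orP[/eqP|]; [left|right].
by apply/forallP => v; apply/implyP => /H[->|->]; rewrite ?orbT.
Qed.

Lemma degin_setD A C v : C \subset A -> degin E A v = degin E C v + degin E (A :\: C) v.
Proof.
move=> CA; rewrite /degin -cardsUI (_ : _ :&: _ :&: _ = set0); last first.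
  by apply/setP => x; rewrite !inE; case: (x \in C); rewrite ?andbF.
rewrite cards0 addn0; apply: eq_card => x; rewrite !inE -andb_orr; congr (_ && _).
by case: (boolP (x \in C)) => [/(subsetP CA)|].
Qed.

Lemma degin_gt0 A v a : adj E v a -> a \in A -> 0 < degin E A v.
Proof. by move=> va aA; apply/card_gt0P; exists a; rewrite !inE va. Qed.

Lemma closed_hub A C v : closed A C -> v \in hubs A -> 0 < degin E C v ->
  nbr E v :&: C = nbr E v :&: A.
Proof.
case/closedP=> CA H /H [->//|vC] _; apply/eqP; rewrite eqEsubset setIS //=.
by rewrite subsetI vC subsetIl.
Qed.

Lemma closed_setD A C : closed A C -> closed A (A :\: C).
Proof.
move=> cC; have [CA _] := closedP _ _ cC; apply/closedP; split; first exact: subsetDl.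
move=> v vA; have [C0|C0] := posnP (degin E C v).
  right; apply/subsetP => x xv; rewrite inE; move: (xv); rewrite !inE => /andP[vx ->]; rewrite andbT.
  by apply/negP => /(degin_gt0 vx); rewrite C0.
left; have := degin_setD v CA; rewrite {1 2}/degin (closed_hub cC) //.
by move/eqP; rewrite -{1}[#|_|]addn0 eqn_add2l => /eqP <-.
Qed.

Lemma closed_trans A C D : closed A C -> closed C D -> closed A D.
Proof.
move=> cC; have [CA H] := closedP _ _ cC; case/closedP=> DC H'.
apply/closedP; split; first exact: subset_trans DC CA.
move=> v vA; have [|D0] := posnP (degin E D v); first by left.
have C0 : 0 < degin E C v by apply: leq_trans D0 (subset_leq_card (setIS _ DC)).
have EC := closed_hub cC vA C0.
have vC : v \in hubs C by move: vA; rewrite !inE /degin EC.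
by right; rewrite -EC; case: (H' v vC) => // D0'; rewrite D0' in D0.
Qed.

(** At a vertex that is not a hub the truncation is inactive, and a hub sees only one of the two
    parts. *)
Lemma coverage_closed A C : closed A C -> coverage A = coverage C + coverage (A :\: C).
Proof.
move=> cC; have [CA H] := closedP _ _ cC; rewrite /coverage -big_split /=; apply: eq_bigr => v _.
have := degin_setD v CA; have : v \notin hubs A \/ degin E C v = 0 \/ degin E (A :\: C) v = 0.
  case: (boolP (v \in hubs A)) => [vA|]; last by left.
  right; have [C0|C0] := posnP (degin E C v); first by left.
  have [_ H'] := closedP _ _ (closed_setD cC).
  case: (H' v vA) => [->|/subsetP vD]; first by right.
  case/card_gt0P: C0 => x; rewrite !inE => /andP[vx xC].
  by have := vD x; rewrite !inE vx xC (subsetP CA) //= => /(_ isT).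
rewrite inE -leqNgt; move: (degin E A v) (degin E C v) (degin E (A :\: C) v) => a b c; clear; lia.
Qed.

Lemma poor_closed A C : poor A -> closed A C -> poor C.
Proof.
move=> pA cC; have [CA H] := closedP _ _ cC; apply/forallP => a; apply/implyP => aC.
have := forallP pA a; rewrite (subsetP CA _ aC) /=; apply: leq_trans; apply: subset_leq_card.
apply/subsetP => v; rewrite !inE => /andP[vC av]; rewrite av andbT; apply: contra vC => vA.
by rewrite /degin (closed_hub cC) ?inE //; apply: degin_gt0 aC; rewrite adj_sym.
Qed.

Lemma deficit_bound C :
  2 * #|C| <= coverage C + \sum_v (degin E C v - 2) + \sum_(a in C) (2 - degree E a).
Proof.
rewrite sum_minn_degin -big_split /= mulnC -sum_nat_const; apply: leq_sum => a _.
by move: (degree E a) => m; clear; lia.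
Qed.

(* The witness U is C together with the hubs adjacent to it. Being connected with few outgoing edges,
   such a C costs a factor (1 + d) e^-d per vertex. *)
Definition bushy (K : nat) C := [&& 3 < #|C|, #|C| <= K &
  [exists U : {set T}, [&& C \subset U, #|U| < 2 * #|C|, #|U| <= #|inner U|.+1 &
    [forall a, (a \in C) ==> (#|nbr E a :\: U| <= 1)]]]].

(** Charges for the pieces of a dual set: a triple of vertices of degree at most 2 pays 1 per common
    neighbour, a triple with two common neighbours pays for the K_{2,3}, and a large piece pays the
    trivial 2 * #|X|. *)
Definition weight (K : nat) X : nat :=
  (if #|X| == 3 then
     (X \subset low E 2) * #|[set v | X \subset nbr E v]| +
     #|[set vw : T * T | [&& vw.1 != vw.2, X \subset nbr E vw.1 & X \subset nbr E vw.2]]|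
   else 0) + (if bushy K X then 2 * #|X| else 0).

Definition cost_bound K A : nat :=
  \sum_(a in A) (2 - degree E a) + \sum_(X : {set T} | X \subset A) weight K X.

(** Subsets of [C] and of [A :\: C] are different subsets of [A], except for the empty one, whose
    weight is 0. *)
Lemma cost_bound_setD K A C : C \subset A -> cost_bound K C + cost_bound K (A :\: C) <= cost_bound K A.
Proof.
move=> CA; rewrite /cost_bound addnACA leq_add //.
  by rewrite [leqRHS](big_setID C) /= (setIidPr CA).
rewrite [leqRHS](bigID (fun X => X \subset C)) /= leq_add //.
  rewrite [leqRHS](eq_bigl (fun X => X \subset C)) // => X.
  by case: (boolP (X \subset C)) => [/subset_trans/(_ CA) ->|]; rewrite ?andbF.
rewrite (bigD1 set0) ?sub0set //= /weight cards0 /= /bushy cards0 add0n.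
rewrite big_mkcond [leqRHS]big_mkcond; apply: leq_sum => X _.
case: ifP => // /andP[XAC X0]; rewrite (subset_trans XAC (subsetDl _ _)) /=.
case: (boolP (X \subset C)) => // XC; case/set0Pn: X0 => x xX.
by have := subsetP XAC x xX; rewrite inE (subsetP XC _ xX).
Qed.

Lemma weight_le K A : weight K A <= \sum_(X : {set T} | X \subset A) weight K X.
Proof. by rewrite (bigD1 A) //= leq_addr. Qed.

Definition productive A := forall C, closed A C -> C != set0 -> coverage C < 2 * #|C|.

(** Productivity gives fewer hubs than vertices. With at most three vertices there is no hub, or
    #|A| = 3 with one hub, when [poor] bounds the degrees by 2, or with two hubs, hence a K_{2,3}. A
    larger atom is bushy with [U] the union of [A] and its hubs, connected because [A] has no
    smaller closed part. *)
Lemma atom_bound K A : A != set0 -> #|A| <= K -> poor A -> productive A ->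
  (forall C, closed A C -> C != set0 -> C = A) -> 2 * #|A| <= coverage A + cost_bound K A.
Proof.
move=> A0 AK pA prA atA.
have cA : closed A A.
  by apply/closedP; split=> // v _; right; apply: subsetIr.
have hubsA : #|hubs A| < #|A|.
  have : coverage A < 2 * #|A| by apply: prA.
  suff : 2 * #|hubs A| <= coverage A by move: #|hubs A| #|A| (coverage A); clear; lia.
  rewrite mulnC -sum_nat_const big_mkcond; apply: leq_sum => v _.
  by rewrite inE; case: ifP => // h; rewrite leq_min leqnn ltnW.
have poorA a : a \in A -> #|nbr E a :\: hubs A| <= 1.
  by move=> aA; have := forallP pA a; rewrite aA.
have def := deficit_bound A.
case: (leqP #|A| 3) => A3; last first.
  suff bA : bushy K A.
    apply: leq_trans (_ : 2 * #|A| <= weight K A) _; first by rewrite /weight bA leq_addl.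
    by apply: leq_trans (weight_le K A) _; rewrite /cost_bound addnA leq_addl.
  rewrite /bushy A3 AK /=; apply/existsP; exists (A :|: hubs A); rewrite subsetUl /=.
  apply/and3P; split.
  - apply: leq_ltn_trans (leq_card_setU _ _) _; move: hubsA; clear; lia.
  - apply: connected_edges => F FU F0 FnU.
    have hubU v F1 : v \in hubs A -> exists2 w, w \in A & adj E v w.
      rewrite inE => vh; have /card_gt0P[w] : 0 < degin E A v by apply: leq_ltn_trans vh.
      by rewrite !inE => /andP[vw wA]; exists w.
    have [/setP H1|[a1]] := set_0Vmem (A :&: F).
      case/set0Pn: F0 => v vF; have := subsetP FU v vF; have := H1 v; rewrite !inE vF andbT => ->.
      move=> vh; have [|w wA vw] := hubU v F; first by rewrite inE.
      by exists v, w; split=> //; rewrite !inE wA; have := H1 w; rewrite !inE wA /= => ->.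
    rewrite inE => /andP[a1A a1F].
    have [/setP H2|[a2]] := set_0Vmem (A :\: F).
      have [v] : exists v, v \in (A :|: hubs A) :\: F.
        by apply/set0Pn; rewrite setD_eq0; apply: contra FnU => UF; rewrite eqEsubset FU.
      rewrite inE => /andP[vF vU]; have vh : v \in hubs A.
        by move: vU; rewrite inE => /orP[vA|//]; have := H2 v; rewrite !inE vA vF.
      have [w wA vw] := hubU v F vh; exists w, v; split; [|by rewrite inE vF|by rewrite adj_sym].
      by have := H2 w; rewrite !inE wA andbT => /negbFE.
    rewrite inE => /andP[a2F a2A].
    have nc : ~~ closed A (A :&: F).
      apply/negP => cF; have AF0 : A :&: F != set0 by apply/set0Pn; exists a1; rewrite inE a1A.
      by have /setP/(_ a2) := atA _ cF AF0; rewrite !inE a2A (negbTE a2F).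
    move: nc; rewrite /closed subsetIl /= => /forallPn[v]; rewrite negb_imply => /andP[vh].
    case/norP; rewrite -lt0n => /card_gt0P[x]; rewrite !inE => /and3P[vx xA xF] /subsetPn[y].
    rewrite !inE => /andP[vy yA]; rewrite yA /= => yF.
    case: (boolP (v \in F)) => vF; first by exists v, y; rewrite !inE yF yA.
    by exists x, v; rewrite inE vF inE vh orbT; split=> //; rewrite adj_sym.
  - apply/forallP => a; apply/implyP => /poorA; apply: leq_trans; apply: subset_leq_card.
    by apply: setDS; apply: subsetUr.
have dA v : degin E A v <= 3 by apply: leq_trans (subset_leq_card (subsetIr _ _)) A3.
have hb : \sum_v (degin E A v - 2) <= #|hubs A|.
  rewrite -sum1_card big_mkcond [leqRHS]big_mkcond; apply: leq_sum => v _; rewrite inE.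
  by have := dA v; move: (degin _ _ _) => m; case: ifP; clear; lia.
apply: leq_trans def _; rewrite -addnA leq_add2l addnC /cost_bound leq_add2l.
apply: leq_trans hb _; apply: leq_trans (weight_le K A).
have [->//|/card_gt0P[v vh]] := posnP #|hubs A|.
have A3' : #|A| = 3.
  apply/eqP; rewrite eqn_leq A3; move: vh; rewrite inE => /leq_trans; apply.
  by apply: subset_leq_card; apply: subsetIr.
have hubAll w : w \in hubs A -> A \subset nbr E w.
  move=> wh; apply/setIidPr/eqP; rewrite eqEcard subsetIr A3' /=.
  by move: wh; rewrite inE.
rewrite /weight A3' eqxx; apply: leq_trans (leq_addr _ _).
move: hubsA; rewrite A3'; case Hh: #|hubs A| => [|[|[|m]]] // _.
  suff -> : A \subset low E 2.
    rewrite mul1n; apply: leq_trans (leq_addr _ _).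
    by apply/card_gt0P; exists v; rewrite inE hubAll.
  apply/subsetP => a aA; rewrite inE /degree -(cardsID (hubs A)).
  have := poorA a aA; have : #|nbr E a :&: hubs A| <= 1.
    by rewrite -Hh; apply: subset_leq_card; apply: subsetIr.
  by move: #|nbr E a :&: _| #|nbr E a :\: _| => x y; clear; lia.
apply: leq_trans (leq_addl _ _).
have /eqP/cards2P[x [y [xy hxy]]] := Hh.
have xh : x \in hubs A by rewrite hxy !inE eqxx.
have yh : y \in hubs A by rewrite hxy !inE eqxx orbT.
apply: leq_trans (_ : #|[set (x, y); (y, x)]| <= _); first by rewrite cards2 xpair_eqE negb_and xy.
apply: subset_leq_card; apply/subsetP => -[u w]; rewrite !inE => /orP[]/eqP[-> ->] /=.
  by rewrite xy !hubAll.
by rewrite eq_sym xy !hubAll.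
Qed.

Lemma productive_bound K A : #|A| <= K -> poor A -> productive A ->
  2 * #|A| <= coverage A + cost_bound K A.
Proof.
have [m] := ubnP #|A|; elim: m A => // m IH A; rewrite ltnS => Am AK pA prA.
have [->|A0] := eqVneq A set0; first by rewrite cards0.
case: (boolP [exists C, [&& closed A C, C != set0 & C != A]]); last first.
  move=> /existsPn H; apply: atom_bound => // C cC C0; apply/eqP.
  by have := H C; rewrite cC C0 /= negbK.
case/existsP=> C /and3P[cC C0 CnA]; have [CA _] := closedP _ _ cC.
have cD := closed_setD cC.
have sC : #|C| < #|A| by apply: proper_card; rewrite properEneq CnA.
have sD : #|A :\: C| < #|A|.
  rewrite cardsD (setIidPr CA); have : 0 < #|C| by rewrite card_gt0.
  by move: sC; move: #|A| #|C|; clear; lia.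
have pr X : closed A X -> productive X by move=> cX Y cY; apply: prA; apply: closed_trans cX cY.
have H1 := IH C (leq_trans sC Am) (leq_trans (ltnW sC) AK) (poor_closed pA cC) (pr _ cC).
have H2 := IH (A :\: C) (leq_trans sD Am) (leq_trans (ltnW sD) AK) (poor_closed pA cD) (pr _ cD).
have H3 := cost_bound_setD K CA; rewrite (coverage_closed cC).
have : #|A| = #|C| + #|A :\: C| by rewrite -(cardsID C A) (setIidPr CA).
by move: H1 H2 H3; move: (cost_bound _ _) (cost_bound _ _) (cost_bound _ _) (coverage _) (coverage _) #|_| #|_| #|_| => *; lia.
Qed.

Lemma sum_degin_sym A C : \sum_(v in A) degin E C v = \sum_(v in C) degin E A v.
Proof.
have H X Y : \sum_(v in X) degin E Y v = \sum_(v in X) \sum_(w in Y) adj E v w.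
  apply: eq_bigr => v _; rewrite /degin -sum1_card big_mkcond [RHS]big_mkcond /=.
  by apply: eq_bigr => w _; rewrite !inE; case: (adj E v w); case: (w \in Y).
rewrite !H exchange_big /=; apply: eq_bigr => v _; apply: eq_bigr => w _.
by rewrite adj_sym.
Qed.

(** Take a set of largest dual value and, among these, of smallest size. It is poor, since a vertex
    with two neighbours outside the hubs could be dropped at no loss, and productive, since a closed
    part without gain could be dropped. *)
Lemma optimal_set : exists A,
  [/\ forall A', 2 * #|A'| + coverage A <= coverage A' + 2 * #|A|, poor A, productive A &
      A != set0 -> exists B, [/\ #|B| < #|A|, #|A| + #|B| <= #|T| &
        \sum_(v in ~: B) degin E A v < 2 * #|A|]].
Proof.
pose g A := 2 * #|T| + coverage A - 2 * #|A|.
(* Lexicographic minimum: first [g], then the size, which is below #|T|.+1. *)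
have [|A _ minA] := @ex_min {set T} (fun=> True) (fun A => g A * #|T|.+1 + #|A|); first by exists set0.
have {minA} minA A' : g A <= g A' /\ (g A' <= g A -> #|A| <= #|A'|).
  have := minA A' I; have := max_card (mem A); have := max_card (mem A').
  by move: (g A) (g A') #|A| #|A'| #|T| => x y a b N; clear; nia.
have gE X : g X + 2 * #|X| = 2 * #|T| + coverage X.
  by rewrite /g subnK // (leq_trans _ (leq_addr _ _)) // leq_mul2l max_card orbT.
have cA : closed A A.
  by apply/closedP; split=> // v _; right; apply: subsetIr.
have prA : productive A.
  move=> C cC C0; rewrite ltnNge; apply/negP => H.
  have [CA _] := closedP _ _ cC; have := minA (A :\: C); have := gE (A :\: C); have := gE A.
  have : 0 < #|C| by rewrite card_gt0.
  have : #|A| = #|C| + #|A :\: C| by rewrite -(cardsID C A) (setIidPr CA).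
  rewrite (coverage_closed cC); move: H.
  by move: (g A) (g _) (coverage C) (coverage _) #|A| #|C| #|A :\: C| #|T| => *; lia.
exists A; split=> //.
- move=> A'; have [H _] := minA A'; have := gE A; have := gE A'; move: H.
  by move: (g A) (g _) (coverage A) (coverage _) #|A| #|A'| #|T| => *; lia.
- apply/forallP => a; apply/implyP => aA; rewrite leqNgt; apply/negP => H.
  have cov : coverage A = coverage (A :\ a) + #|nbr E a :\: hubs A|.
    rewrite /coverage -sum1_card [X in _ = _ + X]big_mkcond -big_split /=; apply: eq_bigr => v _.
    rewrite /hubs !inE {1 3}/degin (cardsD1 a) !inE aA andbT adj_sym.
    rewrite (_ : (_ :&: _) :\ a = nbr E v :&: (A :\ a)); last by apply/setP => x; rewrite !inE; case: (x == a); rewrite ?andbF.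
    rewrite -/(degin _ _ _); case: (adj E a v); move: (degin _ _ _) => m /=; clear; case: ifP; lia.
  have [H1 H2] := minA (A :\ a); have := gE A; have := gE (A :\ a).
  move: H H1 H2; rewrite cov (cardsD1 a A) aA.
  by move: (g A) (g _) (coverage _) #|A :\ a| #|_ :\: _| #|T| => *; lia.
- move=> A0; pose B := [set v | 1 < degin E A v].
  have covA : coverage A = 2 * #|B| + \sum_(v in ~: B) degin E A v.
    rewrite /coverage (bigID (fun v => v \in B)) /= mulnC -sum_nat_const; congr (_ + _).
      by apply: eq_bigr => v; rewrite inE => ?; apply/minn_idPl.
    rewrite (eq_bigl (fun v => v \in ~: B)); last by move=> v; rewrite !inE.
    by apply: eq_bigr => v; rewrite !inE -leqNgt => ?; apply/minn_idPr; apply: ltnW.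
  have := prA A cA A0; rewrite covA => lt; exists B; split.
  + by move: lt; move: #|A| #|B|; clear; lia.
  (* The complement of [B] has dual value at least that of [A], so by minimality [A] is no larger
     than it. *)
  + have [_] := minA (~: B); have := gE A; have := gE (~: B); rewrite covA.
    have : coverage (~: B) + 2 * #|A| <= \sum_(v in ~: B) degin E A v + 2 * #|T|.
      rewrite -sum_degin_sym -(cardsC A) mulnDr [2 * #|A| + _]addnC addnA leq_add2r /coverage.
      rewrite (bigID (fun v => v \in A)) /= leq_add //; first by apply: leq_sum => v _; apply: geq_minr.
      rewrite mulnC -sum_nat_const (eq_bigl (fun v => v \in ~: A)); last by move=> v; rewrite inE.
      by apply: leq_sum => v _; apply: geq_minl.
    have := cardsC B; move: (g A) (g _) (\sum_(v in _) _) (coverage _) #|A| #|B| #|~: B| #|T| => *; lia.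
  + by move: lt; move: #|A| #|B|; clear; lia.
Qed.

Definition sparse_pair K := [exists A : {set T}, exists B : {set T},
  [&& K < #|A|, #|B| < #|A|, #|A| + #|B| <= #|T| & \sum_(v in ~: B) degin E A v < 2 * #|A|]].

(** An optimal dual set with more than [K] vertices produces a sparse pair, and then the trivial
    bound is used; a smaller one is split into atoms. *)
Lemma mu_upper K r : 2 < #|T| -> E \subset vpairs T -> 0 < r ->
  r * (2 * mu E) <= r * (cost_bound K [set: T] + 2 * #|T| * sparse_pair K) + 3 * #|T| + 2 * r
     + 2 * r * short_cycles (2 * r) E.
Proof.
move=> T3 sE r0; have [A' HA'] := mu_approx T3 sE r0; have [A [maxA pA prA spA]] := optimal_set.
suff H : 2 * #|A| <= coverage A + (cost_bound K [set: T] + 2 * #|T| * sparse_pair K).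
  have := maxA A'; move: HA' H; rewrite -/(coverage A').
  move: (cost_bound _ _) (2 * #|T| * _) (coverage _) (coverage _) (short_cycles _ _) #|A| #|A'| (mu E) => b c x y z a a' m.
  by move=> H1 H2 H3; nia.
have [AK|KA] := leqP #|A| K.
  apply: leq_trans (productive_bound AK pA prA) _; rewrite leq_add2l.
  apply: leq_trans (leq_addr _ _).
  by apply: leq_trans (cost_bound_setD K (subsetT A)); rewrite leq_addr.
have A0 : A != set0 by rewrite -card_gt0; apply: leq_ltn_trans KA.
have [B [BA AB S]] := spA A0.
suff -> : sparse_pair K.
  by rewrite muln1 addnA; apply: leq_trans (leq_addl _ _); rewrite leq_mul2l max_card orbT.
by apply/existsP; exists A; apply/existsP; exists B; rewrite KA BA AB.
Qed.

End Atoms.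

(** * First-moment bounds for large atoms and large dual sets *)

Section BushyCount.
Variable T : finType.
Implicit Types (E : {set {set T}}) (A B C U X : {set T}).

Definition bush E U C := (#|U| <= #|inner E U|.+1) &&
  [forall a, (a \in C) ==> (#|nbr E a :\: U| <= 1)].

Lemma leq_bigD1 (I : finType) (P : pred I) (F : I -> nat) i : P i -> F i <= \sum_(j | P j) F j.
Proof. by move=> Pi; rewrite (bigD1 i) //= leq_addr. Qed.

Lemma sum_bushy E K : \sum_(X : {set T}) (if bushy E K X then 2 * #|X| else 0) <=
  \sum_(k < K.+1 | 3 < k) \sum_(u < 2 * k) \sum_(U : {set T} | #|U| == u)
    \sum_(C : {set T} | (C \subset U) && (#|C| == k)) 2 * k * bush E U C.
Proof.
apply: leq_trans (_ : \sum_(X : {set T}) \sum_(k < K.+1 | 3 < k) \sum_(u < 2 * k)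
  \sum_(U : {set T} | #|U| == u) (if (X \subset U) && (#|X| == k) then 2 * k * bush E U X else 0) <= _); last first.
  rewrite exchange_big /=; apply: leq_sum => k _; rewrite exchange_big /=; apply: leq_sum => u _.
  by rewrite exchange_big /=; apply: leq_sum => U _; rewrite -big_mkcond.
apply: leq_sum => X _; case: ifP => // /and3P[X3 XK /existsP[U /and4P[XU U2 eU poorU]]].
pose k := Ordinal (XK : #|X| < K.+1).
apply: leq_trans (leq_bigD1 (i := k) _ _) => //.
apply: leq_trans (leq_bigD1 (i := Ordinal (U2 : #|U| < 2 * k)) _ _) => //=.
apply: leq_trans (leq_bigD1 (i := U) _ _) => //=.
by rewrite XU eqxx /= /bush eU poorU muln1.
Qed.

Lemma ex_subset_card (I : finType) (A : {set I}) m : m <= #|A| -> exists2 S : {set I}, S \subset A & #|S| = m.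
Proof.
case/card_geqP=> s [us <- sA]; exists [set x in s]; first by apply/subsetP => x; rewrite inE => /sA.
by rewrite -(card_uniqP us); apply: eq_card => x; rewrite inE.
Qed.

End BushyCount.

Section Numeric.
Local Open Scope ring_scope.
Variable R : realType.

Lemma geom_tail (x : R) N : 0 <= x <= 1 / 2 -> \sum_(k < N | (3 < k)%N) x ^+ k <= 2 * x ^+ 4.
Proof.
case/andP=> x0 x2; have xk k : 0 <= x ^+ k by apply: exprn_ge0.
suff H : \sum_(k < N | (3 < k)%N) x ^+ k + 2 * x ^+ (maxn N 4) <= 2 * x ^+ 4.
  by apply: le_trans H; rewrite lerDl mulr_ge0.
elim: N => [|N IH]; first by rewrite big_ord0 add0r.
rewrite big_mkcond big_ord_recr -big_mkcond /=; case: ltnP => N3.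
  move: IH; rewrite (maxn_idPl N3) (maxn_idPl (leqW N3)) => IH; apply: le_trans IH.
  rewrite -addrA lerD2l exprS; have := xk N; move: (x ^+ N) => y; nra.
by move: IH; rewrite addr0 (maxn_idPr (N3 : N.+1 <= 4)%N) (maxn_idPr (leqW N3)).
Qed.

Lemma self_power_fact u : u%:R ^+ u <= expR 1 ^+ u * u`!%:R :> R.
Proof.
elim: u => [|u IH]; first by rewrite !expr0 mul1r.
have [->|u0] := posnP u; first by rewrite !expr1 mulr1 ltW // expR_gt1.
have u0' : 0 < u%:R :> R by rewrite ltr0n.
have H : (u.+1%:R : R) ^+ u <= expR 1 * u%:R ^+ u.
  rewrite -[u.+1%:R](mulfVK (lt0r_neq0 u0')) exprMn ler_wpM2r ?exprn_ge0 ?ler0n //.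
  have -> : u.+1%:R / u%:R = 1 + u%:R^-1 :> R by rewrite -natr1 mulrDl mulfV ?lt0r_neq0 // mul1r.
  rewrite -[X in expR X](mulfV (lt0r_neq0 u0')) expRM_natl; apply: lerXn2r.
  - by rewrite nnegrE addr_ge0 // invr_ge0 ltW.
  - by rewrite nnegrE expR_ge0.
  - exact: expR_ge1Dx.
rewrite exprS factS natrM exprS mulrCA -!mulrA ler_wpM2l //.
by apply: le_trans H _; rewrite ler_wpM2l ?expR_ge0.
Qed.

Lemma sqr_le_pow k : (3 < k)%N -> (k ^ 2 <= 2 ^ k)%N.
Proof.
elim: k => // -[|[|[|[|k]]]] IH // _.
by have := IH isT; rewrite [(2 ^ k.+4.+1)%N]expnS; move: (2 ^ _)%N => x; nia.
Qed.

Lemma bin_fact_le N m : ('C(N, m) * m`! <= N ^ m)%N.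
Proof.
rewrite bin_ffact; elim: m => // m IH; rewrite ffactnSr expnSr leq_mul //; exact: leq_subr.
Qed.

(** Spanning trees of a piece with u = v + 1 vertices, relaxed to arbitrary sets of u - 1 pairs:
    both binomials are at most powers over factorials, and u^u <= e^u u!. *)
Lemma tree_count n v :
  ('C(n, v.+1) * 'C('C(v.+1, 2), v))%:R <= n%:R ^+ v.+1 * (expR 1 ^+ 2) ^+ v.+1 :> R.
Proof.
set u := v.+1; have f0 k : 0 < k`!%:R :> R by rewrite ltr0n fact_gt0.
have e0 := expR_ge0 (1 : R).
rewrite -(@ler_pM2r _ (u`! * u`!)%:R); last by rewrite natrM mulr_gt0.
apply: le_trans (_ : (n ^ u * (u ^ u * u ^ u))%:R <= _).
  rewrite -natrM ler_nat mulnACA leq_mul ?bin_fact_le // factS -/u mulnCA.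
  have -> : (u ^ u * u ^ u = u * (u ^ v * u ^ u))%N by rewrite mulnA -expnS.
  rewrite leq_mul //; apply: leq_trans (bin_fact_le _ _) _.
  have H : ('C(u, 2) <= u ^ 2)%N by apply: leq_trans (leq_pmulr _ (fact_gt0 2)) (bin_fact_le _ _).
  have : ('C(u, 2) ^ v <= (u ^ 2) ^ v)%N by case: (v) => [//|w]; rewrite leq_exp2r.
  move=> /leq_trans; apply; by rewrite -expnM mul2n -addnn expnD leq_mul // expnS leq_pmull.
rewrite natrM natrX -[leRHS]mulrA ler_wpM2l ?exprn_ge0 // exprAC expr2 [(u`! * u`!)%:R]natrM [(u ^ u * _)%:R]natrM [leRHS]mulrACA !natrX.
by apply: ler_pM; rewrite ?exprn_ge0 // self_power_fact.
Qed.

(** The binomial theorem, read off from total probability at density x / (1 + x). *)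
Lemma sum_sets (T : finType) (x : R) : 0 <= x -> \sum_(B : {set T}) x ^+ #|B| = (1 + x) ^+ #|T|.
Proof.
move=> x0; have y0 : 1 + x != 0 by rewrite lt0r_neq0 // ltr_pwDl.
rewrite -[RHS]mulr1 -[X in _ = _ * X](Ex_cst (x / (1 + x)) [set: T] 1) /Ex mulr_sumr.
rewrite [RHS](eq_bigl predT); last by move=> B; rewrite subsetT.
apply: eq_bigr => B _; rewrite mulr1.
have -> : 1 - x / (1 + x) = (1 + x)^-1 by apply: (mulIf y0); rewrite mulrBl mulVf // mulfVK // mul1r addrK.
rewrite setTD -(cardsC B) exprD expr_div_n exprVn.
by field; rewrite !expf_neq0.
Qed.

End Numeric.

Section BushProbability.
Local Open Scope ring_scope.
Variables (R : realType) (T : finType) (p : R).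
Hypothesis p01 : 0 <= p <= 1.
Implicit Types (E : {set {set T}}) (A B C U X : {set T}).
Local Notation n := #|T|.

Lemma Pr_bush U C : C \subset U -> Pr p (vpairs T) (fun E => bush E U C) <=
  'C('C(#|U|, 2), #|U|.-1)%:R * (p ^+ #|U|.-1 * binom_le p 1 (n - #|U|) ^+ #|C|).
Proof.
move=> CU; pose pairs := [set e in vpairs T | e \subset U].
have cp : #|pairs| = 'C(#|U|, 2) by rewrite -cards_draws; apply: eq_card => e; rewrite !inE andbC.
pose P (S0 E : {set {set T}}) := (S0 \subset E) && all (fun a => (#|nbr E a :\: U| <= 1)%N) (enum C).
pose fam := [set S : {set {set T}} | S \subset pairs & #|S| == #|U|.-1].
apply: le_trans (_ : Pr p (vpairs T) (fun E => [exists (S0 | S0 \in fam), P S0 E]) <= _).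
  apply: le_Pr => // E sE /andP[eU /forallP poorU].
  have [|S SE cS] := @ex_subset_card _ (inner E U) #|U|.-1; first by move: eU; case: #|U|.
  apply/existsP; exists S; rewrite inE cS eqxx andbT.
  rewrite (subset_trans SE) /=; last first.
    by apply/subsetP => e; rewrite !inE => /andP[/(subsetP sE)]; rewrite inE => -> ->.
  rewrite /P (subset_trans SE) /=; last by apply/subsetP => e; rewrite inE => /andP[].
  by apply/allP => a; rewrite mem_enum => aC; have := poorU a; rewrite aC.
apply: le_trans (Pr_exists _ _ _ p01) _.
rewrite (eq_bigr (fun=> p ^+ #|U|.-1 * binom_le p 1 (n - #|U|) ^+ #|C|)); last first.
  move=> S; rewrite inE => /andP[Sp /eqP cS]; rewrite /P Pr_stars ?enum_uniq ?cS -?cardE //.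
  - by move=> a; rewrite mem_enum => /(subsetP CU).
  - by apply: subset_trans Sp _; apply/subsetP => e; rewrite inE => /andP[].
  - by move=> e /(subsetP Sp); rewrite inE => /andP[].
by rewrite sumr_const cards_draws cp mulr_natl.
Qed.

Local Notation d := (n%:R * p).
Local Notation e1 := (expR 1 : R).
(** Cost per vertex of a bushy set. The e^2 of [tree_count] and the 2 for choosing [C] inside [U]
    occur once for each of fewer than 2 * k vertices, hence 4 e^4; the rest bounds the chance of at
    most one neighbour outside [U]. *)
Definition bush_rate : R := 4 * e1 ^+ 4 * (e1 * ((1 + d) * expR (- d))).

Lemma binom_le1_bound u k : (u < 2 * k)%N -> (2 * k)%:R * p <= 1 -> 1 <= d ->
  binom_le p 1 (n - u) <= e1 * ((1 + d) * expR (- d)).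
Proof.
case/andP: p01 => p0 p1 uk kp d1.
have p0' : 0 < p by rewrite lt0r p0 andbT; apply: contraTneq d1 => ->; rewrite mulr0 -ltNge.
have un : (u < n)%N.
  apply: leq_trans uk _; rewrite -(ler_nat R) -(ler_pM2r p0'); exact: le_trans kp d1.
have -> : (n - u = (n - u.+1).+1)%N by rewrite subnSK.
set m := (n - u.+1)%N.
rewrite /binom_le big_ord_recl big_ord1 /= bin0 bin1 expr0 !mul1r subn0 expr1 subSS subn0.
have q0 : 0 <= 1 - p by rewrite subr_ge0.
apply: le_trans (_ : (1 + d) * (1 - p) ^+ m <= _).
  rewrite mulrDl mul1r lerD //; first by rewrite exprS ler_piMl ?exprn_ge0 // gerBl.
  by rewrite ler_wpM2r ?exprn_ge0 // ler_wpM2r // ler_nat /m subnSK // leq_subr.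
rewrite mulrCA ler_wpM2l ?addr_ge0 ?ler01 //; first by rewrite (le_trans ler01).
apply: le_trans (powr_expR_upper _ p1) _; rewrite -expRD ler_expR /m natrB // mulrBl.
have : u.+1%:R * p <= (2 * k)%:R * p by rewrite ler_wpM2r // ler_nat.
by move: kp; move: (u.+1%:R * p) (_%:R * p) => x y; lra.
Qed.

Lemma bush_term k u : (3 < k)%N -> (u < 2 * k)%N -> (2 * k)%:R * p <= 1 -> 1 <= d ->
  'C(n, u)%:R * 'C(u, k)%:R * ('C('C(u, 2), u.-1)%:R * (p ^+ u.-1 * binom_le p 1 (n - u) ^+ k)) <=
  n%:R * d ^+ (2 * k - 2) * bush_rate ^+ k.
Proof.
move=> k3 uk kp d1; have [p0 p1] := andP p01.
have d0 : 0 <= d by apply: le_trans d1.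
have br0 : 0 <= bush_rate by rewrite !mulr_ge0 ?exprn_ge0 ?expR_ge0 ?addr_ge0.
have rhs0 : 0 <= n%:R * d ^+ (2 * k - 2) * bush_rate ^+ k by rewrite !mulr_ge0 // exprn_ge0.
have [uk'|ku] := ltnP u k; first by rewrite (bin_small uk') mulr0 mul0r.
case: u uk ku => [|v] uk ku; first by move: ku k3; case: k {kp uk rhs0}.
rewrite [v.+1.-1]/=; set u := v.+1.
have H1 : 'C(n, u)%:R * 'C('C(u, 2), v)%:R <= n%:R ^+ u * (e1 ^+ 2) ^+ u by rewrite -natrM; apply: tree_count.
have H2 : ('C(u, k))%:R <= 2 ^+ u :> R.
  rewrite -natrX ler_nat -[u in (2 ^ u)%N]card_ord -cardsT -card_powerset -{1}[u]card_ord -card_draws.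
  by apply: subset_leq_card; apply/subsetP => B _; rewrite inE subsetT.
have H3 := binom_le1_bound uk kp d1.
have b0 := binom_le_ge0 1 (n - u) p01.
have H3k : binom_le p 1 (n - u) ^+ k <= (e1 * ((1 + d) * expR (- d))) ^+ k.
  by apply: lerXn2r; rewrite ?nnegrE // (le_trans b0).
have e0 := expR_ge0 (1 : R).
apply: le_trans (_ : (n%:R ^+ u * (e1 ^+ 2) ^+ u) * 2 ^+ u * (p ^+ v * (e1 * ((1 + d) * expR (- d))) ^+ k) <= _).
  have -> : forall a b c w z : R, a * b * (c * (w * z)) = a * c * b * (w * z) by move=> *; ring.
  apply: ler_pM; rewrite ?mulr_ge0 ?exprn_ge0 //.
    by apply: ler_pM; rewrite ?mulr_ge0.
  by rewrite ler_wpM2l ?exprn_ge0.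
have -> : forall a b c w z : R, a * b * c * (w * z) = a * w * (b * c) * z by move=> *; ring.
rewrite -exprMn /bush_rate [X in _ <= _ * X]exprMn [leRHS]mulrA.
apply: ler_pM; rewrite ?mulr_ge0 ?exprn_ge0 ?mulr_ge0 ?expR_ge0 ?exprn_ge0 ?addr_ge0 //.
apply: ler_pM; rewrite ?mulr_ge0 ?exprn_ge0 ?mulr_ge0 ?exprn_ge0 //.
  rewrite exprS -mulrA -exprMn ler_wpM2l // ler_weXn2l //.
  by move: uk; clear; lia.
have -> : 4 * e1 ^+ 4 = (e1 ^+ 2 * 2) ^+ 2 by ring.
rewrite -exprM ler_weXn2l //; last by move: uk; clear; lia.
have : 1 <= e1 by rewrite ltW // expR_gt1.
by move: e1 => z ?; nra.
Qed.

(** A geometric series in k from k = 4 on, where d^(2 k - 2) is d^6. The factor 4 k^2, from the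
    weight and the choices of [u], is absorbed by k^2 <= 2^k. *)
Lemma Ex_bushy K : (2 * K)%:R * p <= 1 -> 1 <= d -> 2 * d ^+ 2 * bush_rate <= 1 / 2 ->
  Ex p (vpairs T) (fun E => (\sum_(X : {set T}) (if bushy E K X then 2 * #|X| else 0))%:R) <=
  n%:R * (8 * (2 * bush_rate) ^+ 4 * d ^+ 6).
Proof.
move=> Kp d1 rate; have [p0 p1] := andP p01.
have d0 : 0 <= d by apply: le_trans d1.
have dp : 0 < d by apply: lt_le_trans d1.
have pn0 : p != 0 by apply: contraTneq dp => ->; rewrite mulr0 ltxx.
have nn0 : n%:R != 0 :> R by apply: contraTneq dp => ->; rewrite mul0r ltxx.
have br0 : 0 <= bush_rate by rewrite !mulr_ge0 ?exprn_ge0 ?expR_ge0 ?addr_ge0.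
apply: le_trans (_ : Ex p (vpairs T) (fun E => \sum_(k < K.+1 | (3 < k)%N) \sum_(u < 2 * k)
   \sum_(U : {set T} | #|U| == u) \sum_(C : {set T} | (C \subset U) && (#|C| == k)) (2 * k)%:R * (bush E U C)%:R) <= _).
  apply: le_Ex => // E _; apply: le_trans (_ : (\sum_(k < K.+1 | 3 < k) \sum_(u < 2 * k) \sum_(U : {set T} | #|U| == u)
    \sum_(C : {set T} | (C \subset U) && (#|C| == k)) 2 * k * bush E U C)%N%:R <= _); first by rewrite ler_nat sum_bushy.
  rewrite natr_sum ler_sum // => k _; rewrite natr_sum ler_sum // => u _; rewrite natr_sum ler_sum // => U _.
  by rewrite natr_sum ler_sum // => C _; rewrite natrM.
rewrite Ex_sum; apply: le_trans (_ : \sum_(k < K.+1 | (3 < k)%N) n%:R * 4 / d ^+ 2 * (2 * d ^+ 2 * bush_rate) ^+ k <= _).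
  apply: ler_sum => k k3; rewrite Ex_sum.
  have kK : (2 * k)%:R * p <= 1.
    by apply: le_trans Kp; rewrite ler_wpM2r // ler_nat leq_mul2l -ltnS ltn_ord orbT.
  apply: le_trans (_ : \sum_(u < 2 * k) (2 * k)%:R * (n%:R * d ^+ (2 * k - 2) * bush_rate ^+ k) <= _).
    apply: ler_sum => u _; apply: le_trans (ler_wpM2l (ler0n _ _) (bush_term k3 (ltn_ord u) kK d1)).
    rewrite Ex_sum; apply: le_trans (_ : \sum_(U : {set T} | #|U| == u) 'C(u, k)%:R * ((2 * k)%:R *
       ('C('C(u, 2), u.-1)%:R * (p ^+ u.-1 * binom_le p 1 (n - u) ^+ k))) <= _).
      apply: ler_sum => U /eqP Uu; rewrite Ex_sum -Uu -cards_draws mulr_natl -sumr_const.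
      rewrite [leRHS](eq_bigl (fun C : {set T} => (C \subset U) && (#|C| == k))); last by move=> C; rewrite inE.
      apply: ler_sum => C /andP[CU /eqP Ck]; rewrite ExZl ler_wpM2l //.
      by apply: le_trans (Pr_bush CU) _; rewrite Ck.
    rewrite (eq_bigl (fun U => U \in [set U : {set T} | #|U| == u])); last by move=> U; rewrite inE.
    rewrite [leLHS]sumr_const card_draws -[leLHS]mulr_natl !mulrA.
    by have -> : forall a b c w z y : R, a * b * c * w * z * y = c * a * b * w * z * y by move=> *; ring.
  rewrite sumr_const card_ord -[leLHS]mulr_natl.
  have k2 : (k ^ 2 <= 2 ^ k)%N.
    exact: sqr_le_pow.
  have -> : (2 * k - 2 = 2 * (k - 1))%N by rewrite mulnBr.
  have rateE (x y : R) : (2 * x ^+ 2 * y) ^+ k = 2 ^+ k * x ^+ 2 * x ^+ (2 * (k - 1)) * y ^+ k.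
    rewrite [(2 * _ * y) ^+ k]exprMn [(2 * _) ^+ k]exprMn -exprM; congr (_ * _); rewrite -[RHS]mulrA -exprD; congr (_ * x ^+ _).
    by move: k3; clear; lia.
  rewrite rateE.
  have -> : n%:R * 4 / d ^+ 2 * (2 ^+ k * d ^+ 2 * d ^+ (2 * (k - 1)) * bush_rate ^+ k) =
    4 * 2 ^+ k * (n%:R * d ^+ (2 * (k - 1)) * bush_rate ^+ k).
    by field; rewrite pn0 nn0.
  rewrite [leLHS]mulrA ler_wpM2r ?mulr_ge0 ?exprn_ge0 //.
  rewrite -!natrX -!natrM ler_nat; move: k2; move: (nat_of_ord k) (2 ^ _)%N => x y; clear; nia.
rewrite -mulr_sumr; apply: le_trans (ler_wpM2l _ (geom_tail _ _)) _.
- by rewrite !mulr_ge0 // invr_ge0 exprn_ge0.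
- by rewrite rate andbT mulr_ge0 // mulr_ge0 // exprn_ge0.
rewrite le_eqVlt; apply/orP; left; apply/eqP.
by field; rewrite pn0 nn0.
Qed.

End BushProbability.

Section Cross.
Variable T : finType.
Implicit Types (E : {set {set T}}) (A B C D : {set T}).

Definition cross A D : {set {set T}} :=
  [set e in vpairs T | [exists t : T * T, [&& t.1 \in A, t.2 \in D & e == [set t.1; t.2]]]].

Lemma cross_vpairs A D : cross A D \subset vpairs T.
Proof. by apply/subsetP => e; rewrite inE => /andP[]. Qed.

Lemma mem_cross A D a v : a \in A -> v \in D -> a != v -> [set a; v] \in cross A D.
Proof.
move=> aA vD av; rewrite inE pair_vpairs av; apply/existsP; exists (a, v) => /=.
by rewrite aA vD eqxx.
Qed.

Lemma card_cross_le E A D : #|E :&: cross A D| <= \sum_(v in D) degin E A v.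
Proof.
pose P := [set t : T * T | [&& t.1 \in D, t.2 \in A & adj E t.1 t.2]].
apply: leq_trans (_ : #|P| <= _).
  apply: leq_trans (leq_imset_card (fun t : T * T => [set t.1; t.2]) _); apply: subset_leq_card.
  apply/subsetP => e; rewrite !inE => /and3P[eE _ /existsP[[a v] /= /and3P[aA vD /eqP ee]]].
  apply/imsetP; exists (v, a); last by rewrite ee setUC.
  by rewrite inE /= vD aA /= /adj /= setUC -ee.
rewrite -sum1_card (eq_bigl (fun t : T * T => (t.1 \in D) && (t.2 \in nbr E t.1 :&: A))); last first.
  by move=> t; rewrite !inE; case: (t.1 \in D); case: (t.2 \in A); rewrite ?andbF ?andbT.
rewrite -(pair_big_dep (fun v => v \in D) (fun v a => a \in nbr E v :&: A) (fun _ _ => 1)) /=.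
by apply: leq_sum => v _; rewrite sum1_card.
Qed.

(** A pair of [cross A D] comes from at most two ordered pairs, told apart by the bit in [f]. *)
Lemma card_cross_ge A D : #|A| * (#|D| - 1) <= 2 * #|cross A D|.
Proof.
pose P := [set t : T * T | [&& t.1 \in A, t.2 \in D & t.1 != t.2]].
pose f (t : T * T) := ([set t.1; t.2], enum_rank t.1 < enum_rank t.2).
apply: leq_trans (_ : #|P| <= _).
  rewrite -[#|P|]sum1_card (eq_bigl (fun t : T * T => (t.1 \in A) && (t.2 \in D :\ t.1))); last first.
    by move=> t; rewrite !inE [t.1 == _]eq_sym [(t.2 \in D) && _]andbC.
  rewrite -(pair_big_dep (fun v => v \in A) (fun v a => a \in D :\ v) (fun _ _ => 1)) /=.
  rewrite -sum_nat_const; apply: leq_sum => v _; rewrite sum1_card (cardsD1 v D).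
  by case: (v \in D); move: #|_| => m /=; lia.
rewrite -(@card_in_imset _ _ f).
  apply: leq_trans (_ : #|setX (cross A D) [set: bool]| <= _); last by rewrite cardsX cardsT card_bool mulnC.
  apply: subset_leq_card; apply/subsetP => y /imsetP[[a v]]; rewrite inE /= => /and3P[aA vD av] ->.
  by rewrite in_setX in_setT andbT; apply: mem_cross.
move=> [a v] [b w]; rewrite !inE /= => /and3P[_ _ av] /and3P[_ _ bw] [] /setP H.
have := H a; have := H v; rewrite !inE !eqxx orbT /= => /esym vE /esym aE.
case/orP: aE => /eqP aE; case/orP: vE => /eqP vE; rewrite aE vE //; do ?by rewrite aE vE eqxx in av.
by case: (ltngtP (enum_rank w) (enum_rank b)) => // /val_inj/enum_rank_inj wb; rewrite wb eqxx in bw.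
Qed.

End Cross.

Section Tails.
Local Open Scope ring_scope.
Variables (R : realType) (p : R).
Hypothesis p01 : 0 <= p <= 1.

Lemma Ex_geom (I : finType) (S : {set I}) (x : R) :
  Ex p S (fun B => x ^+ #|B|) = (1 - p + p * x) ^+ #|S|.
Proof.
elim/setD1_ind: S => [|S e eS IH]; first by rewrite Ex_set0 cards0.
rewrite (ExD1 _ _ eS) IH (cardsD1 e S) eS /= exprS.
rewrite (_ : Ex p (S :\ e) _ = Ex p (S :\ e) (fun B => x * x ^+ #|B|)); last first.
  by apply: eq_Ex => B /subsetP BS; rewrite cardsU1; case: (boolP (e \in B)) => [/BS|]; rewrite ?inE ?eqxx // exprS.
by rewrite ExZl IH; ring.
Qed.

(** Markov's inequality for 2^-X, where X is the number of kept elements of [S]. *)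
Lemma Pr_few (I : finType) (D S : {set I}) t : S \subset D ->
  Pr p D (fun E => (#|E :&: S| <= t)%N) <= 2 ^+ t * (1 - p / 2) ^+ #|S|.
Proof.
move=> SD; apply: le_trans (_ : Ex p D (fun E => 2 ^+ t * (1 / 2) ^+ #|E :&: S|) <= _).
  apply: le_Ex => // E _; case: leqP => [le_t|_]; last by rewrite mulr_ge0 ?exprn_ge0 // divr_ge0.
  rewrite -{1}(subnK le_t) exprD -mulrA -exprMn (_ : 2 * (1 / 2) = 1); last by lra.
  rewrite expr1n mulr1.
  by rewrite exprn_ege1 // ler1n.
rewrite ExZl ler_wpM2l ?exprn_ge0 // (Ex_restrict p (fun B => (1 / 2) ^+ #|B|) SD) Ex_geom.
by rewrite (_ : 1 - p + p * (1 / 2) = 1 - p / 2) //; field.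
Qed.

End Tails.

Section SparsePair.
Local Open Scope ring_scope.
Variables (R : realType) (T : finType) (p : R).
Hypothesis p01 : 0 <= p <= 1.
Local Notation n := #|T|.
Local Notation d := (n%:R * p).
Local Notation e1 := (expR 1 : R).

Definition pair_rate : R := 4 * (e1 * expR (- (d / 8))).

(** The complement of [B] has at least half of the vertices, so about #|A| n / 4 pairs would have to
    contain fewer than 2 * #|A| edges. *)
Lemma Pr_one_pair (A B : {set T}) : (#|B| < #|A|)%N -> (#|A| + #|B| <= n)%N ->
  Pr p (vpairs T) (fun E => (\sum_(v in ~: B) degin E A v < 2 * #|A|)%N) <= pair_rate ^+ #|A|.
Proof.
move=> BA AB; have [p0 p1] := andP p01.
apply: le_trans (_ : Pr p (vpairs T) (fun E => (#|E :&: cross A (~: B)| <= 2 * #|A|)%N) <= _).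
  by apply: le_Pr => // E _ /ltnW; apply: leq_trans; apply: card_cross_le.
apply: le_trans (Pr_few p01 _ (cross_vpairs _ _)) _.
rewrite /pair_rate exprMn exprM -[2 ^+ 2]natrX ler_wpM2l ?exprn_ge0 //.
apply: le_trans (powr_expR_upper _ _) _; first by lra.
rewrite -expRD -expRM_natl ler_expR.
have H : (#|A| * (n - 1) <= 4 * #|cross A (~: B)|)%N.
  have := card_cross_ge A (~: B); have := cardsC B; move: AB BA; move: #|~: B| #|cross A (~: B)| #|A| #|B| n => D c a b N.
  by clear; nia.
have H' : #|A|%:R * (n%:R - 1) <= 4 * #|cross A (~: B)|%:R :> R.
  rewrite -[1]/(1%:R) -natrB; last by apply: leq_trans AB; apply: leq_trans (leq_addr _ _); case: #|A| BA.
  by rewrite -[4]/(4%:R) -!natrM ler_nat.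
have := ler_wpM2r p0 H'; have : #|A|%:R * p <= #|A|%:R :> R by rewrite ler_piMr.
have := ler0n R #|A|; move: #|A|%:R #|cross A (~: B)|%:R n%:R => a c N; nra.
Qed.

(** Union bound over all [A] and [B] with weights x^(#|A| + #|B|), x = 1 / (2 d). The weights sum to
    at most e^(n / d) <= e^(2 (K + 1)), and a factor [pair_rate] / x^2 remains for each vertex of
    [A]. *)
Lemma Pr_sparse_pair K : 1 <= d -> n%:R <= 2 * d * K.+1%:R ->
  expR 2 * (4 * d ^+ 2 * pair_rate) <= 1 / 2 ->
  Pr p (vpairs T) (fun E => sparse_pair E K) <= (1 / 2) ^+ K.+1.
Proof.
move=> d1 nK rate; have [p0 p1] := andP p01.
have dp : 0 < d by apply: lt_le_trans d1.
have dp2 : 0 < 2 * d by rewrite mulr_gt0.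
have pn0 : p != 0 by apply: contraTneq dp => ->; rewrite mulr0 ltxx.
have nn0 : n%:R != 0 :> R by apply: contraTneq dp => ->; rewrite mul0r ltxx.
pose x : R := (2 * d)^-1; have x0 : 0 <= x by rewrite invr_ge0 mulr_ge0 // ltW.
have x1 : x <= 1 by rewrite /x -[leRHS]invr1 lef_pV2 ?posrE //; move: d1; move: d => z z1; lra.
have g0 : 0 <= pair_rate by rewrite !mulr_ge0 ?expR_ge0.
pose r := 4 * d ^+ 2 * pair_rate.
have r0 : 0 <= r by rewrite mulr_ge0 // mulr_ge0 // exprn_ge0 // ltW.
have r1 : r <= 1.
  move: rate; rewrite -/r; have : 1 <= expR 2 :> R by rewrite ltW // expR_gt1.
  by move: (expR 2) => z; nra.
apply: le_trans (_ : Pr p (vpairs T) (fun E => [exists (A : {set T} | (K < #|A|)%N),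
  [exists (B : {set T} | (#|B| < #|A|)%N && (#|A| + #|B| <= n)%N), (\sum_(v in ~: B) degin E A v < 2 * #|A|)%N]]) <= _).
  apply: le_Pr => // E _ /existsP[A /existsP[B /and4P[KA BA AB S]]].
  by apply/existsP; exists A; rewrite KA; apply/existsP; exists B; rewrite BA AB.
apply: le_trans (Pr_exists _ _ _ p01) _.
apply: le_trans (_ : \sum_(A : {set T}) \sum_(B : {set T}) r ^+ K.+1 * x ^+ #|A| * x ^+ #|B| <= _).
  rewrite big_mkcond; apply: ler_sum => A _; case: ifP => KA; last first.
    by apply: sumr_ge0 => B _; rewrite !mulr_ge0 // exprn_ge0.
  apply: le_trans (Pr_exists _ _ _ p01) _.
  rewrite big_mkcond; apply: ler_sum => B _; case: ifP => [/andP[BA AB]|_]; last first.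
    by rewrite !mulr_ge0 // exprn_ge0.
  apply: le_trans (Pr_one_pair BA AB) _.
  have -> : pair_rate = r * x * x by rewrite /r /x; field; rewrite pn0 nn0.
  move: (r) r0 r1 => z z0 z1; rewrite [(z * x * x) ^+ _]exprMn [(z * x) ^+ _]exprMn.
  apply: ler_pM; rewrite ?mulr_ge0 ?exprn_ge0 //.
    by rewrite ler_wpM2r ?exprn_ge0 // ler_wiXn2l.
  by rewrite ler_wiXn2l // ltnW.
under eq_bigr => A _ do rewrite -mulr_sumr (sum_sets _ x0).
rewrite -mulr_suml -mulr_sumr (sum_sets _ x0) -mulrA -expr2.
apply: le_trans (_ : r ^+ K.+1 * expR 2 ^+ K.+1 <= _).
  rewrite ler_wpM2l ?exprn_ge0 // -expRM_natl -exprM.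
  apply: le_trans (_ : expR ((n * 2)%:R * x) <= _).
    rewrite expRM_natl; apply: lerXn2r; rewrite ?nnegrE ?expR_ge0 ?addr_ge0 //; exact: expR_ge1Dx.
  rewrite ler_expR natrM /x ler_pdivrMr //; move: nK; move: (2 * d) n%:R K.+1%:R => D N k; nra.
rewrite -exprMn mulrC; apply: lerXn2r => //; rewrite nnegrE ?mulr_ge0 ?expR_ge0 //; lra.
Qed.

End SparsePair.

(** * Expansion of the limit *)

Section Expansion.
Import numFieldNormedType.Exports.
Local Open Scope classical_set_scope.
Local Open Scope ring_scope.
Variable R : realType.
Implicit Types (d x p : R) (n k : nat).

Lemma cvg_eq_near (u v : nat -> R) (l : R) : u n @[n --> \oo] --> l ->
  (\forall n \near \oo, u n = v n) -> v n @[n --> \oo] --> l.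
Proof. by move=> ul uv; apply: cvg_trans ul; apply: near_eq_cvg. Qed.

Lemma cvg_one_minus_sub d k : 0 <= d -> (1 - d / n%:R) ^+ (n - k) @[n --> \oo] --> expR (- d).
Proof.
move=> d0.
have L : 1 - d / n%:R @[n --> \oo] --> (1 : R).
  rewrite -[X in _ --> X]subr0; apply: cvgB; [exact: cvg_cst|exact: cvg_over_n].
have LV : ((1 - d / n%:R) ^+ k)^-1 @[n --> \oo] --> ((1 : R) ^+ k)^-1.
  by apply: cvgV; [rewrite expr1n oner_eq0|exact: cvg_pow L].
rewrite -[X in _ --> X]mulr1 -[X in _ * X](_ : (1 ^+ k)^-1 = 1); last by rewrite expr1n invr1.
apply: (cvg_eq_near (cvgM (cvg_one_minus d0) LV)); near=> n => /=.
have n1 : d / n%:R < 1 by near: n; exact: near_over_lt1.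
have kn : (k <= n)%N by near: n; apply: (@near_infty_ge _ k).
have q0 : 1 - d / n%:R != 0 by rewrite subr_eq0 gt_eqF.
have -> : (1 - d / n%:R) ^+ n = (1 - d / n%:R) ^+ (n - k) * (1 - d / n%:R) ^+ k by rewrite -exprD subnK.
by rewrite mulfK // expf_neq0.
Unshelve. all: by end_near. Qed.

Lemma cvg_bin d m : 'C(n, m)%:R * (d / n%:R) ^+ m @[n --> \oo] --> d ^+ m / m`!%:R.
Proof.
rewrite -[X in _ --> X]mul1r; apply: (@cvg_eq_near (fun n => (n ^_ m)%:R / n%:R ^+ m * (d ^+ m / m`!%:R))).
  by apply: cvgM; [exact: cvg_ffact|exact: cvg_cst].
near=> n.
have n0 : (0 < n)%N by near: n; apply: (@near_infty_ge _ 1).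
have n0' : n%:R != 0 :> R by rewrite pnatr_eq0 -lt0n.
have m0 : m`!%:R != 0 :> R by rewrite pnatr_eq0 -lt0n fact_gt0.
rewrite -bin_ffact natrM expr_div_n; field.
by rewrite m0 expf_neq0.
Unshelve. all: by end_near. Qed.

Lemma cvg_bin_pred d m : 0 < d -> 'C(n.-1, m)%:R * (d / n%:R) ^+ m @[n --> \oo] --> d ^+ m / m`!%:R.
Proof.
move=> d0; have dn0 := lt0r_neq0 d0.
have m0 : m`!%:R != 0 :> R by rewrite pnatr_eq0 -lt0n fact_gt0.
have m1 : m.+1%:R != 0 :> R by rewrite pnatr_eq0.
have -> : d ^+ m / m`!%:R = m.+1%:R / d * (d ^+ m.+1 / (m.+1)`!%:R).
  by rewrite factS natrM exprS; field; rewrite m0 dn0 nat1r m1.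
apply: (@cvg_eq_near (fun n => m.+1%:R / d * ('C(n, m.+1)%:R * (d / n%:R) ^+ m.+1))).
  by apply: cvgM; [exact: cvg_cst|exact: cvg_bin].
near=> n.
have n0 : (0 < n)%N by near: n; apply: (@near_infty_ge _ 1).
have n0' : n%:R != 0 :> R by rewrite pnatr_eq0 -lt0n.
have H : m.+1%:R * 'C(n, m.+1)%:R = n%:R * 'C(n.-1, m)%:R :> R by rewrite -!natrM mul_bin_diag.
have -> : m.+1%:R / d * ('C(n, m.+1)%:R * (d / n%:R) ^+ m.+1) = (m.+1%:R * 'C(n, m.+1)%:R) * (d / n%:R) ^+ m / n%:R.
  by rewrite exprS; move: 'C(n, m.+1)%:R ((d / n%:R) ^+ m) => a b; field; rewrite n0' dn0.
by rewrite H; move: 'C(n.-1, m)%:R ((d / n%:R) ^+ m) => a b; field.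
Unshelve. all: by end_near. Qed.

Lemma cvg_binom_le d k : 0 < d -> binom_le (d / n%:R) 1 (n - k) @[n --> \oo] --> (1 + d) * expR (- d).
Proof.
move=> d0; have d0' := ltW d0.
have H : (n - k)%:R * (d / n%:R) @[n --> \oo] --> d.
  have L : d - k%:R * (d / n%:R) @[n --> \oo] --> d.
    rewrite -[X in _ --> X]subr0 -[X in _ - X](mulr0 k%:R); apply: cvgB; first exact: cvg_cst.
    by apply: cvgM; [exact: cvg_cst|exact: cvg_over_n].
  apply: cvg_trans L; apply: near_eq_cvg; near=> n.
  have n0 : (0 < n)%N by near: n; apply: (@near_infty_ge _ 1).
  have kn : (k <= n)%N by near: n; apply: (@near_infty_ge _ k).
  by rewrite natrB // mulrBl [n%:R * _]mulrC divfK // pnatr_eq0 -lt0n.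
have -> : (1 + d) * expR (- d) = expR (- d) + d * expR (- d) by rewrite mulrDl mul1r.
apply: (@cvg_eq_near (fun n => (1 - d / n%:R) ^+ (n - k) + (n - k)%:R * (d / n%:R) * (1 - d / n%:R) ^+ (n - k.+1))).
  apply: cvgD; first exact: cvg_one_minus_sub.
  by apply: cvgM; [exact: H|exact: cvg_one_minus_sub].
near=> n.
rewrite /binom_le big_ord_recl big_ord1 /= bin0 bin1 expr0 !mul1r subn0 expr1.
by rewrite -subnDA addn1.
Unshelve. all: by end_near. Qed.

(** Isolated vertices, pendant vertices at 1/2 each, and triples of neighbours of degree at most 2,
    with coefficient 1/2 times 1 / 3!. *)
Definition main_term d : R :=
  expR (- d) + d * expR (- d) / 2 + d ^+ 3 * ((1 + d) * expR (- d)) ^+ 3 / 12.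

Section FixedDegree.
Variable d : R.
Hypothesis d0 : 0 < d.

Local Notation p n := (d / n%:R : R).

Lemma near_setup : \forall n \near \oo, [/\ 0 <= p n <= 1, (2 < #|'I_n|)%N & #|'I_n|%:R * p n = d].
Proof.
near=> n; have n1 : p n < 1 by near: n; exact: near_over_lt1.
have n3 : (2 < #|'I_n|)%N by rewrite card_ord; near: n; apply: (@near_infty_ge _ 3).
split=> //; first by rewrite divr_ge0 ?ler0n ?(ltW n1) ?(ltW d0).
by rewrite card_ord mulrC divfK // pnatr_eq0 -lt0n; move: n3; rewrite card_ord => /ltnW/ltnW.
Unshelve. all: by end_near. Qed.

Let isolated n := 'C(n.-1, 0)%:R * p n ^+ 0 * (1 - p n) ^+ (n.-1 - 0).
Let pendant n := 'C(n.-1, 1)%:R * p n ^+ 1 * (1 - p n) ^+ (n.-1 - 1).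

Lemma cvg_isolated : isolated n @[n --> \oo] --> expR (- d).
Proof.
apply: (@cvg_eq_near (fun n => (1 - d / n%:R) ^+ (n - 1))); first by apply: cvg_one_minus_sub; apply: ltW.
near=> n.
by rewrite /isolated bin0 expr0 !mul1r subn0 subn1.
Unshelve. all: by end_near. Qed.

Lemma cvg_pendant : pendant n @[n --> \oo] --> d * expR (- d).
Proof.
have -> : d * expR (- d) = d ^+ 1 / 1`!%:R * expR (- d) by rewrite divr1.
apply: (@cvg_eq_near (fun n => 'C(n.-1, 1)%:R * (d / n%:R) ^+ 1 * (1 - d / n%:R) ^+ (n - 2))).
  by apply: cvgM; [exact: cvg_bin_pred|apply: cvg_one_minus_sub; apply: ltW].
near=> n.
by rewrite /pendant -subn1 -subnDA.
Unshelve. all: by end_near. Qed.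

Lemma mean_lower : main_term d - d ^+ 4 * ((1 + d) * expR (- d)) ^+ 4 / 24 <= limn (mean d).
Proof.
pose u n := isolated n + pendant n / 2 +
  ('C(n.-1, 3)%:R * p n ^+ 3 * binom_le (p n) 1 (n - 4) ^+ 3 - 3 * (p n * ('C(n.-1, 3)%:R * p n ^+ 3))) / 2 -
  'C(n, 4)%:R * p n ^+ 4 * binom_le (p n) 1 (n - 5) ^+ 4.
have ul : u n @[n --> \oo] --> main_term d - d ^+ 4 * ((1 + d) * expR (- d)) ^+ 4 / 24.
  have -> : main_term d - d ^+ 4 * ((1 + d) * expR (- d)) ^+ 4 / 24 =
    expR (- d) + (d * expR (- d)) / 2 + (d ^+ 3 / 3`!%:R * ((1 + d) * expR (- d)) ^+ 3 - 3 * (0 * (d ^+ 3 / 3`!%:R))) / 2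
    - d ^+ 4 / 4`!%:R * ((1 + d) * expR (- d)) ^+ 4.
    by rewrite /main_term (_ : 3`! = 6)%N // (_ : 4`! = 24)%N //; move: (expR _) => z; field.
  apply: cvgB; last first.
    by apply: cvgM; [exact: cvg_bin|apply: cvg_pow; exact: cvg_binom_le].
  apply: cvgD; last first.
    apply: cvgM; last exact: cvg_cst.
    apply: cvgB.
      by apply: cvgM; [exact: cvg_bin_pred|apply: cvg_pow; exact: cvg_binom_le].
    apply: cvgM; first exact: cvg_cst.
    by apply: cvgM; [exact: cvg_over_n|exact: cvg_bin_pred].
  apply: cvgD; first exact: cvg_isolated.
  by apply: cvgM; [exact: cvg_pendant|exact: cvg_cst].
rewrite -(cvg_lim _ ul) //; apply: ler_lim; [exact: cvgP ul|exact: cvg_mean|].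
near=> n.
have [p01 n3 nd] : [/\ 0 <= p n <= 1, (2 < #|'I_n|)%N & #|'I_n|%:R * p n = d] by near: n; exact: near_setup.
have n0 : 0 < n%:R :> R by rewrite ltr0n; move: n3; rewrite card_ord => /ltnW/ltnW.
rewrite /mean ler_pdivlMr //.
have E0 := @Ex_num_degree R 'I_n (p n) 0; have E1 := @Ex_num_degree R 'I_n (p n) 1.
have S3 := @Ex_stars_ge R 'I_n (p n) p01; have S4 := @Ex_stars_le R 'I_n (p n) p01 4 isT.
move: E0 E1 S3 S4; rewrite card_ord -/(isolated n) -/(pendant n) => E0 E1 S3 S4.
have H : Ex (p n) (vpairs 'I_n) (fun E => 2 * (num_degree E 0)%:R + (num_degree E 1)%:R + (stars E 2 3)%:R)
   <= Ex (p n) (vpairs 'I_n) (fun E => 2 * (mu E)%:R + 2 * (stars E 2 4)%:R).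
  apply: le_Ex => // E sE; by rewrite -?natrM -?natrD ler_nat; apply: mu_lower.
move: H; rewrite !ExDf !ExZl E0 E1 => H.
move: S3 S4 H; rewrite /u; set a := Ex _ _ _; set b := Ex _ _ _; set c := Ex _ _ _.
move: (isolated n) (pendant n) 'C(n.-1, 3)%:R 'C(n, 4)%:R (binom_le _ _ _) (binom_le _ _ _) => x y z t w2 w1.
move: n%:R (d / _) => N q; clear -N; move=> S3 S4 H.
have -> : (x + y / 2 + (z * q ^+ 3 * w1 ^+ 3 - 3 * (q * (z * q ^+ 3))) / 2 - t * q ^+ 4 * w2 ^+ 4) * N =
  (2 * (N * x) + N * y + N * (z * (q ^+ 3 * w1 ^+ 3 - 3 * q ^+ 4)) - 2 * (N * (t * (q ^+ 4 * w2 ^+ 4)))) / 2 by field.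
lra.
Unshelve. all: by end_near. Qed.

Lemma cost_boundT (T : finType) (E : {set {set T}}) K :
  (cost_bound E K [set: T])%:R <= 2 * (num_degree E 0)%:R + (num_degree E 1)%:R + (stars E 2 3)%:R + (k23 E)%:R
    + (\sum_(X : {set T}) (if bushy E K X then 2 * #|X| else 0))%:R :> R.
Proof.
rewrite /cost_bound natrD -addrA -addrA lerD //.
  rewrite -natrM -natrD ler_nat -low2_deficit [leqRHS]big_mkcond.
  by rewrite (eq_bigl predT) => [|a]; rewrite ?inE //; apply: leq_sum => a _; rewrite inE; case: (degree E a) => [|[|[|m]]].
rewrite (eq_bigl predT) => [|X]; last by rewrite subsetT.
rewrite /weight big_split natrD addrA lerD //= natr_sum.
have -> : (stars E 2 3)%:R + (k23 E)%:R = \sum_(X : {set T}) ((if #|X| == 3 then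
     (X \subset low E 2) * #|[set v | X \subset nbr E v]| +
     #|[set vw : T * T | [&& vw.1 != vw.2, X \subset nbr E vw.1 & X \subset nbr E vw.2]]|
   else 0)%N)%:R :> R; last by [].
rewrite (eq_bigr (fun X : {set T} => (if #|X| == 3 then
     ((X \subset low E 2) * #|[set v | X \subset nbr E v]|)%N%:R else 0 : R) + (if #|X| == 3 then
     (#|[set vw : T * T | [&& vw.1 != vw.2, X \subset nbr E vw.1 & X \subset nbr E vw.2]]|)%:R else 0 : R))); last first.
  by move=> X _; case: ifP => _; rewrite ?addr0 // natrD.
rewrite big_split /=; congr (_ + _).
  rewrite starsE exchange_big /= -big_mkcond /=; apply: eq_bigr => X _.
  rewrite natrM -sum1_card natr_sum mulr_sumr [RHS]big_mkcond /=; apply: eq_bigr => v _; rewrite inE.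
  by case: (X \subset nbr E v); case: (X \subset low E 2); rewrite ?mulr0 ?mulr1.
rewrite /k23 -sum1_card natr_sum.
rewrite (eq_bigl (fun t : {set T} * (T * T) => (#|t.1| == 3) && (t.2 \in
   [set vw : T * T | [&& vw.1 != vw.2, t.1 \subset nbr E vw.1 & t.1 \subset nbr E vw.2]]))); last by move=> t; rewrite !inE.
rewrite -(pair_big_dep (fun X : {set T} => #|X| == 3) (fun (X : {set T}) (t : T * T) => t \in
   [set vw : T * T | [&& vw.1 != vw.2, X \subset nbr E vw.1 & X \subset nbr E vw.2]]) (fun _ _ => 1 : R)) /=.
rewrite -big_mkcond /=; apply: eq_bigr => X _; by rewrite -sum1_card natr_sum.
Qed.

Definition brate : R := 4 * expR 1 ^+ 4 * (expR 1 * ((1 + d) * expR (- d))).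

Lemma mean_upper : 1 <= d -> 2 * d ^+ 2 * brate <= 1 / 2 ->
  expR 2 * (4 * d ^+ 2 * (4 * (expR 1 * expR (- (d / 8))))) <= 1 / 2 ->
  limn (mean d) <= main_term d + 4 * (2 * brate) ^+ 4 * d ^+ 6.
Proof.
move=> d1 rate1 rate2; apply/ler_addgt0Pr => e e0.
have [r r0 Hr] := ex_nat_ge (2 / e).
have r0' : 0 < r%:R :> R by rewrite ltr0n.
have He : 3 / (2 * r%:R) <= e.
  rewrite ler_pdivrMr ?mulr_gt0 //; move: Hr; rewrite ler_pdivrMr //; nra.
pose c := 1 + 2 * d + d ^+ 6 + \sum_(k < (2 * r).+1) d ^+ k.
pose u n := isolated n + pendant n / 2 + 'C(n, 3)%:R * p n ^+ 3 * binom_le (p n) 1 (n - 4) ^+ 3 / 2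
   + (4 * (2 * brate) ^+ 4 * d ^+ 6 + e) + c / n%:R.
have ul : u n @[n --> \oo] --> main_term d + 4 * (2 * brate) ^+ 4 * d ^+ 6 + e.
  have -> : main_term d + 4 * (2 * brate) ^+ 4 * d ^+ 6 + e =
    expR (- d) + (d * expR (- d)) / 2 + d ^+ 3 / 3`!%:R * ((1 + d) * expR (- d)) ^+ 3 / 2
      + (4 * (2 * brate) ^+ 4 * d ^+ 6 + e) + 0.
    by rewrite /main_term (_ : 3`! = 6)%N // addr0; move: (expR _) brate => z w; field.
  apply: cvgD; last exact: cvg_over_n.
  apply: cvgD; last exact: cvg_cst.
  apply: cvgD; last first.
    apply: cvgM; last exact: cvg_cst.
    by apply: cvgM; [exact: cvg_bin|apply: cvg_pow; exact: cvg_binom_le].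
  apply: cvgD; first exact: cvg_isolated.
  by apply: cvgM; [exact: cvg_pendant|exact: cvg_cst].
rewrite -(cvg_lim _ ul) //; apply: ler_lim; [exact: cvg_mean|exact: cvgP ul|].
near=> n.
have [p01 n3 nd] : [/\ 0 <= p n <= 1, (2 < #|'I_n|)%N & #|'I_n|%:R * p n = d] by near: n; exact: near_setup.
have n0 : 0 < n%:R :> R by rewrite ltr0n; move: n3; rewrite card_ord => /ltnW/ltnW.
have nn0 := lt0r_neq0 n0.
rewrite /mean ler_pdivrMr //.
(* The largest [K] allowed in [Ex_bushy]; dual sets beyond it are exponentially unlikely. *)
pose K := Num.truncn (n%:R / (2 * d)).
have Kt : K%:R <= n%:R / (2 * d) < K.+1%:R by apply: truncn_itv; rewrite divr_ge0 ?ltW // mulr_gt0.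
have K1 : (2 * K)%:R * p n <= 1.
  case/andP: Kt => + _; rewrite ler_pdivlMr ?mulr_gt0 // => Kt.
  by rewrite mulrA ler_pdivrMr // mul1r natrM; apply: le_trans Kt; rewrite mulrA [_ * 2]mulrC.
have K2 : n%:R <= 2 * d * K.+1%:R.
  by case/andP: Kt => _ /ltW; rewrite ler_pdivrMr ?mulr_gt0 // mulrC.
have B := @Ex_bushy R 'I_n (p n) p01 K K1; rewrite /bush_rate nd -/brate in B.
have {}B := B d1 rate1.
have SP := @Pr_sparse_pair R 'I_n (p n) p01 K; rewrite /pair_rate nd card_ord in SP.
have {}SP := SP d1 K2 rate2.
have {}SP : n%:R * Pr (p n) (vpairs 'I_n) (fun E => sparse_pair E K) <= 2 * d.
  apply: le_trans (ler_wpM2l (ltW n0) SP) _; rewrite div1r exprVn ler_pdivrMr ?exprn_gt0 //.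
  apply: le_trans K2 _; rewrite ler_wpM2l ?mulr_ge0 ?ltW // -natrX ltr_nat; exact: ltn_expl.
have E0 := @Ex_num_degree R 'I_n (p n) 0; have E1 := @Ex_num_degree R 'I_n (p n) 1.
have S3 := @Ex_stars_le R 'I_n (p n) p01 3 isT.
have K23 := @Ex_k23 R 'I_n (p n) p01; have SC := @Ex_short_cycles R 'I_n (p n) p01 (2 * r).
move: E0 E1 S3 K23 SC B; rewrite nd card_ord -/(isolated n) -/(pendant n) => E0 E1 S3 K23 SC B.
have {}K23 : Ex (p n) (vpairs 'I_n) (fun E => (k23 E)%:R) <= d ^+ 6.
  apply: le_trans K23 _; have -> : n%:R ^+ 5 * p n ^+ 6 = d ^+ 6 / n%:R :> R by field.
  rewrite ler_pdivrMr // ler_peMr ?exprn_ge0 ?(ltW d0) // ler1n.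
  by move: n3; rewrite card_ord => /ltnW/ltnW.
have [k0 k0E] : exists k0 : R, k0 = 3 * n%:R + 2 * r%:R by exists (3 * n%:R + 2 * r%:R).
have H : Ex (p n) (vpairs 'I_n) (fun E => (2 * r%:R) * (mu E)%:R) <= Ex (p n) (vpairs 'I_n) (fun E =>
   r%:R * (2 * (num_degree E 0)%:R + (num_degree E 1)%:R + (stars E 2 3)%:R + (k23 E)%:R
    + (\sum_(X : {set 'I_n}) (if bushy E K X then 2 * #|X| else 0))%:R) + (r%:R * (2 * n%:R)) * (sparse_pair E K)%:R
    + k0 + (2 * r%:R) * (short_cycles (2 * r) E)%:R).
  apply: le_Ex => // E sE; have C := ler_wpM2l (ltW r0') (cost_boundT E K).
  have H : r%:R * (2 * (mu E)%:R) <= r%:R * ((cost_bound E K [set: 'I_n])%:R + 2 * n%:R * (sparse_pair E K)%:R)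
     + 3 * n%:R + 2 * r%:R + 2 * r%:R * (short_cycles (2 * r) E)%:R :> R.
    by have := mu_upper K n3 sE r0; rewrite card_ord -(ler_nat R) -?natrM -?natrD -?natrM -?natrD.
  move: C H; rewrite k0E; move: (r%:R * (_ + _)) (cost_bound _ _ _)%:R => c2 c1.
  move: (mu E)%:R (nat_of_bool _)%:R (short_cycles _ _)%:R r%:R n%:R; clear => m c3 c4 rr N C H.
  have -> : 2 * rr * m = rr * (2 * m) by ring.
  by apply: le_trans H _; rewrite mulrDr; lra.
move: H; rewrite !ExDf !ExZl Ex_cst !ExDf !ExZl E0 E1 k0E.
move: S3 K23 SC B SP; rewrite /Pr.
set s3 := Ex _ _ _; set k3 := Ex _ _ _; set sc := Ex _ _ _; set bu := Ex _ _ _; set sp := Ex _ _ _; set m := Ex _ _ _.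
move=> S3 K23 SC B SP H.
have H2 : m <= (2 * (n%:R * isolated n) + n%:R * pendant n + s3 + k3 + bu) / 2 + n%:R * sp + (3 * n%:R / (2 * r%:R) + 1) + sc.
  rewrite -(@ler_pM2l _ (2 * r%:R)) ?mulr_gt0 //; apply: le_trans H _.
  rewrite le_eqVlt; apply/orP; left; apply/eqP; field; exact: lt0r_neq0.
apply: le_trans H2 _; rewrite /u [leRHS]mulrDl divfK // /c.
have He' : 3 * n%:R / (2 * r%:R) <= e * n%:R by rewrite mulrAC ler_wpM2r // ltW.
move: S3; set b3 := binom_le _ _ _; move: (isolated n) (pendant n) 'C(n, 3)%:R brate B => x y z w B S3.
move: He' B K23 SC S3 SP.
have := exprn_ge0 6 (ltW d0); move: (d / n%:R) (d ^+ 6) => q d6; set h1 := _ / (2 * r%:R); set h3 := \sum_(k < _) _.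
move: h1 h3 n%:R; clear => h1 h3 N d60 He' B K23 SC S3 SP.
have -> : (x + y / 2 + z * q ^+ 3 * b3 ^+ 3 / 2 + (4 * (2 * w) ^+ 4 * d6 + e)) * N =
  N * x + N * y / 2 + N * (z * (q ^+ 3 * b3 ^+ 3)) / 2 + N * (8 * (2 * w) ^+ 4 * d6) / 2 + e * N by field.
move: He' B K23 SC S3 SP.
move: (N * (z * _)) (N * (8 * _ * _)) (e * N) (N * sp) (N * x) (N * y) => *; lra.
Unshelve. all: by end_near. Qed.

End FixedDegree.

(** The k-th power of d / k <= e^(d / k). *)
Lemma expRN_poly d k : 0 < d -> expR (- d) <= (k%:R / d) ^+ k.
Proof.
move=> d0; case: k => [|k]; first by rewrite expr0 -expR0 ler_expR oppr_le0 ltW.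
have k0 : 0 < k.+1%:R :> R by [].
have -> : - d = k.+1%:R * (- (d / k.+1%:R)) by field; rewrite nat1r lt0r_neq0.
rewrite expRM_natl; apply: lerXn2r; first by rewrite nnegrE expR_ge0.
  by rewrite nnegrE divr_ge0 // ltW.
rewrite expRN -[leRHS]invrK lef_pV2 ?posrE ?expR_gt0 ?invr_gt0 ?divr_gt0 // invf_div.
by apply: le_trans (expR_ge1Dx _); rewrite lerDr.
Qed.

(** The error of [mean_upper] has order d^10 e^-4d and that of [mean_lower] order d^8 e^-4d; [D] is
    chosen for the two smallness conditions of [mean_upper]. *)
Lemma mean_expansion : exists2 C : R, 0 < C & exists2 D : R, 1 <= D & forall d, D <= d ->
  `|limn (mean d) - main_term d| <= C * (d ^+ 12 * expR (- d) ^+ 4).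
Proof.
pose q : R := 8 * expR 1 ^+ 5; have q0 : 0 < q by rewrite mulr_gt0 ?exprn_gt0 ?expR_gt0.
pose q2 : R := expR 2 * (16 * expR 1); have q20 : 0 < q2 by rewrite !mulr_gt0 ?expR_gt0.
exists (64 * q ^+ 4 + 1); first by rewrite ltr_wpDl // mulr_ge0 // exprn_ge0 // ltW.
pose D := 1 + 1024 * q + 2 * (13824 * q2).
have D1 : 1 <= D by rewrite /D; lra.
exists D => // d Dd; have d1 : 1 <= d by apply: le_trans Dd.
have d0 : 0 < d by apply: lt_le_trans d1.
have h4 := expRN_poly 4 d0; have h3 : expR (- (d / 8)) <= (3 / (d / 8)) ^+ 3 by apply: expRN_poly; rewrite divr_gt0.
have x0 : 0 < expR (- d) by apply: expR_gt0.
have bE : brate d = q / 2 * ((1 + d) * expR (- d)) by rewrite /brate /q; move: (expR 1) (expR (- d)) => a b; field.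
have r1 : 2 * d ^+ 2 * brate d <= 1 / 2.
  have : q * (2 * d ^+ 3 * (4 / d) ^+ 4) <= 1 / 2.
    have -> : q * (2 * d ^+ 3 * (4 / d) ^+ 4) = 512 * q / d by field; apply: lt0r_neq0.
    rewrite ler_pdivrMr //; move: Dd; rewrite /D; lra.
  apply: le_trans; rewrite bE.
  have -> : 2 * d ^+ 2 * (q / 2 * ((1 + d) * expR (- d))) = q * (d ^+ 2 * (1 + d) * expR (- d)) by field.
  rewrite ler_wpM2l ?(ltW q0) //; apply: ler_pM => //; rewrite ?mulr_ge0 ?exprn_ge0 ?addr_ge0 ?(ltW d0) ?(ltW x0) //.
  by rewrite exprS mulrCA; have := sqr_ge0 d; nra.
have r2 : expR 2 * (4 * d ^+ 2 * (4 * (expR 1 * expR (- (d / 8))))) <= 1 / 2.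
  have -> : expR 2 * (4 * d ^+ 2 * (4 * (expR 1 * expR (- (d / 8))))) = q2 * (d ^+ 2 * expR (- (d / 8))).
    by rewrite /q2; ring.
  apply: le_trans (_ : q2 * (d ^+ 2 * (3 / (d / 8)) ^+ 3) <= _).
    by rewrite ler_wpM2l ?(ltW q20) // ler_wpM2l ?exprn_ge0 ?(ltW d0).
  have -> : q2 * (d ^+ 2 * (3 / (d / 8)) ^+ 3) = 13824 * q2 / d by field; apply: lt0r_neq0.
  rewrite ler_pdivrMr //; move: Dd; rewrite /D; lra.
have L := mean_lower d0; have U := mean_upper d0 d1 r1 r2.
have d8 : 0 <= d ^+ 12 * expR (- d) ^+ 4 by rewrite mulr_ge0 ?exprn_ge0 ?ltW.
have pd : (1 + d) ^+ 4 <= (2 * d) ^+ 4 by apply: lerXn2r; rewrite ?nnegrE; lra.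
have x4 : 0 <= expR (- d) ^+ 4 by rewrite exprn_ge0 ?ltW.
rewrite ler_norml; apply/andP; split.
  have : d ^+ 4 * ((1 + d) * expR (- d)) ^+ 4 / 24 <= d ^+ 12 * expR (- d) ^+ 4.
    rewrite [((1 + d) * _) ^+ 4]exprMn mulrA [leLHS]mulrAC ler_wpM2r //.
    apply: le_trans (_ : d ^+ 4 * (2 * d) ^+ 4 / 24 <= _).
      by rewrite ler_wpM2r ?invr_ge0 // ler_wpM2l // exprn_ge0 // ltW.
    have -> : d ^+ 4 * (2 * d) ^+ 4 / 24 = 2 / 3 * d ^+ 8 by field.
    apply: le_trans (_ : d ^+ 8 <= _); last exact: ler_weXn2l.
    by have := exprn_ge0 8 (ltW d0); lra.
  have : 0 <= 64 * q ^+ 4 * (d ^+ 12 * expR (- d) ^+ 4) by rewrite mulr_ge0 // mulr_ge0 // exprn_ge0 // ltW.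
  rewrite [(_ + 1) * _]mulrDl mul1r; move: L; clear; set qq := _ * (d ^+ 12 * _).
  move: qq (_ / 24) (limn _) (main_term d) (d ^+ 12 * _) => *; lra.
have : 4 * (2 * brate d) ^+ 4 * d ^+ 6 <= 64 * q ^+ 4 * (d ^+ 12 * expR (- d) ^+ 4).
  have -> : 4 * (2 * brate d) ^+ 4 * d ^+ 6 = 4 * q ^+ 4 * expR (- d) ^+ 4 * d ^+ 6 * (1 + d) ^+ 4.
    by rewrite bE; field.
  apply: le_trans (_ : 4 * q ^+ 4 * expR (- d) ^+ 4 * d ^+ 6 * (2 * d) ^+ 4 <= _).
    by rewrite ler_wpM2l // mulr_ge0 ?exprn_ge0 ?(ltW d0) // mulr_ge0 // mulr_ge0 // exprn_ge0 // ltW.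
  have -> : 4 * q ^+ 4 * expR (- d) ^+ 4 * d ^+ 6 * (2 * d) ^+ 4 = 64 * q ^+ 4 * (d ^+ 10 * expR (- d) ^+ 4) by ring.
  apply: ler_wpM2l; first by rewrite mulr_ge0 // exprn_ge0 // ltW.
  by rewrite ler_wpM2r // ler_weXn2l.
by move: U d8; clear; move: (limn _) (main_term d) (d ^+ 12 * _) => *; lra.
Qed.

End Expansion.

Arguments path_edges : simpl never.

(** * Posa rotations and boosters *)

Section SequencePairs.
Variable T : finType.
Implicit Types (E : {set {set T}}) (s p q : seq T) (x y z : T).

Lemma path_edges_cons x y s : path_edges [:: x, y & s] = [set x; y] |: path_edges (y :: s).
Proof. by []. Qed.

Lemma path_edges1 x : path_edges [:: x] = set0.
Proof. by []. Qed.

Lemma path_edges_cat p z y q :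
  path_edges (rcons p z ++ y :: q) = path_edges (rcons p z) :|: ([set z; y] |: path_edges (y :: q)).
Proof.
elim: p => [|a [|b p] IH] /=; first by rewrite path_edges_cons path_edges1 set0U.
  by rewrite !path_edges_cons path_edges1 setU0.
by rewrite !path_edges_cons -setUA -IH.
Qed.

Lemma path_edges_rev s : path_edges (rev s) = path_edges s.
Proof.
elim: s => // x [|y s] IH //; rewrite path_edges_cons -IH !rev_cons -[rcons (rcons _ _) _]cats1.
by rewrite path_edges_cat path_edges1 setU0 setUC [[set y; x]]setUC.
Qed.

Lemma degree_path s x : uniq s -> degree (path_edges s) x <= (x \in s) + (x \in behead s).
Proof.
have sub0 : nbr (set0 : {set {set T}}) x = set0 by apply/setP => w; rewrite !inE /adj /= inE.
elim: s => [|y [|z s] IH] us.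
- by rewrite /degree (_ : path_edges [::] = set0) ?sub0 ?cards0 //; apply/setP => e; rewrite !inE.
- by rewrite /degree path_edges1 sub0 cards0.
move: us; rewrite cons_uniq => /andP[ys us].
have nbrE : nbr (path_edges [:: y, z & s]) x \subset
    nbr (path_edges (z :: s)) x :|: (if x == y then [set z] else if x == z then [set y] else set0).
  apply/subsetP => w; rewrite !inE /adj /= path_edges_cons inE => /orP[|->//].
  rewrite inE => /eqP/setP H; apply/orP; right.
  have := H x; have := H w; rewrite !inE !eqxx orbT /= => /esym wE /esym xE.
  have [xy|xy] := eqVneq x y.
    rewrite inE; case/orP: wE => [/eqP wy|//]; have := H z; rewrite !inE eqxx orbT wy xy orbb => /eqP zy.
    by move: ys; rewrite -zy inE eqxx.
  rewrite (negbTE xy) /= in xE; rewrite xE inE.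
  by case/orP: wE => [//|/eqP wz]; have := H y; rewrite !inE eqxx wz (eqP xE) orbb => /eqP yz; rewrite yz eqxx.
apply: leq_trans (subset_leq_card nbrE) _; apply: leq_trans (leq_card_setU _ _) _.
have := IH us; rewrite /degree => {}IH.
have [xy|xy] := eqVneq x y.
  rewrite xy in IH *; move: IH; rewrite (negbTE ys) [y \in behead _](_ : _ = false); last first.
    by apply: contraNF ys => H; rewrite inE H orbT.
  by rewrite addn0 leqn0 => /eqP ->; rewrite cards1 inE eqxx.
have [xz|xz] := eqVneq x z.
  move: IH; rewrite cards1 xz /= !inE eqxx /= orbT; move: us => /= /andP[/negbTE -> _].
  by move: #|_| => m; lia.
rewrite cards0 addn0; apply: leq_trans IH _; rewrite /= !inE (negbTE xy) (negbTE xz) /=.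
by [].
Qed.

Lemma breaks_gt0 (e : rel T) s : 0 < breaks e s ->
  exists p z y q, s = rcons p z ++ y :: q /\ ~~ e z y.
Proof.
elim: s => // x [|y s] IH //; rewrite breaks_cons; case: (boolP (e x y)) => /= exy.
  rewrite add0n => /IH[p [z [w [q [-> ezw]]]]]; by exists (x :: p), z, w, q.
by move=> _; exists [::], x, y, s.
Qed.

(** The left ends of the breaks, one for each of them. *)
Fixpoint lends (e : rel T) s : seq T :=
  if s is x :: s' then
    (if s' is y :: _ then (if e x y then lends e s' else x :: lends e s') else [::])
  else [::].

Lemma size_lends e s : size (lends e s) = breaks e s.
Proof.
elim: s => // x [|y s] IH //; rewrite breaks_cons -IH /=; by case: (e x y).
Qed.

Lemma lends_sub e s : subseq (lends e s) s.
Proof.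
elim: s => // x [|y s] IH //; rewrite [lends _ _]/=; case: (e x y).
  by apply: subseq_trans IH (subseq_cons _ _).
by rewrite /= eqxx.
Qed.

Lemma lendsP e s x : x \in lends e s -> exists p y q, s = rcons p x ++ y :: q /\ ~~ e x y.
Proof.
elim: s => // a [|b s] IH //; rewrite [lends _ _]/=; case: (boolP (e a b)) => eab.
  by case/IH=> p [y [q [-> exy]]]; exists (a :: p), y, q.
rewrite inE => /orP[/eqP ->|/IH[p [y [q [-> exy]]]]]; first by exists [::], b, s.
by exists (a :: p), y, q.
Qed.

Lemma lends2P e s x y : x \in lends e s -> y \in lends e s -> x != y ->
  exists u v p u' r v' q, [/\ (u, v) = (x, y) \/ (u, v) = (y, x),
    s = rcons p u ++ (rcons (u' :: r) v ++ v' :: q) \/ (u' = v /\ s = rcons p u ++ v :: v' :: q),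
    ~~ e u u' & ~~ e v v'].
Proof.
elim: s => // a [|b s] IH //; rewrite [lends _ _]/=; case: (boolP (e a b)) => eab.
  move=> xs ys xy; case: (IH xs ys xy) => u [v [p [u' [r [v' [q [uv ss e1 e2]]]]]]].
  exists u, v, (a :: p), u', r, v', q; split=> //.
  by case: ss => [->|[-> ->]]; [left|right].
rewrite -/(lends e (b :: s)) !in_cons => /orP[/eqP ->|xs] /orP[/eqP ->|ys]; rewrite ?eqxx // => xy.
- have [p [y' [q [ss ey]]]] := lendsP ys; case: p ss => [|c p] ss.
    exists a, y, [::], y, [::], y', q; split=> //; first by left.
      by right; split=> //; rewrite ss.
    by move: eab; rewrite [b](_ : _ = y) //; case: ss.
  exists a, y, [::], c, p, y', q; split=> //; first by left.
    by left; rewrite ss.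
  by move: eab; rewrite [b](_ : _ = c) //; case: ss.
- have [p [y' [q [ss ey]]]] := lendsP xs; case: p ss => [|c p] ss.
    exists a, x, [::], x, [::], y', q; split=> //; first by right.
      by right; split=> //; rewrite ss.
    by move: eab; rewrite [b](_ : _ = x) //; case: ss.
  exists a, x, [::], c, p, y', q; split=> //; first by right.
    by left; rewrite ss.
  by move: eab; rewrite [b](_ : _ = c) //; case: ss.
- case: (IH xs ys xy) => u [v [p [u' [r [v' [q [uv ss e1 e2]]]]]]].
  exists u, v, (a :: p), u', r, v', q; split=> //.
  by case: ss => [->|[-> ->]]; [left|right].
Qed.

End SequencePairs.

Section Posa.
Variables (T : finType) (V Q Y : {set T}) (J : {set {set T}}).
Implicit Types (E : {set {set T}}) (s p q : seq T) (x y z : T) (S : {set T}).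

(** [V] is to be arranged in one long path using all forced pairs [J]. Rotations happen only at
    vertices of [Y], which no forced pair meets; ends lie in [Q], since any other vertex has two
    forced neighbours. *)
Definition admissible s := [/\ uniq s, s =i V & J \subset path_edges s].

Definition cost E s := breaks (adj (E :|: J)) s.

Hypothesis Y_free : forall y z, y \in Y -> [set z; y] \notin J.
Hypothesis YV : Y \subset V.
Hypothesis inner_forced : forall v, v \in V -> v \notin Q ->
  exists a b, [/\ a != b, [set v; a] \in J & [set v; b] \in J].

Lemma admissible_head x s : admissible (x :: s) -> x \in Q.
Proof.
case=> us sV sJ; apply: contraT => xQ; have xV : x \in V by rewrite -sV mem_head.
have [a [b [ab xa xb]]] := inner_forced xV xQ.
have := degree_path x us; rewrite /= mem_head; case/andP: us => /negbTE -> _; rewrite addn0 leqNgt => /negP[].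
apply: leq_trans (_ : #|[set a; b]| <= _); first by rewrite cards2 ab.
by apply: subset_leq_card; rewrite subUset !sub1set !inE /adj /= !(subsetP sJ).
Qed.

(** Posa rotations with the last vertex fixed: the edge from the first vertex [x] to [y] replaces
    the pair that precedes [y]. Sequences may have breaks, and a rotation never adds one. *)
Inductive reach E s0 : seq T -> Prop :=
| reach0 : reach E s0 s0
| reachS x p y q : reach E s0 (x :: p ++ y :: q) -> adj E x y -> y \in Y ->
    reach E s0 (rev (x :: p) ++ y :: q).

Lemma rotate_edges x p y q : exists2 w, w = last x p &
  path_edges (x :: p ++ y :: q) = path_edges (x :: p) :|: ([set w; y] |: path_edges (y :: q)) /\
  path_edges (rev (x :: p) ++ y :: q) = path_edges (x :: p) :|: ([set x; y] |: path_edges (y :: q)).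
Proof.
exists (last x p) => //; split; first by rewrite -cat_cons lastI path_edges_cat.
by rewrite rev_cons path_edges_cat -rev_cons path_edges_rev.
Qed.

Lemma reach_admissible E s0 t : admissible s0 -> reach E s0 t ->
  [/\ admissible t, cost E t <= cost E s0 & forall x0, last x0 t = last x0 s0].
Proof.
move=> adm0; elim=> [|x p y q _ [[us sV sJ] ct lt] xy yY]; first by [].
have pe : perm_eq (rev (x :: p) ++ y :: q) (x :: p ++ y :: q) by rewrite -cat_cons perm_cat2r perm_rev.
have [w wE [sp sp']] := rotate_edges x p y q.
split; [split| |].
- by rewrite (perm_uniq pe).
- by move=> z; rewrite (perm_mem pe) sV.
- rewrite sp'; move: sJ; rewrite sp => /subsetP sJ; apply/subsetP => e eJ; have := sJ e eJ.
  rewrite !in_setU !in_set1 => /or3P[->//|/eqP ew|->]; last by rewrite !orbT.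
  by have := Y_free w yY; rewrite -ew eJ.
- apply: leq_trans ct; rewrite /cost -[in X in _ <= X]cat_cons [in X in _ <= X]lastI rev_cons !breaks_cat.
  rewrite -rev_cons -lastI breaks_rev; last exact: adj_sym.
  rewrite [adj _ x y](_ : _ = true) ?addn0; first by rewrite leq_add2r leq_addr.
  by rewrite /adj /= inE (xy : _ \in E).
- by move=> x0; rewrite -(lt x0) !last_cat /= last_cat.
Qed.

Definition ends E s0 : {set T} := [set x | boolp.asbool (exists q, reach E s0 (x :: q))].

Lemma endsP E s0 x : reflect (exists q, reach E s0 (x :: q)) (x \in ends E s0).
Proof. by rewrite inE; apply: boolp.asboolP. Qed.

(** As long as no neighbour of [y] in [s0] becomes an end, rotations leave the pairs at [y]
    untouched; but a rotation at [y] itself would make the vertex before it an end. *)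
Lemma posa_ends E s0 y : admissible s0 -> y \in Y -> y \notin ends E s0 ->
  (exists2 x, x \in ends E s0 & adj E x y) -> exists2 x, x \in ends E s0 & adj (path_edges s0) x y.
Proof.
move=> adm0 yY yS [x /endsP[q rx] xy]; apply: boolp.contrapT => nx.
have noS z : z \in ends E s0 -> ~ adj (path_edges s0) z y by move=> zS zy; apply: nx; exists z.
have turn u p v r : reach E s0 (u :: p ++ v :: r) -> adj E u v -> v \in Y ->
    u \in ends E s0 /\ last u p \in ends E s0.
  move=> ru uv vY; split; first by apply/endsP; exists (p ++ v :: r).
  apply/endsP; have := reachS ru uv vY; rewrite [u :: p]lastI rev_rcons cat_cons.
  by exists (rev (belast u p) ++ v :: r).
have inv t : reach E s0 t -> forall z, adj (path_edges t) z y = adj (path_edges s0) z y.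
  elim=> // u p v r ru IH uv vY z.
  have [uS wS] := turn _ _ _ _ ru uv vY.
  have [w wE [sp sp']] := rotate_edges u p v r; rewrite -wE in wS.
  have yv : y != v.
    apply/eqP => yv; apply: (noS w wS); rewrite -IH /adj /= sp yv.
    by rewrite inE setU11 orbT.
  have yu : y != u by apply: contraNneq yS => ->.
  have yw : y != w by apply: contraNneq yS => ->.
  have ny a : y != a -> ([set z; y] == [set a; v]) = false.
    move=> ya; apply/eqP => /setP/(_ y); by rewrite !inE eqxx orbT (negbTE ya) (negbTE yv).
  by rewrite -IH /adj /= sp sp' !in_setU !in_set1 !ny.
have [adm _ _] := reach_admissible adm0 rx; case: adm => ux xV _.
have yq : y \in q.
  have : y \in x :: q by rewrite xV (subsetP YV).
  rewrite inE => /orP[/eqP yx|//]; case/negP: yS; apply/endsP; exists q; by rewrite yx.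
case/splitPr: yq rx ux xV => p r rx _ _.
have [_ wS] := turn _ _ _ _ rx xy yY; apply: (noS _ wS); rewrite -(inv _ rx).
have [w wE [sp _]] := rotate_edges x p y r; by rewrite -wE /adj /= sp inE setU11 orbT.
Qed.

Definition expander m E := forall S, S \subset Q -> S != set0 -> #|S| <= m ->
  2 * #|S| < #|[set y in Y :\: S | [exists x, (x \in S) && adj E x y]]|.

(** By [posa_ends], the neighbours in [Y] of the set of ends that are not ends stand next to an end
    in [s0]; so they are at most twice as many as the ends, which expansion forbids for small
    sets. *)
Lemma posa_large m E s0 : expander m E -> admissible s0 -> s0 != [::] -> m < #|ends E s0|.
Proof.
move=> expE adm0 s0n; rewrite ltnNge; apply/negP => Sm; set S := ends E s0 in Sm.
have SQ : S \subset Q.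
  apply/subsetP => x /endsP[q rx]; have [adm _ _] := reach_admissible adm0 rx.
  exact: admissible_head adm.
have S0 : S != set0.
  rewrite /S; case: (s0) s0n => // x q _; apply/set0Pn; exists x.
  by apply/endsP; exists q; constructor.
have := expE S SQ S0 Sm; rewrite ltnNge => /negP; apply.
pose nb x := nbr (path_edges s0) x.
apply: leq_trans (_ : #|\bigcup_(x in S) nb x| <= _).
  apply: subset_leq_card; apply/subsetP => y; rewrite in_set => /andP[/setDP[yY yS] /existsP[x /andP[xS xy]]].
  have [|z zS zy] := posa_ends adm0 yY yS; first by exists x.
  by apply/bigcupP; exists z => //; rewrite inE.
have us0 : uniq s0 by case: adm0.
apply: leq_trans (_ : \sum_(x in S) #|nb x| <= _).
  elim/big_rec2: _ => [|x n A _ IH]; first by rewrite cards0.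
  by apply: leq_trans (leq_card_setU _ _) _; rewrite leq_add2l.
rewrite mulnC -sum_nat_const; apply: leq_sum => x _; apply: leq_trans (degree_path x us0) _.
by case: (x \in s0); case: (x \in behead s0).
Qed.

Definition attains E c := exists2 s, admissible s & cost E s <= c.

(** By [cost_le] the search in the list succeeds as soon as an admissible sequence exists. *)
Definition mincost E : nat := find (fun c => boolp.asbool (attains E c)) (iota 0 #|T|.+1).

Hypothesis V1 : 1 < #|V|.
Hypothesis ex_admissible : exists s, admissible s.

Lemma cost_le E s : admissible s -> cost E s <= #|T|.
Proof.
case=> us _ _; rewrite /cost /breaks; apply: leq_trans (count_size _ _) _.
rewrite size_zip geq_min; apply/orP; left; rewrite -(card_uniqP us); exact: max_card.
Qed.

Lemma mincostP E : attains E (mincost E) /\ forall c, attains E c -> mincost E <= c.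
Proof.
have hasE : has (fun c => boolp.asbool (attains E c)) (iota 0 #|T|.+1).
  apply/hasP; exists #|T|; first by rewrite mem_iota add0n ltnSn.
  by apply/boolp.asboolP; have [s adm] := ex_admissible; exists s => //; apply: cost_le.
have lt : mincost E < #|T|.+1 by have := hasE; rewrite has_find size_iota.
split.
  by have := nth_find 0 hasE; rewrite -/(mincost E) nth_iota // => /boolp.asboolP.
move=> c ac; rewrite leqNgt; apply/negP => cm.
have := @before_find _ 0 _ _ _ cm; rewrite nth_iota ?add0n; last by apply: ltn_trans cm lt.
by move/boolp.asboolP.
Qed.

Lemma mincost_mono E (F : {set {set T}}) : E \subset F -> mincost F <= mincost E.
Proof.
move=> EF; have [[s adm cs] _] := mincostP E; have [_] := mincostP F; apply; exists s => //.
apply: leq_trans cs; apply: sub_count => -[a b] /=; apply: contra; rewrite /adj /= !inE.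
by move=> /orP[/(subsetP EF) ->|->]; rewrite ?orbT.
Qed.

Definition boosters E : {set {set T}} := [set f in vpairs T | mincost (f |: E) < mincost E].

(** The new pair closes the sequence into a cycle, which is reopened at a break; a break is never a
    forced pair, so [J] survives. *)
Lemma close_sequence E b q : admissible (b :: q) -> 0 < cost E (b :: q) ->
  attains ([set last b q; b] |: E) (cost E (b :: q)).-1.
Proof.
move=> [us sV sJ] c0; have [p [z [y [r [ss ezy]]]]] := breaks_gt0 c0.
have zyJ : [set z; y] \notin J by move: ezy; rewrite /adj /= inE negb_or => /andP[].
have pe : perm_eq ((y :: r) ++ rcons p z) (b :: q) by rewrite perm_catC ss.
have lr : last y r = last b q by have := congr1 (last b) ss; rewrite last_cat /= => <-.
have [p' pE] : exists p', rcons p z = b :: p'.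
  by case: p ss {pe} => [|c p] [-> _]; [exists [::]|exists (rcons p z)].
exists ((y :: r) ++ rcons p z).
  split; first by rewrite (perm_uniq pe).
    by move=> x; rewrite (perm_mem pe) sV.
  move: sJ; rewrite ss path_edges_cat => /subsetP sJ; apply/subsetP => e eJ; have := sJ e eJ.
  rewrite [y :: r]lastI pE path_edges_cat -lastI -pE !in_setU !in_set1 => /or3P[->|/eqP ee|->]; rewrite ?orbT //.
  by rewrite -ee eJ in zyJ.
rewrite /cost [in X in _ <= X]ss breaks_cat ezy [y :: r]lastI pE breaks_cat -lastI -pE lr.
rewrite addn1 addSn /= [adj _ _ b](_ : _ = true); last by rewrite /adj /= !inE eqxx.
rewrite addn0 addnC; apply: leq_add; apply: sub_count => -[u v] /=; apply: contra; rewrite /adj /= !inE.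
  by case/orP=> ->; rewrite ?orbT.
by case/orP=> ->; rewrite ?orbT.
Qed.

Lemma admissible_rev s : admissible s -> admissible (rev s).
Proof.
by case=> us sV sJ; split; [rewrite rev_uniq|move=> x; rewrite mem_rev sV|rewrite path_edges_rev].
Qed.

Lemma cost_rev E s : cost E (rev s) = cost E s.
Proof. by rewrite /cost breaks_rev //; apply: adj_sym. Qed.

(** There are more than [m] ends [a]. After a reversal that makes [a] last, rotations produce more
    than [m] ends [b], and closing up by {a, b} lowers the cost. Each pair is counted at most
    twice. *)
Lemma many_boosters m E : expander m E -> 0 < mincost E -> m.+1 ^ 2 <= 2 * #|boosters E|.
Proof.
move=> expE c0; have [[s adm cs] minE] := mincostP E.
have sn s' : admissible s' -> s' != [::].
  case=> us sV _; apply: contraTneq V1 => s0; rewrite -leqNgt (_ : V = set0) ?cards0 //.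
  by apply/setP => x; rewrite -sV s0 inE.
have large := posa_large expE adm (sn _ adm).
have bo a : a \in ends E s -> m < degree (boosters E) a.
  case/endsP=> q ra; have [adma ca _] := reach_admissible adm ra.
  have admr := admissible_rev adma.
  have := posa_large expE admr (sn _ admr) => /leq_trans; apply; apply: subset_leq_card.
  apply/subsetP => b /endsP[r rb]; have [admb cb lb] := reach_admissible admr rb.
  have la : last b r = a by have := lb b; rewrite /= rev_cons last_rcons.
  have cb' : cost E (b :: r) <= mincost E by apply: leq_trans cb _; rewrite cost_rev (leq_trans ca).
  have cb0 : 0 < cost E (b :: r) by apply: leq_trans c0 _; apply: minE; exists (b :: r).
  have := close_sequence admb cb0; rewrite la => att.
  rewrite inE /adj /= inE pair_vpairs; apply/andP; split.
    apply: contraTneq V1 => ab; rewrite -leqNgt -(cards1 b).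
    apply: subset_leq_card; apply/subsetP => x; case: admb => /= /andP[bn _] sV _; rewrite -sV !inE.
    case/orP=> // xr; move: bn; rewrite -ab -la; case: r la xr {rb lb cb cb' cb0 att sV} => //= c r _ _.
    by rewrite mem_last.
  have [_ minf] := mincostP ([set a; b] |: E); apply: leq_ltn_trans (minf _ att) _.
  by rewrite prednK.
have sB : boosters E \subset vpairs T by apply/subsetP => e; rewrite inE => /andP[].
rewrite -(handshake sB); apply: leq_trans (_ : \sum_(a in ends E s) m.+1 <= _).
  by rewrite sum_nat_const expnS expn1 leq_mul2r large orbT.
by rewrite big_mkcond; apply: leq_sum => a _; case: ifP => // /bo.
Qed.

(* The left ends of the segments of a cheapest sequence are independent, since an edge between two of
   them could be used to join two segments after a reversal. *)
Lemma mincost_independent E : exists2 I : {set T}, mincost E <= #|I| &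
  forall x y, x \in I -> y \in I -> x != y -> ~~ adj E x y.
Proof.
have [[s adm cs] minE] := mincostP E; have [us sV sJ] := adm.
pose e := adj (E :|: J); have esym : symmetric e by apply: adj_sym.
have eJ z y : ~~ e z y -> [set z; y] \notin J by rewrite /e /adj /= inE negb_or => /andP[].
have ule : uniq (lends e s) by apply: subseq_uniq (lends_sub e s) us.
have cse : cost E s = mincost E by apply/eqP; rewrite eqn_leq cs minE //; exists s.
exists [set x in lends e s].
  rewrite -cse /cost -size_lends -(card_uniqP ule) -/e; apply/eq_leq/eq_card => x; by rewrite inE.
move=> x y; rewrite !inE => xl yl xy; apply/negP => axy.
have [u [v [p [u' [r [v' [q [uv ss eu ev]]]]]]]] := lends2P xl yl xy.
have euv : e u v.
  by rewrite /e /adj /= inE; case: uv => -[-> ->]; rewrite ?(axy : [set _; _] \in E) //; rewrite setUC (axy : [set _; _] \in E).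
case: ss => [ss|[u'v ss]]; last by rewrite u'v euv in eu.
pose s' := rcons p u ++ (rev (rcons (u' :: r) v) ++ v' :: q).
have pe : perm_eq s' s by rewrite ss perm_cat2l perm_cat2r perm_rev.
have revE : rev (rcons (u' :: r) v) = v :: rcons (rev r) u' by rewrite rev_rcons rev_cons.
have att : cost E s' < mincost E.
  rewrite -cse /cost -/e ss /s' revE [in X in _ < X]rcons_cons !cat_cons !breaks_cat.
  rewrite -[u' :: (rcons r v ++ _)]cat_cons -rcons_cons breaks_cat -[v :: (rcons _ _ ++ _)]cat_cons -rcons_cons breaks_cat.
  rewrite rcons_cons -revE breaks_rev // euv eu ev /=.
  by move: (breaks e (rcons p u)) (breaks e (u' :: rcons _ v)) (breaks e (v' :: q)) (~~ e u' v') => a b c d; rewrite addn0; clear; case: d; lia.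
suff : attains E (cost E s') by move/minE; rewrite leqNgt att.
exists s' => //; split; first by rewrite (perm_uniq pe).
  by move=> z; rewrite (perm_mem pe) sV.
apply/subsetP => f fJ; have := subsetP sJ f fJ.
rewrite ss /s' revE rcons_cons !cat_cons !path_edges_cat.
rewrite -[u' :: (rcons r v ++ _)]cat_cons -rcons_cons path_edges_cat -[v :: (rcons _ _ ++ _)]cat_cons -rcons_cons path_edges_cat.
have <- : rev (rcons (u' :: r) v) = rcons (v :: rev r) u' by rewrite revE.
rewrite path_edges_rev !in_setU !in_set1.
case/or3P=> [->//|/eqP fu|]; first by have := eJ _ _ eu; rewrite -fu fJ.
case/or3P=> [->|/eqP fv|->]; rewrite ?orbT //.
by have := eJ _ _ ev; rewrite -fv fJ.
Qed.

End Posa.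

Section Completion.
Variable T : finType.
Implicit Types (E F J : {set {set T}}) (s : seq T).

Lemma breaks_forced E J s : uniq s ->
  breaks (adj E) s <= breaks (adj (E :|: J)) s + #|(J :\: E) :&: path_edges s|.
Proof.
elim: s => // x [|y s] IH // us; rewrite !breaks_cons.
have us' : uniq (y :: s) by case/andP: us.
have xys : [set x; y] \notin path_edges (y :: s).
  apply/negP => /path_edges_mem/subsetP/(_ x); rewrite !inE eqxx => /(_ isT) xs.
  by move: us; rewrite cons_uniq inE xs.
have -> : path_edges [:: x, y & s] = [set x; y] |: path_edges (y :: s) by [].
have := IH us'.
have [xyE|xyE] := boolP (adj E x y).
  have -> : adj (E :|: J) x y = true by rewrite /adj /= inE (xyE : _ \in E).
  rewrite /= !add0n => /leq_trans; apply.
  by rewrite leq_add2l; apply: subset_leq_card; apply: setIS; apply: subsetUr.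
have [xyJ|xyJ] := boolP ([set x; y] \in J).
  have -> : adj (E :|: J) x y = true by rewrite /adj /= inE xyJ orbT.
  rewrite /= add0n => H.
  have -> : (J :\: E) :&: ([set x; y] |: path_edges (y :: s)) = [set x; y] |: ((J :\: E) :&: path_edges (y :: s)).
    rewrite setIUr; congr (_ :|: _); apply/setIidPr; rewrite sub1set inE xyJ andbT; exact: xyE.
  rewrite cardsU1 inE (negbTE xys) andbF /= addnCA leq_add2l; exact: H.
have -> : adj (E :|: J) x y = false by rewrite /adj /= inE (negbTE xyJ) orbF; apply/negbTE; exact: xyE.
rewrite /= -addnA leq_add2l => /leq_trans; apply; rewrite leq_add2l.
by apply: subset_leq_card; apply: setIS; apply: subsetUr.
Qed.

Lemma breaks_cat_le (e : rel T) s s' : breaks e (s ++ s') <= breaks e s + size s'.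
Proof.
elim: s' s => [|x s' IH] s; first by rewrite cats0 leq_addr.
rewrite -cat_rcons; apply: leq_trans (IH _) _; rewrite /= addnS -addSn leq_add2r.
case/lastP: s => [|s y] //; rewrite -[rcons (rcons _ _) _]cats1 breaks_cat addn0 -addn1 leq_add2l.
exact: leq_b1.
Qed.

(** A forced pair that is not an edge and a vertex left out of [V] cost at most one break each; the
    final 1 is that of [mu_le_breaks]. *)
Lemma mu_of_mincost (V : {set T}) J E F : 2 < #|T| -> E \subset F -> F \subset vpairs T ->
  (exists s, admissible V J s) -> mincost V J F = 0 -> mu F <= #|J :\: E| + #|~: V| + 1.
Proof.
move=> T3 EF sF exa m0; have [+ _] := mincostP exa F; rewrite m0 => -[s [us sV sJ]].
rewrite leqn0 => /eqP c0.
have usV : uniq (s ++ enum (~: V)).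
  rewrite cat_uniq us enum_uniq andbT /=; apply/hasPn => x; rewrite mem_enum inE => xV.
  by apply/negP; rewrite sV (negbTE xV).
have sz : size (s ++ enum (~: V)) = #|T|.
  rewrite -(card_uniqP usV); apply: eq_card => x; rewrite mem_cat mem_enum inE sV; by case: (x \in V).
apply: leq_trans (mu_le_breaks T3 sF usV sz) _; rewrite addn1 ltnS.
apply: leq_trans (breaks_cat_le _ _ _) _; rewrite -cardE leq_add2r.
have := breaks_forced F J us; rewrite -/(cost J F s) c0 add0n => /leq_trans; apply.
apply: subset_leq_card; apply: subset_trans (subsetIl _ _) _; exact: setDS.
Qed.

End Completion.

Section Rounds.
Local Open Scope ring_scope.
Variables (R : realType) (T : finType) (V Q Y : {set T}) (J : {set {set T}}).
Implicit Types (E : {set {set T}}).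
Hypothesis Y_free : forall y z, y \in Y -> [set z; y] \notin J.
Hypothesis YV : Y \subset V.
Hypothesis inner_forced : forall v, v \in V -> v \notin Q ->
  exists a b, [/\ a != b, [set v; a] \in J & [set v; b] \in J].
Hypothesis V1 : (1 < #|V|)%N.
Hypothesis exa : exists s, admissible V J s.

Lemma expander_mono m E (F : {set {set T}}) : E \subset F -> expander Q Y m E -> expander Q Y m F.
Proof.
move=> EF expE S SQ S0 Sm; apply: leq_trans (expE S SQ S0 Sm) _; apply: subset_leq_card.
apply/subsetP => y; rewrite !inE => /andP[-> /existsP[x /andP[xS xy]]] /=.
by apply/existsP; exists x; rewrite xS; apply: (subsetP EF).
Qed.

Lemma Pr_hit (I : finType) (D S : {set I}) (q : R) : S \subset D ->
  Pr q D (fun A => A :&: S != set0) = 1 - (1 - q) ^+ #|S|.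
Proof.
move=> SD; rewrite (PrC q D (fun A => A :&: S == set0)); congr (1 - _).
rewrite /Pr (Ex_restrict q (fun B => (B == set0)%:R) SD) Ex_point ?sub0set //.
by rewrite cards0 expr0 mul1r setD0.
Qed.

(* Each of t independent rounds hits a booster with probability at least 1 - (1 - q)^N while the cost
   is positive, and the total decrease cannot exceed the initial cost. *)
Lemma rounds m (q : R) (N : nat) t E : 0 <= q <= 1 -> (2 * N <= m.+1 ^ 2)%N -> expander Q Y m E ->
  t%:R * (1 - (1 - q) ^+ N) * Pr (1 - (1 - q) ^+ t) (vpairs T) (fun A => (0 < mincost V J (E :|: A))%N)
  <= (mincost V J E)%:R.
Proof.
move=> q01 Nm; have [q0 q1] := andP q01.
have r01 k : 0 <= 1 - (1 - q) ^+ k <= 1.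
  have H : 0 <= (1 - q) ^+ k by rewrite exprn_ge0 // subr_ge0.
  have H' : (1 - q) ^+ k <= 1 by rewrite exprn_ile1 ?subr_ge0 // gerBl.
  by rewrite subr_ge0 H' gerBl.
set ps := 1 - (1 - q) ^+ N; have /andP[ps0 ps1] := r01 N.
elim: t E => [|t IH] E expE; first by rewrite !mul0r.
set P := Pr _ _ _.
have PE : P = Ex q (vpairs T) (fun B => Pr (1 - (1 - q) ^+ t) (vpairs T) (fun A => (0 < mincost V J ((E :|: B) :|: A))%N)).
  rewrite /P /Pr (_ : 1 - (1 - q) ^+ t.+1 = 1 - (1 - (1 - (1 - q) ^+ t)) * (1 - q)); last first.
    by rewrite subKr exprSr.
  rewrite -Ex_union; apply: eq_Ex => B _; apply: eq_Ex => A _.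
  by rewrite setUA setUAC.
have P1 : P <= (0 < mincost V J E)%N%:R.
  rewrite -(Ex_cst (1 - (1 - q) ^+ t.+1) (vpairs T) (0 < mincost V J E)%N%:R); apply: le_Ex => // A _.
  rewrite ler_nat; have := @mincost_mono T V J exa E (E :|: A) (subsetUl _ _).
  by case: (mincost V J E) => [|c]; case: (mincost V J (E :|: A)).
have P0 : 0 <= P by apply: Pr_ge0.
(* Condition on the first round and apply the induction hypothesis to the remaining ones. *)
have H1 : t%:R * ps * P <= Ex q (vpairs T) (fun B => (mincost V J (E :|: B))%:R).
  rewrite PE -ExZl; apply: le_Ex => // B _; apply: IH; apply: expander_mono expE; exact: subsetUl.
(* While the cost is positive, the first round lowers its mean by at least [ps]. *)
have H2 : Ex q (vpairs T) (fun B => (mincost V J (E :|: B))%:R) <= (mincost V J E)%:R - ps * (0 < mincost V J E)%N%:R.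
  have [c0|c0] := posnP (mincost V J E).
    rewrite mulr0 subr0 -[X in _ <= X](Ex_cst q (vpairs T)); apply: le_Ex => // B _; rewrite ler_nat.
    exact: mincost_mono (subsetUl _ _).
  rewrite mulr1; pose S := boosters V J E.
  have SD : S \subset vpairs T by apply/subsetP => e; rewrite inE => /andP[].
  have NS : (N <= #|S|)%N.
    by have := many_boosters Y_free YV inner_forced V1 exa expE c0; rewrite -/S; move: Nm; move: (m.+1 ^ 2)%N #|S| => x y; lia.
  apply: le_trans (_ : (mincost V J E)%:R - Pr q (vpairs T) (fun B => B :&: S != set0) <= _).
    rewrite -[X in _ <= X - _](Ex_cst q (vpairs T)) /Pr -ExB; apply: le_Ex => // B sB.
    case: (boolP (B :&: S != set0)) => [/set0Pn[f]|_] /=; last first.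
      by rewrite subr0 ler_nat mincost_mono // subsetUl.
    rewrite inE => /andP[fB fS]; rewrite lerBrDr -natrD ler_nat addn1.
    move: fS; rewrite inE => /andP[_]; apply: leq_ltn_trans; apply: mincost_mono => //.
    by rewrite subUset sub1set !inE fB orbT subsetUl.
  rewrite (Pr_hit q SD) lerD2l lerN2 /ps lerD2l lerN2 ler_wiXn2l ?subr_ge0 // gerBl //.
have -> : t.+1%:R * ps * P = t%:R * ps * P + ps * P by rewrite -natr1; ring.
by have := ler_wpM2l ps0 P1; move: H1 H2; move: (t%:R * ps * P) (ps * P) (ps * _) (Ex _ _ _) => *; lra.
Qed.

End Rounds.

(** * Forced paths through vertices of small degree *)

Section PairUp.
Variables (T : finType) (block : T -> seq T).
Implicit Types (s : seq T).

Lemma path_edges_catl s s' : path_edges s \subset path_edges (s ++ s').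
Proof.
case/lastP: s => [|s x]; first exact: sub0set.
case: s' => [|y s']; first by rewrite cats0.
by rewrite path_edges_cat subsetUl.
Qed.

Lemma path_edges_catr s s' : path_edges s' \subset path_edges (s ++ s').
Proof.
case: s' => [|y s']; first exact: sub0set.
case/lastP: s => [|s x]; first by [].
by rewrite path_edges_cat; apply: subset_trans (subsetUr _ _); apply: subsetUr.
Qed.

(** Used for blocks that end at a pendant vertex: gluing two of them at these vertices makes both
    interior at the price of one missing edge. An unpaired last entry is dropped. *)
Fixpoint pairup s : seq (seq T) :=
  if s is v :: s' then (if s' is w :: s'' then (block v ++ rev (block w)) :: pairup s'' else [::]) else [::].

Fixpoint evenpart s : seq T :=
  if s is v :: s' then (if s' is w :: s'' then v :: w :: evenpart s'' else [::]) else [::].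

Fixpoint pairlist s : seq {set T} :=
  if s is v :: s' then (if s' is w :: s'' then [set v; w] :: pairlist s'' else [::]) else [::].

Lemma pair_ind (P : seq T -> Prop) : P [::] -> (forall x, P [:: x]) ->
  (forall x y s, P s -> P [:: x, y & s]) -> forall s, P s.
Proof.
move=> P0 P1 P2 s; have [m] := ubnP (size s); elim: m s => // m IH [|x [|y s]] //= sm.
by apply: P2; apply: IH; move: sm; lia.
Qed.

Lemma evenpart_sub s : subseq (evenpart s) s.
Proof. by elim/pair_ind: s => //= x y s IH; rewrite !eqxx. Qed.

Lemma evenpart_last s x : x \in s -> x \notin evenpart s -> x = last x s.
Proof.
elim/pair_ind: s => [|y|y z s IH] //=; first by rewrite inE => /eqP.
rewrite !inE !negb_or => /or3P[/eqP->|/eqP->|xs]; rewrite ?eqxx ?andbF //.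
case/and3P=> _ _ /(IH xs); by case: s {IH} xs.
Qed.

Lemma size_pairlist s : 2 * size (pairlist s) <= size s.
Proof. by elim/pair_ind: s => //= x y s; lia. Qed.

Lemma flatten_pairup s : perm_eq (flatten (pairup s)) (flatten (map block (evenpart s))).
Proof.
elim/pair_ind: s => //= x y s IH; rewrite -catA perm_cat2l; apply: perm_cat => //.
by rewrite perm_rev.
Qed.

Lemma pairupP s c : c \in pairup s -> exists a b, [/\ c = block a ++ rev (block b),
  a \in s, b \in s & [set a; b] \in pairlist s].
Proof.
elim/pair_ind: s => //= x y s IH; rewrite inE => /orP[/eqP ->|/IH[a [b [-> sa sb sab]]]].
  by exists x, y; rewrite !inE !eqxx ?orbT.
by exists a, b; rewrite !inE sa sb sab !orbT.
Qed.

Lemma evenpart_chain s v : uniq s -> v \in evenpart s -> exists a b,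
  [/\ a != b, a \in s, b \in s, (v == a) || (v == b) & block a ++ rev (block b) \in pairup s].
Proof.
elim/pair_ind: s => //= x y s IH; rewrite !inE negb_or -!andbA => /and4P[xy xs ys us] /or3P[vx|vy|/(IH us)].
- by exists x, y; rewrite !inE xy vx !eqxx ?orbT.
- by exists x, y; rewrite !inE xy vy !eqxx ?orbT.
- by case=> a [b [ab sa sb vab c]]; exists a, b; rewrite !inE sa sb c !orbT.
Qed.

Lemma uniq_flatten s : uniq s -> (forall v, v \in s -> uniq (block v)) ->
  (forall v w x, v \in s -> w \in s -> x \in block v -> x \in block w -> v = w) ->
  uniq (flatten (map block s)).
Proof.
elim: s => //= v s IH /andP[vs us] ub dis; rewrite cat_uniq ub ?mem_head //= IH //; first last.
- by move=> a b x sa sb; apply: dis; rewrite inE ?sa ?sb orbT.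
- by move=> a sa; apply: ub; rewrite inE sa orbT.
rewrite andbT; apply/hasPn => x /flatten_mapP[w ws xw]; apply/negP => xv.
by move: vs; rewrite (dis v w x) ?ws // ?mem_head // inE ws orbT.
Qed.

End PairUp.

Section Structure.
Variables (T : finType) (E : {set {set T}}).
Hypothesis sE : E \subset vpairs T.
Implicit Types (S : {set T}) (v w x y z q : T).

(** 18 = 12 + 6: at most 6 neighbours are lost in [card_nonfree], and 12 free ones are what
    [structure_expander] needs. *)
Definition small : {set T} := [set v | degree E v < 18].

(* The exceptional small vertices: there are o(d e^-d n) of them, and they are simply left out of the
   long path. *)
Definition crowded : {set T} := [set v in small | (degree E v == 0) ||
  [exists u, [&& u \in small, u != v & u \in gball E 4 v]]].

Definition sparse_sets t := [forall S : {set T}, (S != set0) ==> (#|S| <= t) ==> (#|inner E S| < 2 * #|S|)].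

Definition nbrs S : {set T} := [set y | [exists x, (x \in S) && adj E x y]].

Definition wide t m := [forall S : {set T}, (t < 3 * #|S|) ==> (#|S| <= m) ==> (4 * #|S| < #|S :|: nbrs S|)].

Lemma inner_setU1 S w : w \notin S -> #|inner E S| + #|nbr E w :&: S| <= #|inner E (w |: S)|.
Proof.
move=> wS; have wS' : w \notin nbr E w :&: S by rewrite inE (negbTE wS) andbF.
have dis : inner E S :&: spokes w (nbr E w :&: S) = set0; last first.
  rewrite -(card_spokes wS') -cardsUI dis cards0 addn0.
  apply: subset_leq_card; rewrite subUset; apply/andP; split; apply/subsetP => e.
    by rewrite !inE => /andP[-> /subset_trans]; apply; apply: subsetUr.
  case/imsetP=> b; rewrite !inE => /andP[wb bS] ->.
  by rewrite (wb : _ \in E) subUset !sub1set !inE eqxx bS orbT.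
apply/setP => e; rewrite !inE; apply/negbTE/negP => /andP[/andP[_ /subsetP eS] /imsetP[b _ ee]].
by move: wS; rewrite eS // ee !inE eqxx.
Qed.

(** Vertices with four neighbours in the set are absorbed; each brings four edges, so the set would
    become too dense before tripling. At a minimum of 3 * #|X| minus the edges inside [X], no
    further vertex can be absorbed. *)
Lemma closure_exists t : sparse_sets t -> 3 * #|crowded| < t -> exists X : {set T},
  [/\ crowded \subset X, #|X| <= 3 * #|crowded| & forall w, w \notin X -> #|nbr E w :&: X| <= 3].
Proof.
move=> /forallP sp ct; set x0 := #|crowded| in ct *.
have innE S : #|inner E S| <= #|E| by apply: subset_leq_card; apply/subsetP => e; rewrite inE => /andP[].
have [|X [cX Xle] minX] := @ex_min {set T} (fun X => crowded \subset X /\ #|X| <= (3 * x0).+1)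
    (fun X => 3 * #|X| + (#|E| - #|inner E X|)).
  by exists crowded; split=> //; rewrite /x0; lia.
have X3 : #|X| <= 3 * x0.
  have := minX crowded; rewrite -/x0 => Hc.
  have {}Hc : 3 * #|X| + (#|E| - #|inner E X|) <= 3 * x0 + (#|E| - #|inner E crowded|).
    by apply: Hc; split=> //; lia.
  have := innE X; have := sp X.
  have [->|X0] := eqVneq X set0; first by rewrite cards0.
  rewrite (leq_trans Xle) //= => H1 H2.
  by move: Hc H1 H2 Xle; move: #|X| #|inner E X| #|inner E crowded| #|E| => *; lia.
exists X; split=> // w wX; rewrite leqNgt; apply/negP => d4.
have cU : #|w |: X| = #|X|.+1 by rewrite cardsU1 wX.
have := minX (w |: X); rewrite cU => H.
have {}H := H (conj (subset_trans cX (subsetUr _ _)) (X3 : #|X|.+1 <= _.+1)).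
have := inner_setU1 wX; have := innE (w |: X); move: H d4.
by move: #|nbr E w :&: X| #|X| #|inner E X| #|inner E (w |: X)| #|E| => *; lia.
Qed.

Section Closure.
Variable X : {set T}.
Hypothesis cX : crowded \subset X.
Hypothesis X3 : forall w, w \notin X -> #|nbr E w :&: X| <= 3.

(** A nice vertex has only bulk neighbours, and every other small vertex is at distance more than 4,
    so the forced paths around nice vertices are disjoint. *)
Definition nice : {set T} := [set v in small | (v \notin X) && (nbr E v :&: X == set0)].

Definition bulk : {set T} := ~: (small :|: X).

Lemma far v w : v \in small -> v \notin X -> w \in small -> w \in gball E 4 v -> w = v.
Proof.
move=> vs vX ws wv; apply/eqP; apply: contraNT vX => nwv; apply: (subsetP cX).
by rewrite inE vs; apply/orP; right; apply/existsP; exists w; rewrite ws nwv.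
Qed.

Lemma walk1 v a : adj E v a -> a \in gball E 1 v.
Proof. by move=> va; apply: gball_nbr va; apply: gball_center. Qed.

Lemma walk2 v a b : adj E v a -> adj E a b -> b \in gball E 2 v.
Proof. by move=> /walk1 va ab; apply: gball_nbr ab. Qed.

Lemma walk4 v a b c d : adj E v a -> adj E a b -> adj E b c -> adj E c d -> d \in gball E 4 v.
Proof. by move=> va ab bc cd; do 2![apply: gball_nbr; last by eauto]; apply: walk2 va ab. Qed.

Lemma ball_le v w r : r <= 4 -> w \in gball E r v -> w \in gball E 4 v.
Proof. by move=> r4; apply: (subsetP (gball_le _ _ r4)). Qed.

Lemma niceP v : v \in nice -> [/\ v \in small, v \notin X & forall a, adj E v a -> a \in bulk].
Proof.
rewrite inE => /and3P[vs vX /eqP/setP nX]; split=> // a va; rewrite !inE negb_or; apply/andP; split.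
  apply/negP => da; have asm : a \in small by rewrite inE.
  have := far vs vX asm (ball_le _ (walk1 va)) => /(_ isT) av; have := adj_neq sE va; by rewrite av eqxx.
by have := nX a; rewrite !inE va /= => ->.
Qed.

Lemma bulk_nice v : v \in bulk -> v \notin nice.
Proof. by rewrite !inE negb_or => /andP[/negbTE -> _]. Qed.

Lemma nice_degree v : v \in nice -> 0 < degree E v.
Proof.
move=> /niceP[vs vX _]; rewrite lt0n; apply: contraNN vX => d0; apply: (subsetP cX).
by rewrite inE vs d0.
Qed.

Definition c1 v := nth v (enum (nbr E v)) 0.
Definition c2 v := nth v (enum (nbr E v)) 1.

Lemma c1_adj v : v \in nice -> adj E v (c1 v).
Proof.
move=> vn; have : c1 v \in enum (nbr E v) by rewrite mem_nth // -cardE; apply: nice_degree.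
by rewrite mem_enum inE.
Qed.

Lemma c2_adj v : 1 < degree E v -> adj E v (c2 v) && (c1 v != c2 v).
Proof.
move=> dv; have d1 : 1 < size (enum (nbr E v)) by rewrite -cardE.
have : c2 v \in enum (nbr E v) by rewrite mem_nth.
rewrite mem_enum inE => ->; rewrite /c1 /c2 nth_uniq ?enum_uniq //; exact: ltnW.
Qed.

Definition block v := if degree E v == 1 then [:: c1 v; v] else [:: c1 v; v; c2 v].

Lemma degree_gt1 v : v \in nice -> degree E v != 1 -> 1 < degree E v.
Proof. by move=> /nice_degree; case: (degree E v) => [|[|d]]. Qed.

Lemma blockP v x : v \in nice -> x \in block v -> x = v \/ (adj E v x /\ x \in [set c1 v; c2 v]).
Proof.
move=> vn; rewrite /block; case: (boolP (degree E v == 1)) => dv; rewrite !inE.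
  by case/orP=> /eqP ->; [right; rewrite eqxx c1_adj|left].
have /andP[a2 _] := c2_adj (degree_gt1 vn dv).
by case/or3P=> /eqP ->; [right; rewrite eqxx c1_adj|left|right; rewrite eqxx orbT].
Qed.

Lemma mem_block v : v \in block v.
Proof. by rewrite /block; case: ifP => _; rewrite !inE eqxx ?orbT. Qed.

Lemma uniq_block v : v \in nice -> uniq (block v).
Proof.
move=> vn; rewrite /block; have a1 := c1_adj vn; have n1 := adj_neq sE a1.
case: (boolP (degree E v == 1)) => dv /=; first by rewrite inE eq_sym n1.
have /andP[a2 c12] := c2_adj (degree_gt1 vn dv).
by rewrite !inE negb_or eq_sym n1 c12 (adj_neq sE a2).
Qed.

Lemma block_disjoint v w x : v \in nice -> w \in nice -> x \in block v -> x \in block w -> v = w.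
Proof.
move=> vn wn xv xw; have [vs vX _] := niceP vn; have [ws wX _] := niceP wn.
case: (blockP vn xv) => [xE|[vx _]]; case: (blockP wn xw) => [xE'|[wx _]].
- by rewrite -xE.
- by rewrite xE in wx; exact: (far ws wX vs (@ball_le _ _ 1 isT (walk1 wx))).
- by rewrite xE' in vx; exact: esym (far vs vX ws (@ball_le _ _ 1 isT (walk1 vx))).
- by rewrite adj_sym in wx; exact: esym (far vs vX ws (@ball_le _ _ 2 isT (walk2 vx wx))).
Qed.

Let ones := [seq v <- enum nice | degree E v == 1].
Let twos := [seq v <- enum nice | degree E v != 1].
Let covered := evenpart ones ++ twos.
Definition chains := pairup block ones ++ map block twos.

Lemma onesE v : (v \in ones) = (degree E v == 1) && (v \in nice).
Proof. by rewrite mem_filter mem_enum. Qed.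

Lemma twosE v : (v \in twos) = (degree E v != 1) && (v \in nice).
Proof. by rewrite mem_filter mem_enum. Qed.

Lemma covered_nice v : v \in covered -> v \in nice.
Proof.
by rewrite mem_cat => /orP[/(mem_subseq (evenpart_sub _))|]; rewrite ?onesE ?twosE => /andP[].
Qed.

Lemma uniq_covered : uniq covered.
Proof.
rewrite /covered cat_uniq; apply/and3P; split; last by rewrite filter_uniq ?enum_uniq.
  by apply: subseq_uniq (evenpart_sub _) _; rewrite filter_uniq ?enum_uniq.
apply/hasPn => v; rewrite twosE => /andP[d1 _]; apply/negP => /(mem_subseq (evenpart_sub _)).
by rewrite onesE (negbTE d1).
Qed.

Lemma flatten_chains : perm_eq (flatten chains) (flatten (map block covered)).
Proof. by rewrite /chains flatten_cat map_cat flatten_cat perm_cat2r flatten_pairup. Qed.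

Lemma uniq_chains : uniq (flatten chains).
Proof.
rewrite (perm_uniq flatten_chains); apply: uniq_flatten; first exact: uniq_covered.
  by move=> v /covered_nice; apply: uniq_block.
by move=> v w x /covered_nice vn /covered_nice wn; apply: block_disjoint.
Qed.

Lemma chainsP x : x \in flatten chains -> exists2 v, v \in covered & x \in block v.
Proof. by rewrite (perm_mem flatten_chains) => /flatten_mapP[v vc xv]; exists v. Qed.

Lemma covered_chains v x : v \in covered -> x \in block v -> x \in flatten chains.
Proof. by move=> vc xv; rewrite (perm_mem flatten_chains); apply/flatten_mapP; exists v. Qed.

Definition forced : {set {set T}} := [set e | has (fun c => e \in path_edges c) chains].
Definition skeleton := flatten chains ++ [seq x <- enum bulk | x \notin flatten chains].
Definition support : {set T} := [set x in skeleton].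
Definition free_bulk : {set T} := [set x in bulk | x \notin flatten chains].

Lemma forced_chain e c : c \in chains -> e \in path_edges c -> e \in forced.
Proof. by move=> cc ec; rewrite inE; apply/hasP; exists c. Qed.

Lemma chains_edges c : c \in chains -> path_edges c \subset path_edges (flatten chains).
Proof.
case/splitPr=> cs1 cs2; rewrite flatten_cat /=; apply: subset_trans (path_edges_catr _ _).
exact: path_edges_catl.
Qed.

Lemma skeleton_admissible : admissible support forced skeleton.
Proof.
split.
- rewrite cat_uniq uniq_chains filter_uniq ?enum_uniq // andbT /=; apply/hasPn => x.
  by rewrite mem_filter => /andP[].
- by move=> x; rewrite inE.
- apply/subsetP => e; rewrite inE => /hasP[c cc ec].
  by apply: (subsetP (path_edges_catl _ _)); apply: (subsetP (chains_edges cc)).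
Qed.

Lemma bulk_support : bulk \subset support.
Proof.
apply/subsetP => x xb; rewrite inE mem_cat; case: (boolP (x \in flatten chains)) => //= xc.
by rewrite mem_filter xc mem_enum.
Qed.

Lemma free_bulk_support : free_bulk \subset support.
Proof. by apply: subset_trans bulk_support; apply/subsetP => x; rewrite inE => /andP[]. Qed.

Lemma free_bulk_free y z : y \in free_bulk -> [set z; y] \notin forced.
Proof.
rewrite inE => /andP[_ yc]; apply: contra yc; rewrite inE => /hasP[c cc /path_edges_mem/subsetP/(_ y)].
by rewrite !inE eqxx orbT => /(_ isT) yc; apply/flattenP; exists c.
Qed.

(** A vertex of the support outside the bulk is nice and interior to a chain; a pendant one gets its
    second forced pair from its partner. *)
Lemma support_forced v : v \in support -> v \notin bulk ->
  exists a b, [/\ a != b, [set v; a] \in forced & [set v; b] \in forced].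
Proof.
move=> vV vb; have : v \in flatten chains.
  move: vV; rewrite inE mem_cat => /orP[//|]; by rewrite mem_filter mem_enum (negbTE vb) andbF.
case/chainsP=> w wc vw; have wn := covered_nice wc.
have vE : v = w.
  case: (blockP wn vw) => // -[wv _]; have [_ _ H] := niceP wn; by rewrite (H _ wv) in vb.
rewrite {v vV vb vw}vE; move: wc; rewrite mem_cat => /orP[wo|wt]; last first.
  have bc : block w \in chains by rewrite mem_cat map_f ?orbT.
  move: wt; rewrite twosE => /andP[d1 _]; have /andP[a2 c12] := c2_adj (degree_gt1 wn d1).
  exists (c1 w), (c2 w); split=> //; apply: (forced_chain bc); rewrite /block (negbTE d1) !path_edges_cons.
    by rewrite setUC setU11.
  by rewrite !in_setU !in_set1 eqxx orbT.
have uo : uniq ones by rewrite filter_uniq ?enum_uniq.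
have [a [b [ab ao bo wab c]]] := evenpart_chain block uo wo.
have cc : block a ++ rev (block b) \in chains by rewrite mem_cat c.
move: ao bo; rewrite !onesE => /andP[da an] /andP[db bn].
have bE : block a ++ rev (block b) = [:: c1 a; a; b; c1 b] by rewrite /block da db.
have fa e : e \in path_edges [:: c1 a; a; b; c1 b] -> e \in forced by rewrite -bE; apply: forced_chain.
rewrite !path_edges_cons in fa.
have [as_ _ aQ] := niceP an; have [bs _ bQ] := niceP bn.
have nb v u : u \in nice -> v \in bulk -> v != u by move=> un vb; apply: contraTneq un => <-; apply: bulk_nice.
case/orP: wab => /eqP ->.
  exists (c1 a), b; split; first by apply: nb => //; apply/aQ/c1_adj.
    by apply: fa; rewrite setUC setU11.
  by apply: fa; rewrite !in_setU !in_set1 eqxx orbT.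
exists (c1 b), a; split; first by apply: nb => //; apply/bQ/c1_adj.
  by apply: fa; rewrite !in_setU !in_set1 eqxx !orbT.
by apply: fa; rewrite [[set b; a]]setUC !in_setU !in_set1 eqxx orbT.
Qed.

(** Only pairs gluing two pendant vertices can be missing, one for every two of them. *)
Lemma card_forced : 2 * #|forced :\: E| <= num_degree E 1.
Proof.
apply: leq_trans (_ : 2 * size (pairlist ones) <= _); last first.
  apply: leq_trans (size_pairlist _) _; have uo : uniq ones by rewrite filter_uniq ?enum_uniq.
  rewrite -(card_uniqP uo); apply: subset_leq_card; apply/subsetP => v; by rewrite onesE inE => /andP[].
rewrite leq_mul2l /=; apply: leq_trans (_ : #|[set e in pairlist ones]| <= _); last first.
  by apply: leq_trans (card_size (pairlist ones)); apply: subset_leq_card; apply/subsetP => e; rewrite inE.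
apply: subset_leq_card; apply/subsetP => e; rewrite in_setD in_set => /andP[eE /hasP[c cc ec]].
rewrite in_set; move: cc; rewrite mem_cat => /orP[/pairupP[a [b [cE ao bo ab]]]|/mapP[v vt cE]].
  move: ao bo; rewrite !onesE => /andP[da an] /andP[db bn].
  move: ec; rewrite cE (_ : block a ++ rev (block b) = [:: c1 a; a; b; c1 b]); last by rewrite /block da db.
  rewrite !path_edges_cons path_edges1 setU0 !in_setU !in_set1 => /or3P[/eqP ee|/eqP ->//|/eqP ee].
    by move: eE; rewrite ee setUC (c1_adj an : _ \in E).
  by move: eE; rewrite ee (c1_adj bn : _ \in E).
move: vt; rewrite twosE => /andP[d1 vn].
have /andP[a2 _] := c2_adj (degree_gt1 vn d1).
move: ec; rewrite cE /block (negbTE d1) !path_edges_cons path_edges1 setU0 in_setU !in_set1 => /orP[]/eqP ee; move: eE.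
  by rewrite ee setUC (c1_adj vn : _ \in E).
by rewrite ee (a2 : _ \in E).
Qed.

(** Left out are [X], the small vertices next to [X], at most one per vertex of [X] since two would
    be at distance 2, and possibly one pendant vertex without partner. *)
Lemma card_support : #|~: support| <= 2 * #|X| + 1.
Proof.
pose near := [set v in small | (v \notin X) && (v \notin nice)].
have nearX : #|near| <= #|X|.
  have H v : v \in near -> exists t, (t \in X) && adj E v t.
    rewrite !inE => /and3P[vs vX]; rewrite vs vX /= => /set0Pn[t]; rewrite !inE => /andP[vt tX].
    by exists t; rewrite tX.
  pose f v := if [pick t | (t \in X) && adj E v t] is Some t then t else v.
  have fP v : v \in near -> (f v \in X) && adj E v (f v).
    by move=> /H[t Ht]; rewrite /f; case: pickP => [t' //|/(_ t)]; rewrite Ht.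
  rewrite -(@card_in_imset _ _ f near).
    by apply: subset_leq_card; apply/subsetP => t /imsetP[v /fP/andP[? _] ->].
  move=> v w vN wN fvw; have /andP[_ va] := fP v vN; have /andP[_ wa] := fP w wN.
  rewrite -fvw adj_sym in wa; move: vN; rewrite in_set => /and3P[vs vX _]; move: wN; rewrite in_set => /and3P[ws wX _].
  exact: esym (far vs vX ws (@ball_le _ _ 2 isT (walk2 va wa))).
have rest1 : #|nice :\: [set v in covered]| <= 1.
  apply/card_le1_eqP.
  have H v : v \in nice :\: [set v in covered] -> v \in ones /\ v \notin evenpart ones.
    rewrite in_setD in_set mem_cat negb_or => /andP[/andP[ve vt] vn].
    by split=> //; move: vt; rewrite twosE onesE vn !andbT negbK.
  move=> v w /H[vo ve] /H[wo we]; rewrite (evenpart_last vo ve) (evenpart_last wo we).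
  by case: (ones) vo.
apply: leq_trans (_ : #|X :|: near :|: (nice :\: [set v in covered])| <= _); last first.
  apply: leq_trans (leq_card_setU _ _) _; apply: leq_add => //.
  by apply: leq_trans (leq_card_setU _ _) _; rewrite mul2n -addnn leq_add2l.
apply: subset_leq_card; apply/subsetP => v; rewrite in_setC => vV.
have vb : v \notin bulk by apply: contra vV; apply: (subsetP bulk_support).
case: (boolP (v \in X)) => vX; first by rewrite !in_setU vX.
have vs : v \in small by move: vb; rewrite inE negbK inE (negbTE vX) orbF.
case: (boolP (v \in nice)) => vn; last by rewrite !in_setU [v \in near]inE vs vX vn !orbT.
rewrite in_setU in_setD vn andbT; apply/orP; right; apply: contra vV; rewrite inE => vc.
by rewrite inE mem_cat (covered_chains vc) ?mem_block.
Qed.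

(** 6 = 3 + 1 + 2: three neighbours in [X], one small vertex outside [X], and two block vertices,
    which belong to a single nice vertex since two nice vertices are never within distance 4. *)
Lemma card_nonfree q : q \in bulk -> #|nbr E q :\: free_bulk| <= 6.
Proof.
move=> qb; have qX : q \notin X by move: qb; rewrite !inE negb_or => /andP[].
pose Z := [set z in bulk | z \in flatten chains].
apply: leq_trans (_ : #|(nbr E q :&: X) :|: (nbr E q :&: (small :\: X)) :|: (nbr E q :&: Z)| <= _).
  apply: subset_leq_card; apply/subsetP => v; rewrite in_setD => /andP[vf vq].
  rewrite !in_setU !in_setI vq /=; move: vf; rewrite in_set negb_and negbK.
  case: (boolP (v \in bulk)) => vb /=; first by move=> vc; rewrite [v \in Z]in_set vb vc !orbT.
  move: vb; rewrite in_setC negbK in_setU in_setD => /orP[->|->] //; rewrite ?orbT //.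
  by case: (v \in X).
have h1 := X3 qX.
have h2 : #|nbr E q :&: (small :\: X)| <= 1.
  apply/card_le1_eqP => v w; rewrite !in_setI !in_setD => /and3P[qv vX vs] /and3P[qw wX ws].
  rewrite inE adj_sym in qv; rewrite inE in qw.
  exact: far vs vX ws (@ball_le _ _ 2 isT (walk2 qv qw)).
have h3 : #|nbr E q :&: Z| <= 2.
  have [->|[z]] := set_0Vmem (nbr E q :&: Z); first by rewrite cards0.
  have H z' : z' \in nbr E q :&: Z -> exists2 v, v \in nice & [/\ adj E q z', adj E v z' & z' \in [set c1 v; c2 v]].
    rewrite in_setI => /andP[]; rewrite in_set => qz; rewrite in_set => /andP[zb /chainsP[v /covered_nice vn zv]].
    exists v => //; case: (blockP vn zv) => [zE|[vz zc]]; last by split.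
    by move: (bulk_nice zb); rewrite zE vn.
  case/H=> v vn [qz vz _]; apply: leq_trans (_ : #|[set c1 v; c2 v]| <= _); last by rewrite cards2; case: eqP.
  apply: subset_leq_card; apply/subsetP => z' /H[w wn [qz' wz' zc]].
  have [vs vX _] := niceP vn; have [ws _ _] := niceP wn.
  suff -> : v = w by []; apply: esym; apply: far vs vX ws _.
  by apply: walk4 vz _ qz' _; rewrite adj_sym.
apply: leq_trans (leq_card_setU _ _) _; rewrite -[6]/(4 + 2) leq_add //.
by apply: leq_trans (leq_card_setU _ _) _; rewrite -[4]/(3 + 1) leq_add.
Qed.

Lemma card_free : #|~: free_bulk| <= #|X| + 4 * #|small|.
Proof.
apply: leq_trans (_ : #|X :|: small :|: [set x in flatten chains]| <= _).
  apply: subset_leq_card; apply/subsetP => v; rewrite in_setC in_set negb_and negbK in_setC negbK.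
  by rewrite !in_setU [v \in [set _ in _]]in_set => /orP[/orP[->|->]|->]; rewrite ?orbT.
apply: leq_trans (leq_card_setU _ _) _; rewrite mulSn addnA leq_add ?leq_card_setU //.
apply: leq_trans (_ : size (flatten (map block covered)) <= _).
  by rewrite -(perm_size flatten_chains); apply: leq_trans (card_size _); apply/eq_leq/eq_card => x; rewrite inE.
apply: leq_trans (_ : 3 * size covered <= _).
  elim: (covered) => //= v s IH; rewrite size_cat mulnS leq_add //.
  by rewrite /block; case: ifP.
rewrite leq_mul2l -(card_uniqP uniq_covered) /=; apply: subset_leq_card; apply/subsetP => v /covered_nice.
by rewrite in_set => /andP[].
Qed.

(** For small [S] with few neighbours, at most 3 * #|S| vertices would span 12 * #|S| / 2 edges,
    against [sparse_sets]. For larger [S] the vertices outside [free_bulk] are fewer than #|S|, so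
    [wide] still leaves more than 2 * #|S| neighbours. *)
Lemma structure_expander t m : sparse_sets t -> wide t m -> 3 * (#|X| + 4 * #|small|) <= t ->
  expander bulk free_bulk m E.
Proof.
move=> /forallP sp /forallP wd szt S SQ S0 Sm; rewrite ltnNge; apply/negP.
set N := [set y in _ | _] => NS.
have [tS|St] := ltnP t (3 * #|S|).
  have := wd S; rewrite tS Sm /= ltnNge => /negP; apply.
  apply: leq_trans (_ : #|S :|: N :|: ~: free_bulk| <= _).
    apply: subset_leq_card; apply/subsetP => y; rewrite in_setU => /orP[yS|]; first by rewrite !in_setU yS.
    rewrite in_set => yN; rewrite !in_setU; case: (boolP (y \in S)) => //= yS.
    by rewrite [y \in N]in_set in_setD yS yN andbT in_setC; case: (y \in free_bulk).
  apply: leq_trans (leq_card_setU _ _) _; have := card_free; have : #|S :|: N| <= #|S| + #|N| by apply: leq_card_setU.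
  by move: NS szt tS; move: #|S :|: N| #|~: free_bulk| #|N| #|S| #|X| #|small| => *; lia.
pose W := S :|: N.
have WS : #|W| <= 3 * #|S| by apply: leq_trans (leq_card_setU _ _) _; move: NS; move: #|N| #|S|; lia.
have W0 : W != set0 by case/set0Pn: S0 => x xS; apply/set0Pn; exists x; rewrite inE xS.
have := sp W; rewrite W0 (leq_trans WS St) /= ltnNge => /negP; apply.
suff : 12 * #|S| <= 2 * #|inner E W| by move: WS; move: #|W| #|S| #|inner E W|; lia.
have sI : inner E W \subset vpairs T.
  by apply: subset_trans sE; apply/subsetP => e; rewrite inE => /andP[].
rewrite -(handshake sI) mulnC -sum_nat_const [leqLHS]big_mkcond; apply: leq_sum => x _.
case: ifP => // xS.
have xQ : x \in bulk by apply: (subsetP SQ).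
have d18 : 18 <= degree E x.
  by move: xQ; rewrite in_setC in_setU negb_or in_set -leqNgt => /andP[].
have := card_nonfree xQ; have := cardsID free_bulk (nbr E x); rewrite -/(degree E x).
suff : #|nbr E x :&: free_bulk| <= degree (inner E W) x by move: d18; move: (degree E x) (degree _ _) #|_ :&: _| #|_ :\: _|; lia.
apply: subset_leq_card; apply/subsetP => y; rewrite in_setI => /andP[]; rewrite in_set => xy yf.
rewrite in_set /adj /= in_set (xy : _ \in E) subUset !sub1set !in_setU xS /=.
case: (boolP (y \in S)) => //= yS; rewrite in_set in_setD yS yf /=.
by apply/existsP; exists x; rewrite xS.
Qed.

End Closure.

(** Since #|X| is at most three times the number of crowded vertices, 21 is 3 (3 + 4) and 12 is 2
    times 2 times 3. *)
Lemma structure t m : sparse_sets t -> wide t m -> 21 * #|small| < t -> 21 * #|small| + 3 <= #|T| ->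
  exists (V Q Y : {set T}) (J : {set {set T}}),
  [/\ [/\ forall y z, y \in Y -> [set z; y] \notin J, Y \subset V,
          forall v, v \in V -> v \notin Q -> exists a b, [/\ a != b, [set v; a] \in J & [set v; b] \in J],
          1 < #|V| & exists s, admissible V J s],
      expander Q Y m E & 2 * (#|J :\: E| + #|~: V|) <= num_degree E 1 + 12 * #|crowded| + 2].
Proof.
move=> sp wd st sn.
have cs : #|crowded| <= #|small| by apply: subset_leq_card; apply/subsetP => v; rewrite inE => /andP[].
have [|X [cX Xc X3]] := closure_exists sp; first by move: cs st; move: #|crowded| #|small|; lia.
have h1 := card_support cX; have h2 := card_forced cX.
exists (support X), (bulk X), (free_bulk X), (forced X); split.
- split.
  + by move=> y z; apply: free_bulk_free.
  + exact: free_bulk_support.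
  + exact: support_forced.
  + by have := cardsC (support X); move: h1 Xc cs sn; move: #|support X| #|~: _| #|X| #|crowded| #|small| #|T|; lia.
  + by exists (skeleton X); apply: skeleton_admissible.
- apply: (structure_expander cX X3 sp wd); by move: Xc cs st; move: #|X| #|crowded| #|small|; lia.
- by move: h1 h2 Xc; move: #|forced X :\: E| #|~: _| #|X| #|crowded| (num_degree E 1); lia.
Qed.

End Structure.

(** * Typical properties of the random graph *)

Section Typical.
Local Open Scope ring_scope.
Variables (R : realType) (T : finType) (p : R).
Hypothesis p01 : 0 <= p <= 1.
Implicit Types (E : {set {set T}}) (S W I : {set T}).
Local Notation n := #|T|.
Local Notation d := (n%:R * p).
Local Notation e1 := (expR 1 : R).

Lemma half_sum N : \sum_(s < N | (0 < s)%N) (1 / 2 : R) ^+ s <= 1.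
Proof.
have h0 k : 0 <= (1 / 2 : R) ^+ k by apply: exprn_ge0; lra.
suff H : \sum_(s < N | (0 < s)%N) (1 / 2 : R) ^+ s + (1 / 2) ^+ N.-1 <= 1.
  by apply: le_trans H; rewrite lerDl.
elim: N => [|N IH]; first by rewrite big_ord0 add0r expr0.
rewrite big_mkcond big_ord_recr -big_mkcond /=; case: N IH => [|N] IH /=.
  by rewrite big_ord0 !add0r expr0.
apply: le_trans IH; rewrite -addrA lerD2l /= -mulr2n exprS; have := h0 N; move: ((1 / 2) ^+ N) => x; lra.
Qed.

(** First moment of sets of [s] vertices spanning 2 * s edges. Since (2 s)! >= s!^2, three
    factorials appear in the denominator, each at least (s / e)^s. *)
Lemma dense_count s : (0 < s)%N ->
  'C(n, s)%:R * ('C('C(s, 2), 2 * s)%:R * p ^+ (2 * s)) <= (e1 ^+ 3 * (n%:R * p ^+ 2) * s%:R) ^+ s.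
Proof.
move=> s0; have [p0 p1] := andP p01; have f0 k : 0 < k`!%:R :> R by rewrite ltr0n fact_gt0.
have e0 := expR_ge0 (1 : R).
have c2 : ('C(s, 2) <= s ^ 2)%N by apply: leq_trans (leq_pmulr _ (fact_gt0 2)) (bin_fact_le _ _).
have H : ('C(n, s) * 'C('C(s, 2), 2 * s) * (s`! * (s`! * s`!)) <= n ^ s * s ^ (4 * s))%N.
  rewrite mulnACA leq_mul ?bin_fact_le //; apply: leq_trans (_ : 'C('C(s, 2), 2 * s) * (2 * s)`! <= _)%N.
    rewrite leq_mul2l; apply/orP; right; rewrite -(@bin_fact (2 * s) s) ?leq_pmull // mul2n -addnn addnK.
    by rewrite leq_pmull // bin_gt0 leq_addr.
  apply: leq_trans (bin_fact_le _ _) _; have -> : (4 * s = 2 * (2 * s))%N by clear; lia.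
  by rewrite [leqRHS]expnM leq_exp2r // muln_gt0.
have H' : ('C(n, s)%:R * 'C('C(s, 2), 2 * s)%:R) * s`!%:R ^+ 3 <= n%:R ^+ s * s%:R ^+ (4 * s) :> R.
  by move: H; rewrite -(ler_nat R) !natrM !natrX -expr2 -exprS.
have F : (s%:R ^+ s) ^+ 3 <= (e1 ^+ s * s`!%:R) ^+ 3 :> R.
  by apply: lerXn2r (self_power_fact _ _); rewrite nnegrE ?exprn_ge0 // mulr_ge0 ?exprn_ge0 // ltW.
rewrite mulrA -(@ler_pM2r _ (s`!%:R ^+ 3)) ?exprn_gt0 //.
apply: le_trans (_ : n%:R ^+ s * s%:R ^+ (4 * s) * p ^+ (2 * s) <= _).
  by rewrite mulrAC ler_wpM2r ?exprn_ge0.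
have -> : n%:R ^+ s * s%:R ^+ (4 * s) * p ^+ (2 * s) = (n%:R * p ^+ 2 * s%:R) ^+ s * (s%:R ^+ s) ^+ 3 :> R.
  have -> : (n%:R * p ^+ 2 * s%:R) ^+ s = n%:R ^+ s * p ^+ (2 * s) * s%:R ^+ s by rewrite 2!exprMn -exprM.
  by rewrite -exprM (_ : 4 * s = s + s * 3)%N ?exprD; [ring|clear; lia].
have -> : (e1 ^+ 3 * (n%:R * p ^+ 2) * s%:R) ^+ s * s`!%:R ^+ 3 = (n%:R * p ^+ 2 * s%:R) ^+ s * (e1 ^+ s * s`!%:R) ^+ 3.
  rewrite -mulrA [(e1 ^+ 3 * _) ^+ s]exprMn -exprM [(3 * s)%N]mulnC exprM [(e1 ^+ s * _) ^+ 3]exprMn; ring.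
by rewrite ler_wpM2l // exprn_ge0 // mulr_ge0 // mulr_ge0 // exprn_ge0.
Qed.

Lemma Pr_sparse_sets t : e1 ^+ 3 * (n%:R * p ^+ 2) * t%:R <= 1 / 4 ->
  Pr p (vpairs T) (fun E => ~~ sparse_sets E t) <= 2 * (e1 ^+ 3 * (n%:R * p ^+ 2)).
Proof.
set A := e1 ^+ 3 * _ => At; have [p0 p1] := andP p01.
have A0 : 0 <= A by rewrite mulr_ge0 ?exprn_ge0 ?expR_ge0 // mulr_ge0 // exprn_ge0.
apply: le_trans (_ : Pr p (vpairs T) (fun E => [exists (s : 'I_t.+1 | (0 < s)%N),
   [exists (S : {set T} | #|S| == s), (2 * s <= #|inner E S|)%N]]) <= _).
  apply: le_Pr => // E sE /forallPn[S]; rewrite !negb_imply -leqNgt => /and3P[S0 St iS].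
  apply/existsP; exists (Ordinal (St : (#|S| < t.+1)%N)); rewrite /= card_gt0 S0.
  by apply/existsP; exists S; rewrite eqxx iS.
apply: le_trans (Pr_exists _ _ _ p01) _.
apply: le_trans (_ : \sum_(s < t.+1 | (0 < s)%N) 2 * A * (1 / 2) ^+ s <= _); last first.
  rewrite -mulr_sumr -[leRHS]mulr1 ler_wpM2l ?half_sum // mulr_ge0 //.
apply: ler_sum => s s0; apply: le_trans (Pr_exists _ _ _ p01) _.
apply: le_trans (_ : \sum_(S : {set T} | #|S| == s) ('C('C(s, 2), 2 * s)%:R * p ^+ (2 * s)) <= _).
  apply: ler_sum => S /eqP Ss.
  pose pairs := [set e in vpairs T | e \subset S].
  have cp : #|pairs| = 'C(s, 2) by rewrite -Ss -cards_draws; apply: eq_card => e; rewrite !inE andbC.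
  pose fam := [set F : {set {set T}} | F \subset pairs & #|F| == (2 * s)%N].
  apply: le_trans (_ : Pr p (vpairs T) (fun E => [exists (F | F \in fam), F \subset E]) <= _).
    apply: le_Pr => // E sE iS; have [F FE cF] := ex_subset_card iS.
    apply/existsP; exists F; rewrite inE cF eqxx andbT; apply/andP; split.
      by apply: subset_trans FE _; apply/subsetP => e; rewrite !inE => /andP[/(subsetP sE)]; rewrite inE => -> ->.
    by apply: subset_trans FE _; apply/subsetP => e; rewrite !inE => /andP[].
  apply: le_trans (Pr_exists _ _ _ p01) _.
  rewrite (eq_bigr (fun=> p ^+ (2 * s))); last first.
    move=> F; rewrite inE => /andP[Fp /eqP cF]; rewrite Pr_subset ?cF //.
    by apply: subset_trans Fp _; apply/subsetP => e; rewrite inE => /andP[].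
  by rewrite [leLHS]sumr_const cards_draws cp -[leLHS]mulr_natl.
rewrite (eq_bigl (fun S => S \in [set S : {set T} | #|S| == s])); last by move=> S; rewrite inE.
rewrite [leLHS]sumr_const card_draws -[leLHS]mulr_natl; apply: le_trans (dense_count s0) _; rewrite -/A.
have s1 : A * s%:R <= 1 / 4 by apply: le_trans At; rewrite ler_wpM2l // ler_nat -ltnS ltn_ord.
rewrite -(prednK s0) exprS; set k := s.-1.
apply: le_trans (_ : A * k.+1%:R * (1 / 4) ^+ k <= _).
  have Ak : 0 <= A * k.+1%:R by apply: mulr_ge0.
  rewrite ler_wpM2l //; apply: lerXn2r; rewrite ?nnegrE //; last by rewrite /k prednK.
  by rewrite divr_ge0.
rewrite exprS; have -> : (1 / 4 : R) ^+ k = (1 / 2) ^+ k * (1 / 2) ^+ k.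
  by rewrite -exprMn; congr (_ ^+ _); lra.
have k2 : k.+1%:R * (1 / 2) ^+ k <= 1 :> R.
  by rewrite expr_div_n expr1n mul1r ler_pdivrMr ?exprn_gt0 // mul1r -natrX ler_nat ltn_expl.
have h0 : 0 <= (1 / 2 : R) ^+ k by apply: exprn_ge0; lra.
by have := ler_wpM2r h0 (ler_wpM2l A0 k2); lra.
Qed.

Definition wide_rate : R := e1 * expR (- (d / 8)).

Lemma Pr_no_cross S W : (2 * #|W| <= n)%N ->
  Pr p (vpairs T) (fun E => E :&: cross S (~: W) == set0) <= wide_rate ^+ #|S|.
Proof.
move=> Wn; have [p0 p1] := andP p01.
apply: le_trans (_ : Pr p (vpairs T) (fun E => (#|E :&: cross S (~: W)| <= 0)%N) <= _).
  by apply: le_Pr => // E _ /eqP ->; rewrite cards0.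
apply: le_trans (Pr_few p01 _ (cross_vpairs _ _)) _; rewrite expr0 mul1r.
apply: le_trans (powr_expR_upper _ _) _; first by lra.
rewrite /wide_rate -expRD -expRM_natl ler_expR.
have H : (#|S| * n <= 4 * #|cross S (~: W)| + 2 * #|S|)%N.
  have := card_cross_ge S (~: W); have := cardsC W; move: Wn; move: #|~: W| #|cross S (~: W)| #|S| #|W| n => D c a b N.
  by clear; nia.
have H' : #|S|%:R * n%:R <= 4 * #|cross S (~: W)|%:R + 2 * #|S|%:R :> R.
  by rewrite -[4]/(4%:R) -[2]/(2%:R) -!natrM -natrD ler_nat.
have := ler_wpM2r p0 H'; have : #|S|%:R * p <= #|S|%:R :> R by rewrite ler_piMr.
have := ler0n R #|S|; move: #|S|%:R #|cross S (~: W)|%:R n%:R => a c N; nra.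
Qed.

(** As for sparse pairs, two sets carry the weight x^(#|S| + #|W|), where [W] stands for [S] and its
    neighbours; #|W| <= 4 * #|S| explains x^5. *)
Lemma Pr_wide t m (x : R) : 0 < x <= 1 -> 3 * x * n%:R <= t.+1%:R -> (8 * m <= n)%N ->
  expR 2 * (wide_rate / x ^+ 5) <= 1 / 2 ->
  Pr p (vpairs T) (fun E => ~~ wide E t m) <= (1 / 2) ^+ (t %/ 3).+1.
Proof.
case/andP=> x0 x1 xt m8 rate; have [p0 p1] := andP p01; set s0 := (t %/ 3).+1.
have x0' := ltW x0.
have w0 : 0 <= wide_rate by rewrite mulr_ge0 ?expR_ge0.
pose r := wide_rate / x ^+ 5.
have r0 : 0 <= r by rewrite divr_ge0 // exprn_ge0.
have r1 : r <= 1.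
  move: rate; rewrite -/r; have : 1 <= expR 2 :> R by rewrite ltW // expR_gt1.
  by move: (expR 2) => z; nra.
apply: le_trans (_ : Pr p (vpairs T) (fun E => [exists (S : {set T} | (s0 <= #|S|)%N),
  [exists (W : {set T} | (#|W| <= 4 * #|S|)%N && (2 * #|W| <= n)%N), E :&: cross S (~: W) == set0]]) <= _).
  apply: le_Pr => // E sE /forallPn[S]; rewrite !negb_imply -leqNgt => /and3P[tS Sm SW].
  apply/existsP; exists S; apply/andP; split; first by rewrite /s0; move: tS; lia.
  apply/existsP; exists (S :|: nbrs E S); rewrite SW /=; apply/andP; split.
    by move: SW Sm m8; move: #|_ :|: _| #|S| n => *; lia.
  apply/eqP/setP => e; rewrite !inE; apply/negbTE/negP => /andP[eE /andP[_ /existsP[[a v] /= /and3P[aS vW /eqP ee]]]].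
  move: vW; rewrite in_setC in_setU negb_or => /andP[_]; rewrite in_set => /existsPn/(_ a).
  by rewrite aS /adj /= -ee eE.
apply: le_trans (Pr_exists _ _ _ p01) _.
apply: le_trans (_ : \sum_(S : {set T}) \sum_(W : {set T}) r ^+ s0 * x ^+ #|S| * x ^+ #|W| <= _).
  rewrite big_mkcond; apply: ler_sum => S _; case: ifP => sS; last first.
    by apply: sumr_ge0 => W _; rewrite !mulr_ge0 // exprn_ge0.
  apply: le_trans (Pr_exists _ _ _ p01) _.
  rewrite big_mkcond; apply: ler_sum => W _; case: ifP => [/andP[W4 Wn]|_]; last first.
    by rewrite !mulr_ge0 // exprn_ge0.
  apply: le_trans (Pr_no_cross S Wn) _.
  have -> : wide_rate = r * x * x ^+ 4 by rewrite /r; field; apply: lt0r_neq0.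
  move: (r) r0 r1 => z z0 z1; rewrite [(z * x * _) ^+ _]exprMn [(z * x) ^+ _]exprMn -exprM.
  apply: ler_pM; rewrite ?mulr_ge0 ?exprn_ge0 //.
    by rewrite ler_wpM2r ?exprn_ge0 // ler_wiXn2l.
  by rewrite ler_wiXn2l.
under eq_bigr => S _ do rewrite -mulr_sumr (sum_sets _ x0').
rewrite -mulr_suml -mulr_sumr (sum_sets _ x0') -mulrA -expr2.
apply: le_trans (_ : r ^+ s0 * expR 2 ^+ s0 <= _).
  rewrite ler_wpM2l ?exprn_ge0 // -expRM_natl -exprM.
  apply: le_trans (_ : expR ((n * 2)%:R * x) <= _).
    rewrite expRM_natl; apply: lerXn2r; rewrite ?nnegrE ?expR_ge0 ?addr_ge0 //; exact: expR_ge1Dx.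
  rewrite ler_expR natrM.
  have : t.+1%:R <= 3 * s0%:R :> R by rewrite -[3]/(3%:R) -natrM ler_nat /s0; lia.
  by move: xt; move: t.+1%:R s0%:R n%:R => a b c; lra.
have h : r * expR 2 <= 1 / 2 by rewrite mulrC.
have h0 : 0 <= r * expR 2 by apply: mulr_ge0 => //; apply: expR_ge0.
by rewrite -exprMn; apply: lerXn2r; rewrite ?nnegrE // (le_trans h0).
Qed.

Lemma Pr_independent k : Pr p (vpairs T) (fun E => [exists (I : {set T} | (k <= #|I|)%N),
   [forall x, forall y, [&& x \in I, y \in I & x != y] ==> ~~ adj E x y]])
  <= 2 ^+ n * expR (- (p / 4 * (k * (k - 1))%:R)).
Proof.
have [p0 p1] := andP p01; apply: le_trans (Pr_exists _ _ _ p01) _.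
have -> : 2 ^+ n = \sum_(I : {set T}) (1 : R).
  rewrite sumr_const -natrX; congr (_%:R); rewrite -[in LHS]cardsT -card_powerset.
  by apply: eq_card => A; rewrite !inE subsetT.
rewrite mulr_suml big_mkcond; apply: ler_sum => I _; rewrite mul1r; case: ifP => kI; last exact: expR_ge0.
apply: le_trans (_ : Pr p (vpairs T) (fun E => (#|E :&: cross I I| <= 0)%N) <= _).
  apply: le_Pr => // E sE /forallP ind; rewrite leqn0 cards_eq0; apply/eqP/setP => e; rewrite !inE.
  apply/negbTE/negP => /andP[eE /andP[e2 /existsP[[a v] /= /and3P[aI vI /eqP ee]]]].
  have av : a != v by move: e2; rewrite ee cards2; case: (a != v).
  by have := forallP (ind a) v; rewrite aI vI av /adj /= -ee eE.
apply: le_trans (Pr_few p01 _ (cross_vpairs _ _)) _; rewrite expr0 mul1r.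
apply: le_trans (powr_expR_upper _ _) _; first by lra.
rewrite ler_expR lerN2 (_ : p / 4 * (k * (k - 1))%:R = (k * (k - 1))%:R / 2 * (p / 2)); last by field.
rewrite ler_wpM2r ?divr_ge0 // ler_pdivrMr // -[2]/(2%:R) -natrM ler_nat mulnC [leqRHS]mulnC.
rewrite mulnC; apply: leq_trans (_ : #|I| * (#|I| - 1) <= _)%N; last exact: card_cross_ge.
by rewrite leq_mul // leq_sub2r.
Qed.

Lemma binom_le_bound j m : (m <= n)%N -> 1 <= d ->
  binom_le p j m <= j.+1%:R * (d ^+ j * expR (- ((m%:R - j%:R) * p))).
Proof.
move=> mn d1; have [p0 p1] := andP p01; have d0 : 0 <= d by apply: le_trans d1.
rewrite /binom_le -[j.+1 in leRHS]card_ord mulr_natl -sumr_const; apply: ler_sum => i _.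
have ij : (i <= j)%N by rewrite -ltnS.
have q0 : 0 <= 1 - p by rewrite subr_ge0.
apply: ler_pM; rewrite ?mulr_ge0 ?exprn_ge0 //.
  apply: le_trans (_ : d ^+ i <= _); last by rewrite ler_weXn2l.
  rewrite exprMn ler_wpM2r ?exprn_ge0 // -natrX ler_nat.
  apply: leq_trans (leq_pmulr _ (fact_gt0 i)) _; apply: leq_trans (bin_fact_le _ _) _.
  by case: (nat_of_ord i) => // k; rewrite leq_exp2r.
apply: le_trans (powr_expR_upper _ p1) _; rewrite ler_expR lerN2 ler_wpM2r //.
rewrite lerBlDr -natrD ler_nat; move: ij; lia.
Qed.

(** Bounds the chance of fewer than 18 neighbours when up to five vertices are set aside; 22 = 17 +
    5 pays for the shortened exponent, as p <= 1. *)
Definition small_rate : R := 18 * expR 22 * (d ^+ 17 * expR (- d)).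

Lemma binom_le_small l : (l <= 5)%N -> (5 <= n)%N -> 1 <= d -> binom_le p 17 (n - l) <= small_rate.
Proof.
move=> l5 n5 d1; have [p0 p1] := andP p01; have d0 : 0 <= d by apply: le_trans d1.
apply: le_trans (binom_le_bound _ (leq_subr _ _) d1) _; rewrite /small_rate -mulrA ler_wpM2l //.
rewrite mulrCA ler_wpM2l ?exprn_ge0 // -expRD ler_expR natrB ?(leq_trans l5) //.
have : l%:R <= 5 :> R by rewrite -[5]/(5%:R) ler_nat.
by move: l%:R n%:R => a N; nra.
Qed.

Lemma Ex_small : (5 <= n)%N -> 1 <= d ->
  Ex p (vpairs T) (fun E => #|small E|%:R) <= n%:R * small_rate.
Proof.
move=> n5 d1; rewrite /small Ex_card [leRHS]mulr_natl -sumr_const; apply: ler_sum => v _.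
have v1 : v \in [set v] by rewrite inE.
apply: le_trans (@binom_le_small 1 isT n5 d1).
have := @Pr_stars R T p 17 set0 [set v] [:: v] isT; rewrite cards0 expr0 mul1r expr1 cards1 => <-.
- by apply: le_Pr => // E sE; rewrite sub0set /= andbT ltnS; apply: leq_trans; apply: subset_leq_card; apply: subsetDl.
- by move=> x; rewrite inE => /eqP ->.
- exact: sub0set.
- by move=> e; rewrite inE.
Qed.

(** A crowded vertex is isolated or starts a path of one to four edges to another small vertex; the
    degrees at the two ends are read outside the path, which makes them independent of it. *)
Lemma Ex_crowded : (5 <= n)%N -> 1 <= d ->
  Ex p (vpairs T) (fun E => #|crowded E|%:R) <= n%:R * (e1 * expR (- d) + 4 * d ^+ 4 * small_rate ^+ 2).
Proof.
move=> n5 d1; have [p0 p1] := andP p01; have d0 : 0 <= d by apply: le_trans d1.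
pose good (l : 'I_4) (t : l.+2.-tuple T) E := [&& sorted (adj E) t, degree E (thead t) < 18 & degree E (last (thead t) t) < 18]%N.
have sr0 : 0 <= small_rate by rewrite !mulr_ge0 ?expR_ge0 ?exprn_ge0.
have goodP (l : 'I_4) (t : l.+2.-tuple T) : uniq t -> Pr p (vpairs T) (good l t) <= p ^+ l.+1 * small_rate ^+ 2.
  move=> ut; pose U := [set x in tval t].
  have cU : #|U| = l.+2 by rewrite -(size_tuple t) -(card_uniqP ut); apply: eq_card => x; rewrite inE.
  have hl : thead t != last (thead t) t.
    clear U cU; case: t ut => -[|x [|y s]] // st; have -> : thead (Tuple st) = x by [].
    by case/andP=> xs _; apply: contraNneq xs => xl; rewrite xl; apply: (mem_last y s).
  have us : uniq [:: thead t; last (thead t) t] by rewrite /= inE hl.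
  have := @Pr_stars R T p 17 (path_edges t) U _ us; rewrite card_path_edges // size_tuple cU => H.
  apply: le_trans (_ : p ^+ l.+1 * binom_le p 17 (n - l.+2) ^+ 2 <= _); last first.
    rewrite ler_wpM2l ?exprn_ge0 //; apply: lerXn2r; rewrite ?nnegrE ?binom_le_ge0 //.
    by apply: binom_le_small => //; exact: (ltn_ord l).
  rewrite -H.
  - apply: le_Pr => // E sE /and3P[st dh dl]; rewrite sub_path_edges st /= andbT.
    by apply/andP; split; [move: dh|move: dl]; rewrite ltnS; apply: leq_trans; apply: subset_leq_card; apply: subsetDl.
  - have lt : last (thead t) t \in tval t by case: (t) => -[|a s] // st; exact: (mem_last a s).
    by move=> x; rewrite !inE => /orP[]/eqP ->; rewrite ?mem_tnth.
  - exact: path_edges_vpairs.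
  - by move=> e /path_edges_mem/subsetP eS; apply/subsetP => x /eS xt; rewrite inE.
rewrite /crowded Ex_card.
apply: le_trans (_ : \sum_v (Pr p (vpairs T) (fun E => degree E v == 0%N) +
   \sum_(l < 4) \sum_(t : l.+2.-tuple T | uniq t && (thead t == v)) Pr p (vpairs T) (good l t)) <= _).
  apply: ler_sum => v _.
  apply: le_trans (_ : Pr p (vpairs T) (fun E => (degree E v == 0%N) || [exists (l : 'I_4 | true),
     [exists (t : l.+2.-tuple T | uniq t && (thead t == v)), good l t E]]) <= _).
    apply: le_Pr => // E sE /andP[vs /orP[->//|/existsP[u /and3P[us uv ub]]]]; apply/orP; right.
    have [s [ps ls uvs s4]] := gball_path ub.
    have s0 : (0 < size s)%N by case: s ls {ps uvs s4} => //= vu; rewrite vu eqxx in uv.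
    have l4 : ((size s).-1 < 4)%N by case: (size s) s0 s4.
    have st : size (v :: s) == (Ordinal l4).+2 by rewrite /= prednK.
    apply/existsP; exists (Ordinal l4) => /=; apply/existsP; exists (Tuple st).
    have th : thead (Tuple st) = v by [].
    rewrite uvs th eqxx /= /good th /= ps ls; move: vs us; rewrite !inE => -> ->; by [].
  apply: le_trans (Pr_or _ _ _ p01) _; rewrite lerD2l.
  apply: le_trans (Pr_exists _ _ _ p01) _; apply: ler_sum => l _.
  exact: Pr_exists.
rewrite big_split /= mulrDr; apply: lerD.
  rewrite [leRHS]mulr_natl -sumr_const; apply: ler_sum => v _; rewrite Pr_degree bin0 expr0 !mul1r subn0.
  apply: le_trans (powr_expR_upper _ p1) _; rewrite -expRD ler_expR.
  have -> : n = n.-1.+1 by rewrite prednK //; apply: leq_trans n5.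
  by rewrite -natr1 /=; move: n.-1%:R => N; lra.
rewrite exchange_big /=.
have -> : n%:R * (4 * d ^+ 4 * small_rate ^+ 2) = \sum_(l < 4) n%:R * (d ^+ 4 * small_rate ^+ 2).
  by rewrite sumr_const card_ord -mulr_natl; ring.
apply: ler_sum => l _.
apply: le_trans (_ : \sum_(t : l.+2.-tuple T) p ^+ l.+1 * small_rate ^+ 2 <= _).
  rewrite (exchange_big_dep (fun t : l.+2.-tuple T => uniq t)) /=; last by move=> v t _ /andP[].
  rewrite big_mkcond; apply: ler_sum => t _; case: ifP => ut; last by rewrite mulr_ge0 ?exprn_ge0.
  rewrite (big_pred1 (thead t)) ?goodP // => v; by rewrite /= ut eq_sym.
rewrite [leLHS]sumr_const card_tuple -[leLHS]mulr_natl natrX exprS -[leLHS]mulrA ler_wpM2l // mulrA -exprMn.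
by rewrite ler_wpM2r ?exprn_ge0 // ler_weXn2l.
Qed.

End Typical.

(** * Sprinkling *)

Section Sprinkling.
Local Open Scope ring_scope.
Variables (R : realType) (T : finType).
Implicit Types (E : {set {set T}}).

Definition independent_set k E : bool := [exists (I : {set T} | (k <= #|I|)%N),
   [forall x, forall y, [&& x \in I, y \in I & x != y] ==> ~~ adj E x y]].

(* Bounds twice the completion number once the skeleton has been closed up. *)
Definition deficiency E : nat := (num_degree E 1 + 12 * #|crowded E| + 4)%N.

Definition typical t m k (M : R) E : bool := [&& sparse_sets E t, wide E t m,
  (21 * #|small E| < t)%N, ~~ independent_set k E & (deficiency E)%:R < 2 * M].

(** The initial cost is at most [k] because it is bounded by the size of an independent set;
    [rounds] then bounds the chance that it is still positive after [t] rounds. *)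
Lemma typical_sprinkle (q : R) t1 m k N t (M g : R) E : (2 < #|T|)%N -> E \subset vpairs T ->
  0 <= q <= 1 -> (2 * N <= m.+1 ^ 2)%N -> (t1 + 2 <= #|T|)%N ->
  0 < t%:R * (1 - (1 - q) ^+ N) -> k%:R <= g * (t%:R * (1 - (1 - q) ^+ N)) ->
  typical t1 m k M E ->
  1 - g <= Pr (1 - (1 - q) ^+ t) (vpairs T) (fun A => (mu (A :|: E))%:R <= M).
Proof.
move=> T3 sE q01 Nm t1n tp kg /and5P[sp wd st ind def]; have [q0 q1] := andP q01.
have r01 : 0 <= 1 - (1 - q) ^+ t <= 1.
  have H : 0 <= (1 - q) ^+ t by rewrite exprn_ge0 // subr_ge0.
  have H' : (1 - q) ^+ t <= 1 by rewrite exprn_ile1 ?subr_ge0 // gerBl.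
  by rewrite subr_ge0 H' gerBl.
have [|V [Q [Y [J [[Yf YV inf V1 exa] expE cst]]]]] := structure sE sp wd st.
  by move: st t1n; move: #|small E| #|T|; lia.
set b := 1 - (1 - q) ^+ t in r01 *.
have H : Pr b (vpairs T) (fun A => (0 < mincost V J (E :|: A))%N) <= g.
  rewrite -(@ler_pM2l _ (t%:R * (1 - (1 - q) ^+ N))) // [leRHS]mulrC; apply: le_trans kg.
  apply: le_trans (rounds Yf YV inf V1 exa t q01 Nm expE) _; rewrite ler_nat.
  have [I mI indI] := mincost_independent exa E; apply: leq_trans mI _.
  rewrite leqNgt; apply: contra ind => kI; apply/existsP; exists I; rewrite ltnW //=.
  by apply/forallP => x; apply/forallP => y; apply/implyP => /and3P[]; apply: indI.
have one : Pr b (vpairs T) (fun=> true) = 1 by rewrite /Pr Ex_cst.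
rewrite lerBlDr; apply: (@le_trans _ _ (Pr b (vpairs T) (fun=> true))); first by rewrite one.
apply: (@le_trans _ _ (Pr b (vpairs T) (fun A => (mu (A :|: E))%:R <= M) +
  Pr b (vpairs T) (fun A => (0 < mincost V J (E :|: A))%N))); last by rewrite lerD2l.
apply: le_trans (Pr_or _ _ _ r01); apply: le_Pr => // A sA _.
rewrite setUC; case: posnP => [m0|]; last by rewrite orbT.
rewrite orbF -(@ler_pM2l _ 2) //; apply: le_trans (ltW def).
rewrite -[2]/(2%:R) -natrM ler_nat.
have sEA : E :|: A \subset vpairs T by rewrite subUset sE.
have := mu_of_mincost T3 (subsetUl E A) sEA exa m0; move: cst; rewrite /deficiency.
by move: #|J :\: E| #|~: V| (mu _) (num_degree _ _) #|crowded E|; clear; lia.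
Qed.

Lemma mu_sprinkle (p q : R) t1 m k N t (M g : R) : (2 < #|T|)%N ->
  0 <= p <= 1 -> 0 <= q <= 1 -> (2 * N <= m.+1 ^ 2)%N -> (t1 + 2 <= #|T|)%N ->
  0 < t%:R * (1 - (1 - q) ^+ N) -> k%:R <= g * (t%:R * (1 - (1 - q) ^+ N)) -> g <= 1 ->
  (1 - g) * (1 - (Pr p (vpairs T) (fun E => ~~ sparse_sets E t1) +
     (Pr p (vpairs T) (fun E => ~~ wide E t1 m) +
     (Pr p (vpairs T) (fun E => (t1 <= 21 * #|small E|)%N) +
     (Pr p (vpairs T) (independent_set k) +
      Pr p (vpairs T) (fun E => 2 * M <= (deficiency E)%:R))))))
  <= Pr (1 - (1 - q) ^+ t * (1 - p)) (vpairs T) (fun E => (mu E)%:R <= M).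
Proof.
move=> T3 p01 q01 Nm t1n tp kg g1.
have -> : 1 - (1 - q) ^+ t * (1 - p) = 1 - (1 - (1 - (1 - q) ^+ t)) * (1 - p) by rewrite subKr.
rewrite /Pr -Ex_union.
apply: le_trans (_ : Ex p (vpairs T) (fun E => (1 - g) * (typical t1 m k M E)%:R) <= _); last first.
  apply: le_Ex => // E sE; case: (boolP (typical _ _ _ _ _)) => ty; last first.
    have [q0 q1] := andP q01.
    rewrite mulr0; apply: Ex_ge0 => //.
    have H : 0 <= (1 - q) ^+ t by rewrite exprn_ge0 // subr_ge0.
    have H' : (1 - q) ^+ t <= 1 by rewrite exprn_ile1 ?subr_ge0 // gerBl.
    by rewrite subr_ge0 H' gerBl.
  by rewrite mulr1; apply: (typical_sprinkle T3 sE q01 Nm t1n tp kg ty).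
rewrite ExZl ler_wpM2l ?subr_ge0 //.
have -> : Ex p (vpairs T) (fun E => (typical t1 m k M E)%:R) = 1 - Pr p (vpairs T) (fun E => ~~ typical t1 m k M E).
  by rewrite PrC subKr.
rewrite lerD2l lerN2.
apply: le_trans (_ : Pr p (vpairs T) (fun E => [|| ~~ sparse_sets E t1, ~~ wide E t1 m,
  (t1 <= 21 * #|small E|)%N, independent_set k E | 2 * M <= (deficiency E)%:R]) <= _).
  apply: le_Pr => // E _; rewrite /typical !negb_and -leqNgt negbK -leNgt //.
apply: le_trans (Pr_or _ _ _ p01) _; rewrite lerD2l.
apply: le_trans (Pr_or _ _ _ p01) _; rewrite lerD2l.
apply: le_trans (Pr_or _ _ _ p01) _; rewrite lerD2l.
exact: Pr_or.
Qed.

End Sprinkling.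

Section Decay.
Local Open Scope ring_scope.
Variable R : realType.
Implicit Types (d : R).

Lemma exp_decay (C e : R) a c : 0 <= C -> 0 < e -> (0 < c)%N ->
  exists2 D : R, 1 <= D & forall d, D <= d -> C * (d ^+ a * expR (- (d / c%:R))) <= e.
Proof.
move=> C0 e0 c0; have c0' : 0 < c%:R :> R by rewrite ltr0n.
pose A : R := (a.+1%:R * c%:R) ^+ a.+1; have A0 : 0 <= A by rewrite exprn_ge0 // mulr_ge0.
exists (1 + C * A / e); first by rewrite lerDl divr_ge0 ?mulr_ge0 // ltW.
move=> d Dd; have d0 : 0 < d by apply: lt_le_trans Dd; rewrite ltr_pwDl // divr_ge0 ?mulr_ge0 // ltW.
apply: le_trans (_ : C * (A / d) <= _); last first.
  rewrite mulrA ler_pdivrMr // [leRHS]mulrC -ler_pdivrMr //; apply: le_trans Dd; by rewrite lerDr.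
rewrite ler_wpM2l //; apply: le_trans (_ : d ^+ a * (a.+1%:R / (d / c%:R)) ^+ a.+1 <= _).
  by rewrite ler_wpM2l ?exprn_ge0 ?(ltW d0) //; apply: expRN_poly; rewrite divr_gt0.
have -> : a.+1%:R / (d / c%:R) = (a.+1%:R * c%:R) / d by field; rewrite !lt0r_neq0.
rewrite expr_div_n -/A exprS le_eqVlt; apply/orP; left; apply/eqP; field.
by rewrite expf_neq0 lt0r_neq0.
Qed.

Lemma bernoulli (q : R) t : 0 <= q <= 1 -> 1 - t%:R * q <= (1 - q) ^+ t.
Proof.
case/andP=> q0 q1; elim: t => [|t IH]; first by rewrite mul0r subr0 expr0.
rewrite exprS -natr1; have r0 : 0 <= 1 - q by rewrite subr_ge0.
have := ler_wpM2l r0 IH; apply: le_trans; have : 0 <= t%:R * q ^+ 2 by rewrite mulr_ge0 ?exprn_ge0.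
by rewrite expr2; move: t%:R => z; nra.
Qed.

Lemma expR_le_inv (x : R) : 0 <= x <= 1 / 2 -> expR x <= 1 + 2 * x.
Proof.
case/andP=> x0 x1; have := expR_upper x; rewrite expRN => H.
have y0 : 0 < 1 - x by lra.
have e0 := expR_gt0 x; have : (1 - x) * expR x <= 1 by rewrite -ler_pdivlMr // mul1r.
by move: (expR x) e0 => z; nra.
Qed.

End Decay.

(** * Parameters of the sprinkling for growing degree *)

Module SparseRange.

Local Open Scope ring_scope.

(* The explicit inequalities used for large d; given eps, those from [sr_20] on, except [sr_n], hold
   for all large d. *)
Record sparse_regime (R : realType) (eps d : R) (n : nat) : Prop := SparseRegime {
  sr_eps : 0 < eps <= 1;
  sr_20 : 20 <= d;
  sr_n : expR (2 * d) <= n%:R;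
  sr_kap : 2 * expR (- d) <= eps / 16 / 46 / 46;
  sr_y : 64 * expR (- d) <= eps;
  sr_sparse : 12 * expR 1 ^+ 3 * (d ^+ 2 * expR (- d)) <= eps / 32;
  sr_wide : expR 2 * expR 1 ^+ 2 * (12 * expR 1 ^+ 3) ^+ 5 * (d ^+ 10 * expR (- (d / 8))) <= 1 / 2;
  sr_indep : 16 / (eps / 16 / 46 / 46) ^+ 2 + 1 <= d;
  sr_small : 168 * expR 1 ^+ 3 * (18 * expR 22 * expR 1) * (d ^+ 19 * expR (- d)) <= eps / 32;
  sr_crowd1 : 192 * expR 1 ^+ 2 <= eps * d;
  sr_crowd2 : 48 * (18 * expR 22 * expR 1) ^+ 2 * (d ^+ 38 * expR (- d)) <= eps / 16;
  sr_eta : 2 * (d * expR (- d)) <= eps / 16 }.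

Section Regime.
Variables (R : realType) (eps d : R) (n : nat).
Hypothesis SR : sparse_regime eps d n.
Local Notation N := (n%:R : R).
Local Notation e1 := (expR 1 : R).
Local Notation y := (expR (- d)).
(** [eta] is the average degree spent on sprinkling, and [kap] bounds independent sets as a fraction
    of n. The factor 46^2 = 2116 is large enough for [eta * N] rounds, each successful with
    probability at least 1/257, to exhaust that cost with probability at least 1/2. *)
Local Definition eta : R := eps / 16.
Local Definition kap : R := eps / 16 / 46 / 46.

Lemma eps0 : 0 < eps. Proof. by have /andP[] := sr_eps SR. Qed.
#[local] Hint Resolve eps0 : core.
Lemma eps1 : eps <= 1. Proof. by have /andP[] := sr_eps SR. Qed.
Lemma d20 : 20 <= d. Proof. exact: sr_20 SR. Qed.
Lemma etaE : eta = eps / 16. Proof. by []. Qed.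
Lemma eta0 : 0 < eta. Proof. by rewrite divr_gt0. Qed.
#[local] Hint Resolve eta0 : core.
Lemma kap0 : 0 < kap. Proof. by rewrite /kap !divr_gt0. Qed.
#[local] Hint Resolve kap0 : core.
Lemma d0 : 0 < d. Proof. by apply: lt_le_trans d20; rewrite ltr0n. Qed.
#[local] Hint Resolve d0 : core.
Lemma y0 : 0 < y. Proof. exact: expR_gt0. Qed.
#[local] Hint Resolve y0 : core.
Lemma ee0 : 0 < e1. Proof. exact: expR_gt0. Qed.
#[local] Hint Resolve ee0 : core.
Lemma ee1 : 1 <= e1. Proof. by rewrite ltW // expR_gt1. Qed.
#[local] Hint Resolve ee1 : core.

Lemma N0 : 0 < N. Proof. by apply: lt_le_trans (sr_n SR); apply: expR_gt0. Qed.
#[local] Hint Resolve N0 : core.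

Lemma Ny : 1 <= N * y * y.
Proof.
have : expR (2 * d) * (y * y) = 1 by rewrite -!expRD (_ : 2 * d + (- d + - d) = 0) ?expR0 //; ring.
move=> H; apply: le_trans (_ : expR (2 * d) * (y * y) <= _); first by rewrite H.
by rewrite -[leRHS]mulrA ler_wpM2r ?(sr_n SR) // mulr_ge0 // ltW.
Qed.

Lemma y1 : y <= 1. Proof. by rewrite -expR0 ler_expR oppr_le0 ltW. Qed.
#[local] Hint Resolve y1 : core.

Ltac blra := move: eps0 eps1 d20 y0 y1 ee1; rewrite ?etaE; lra.

Lemma invN : 1 / N <= y * y.
Proof. by rewrite ler_pdivrMr // mulrC mulrA; exact: Ny. Qed.

Lemma Ny1 : 1 <= N * y.
Proof. by apply: le_trans Ny _; rewrite ler_piMr // mulr_ge0 ?(ltW N0) ?(ltW y0). Qed.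

Lemma n40 : (41 <= n)%N.
Proof. by rewrite -(ler_nat R); apply: le_trans (sr_n SR); apply: le_trans (expR_ge1Dx _); blra. Qed.

(** About [eta * N] rounds of density N^-2 add degree [eta] in total. Expansion up to [m] provides
    [K] boosters, about n^2 / 128, so a round hits one with probability bounded below; [t1] is
    chosen to meet the condition of [Pr_sparse_sets]. *)
Local Definition q : R := 1 / N ^+ 2.
Local Definition t := Num.truncn (eta * N).
Local Definition m := (n %/ 8)%N.
Local Definition K := ((m.+1 ^ 2) %/ 2)%N.
Local Definition t1 := Num.truncn (N / (4 * e1 ^+ 3 * d ^+ 2)).
Local Definition k := (Num.truncn (kap * N)).+1.

Lemma q01 : 0 <= q <= 1.
Proof.
rewrite divr_ge0 ?exprn_ge0 //= ler_pdivrMr ?exprn_gt0 // mul1r exprn_ege1 // ler1n.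
exact: leq_trans n40.
Qed.

Lemma truncP (z : R) : 0 <= z -> (Num.truncn z)%:R <= z /\ z < (Num.truncn z).+1%:R.
Proof. by move=> z0; have /andP[] := truncn_itv z0. Qed.

Lemma etaN : 2 <= eta * N.
Proof.
have h : 2 * y <= eta by apply: le_trans (sr_kap SR) _; blra.
apply: le_trans (_ : 2 * y * N <= _); last by rewrite ler_wpM2r // ltW.
by rewrite -mulrA [y * N]mulrC; have := Ny1; blra.
Qed.

Lemma kapN : 2 <= kap * N.
Proof.
apply: le_trans (_ : 2 * y * N <= _); last by rewrite ler_wpM2r ?(ltW N0) // (sr_kap SR).
by rewrite -mulrA [y * N]mulrC; have := Ny1; blra.
Qed.

Lemma t_ge : eta * N / 2 <= t%:R.
Proof.
have [_] := @truncP (eta * N) (le_trans (ler0n R 2) etaN); rewrite -[t.+1%:R]natr1; have := etaN; move: (eta * N) => z; blra.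
Qed.

Lemma t_le : t%:R <= eta * N.
Proof. by have [] := @truncP (eta * N) (le_trans (ler0n R 2) etaN). Qed.

Lemma Kq : 1 / 256 <= K%:R * q.
Proof.
have H : (n ^ 2 <= 64 * (2 * K + 1))%N.
  apply: leq_trans (_ : (8 * m.+1) ^ 2 <= _)%N; first by rewrite leq_exp2r // /m; clear; lia.
  by rewrite expnMn /K; move: (m.+1 ^ 2)%N => z; clear; lia.
rewrite /q mulrA mulr1 ler_pdivlMr ?exprn_gt0 //.
have H' : N ^+ 2 <= 64 * (2 * K%:R + 1).
  by move: H; rewrite -(ler_nat R) natrX natrM natrD natrM.
have : 41 ^+ 2 <= N ^+ 2 by apply: lerXn2r; rewrite ?nnegrE ?ler_nat ?n40.
by move: H'; move: (N ^+ 2) K%:R => a b; blra.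
Qed.

Lemma ps_ge : 1 / 257 <= 1 - (1 - q) ^+ K.
Proof.
have /andP[q0 q1] := q01.
have : (1 - q) ^+ K <= (1 + 1 / 256)^-1.
  apply: le_trans (powr_expR_upper _ q1) _; rewrite expRN lef_pV2 ?posrE ?expR_gt0 //; last by blra.
  by apply: le_trans (expR_ge1Dx _); rewrite lerD2l Kq.
by rewrite (_ : (1 + 1 / 256)^-1 = 256 / 257 :> R); [blra|field].
Qed.

Lemma tps : 0 < t%:R * (1 - (1 - q) ^+ K) /\ k%:R <= 1 / 2 * (t%:R * (1 - (1 - q) ^+ K)).
Proof.
have t0 : 0 < t%:R :> R by apply: lt_le_trans t_ge; have := etaN; blra.
have pg := ps_ge; split; first by rewrite mulr_gt0 //; apply: lt_le_trans pg; blra.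
have [kl _] := @truncP (kap * N) (le_trans (ler0n R 2) kapN).
have : eta * N / 2 * (1 / 257) <= t%:R * (1 - (1 - q) ^+ K).
  by apply: ler_pM => //; [have := etaN; blra|blra|exact: t_ge].
rewrite /k -[(Num.truncn _).+1%:R]natr1; move: kl kapN; rewrite -[kap]/(eta / 46 / 46).
by move: (t%:R * (1 - (1 - q) ^+ K)) (Num.truncn _)%:R (eta) => b c f; blra.
Qed.

Local Definition p : R := d / N.
Local Definition w : R := (1 - q) ^+ t.
(* G(n, p) is the union of G(n, p1) and t rounds of G(n, q). *)
Local Definition p1 : R := 1 - (1 - p) / w.

Lemma pN : p <= d * y.
Proof. by rewrite /p ler_pdivrMr // -mulrA ler_peMr ?(ltW d0) // mulrC Ny1. Qed.

Lemma p_half : p <= 1 / 2.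
Proof. by apply: le_trans pN _; have := sr_eta SR; blra. Qed.

Lemma w_bounds : 1 - eta / N <= w <= 1.
Proof.
have /andP[q0 q1] := q01; rewrite /w exprn_ile1 ?subr_ge0 ?gerBl // andbT.
apply: le_trans (bernoulli _ q01); rewrite lerD2l lerN2 /q mulrA mulr1 ler_pdivrMr ?exprn_gt0 //.
by rewrite expr2 mulrA divfK ?lt0r_neq0 // t_le.
Qed.

Lemma p1_bounds : p - eta / N <= p1 <= p.
Proof.
have /andP[wl wu] := w_bounds.
have e2 : eta / N <= p by rewrite /p ler_wpM2r ?invr_ge0 ?(ltW N0) //; blra.
have e0 : 0 <= eta / N by rewrite divr_ge0 // ltW.
have w0 : 0 < w by apply: lt_le_trans wl; have := p_half; move: e2; blra.
have p0 : 0 <= 1 - p by have := p_half; blra.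
apply/andP; split; rewrite /p1.
  rewrite lerBrDr addrC -lerBrDr ler_pdivrMr //; move: wl e2 e0 p0.
  by move: (eta / N) (w) (p) => a b c; nra.
rewrite lerBlDr addrC -lerBlDr ler_pdivlMr //; by move: wl wu p0; move: (w) (p) => a b; nra.
Qed.

Lemma p1_eq : 1 - (1 - q) ^+ t * (1 - p1) = p.
Proof.
have /andP[wl wu] := w_bounds; have w0 : w != 0.
  have e2 : eta / N <= p by rewrite /p ler_wpM2r ?invr_ge0 ?(ltW N0) //; blra.
  by apply: lt0r_neq0; apply: lt_le_trans wl; have := p_half; move: e2; blra.
by rewrite -/w /p1 subKr mulrC divfK // subKr.
Qed.

Lemma p1_01 : 0 <= p1 <= 1.
Proof.
have /andP[l u] := p1_bounds; apply/andP; split; last by apply: le_trans u _; have := p_half; blra.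
apply: le_trans l; rewrite /p -mulrBl divr_ge0 ?(ltW N0) //; blra.
Qed.

Lemma d1_bounds : d - eta <= N * p1 <= d.
Proof.
have /andP[l u] := p1_bounds; apply/andP; split.
  by have := ler_wpM2l (ltW N0) l; rewrite /p -mulrBl mulrC divfK // lt0r_neq0.
by have := ler_wpM2l (ltW N0) u; rewrite /p mulrC [N * _]mulrC divfK // lt0r_neq0.
Qed.

Lemma d1_1 : 1 <= N * p1.
Proof. by have /andP[l _] := d1_bounds; apply: le_trans l; blra. Qed.

Lemma yd1 : expR (- (N * p1)) <= e1 * y.
Proof. by rewrite -expRD ler_expR; have /andP[l _] := d1_bounds; move: l; blra. Qed.

Lemma np1 : N * p1 ^+ 2 <= d ^+ 2 / N.
Proof.
have /andP[_ u] := d1_bounds; rewrite ler_pdivlMr //.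
have -> : N * p1 ^+ 2 * N = (N * p1) ^+ 2 by ring.
by apply: lerXn2r; rewrite ?nnegrE ?(ltW d0) // (le_trans ler01 d1_1).
Qed.

Lemma t1_scale : 0 < 4 * e1 ^+ 3 * d ^+ 2.
Proof. by apply: mulr_gt0; [apply: mulr_gt0 => //|]; apply: exprn_gt0. Qed.
#[local] Hint Resolve t1_scale : core.

Lemma t1_le : t1%:R <= N / (4 * e1 ^+ 3 * d ^+ 2).
Proof. by have [] := @truncP (N / (4 * e1 ^+ 3 * d ^+ 2)) (divr_ge0 (ltW N0) (ltW t1_scale)). Qed.

Lemma t1_gt : N / (4 * e1 ^+ 3 * d ^+ 2) < t1.+1%:R.
Proof. by have [] := @truncP (N / (4 * e1 ^+ 3 * d ^+ 2)) (divr_ge0 (ltW N0) (ltW t1_scale)). Qed.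

Lemma t1_ge : N / (8 * e1 ^+ 3 * d ^+ 2) <= t1%:R.
Proof.
have big : 2 <= N / (4 * e1 ^+ 3 * d ^+ 2).
  rewrite ler_pdivlMr //; have z0 : 0 <= e1 ^+ 3 * d ^+ 2 * y by rewrite !mulr_ge0 ?exprn_ge0 ?(ltW ee0) ?(ltW d0) ?(ltW y0).
  have h : 2 * (4 * e1 ^+ 3 * d ^+ 2) * y <= 1.
    have := sr_sparse SR; move: z0.
    have -> : 2 * (4 * e1 ^+ 3 * d ^+ 2) * y = 8 * (e1 ^+ 3 * d ^+ 2 * y) by ring.
    have -> : 12 * e1 ^+ 3 * (d ^+ 2 * y) = 12 * (e1 ^+ 3 * d ^+ 2 * y) by ring.
    by move: (e1 ^+ 3 * d ^+ 2 * y) => z; blra.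
  apply: le_trans (_ : 2 * (4 * e1 ^+ 3 * d ^+ 2) * (N * y) <= _).
    by rewrite ler_peMr ?Ny1 // mulr_ge0 ?(ltW t1_scale).
  by rewrite mulrCA ler_piMr ?(ltW N0).
have := t1_gt; move: big; rewrite -[t1.+1%:R]natr1.
have -> : N / (8 * e1 ^+ 3 * d ^+ 2) = N / (4 * e1 ^+ 3 * d ^+ 2) / 2 by field; rewrite !lt0r_neq0.
by move: (N / _) t1%:R => a b; blra.
Qed.

Lemma fail_sparse : Pr p1 (vpairs 'I_n) (fun E => ~~ sparse_sets E t1) <= eps / 32.
Proof.
have H := @Pr_sparse_sets R 'I_n p1 p1_01 t1; rewrite card_ord in H.
have A1 : e1 ^+ 3 * (N * p1 ^+ 2) <= e1 ^+ 3 * (d ^+ 2 / N) by rewrite ler_wpM2l ?exprn_ge0 ?(ltW ee0) ?np1.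
apply: le_trans (H _) _.
  apply: le_trans (_ : e1 ^+ 3 * (d ^+ 2 / N) * (N / (4 * e1 ^+ 3 * d ^+ 2)) <= _).
    apply: ler_pM => //; last exact: t1_le.
    by rewrite mulr_ge0 ?exprn_ge0 ?(ltW ee0) // mulr_ge0 ?(ltW N0) // exprn_ge0 //; have /andP[] := p1_01.
  by rewrite le_eqVlt; apply/orP; left; apply/eqP; field; rewrite !lt0r_neq0.
apply: le_trans (_ : 2 * (e1 ^+ 3 * (d ^+ 2 * y)) <= _).
  rewrite ler_wpM2l //; apply: le_trans A1 _; rewrite ler_wpM2l ?exprn_ge0 ?(ltW ee0) // ler_wpM2l ?exprn_ge0 ?(ltW d0) //.
  by rewrite -div1r; apply: le_trans invN _; rewrite ler_piMr // ltW.
have := sr_sparse SR; rewrite -mulrA; have : 0 <= e1 ^+ 3 * (d ^+ 2 * y) by rewrite !mulr_ge0 ?exprn_ge0 ?(ltW ee0) ?(ltW d0) ?(ltW y0).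
by move: (e1 ^+ 3 * _) => z; blra.
Qed.

Lemma fail_wide : Pr p1 (vpairs 'I_n) (fun E => ~~ wide E t1 m) <= eps / 32.
Proof.
pose x := (12 * e1 ^+ 3 * d ^+ 2)^-1.
have sc : 0 < 12 * e1 ^+ 3 * d ^+ 2 by apply: mulr_gt0; [apply: mulr_gt0 => //|]; apply: exprn_gt0.
have sc1 : 1 <= 12 * e1 ^+ 3 * d ^+ 2.
  have : 1 <= e1 ^+ 3 * d ^+ 2 by apply: mulr_ege1; apply: exprn_ege1 => //; move: d20; blra.
  by rewrite -mulrA; move: (e1 ^+ 3 * d ^+ 2) => z; blra.
have x01 : 0 < x <= 1 by rewrite invr_gt0 sc invf_le1.
have H := @Pr_wide R 'I_n p1 p1_01 t1 m x x01; rewrite /wide_rate card_ord in H.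
apply: le_trans (H _ _ _) _.
- apply: le_trans (ltW t1_gt); rewrite le_eqVlt; apply/orP; left; apply/eqP; rewrite /x; field.
  by rewrite !lt0r_neq0.
- by rewrite /m mulnC leq_trunc_div.
- apply: le_trans (sr_wide SR); rewrite /x exprVn invrK.
  have -> : expR 2 * e1 ^+ 2 * (12 * e1 ^+ 3) ^+ 5 * (d ^+ 10 * expR (- (d / 8))) =
    expR 2 * (e1 * (e1 * expR (- (d / 8))) * (12 * e1 ^+ 3 * d ^+ 2) ^+ 5) by ring.
  rewrite ler_wpM2l ?expR_ge0 // ler_wpM2r ?exprn_ge0 ?(ltW sc) // ler_wpM2l ?(ltW ee0) // -expRD ler_expR.
  by have /andP[l _] := d1_bounds; move: l; blra.
apply: le_trans (_ : ((t1 %/ 3).+1%:R)^-1 <= _).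
  rewrite expr_div_n expr1n div1r lef_pV2 ?posrE ?exprn_gt0 ?ltr0n // -natrX ler_nat; exact/ltnW/ltn_expl.
apply: le_trans (_ : 12 * e1 ^+ 3 * d ^+ 2 / N <= _).
  rewrite -[leRHS]invrK lef_pV2 ?posrE ?ltr0n ?invr_gt0 ?divr_gt0 // invf_div.
  have -> : N / (12 * e1 ^+ 3 * d ^+ 2) = N / (4 * e1 ^+ 3 * d ^+ 2) / 3 by field; rewrite !lt0r_neq0.
  rewrite ler_pdivrMr //; apply: le_trans (ltW t1_gt) _.
  by rewrite -[3]/(3%:R) -natrM ler_nat; lia.
apply: le_trans (sr_sparse SR).
have -> : 12 * e1 ^+ 3 * d ^+ 2 / N = 12 * e1 ^+ 3 * (d ^+ 2 * (1 / N)) by field; rewrite lt0r_neq0.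
rewrite ler_wpM2l ?(mulr_ge0 _ (exprn_ge0 3 (ltW ee0))) // ler_wpM2l ?(exprn_ge0 2 (ltW d0)) //.
by apply: le_trans invN _; rewrite ler_piMr // ltW.
Qed.

Lemma fail_independent : Pr p1 (vpairs 'I_n) (independent_set k) <= eps / 32.
Proof.
apply: le_trans (@Pr_independent R 'I_n p1 p1_01 k) _; rewrite card_ord.
have [_ kg] := @truncP (kap * N) (le_trans (ler0n R 2) kapN).
have big : 2 * N <= p1 / 4 * (k * (k - 1))%:R.
  have k1 : kap * N / 2 <= (k - 1)%:R by rewrite /k subn1 /=; move: kg; have := kapN; rewrite -[(Num.truncn _).+1%:R]natr1; move: (kap * N) => z; blra.
  have kk : kap * N * (kap * N / 2) <= (k * (k - 1))%:R.
    by rewrite natrM; apply: ler_pM => //; [| |apply: ltW]; have := kapN; move: kg; rewrite /k; move: (kap * N) => z; blra.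
  have p1d : (d - 1) / N <= p1.
    by rewrite ler_pdivrMr // mulrC; have /andP[l _] := d1_bounds; apply: le_trans l; blra.
  have d1n : 0 <= (d - 1) / N by rewrite divr_ge0 ?(ltW N0) //; blra.
  apply: le_trans (_ : (d - 1) / N / 4 * (kap * N * (kap * N / 2)) <= _).
    have -> : (d - 1) / N / 4 * (kap * N * (kap * N / 2)) = (d - 1) * kap ^+ 2 / 8 * N by field; exact: lt0r_neq0.
    rewrite ler_wpM2r ?(ltW N0) // ler_pdivlMr //; have := sr_indep SR; rewrite -/kap -lerBrDr ler_pdivrMr ?exprn_gt0 //; blra.
  apply: ler_pM => //; first by rewrite divr_ge0.
    by rewrite !mulr_ge0 ?invr_ge0 // ltW.
  by rewrite ler_wpM2r ?invr_ge0.
apply: le_trans (_ : expR N * expR (- (2 * N)) <= _).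
  apply: ler_pM; rewrite ?exprn_ge0 ?expR_ge0 //; last by rewrite ler_expR lerN2.
  rewrite -[N]mulr1 expRM_natl; apply: lerXn2r; rewrite ?nnegrE ?expR_ge0 //.
  by apply: le_trans (expR_ge1Dx _); blra.
rewrite -expRD (_ : N - 2 * N = - N); last by ring.
have : expR (- N) <= y by rewrite ler_expR lerN2; apply: le_trans (sr_n SR); apply: le_trans (expR_ge1Dx _); blra.
by have := sr_y SR; blra.
Qed.

Lemma small_rate_le : small_rate 'I_n p1 <= 18 * expR 22 * e1 * (d ^+ 17 * y).
Proof.
rewrite /small_rate card_ord; have /andP[_ u] := d1_bounds.
have -> : 18 * expR 22 * e1 * (d ^+ 17 * y) = 18 * expR 22 * (d ^+ 17 * (e1 * y)) by ring.
rewrite ler_wpM2l ?mulr_ge0 ?expR_ge0 //; apply: ler_pM; rewrite ?expR_ge0 ?exprn_ge0 ?(le_trans ler01 d1_1) ?yd1 //.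
by apply: lerXn2r; rewrite ?nnegrE ?(ltW d0) // (le_trans ler01 d1_1).
Qed.

Lemma t1_pos : 0 < t1%:R :> R.
Proof. by apply: lt_le_trans t1_ge; apply: divr_gt0 => //; apply: mulr_gt0; [apply: mulr_gt0 => //|]; apply: exprn_gt0. Qed.
#[local] Hint Resolve t1_pos : core.

Lemma fail_small : Pr p1 (vpairs 'I_n) (fun E => (t1 <= 21 * #|small E|)%N) <= eps / 32.
Proof.
have n5 : (5 <= #|'I_n|)%N by rewrite card_ord; apply: leq_trans n40.
have H := @Ex_small R 'I_n p1 p1_01 n5; rewrite card_ord in H.
have {}H := H d1_1.
apply: le_trans (_ : Pr p1 (vpairs 'I_n) (fun E => t1%:R / 21 <= #|small E|%:R :> R) <= _).
  by apply: le_Pr p1_01 _ => E _; rewrite ler_pdivrMr // -[21]/(21%:R) -natrM ler_nat mulnC.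
have c0 : 0 < t1%:R / 21 :> R by rewrite divr_gt0.
apply: le_trans (markov_Pr p1_01 c0 _) _ => //.
rewrite invf_div mulrCA; apply: le_trans (sr_small SR).
apply: le_trans (_ : 21 * (N * (18 * expR 22 * e1 * (d ^+ 17 * y)) * (8 * e1 ^+ 3 * d ^+ 2 / N)) <= _).
  rewrite ler_wpM2l //; apply: ler_pM.
  - by apply: Ex_ge0 p1_01 _ => E _.
  - by rewrite invr_ge0 ltW.
  - by apply: le_trans H _; rewrite ler_wpM2l ?(ltW N0) // small_rate_le.
  - by rewrite -[leRHS]invrK lef_pV2 ?posrE ?invr_gt0 ?divr_gt0 // ?invf_div ?t1_ge //; apply: mulr_gt0; [apply: mulr_gt0 => //|]; apply: exprn_gt0.
rewrite le_eqVlt; apply/orP; left; apply/eqP; field; exact: lt0r_neq0.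
Qed.

(** Pendant vertices give the main term d e^-d n; the crowded ones are of smaller order, and the
    constant 4 is absorbed because n e^-2d >= 1. *)
Lemma deficiency_mean : Ex p1 (vpairs 'I_n) (fun E => (deficiency E)%:R) <= (1 + eps / 2) * (d * y * N).
Proof.
have n5 : (5 <= #|'I_n|)%N by rewrite card_ord; apply: leq_trans n40.
have H := @Ex_crowded R 'I_n p1 p1_01 n5; rewrite card_ord in H.
have {}H := H d1_1; have /andP[dl du] := d1_bounds; have /andP[p10 p11] := p1_01.
have -> : Ex p1 (vpairs 'I_n) (fun E => (deficiency E)%:R) =
  Ex p1 (vpairs 'I_n) (fun E => (num_degree E 1)%:R) + 12 * Ex p1 (vpairs 'I_n) (fun E => #|crowded E|%:R) + 4.
  rewrite -ExZl -ExDf -[4 in RHS](Ex_cst p1 (vpairs 'I_n)) -ExDf; apply: eq_Ex => E _.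
  by rewrite /deficiency 2!natrD natrM.
have H1 : Ex p1 (vpairs 'I_n) (fun E => (num_degree E 1)%:R) <= (1 + eps / 4) * (d * y * N).
  rewrite Ex_num_degree card_ord bin1 expr1.
  apply: le_trans (_ : N * (d * expR (- ((n - 2)%:R * p1))) <= _).
    have -> : (n.-1 - 1 = n - 2)%N by rewrite -subn1 -subnDA.
    rewrite ler_wpM2l ?(ltW N0) //; apply: ler_pM; last exact: powr_expR_upper.
    - by rewrite mulr_ge0.
    - by rewrite exprn_ge0 // subr_ge0.
    - by apply: (le_trans _ du); rewrite ler_wpM2r // ler_nat leq_pred.
  have -> : (1 + eps / 4) * (d * y * N) = N * (d * (y * (1 + eps / 4))) by ring.
  rewrite ler_wpM2l ?(ltW N0) // ler_wpM2l ?(ltW d0) //.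
  apply: le_trans (_ : y * expR (2 * eta) <= _).
    rewrite -expRD ler_expR natrB; last by apply: leq_trans n40.
    have /andP[_ pu] := p1_bounds; move: dl (le_trans pu pN) (sr_eta SR).
    by move: (p1) (N) (d * y) => a b c; blra.
  rewrite ler_wpM2l ?(ltW y0) //; apply: le_trans (expR_le_inv _) _; rewrite /eta; blra.
have s0 : 0 <= small_rate 'I_n p1.
  by rewrite /small_rate card_ord !mulr_ge0 ?expR_ge0 // exprn_ge0 // (le_trans ler01 d1_1).
have S2 : small_rate 'I_n p1 ^+ 2 <= (18 * expR 22 * e1 * (d ^+ 17 * y)) ^+ 2.
  apply: lerXn2r small_rate_le; rewrite nnegrE //.
  by rewrite !mulr_ge0 ?expR_ge0 ?exprn_ge0 ?(ltW d0).
have H2 : 12 * Ex p1 (vpairs 'I_n) (fun E => #|crowded E|%:R) <= eps / 8 * (d * y * N).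
  apply: le_trans (_ : 12 * (N * (e1 ^+ 2 * y + 4 * d ^+ 4 * (18 * expR 22 * e1 * (d ^+ 17 * y)) ^+ 2)) <= _).
    rewrite ler_wpM2l //; apply: le_trans H _; rewrite ler_wpM2l ?(ltW N0) //; apply: lerD.
      by rewrite expr2 -mulrA ler_wpM2l ?(ltW ee0) ?yd1.
    apply: ler_pM => //; first by rewrite mulr_ge0 ?exprn_ge0 // (le_trans ler01 d1_1).
      by rewrite exprn_ge0.
    by rewrite ler_wpM2l //; apply: lerXn2r; rewrite ?nnegrE ?(ltW d0) // (le_trans ler01 d1_1).
  have c1 : 12 * (e1 ^+ 2 * y) <= eps / 16 * (d * y).
    have := ler_wpM2r (ltW y0) (sr_crowd1 SR); move: (e1 ^+ 2) => z; blra.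
  have c2 : 12 * (4 * d ^+ 4 * (18 * expR 22 * e1 * (d ^+ 17 * y)) ^+ 2) <= eps / 16 * (d * y).
    have -> : 12 * (4 * d ^+ 4 * (18 * expR 22 * e1 * (d ^+ 17 * y)) ^+ 2) =
      48 * (18 * expR 22 * e1) ^+ 2 * (d ^+ 38 * y) * y by ring.
    apply: le_trans (ler_wpM2r (ltW y0) (sr_crowd2 SR)) _.
    by rewrite ler_wpM2l ?divr_ge0 ?(ltW eps0) // ler_peMl ?(ltW y0) //; blra.
  have := ler_wpM2l (ltW N0) c1; have := ler_wpM2l (ltW N0) c2.
  by move: (e1 ^+ 2 * y) (4 * d ^+ 4 * _) (d * y) N => a b c f; blra.
have H3 : 4 <= eps / 16 * (d * y * N).
  have a1 : 1 / y <= y * N by rewrite ler_pdivrMr // [y * N]mulrC; exact: Ny.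
  have a2 : 64 / eps <= 1 / y by rewrite ler_pdivrMr // mulrAC ler_pdivlMr // mul1r; exact: sr_y SR.
  have a3 : 64 <= eps * (y * N) by rewrite mulrC -ler_pdivrMr //; apply: le_trans a2 a1.
  have : 20 * 64 <= d * (eps * (y * N)) by have d20' := d20; apply: ler_pM.
  have -> : eps / 16 * (d * y * N) = d * (eps * (y * N)) / 16 by field.
  by rewrite ler_pdivlMr //; blra.
move: H1 H2 H3; move: (Ex _ _ _) (Ex _ _ _) (d * y * N) => a b c; blra.
Qed.

Lemma sparse_range : eps / 16 <= Pr (d / N) (vpairs 'I_n) (fun E => (mu E)%:R <= (1 + eps) * (d / 2 * y) * N).
Proof.
have T3 : (2 < #|'I_n|)%N by rewrite card_ord; apply: leq_trans n40.
have Km : (2 * K <= m.+1 ^ 2)%N by rewrite /K mulnC leq_trunc_div.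
have t1n : (t1 + 2 <= #|'I_n|)%N.
  rewrite card_ord -(ler_nat R) natrD; have : t1%:R <= N / 4 :> R.
    apply: le_trans t1_le _; rewrite ler_wpM2l ?(ltW N0) // lef_pV2 ?posrE //.
    have : 1 <= e1 ^+ 3 * d ^+ 2 by apply: mulr_ege1; apply: exprn_ege1 => //; move: d20; blra.
    by rewrite -mulrA; move: (e1 ^+ 3 * d ^+ 2) => z; blra.
  have : 41 <= N by rewrite ler_nat n40.
  by move: (N) t1%:R => a b; blra.
have [tp kg] := tps.
have g1 : 1 / 2 <= 1 :> R by blra.
(* The four rare failures cost eps / 8 in all and Markov's inequality 1 - eps / 4, so eps / 8 is
   left, of which g = 1/2 keeps half. *)
have := mu_sprinkle ((1 + eps) * (d / 2 * y) * N) T3 p1_01 q01 Km t1n tp kg g1; rewrite p1_eq -/p.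
apply: le_trans.
have F5 : Pr p1 (vpairs 'I_n) (fun E => 2 * ((1 + eps) * (d / 2 * y) * N) <= (deficiency E)%:R) <= 1 - eps / 4.
  have M0 : 0 < d * y * N by rewrite !mulr_gt0.
  have c0 : 0 < 2 * ((1 + eps) * (d / 2 * y) * N).
    by rewrite mulr_gt0 // mulr_gt0 // mulr_gt0 ?mulr_gt0 ?divr_gt0 //; move: eps0; blra.
  apply: le_trans (markov_Pr p1_01 c0 _) _ => //.
  rewrite ler_pdivrMr //; apply: le_trans deficiency_mean _.
  have -> : 2 * ((1 + eps) * (d / 2 * y) * N) = (1 + eps) * (d * y * N) by field.
  by rewrite [leRHS]mulrA ler_wpM2r ?(ltW M0) //; move: eps0 eps1; nra.
have F1 := fail_sparse; have F2 := fail_wide; have F3 := fail_independent; have F4 := fail_small.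
move: F1 F2 F3 F4 F5; move: (Pr _ _ _) (Pr _ _ _) (Pr _ _ _) (Pr _ _ _) (Pr _ _ _) => a b c f g; blra.
Qed.

End Regime.

End SparseRange.
Import SparseRange (sparse_regime, SparseRegime, sparse_range, Ny).

Lemma mu_low_degree (T : finType) (E : {set {set T}}) : (2 < #|T|)%N -> E \subset vpairs T ->
  (2 * num_degree E 0 + num_degree E 1 <= 2 * mu E)%N.
Proof.
move=> T3 sE; pose A := [set v | (degree E v <= 1)%N].
have D := mu_dual T3 A sE.
have cA : (#|A| = num_degree E 0 + num_degree E 1)%N.
  rewrite /num_degree -cardsUI [X in (_ + X)%N](_ : _ = 0)%N ?addn0.
    by apply: eq_card => v; rewrite !inE; case: (degree E v) => [|[]].
  by apply: eq_card0 => v; rewrite !inE; case: (degree E v).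
have swap : (\sum_v #|nbr E v :&: A| = \sum_(a in A) degree E a)%N.
  transitivity (\sum_v \sum_(a in A) (adj E v a : nat))%N.
    apply: eq_bigr => v _; rewrite -sum1_card big_mkcond [RHS]big_mkcond; apply: eq_bigr => a _.
    by rewrite in_setI [a \in nbr E v]inE; case: (a \in A); case: (adj E v a).
  rewrite exchange_big; apply: eq_bigr => a _; rewrite /degree -sum1_card [RHS]big_mkcond.
  by apply: eq_bigr => v _; rewrite inE adj_sym; case: (adj E a v).
have s1 : (\sum_v minn 2 #|nbr E v :&: A| <= num_degree E 1)%N.
  apply: leq_trans (_ : \sum_v #|nbr E v :&: A| <= _)%N; first by apply: leq_sum => v _; apply: geq_minr.
  rewrite swap /num_degree -sum1_card big_mkcond [leqRHS]big_mkcond /=; apply: leq_sum => v _.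
  by rewrite !inE; case: (degree E v) => [|[]].
by move: D s1 cA; move: #|A| (\sum_v _)%N (num_degree E 0) (num_degree E 1) (mu E) => *; lia.
Qed.

(** * Uniform control of the mean *)

Section SparseMean.
Import numFieldNormedType.Exports.
Local Open Scope classical_set_scope.
Local Open Scope ring_scope.
Variable R : realType.
Implicit Types (d eps : R).

Lemma exp_decay1 (C e : R) a : 0 <= C -> 0 < e ->
  exists2 D : R, 1 <= D & forall d, D <= d -> C * (d ^+ a * expR (- d)) <= e.
Proof.
move=> C0 e0; have [D D1 H] := @exp_decay R C e a 1 C0 e0 isT.
by exists D => // d /H; rewrite divr1.
Qed.

Lemma sparse_regimeP eps : 0 < eps <= 1 -> exists2 D : R, 20 <= D &
  forall d n, D <= d -> expR (2 * d) <= n%:R -> sparse_regime eps d n.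
Proof.
move=> e01; have [e0 _] := andP e01; have E := expR_ge0.
have k0 : 0 < eps / 16 / 46 / 46 by rewrite !divr_gt0.
have e32 : 0 < eps / 32 by rewrite divr_gt0.
have e16 : 0 < eps / 16 by rewrite divr_gt0.
have [D1 d1 H1] := @exp_decay1 2 _ 0 (ler0n R 2) k0.
have [D2 d2 H2] := @exp_decay1 64 _ 0 (ler0n R 64) e0.
have [|D3 d3 H3] := @exp_decay1 (12 * expR 1 ^+ 3) _ 2 _ e32; first by do ?[exact: E|exact: ler0n|apply: exprn_ge0|apply: mulr_ge0].
have half0 : 0 < 1 / 2 :> R by lra.
have [|D4 d4 H4] := @exp_decay R (expR 2 * expR 1 ^+ 2 * (12 * expR 1 ^+ 3) ^+ 5) (1 / 2) 10 8 _ half0 isT.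
  by do ?[exact: E|exact: ler0n|apply: exprn_ge0|apply: mulr_ge0].
have [|D5 d5 H5] := @exp_decay1 (168 * expR 1 ^+ 3 * (18 * expR 22 * expR 1)) _ 19 _ e32.
  by do ?[exact: E|exact: ler0n|apply: exprn_ge0|apply: mulr_ge0].
have [|D6 d6 H6] := @exp_decay1 (48 * (18 * expR 22 * expR 1) ^+ 2) _ 38 _ e16.
  by do ?[exact: E|exact: ler0n|apply: exprn_ge0|apply: mulr_ge0].
have [D7 d7 H7] := @exp_decay1 2 _ 1 (ler0n R 2) e16.
set a := 16 / (eps / 16 / 46 / 46) ^+ 2 + 1; set b := 192 * expR 1 ^+ 2 / eps.
have a0 : 0 <= a by rewrite addr_ge0 // divr_ge0 // exprn_ge0 // ltW.
have b0 : 0 <= b.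
  by apply: divr_ge0 (ltW e0); apply: mulr_ge0; [exact: ler0n|apply: exprn_ge0; exact: E].
exists (D1 + D2 + D3 + D4 + D5 + D6 + D7 + a + b + 20); first by lra.
move=> d n Dd nd; split => //.
- by lra.
- by have := H1 d; rewrite expr0 mul1r; apply; lra.
- by have := H2 d; rewrite expr0 mul1r; apply; lra.
- by apply: H3; lra.
- by apply: H4; lra.
- by rewrite -/a; lra.
- by apply: H5; lra.
- by rewrite [leRHS]mulrC -ler_pdivrMr // -/b; lra.
- by apply: H6; lra.
- by have := H7 d; rewrite expr1; apply; lra.
Qed.

Lemma card_vpairs_le n : #|vpairs 'I_n|%:R <= n%:R ^+ 2 / 2 :> R.
Proof.
rewrite ler_pdivlMr // -natrX -[2]/(2%:R) -natrM ler_nat.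
have -> : #|vpairs 'I_n| = 'C(n, 2).
  by rewrite -[n in RHS]card_ord -card_draws; apply: eq_card => e; rewrite !inE.
by rewrite bin2; have := leq_pred n; move: (half_leq); case: n => // n; nia.
Qed.

Lemma mu_concentrated d (t : R) n : (2 < n)%N -> 0 <= d <= n%:R -> 0 < t ->
  Pr (d / n%:R) (vpairs 'I_n) (fun E => t * n%:R <= `|(mu E)%:R - mean d n * n%:R|) <= d / (2 * t ^+ 2 * n%:R).
Proof.
move=> n3 /andP[d0 dn] t0; have n0 : 0 < n%:R :> R by rewrite ltr0n; apply: leq_trans n3.
have p01 : 0 <= d / n%:R <= 1 by rewrite divr_ge0 ?(ltW n0) //= ler_pdivrMr // mul1r.
have T3 : (2 < #|'I_n|)%N by rewrite card_ord.
have -> : mean d n * n%:R = Ex (d / n%:R) (vpairs 'I_n) (fun E => (mu E)%:R).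
  by rewrite /mean divfK ?lt0r_neq0.
have c0 : 0 < t * n%:R by rewrite mulr_gt0.
apply: le_trans (@chebyshev_Pr R _ _ _ (fun E : {set {set 'I_n}} => (mu E)%:R) 1 _ p01 c0 _) _.
  move=> E e sE eV; have /andP[] := mu_setU1 T3 sE eV.
  rewrite -!(ler_nat R) -natr1; move: (mu _)%:R (mu _)%:R => a b; rewrite ler_norml; lra.
rewrite expr1n mulr1 ler_pdivrMr ?exprn_gt0 //.
apply: le_trans (_ : n%:R ^+ 2 / 2 * (d / n%:R) <= _).
  by rewrite ler_wpM2r ?card_vpairs_le //; case/andP: p01.
by rewrite le_eqVlt; apply/orP; left; apply/eqP; field; rewrite !lt0r_neq0.
Qed.

(* A positive lower bound on the probability that mu is small suffices: by concentration the mean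
   cannot exceed that value by much. *)
Lemma mean_sparse_upper eps : 0 < eps <= 1 -> exists2 D : R, 20 <= D &
  forall d n, D <= d -> expR (2 * d) <= n%:R -> mean d n <= (1 + eps) * (d / 2 * expR (- d)).
Proof.
move=> e01; have [e0 e1] := andP e01.
(* One half of [eps] goes to [sparse_range], the other is the deviation [t] from the mean. *)
pose h := eps / 2; have h0 : 0 < h by rewrite divr_gt0.
have h01 : 0 < h <= 1 by rewrite h0 /h ler_pdivrMr //; lra.
have [D D20 H] := sparse_regimeP h01.
have h3 : 0 < 32 / h ^+ 3 by rewrite divr_gt0 ?exprn_gt0.
exists (D + 32 / h ^+ 3 + 1); first by lra.
move=> d n Dd nd; have SR : sparse_regime h d n by apply: H => //; lra.
have d0 : 0 < d by lra.
have dn : d <= n%:R by apply: le_trans nd; apply: le_trans (expR_ge1Dx _); lra.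
have n3 : (2 < n)%N by rewrite -(ltr_nat R); apply: lt_le_trans dn; lra.
have n0 : 0 < n%:R :> R by lra.
have ny : 1 <= n%:R * expR (- d) ^+ 2 by rewrite expr2 mulrA; apply: Ny SR.
rewrite leNgt; apply/negP => lt.
pose t := h * (d / 2 * expR (- d)).
have t0 : 0 < t by rewrite mulr_gt0 // mulr_gt0 ?expR_gt0 // divr_gt0.
have d0n : 0 <= d <= n%:R by rewrite (ltW d0).
have := le_trans (sparse_range SR) (le_trans (le_Pr _ _) (mu_concentrated n3 d0n t0)).
have p01 : 0 <= d / n%:R <= 1 by rewrite divr_ge0 ?(ltW n0) ?(ltW d0) //= ler_pdivrMr // mul1r.
move=> /(_ p01) K; suff : h / 16 <= d / (2 * t ^+ 2 * n%:R).
  apply/negP; rewrite -ltNge.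
  have -> : d / (2 * t ^+ 2 * n%:R) = 2 / (h ^+ 2 * d * (n%:R * expR (- d) ^+ 2)).
    by rewrite /t; field; rewrite !lt0r_neq0 ?expR_gt0.
  have hd : 0 < h ^+ 2 * d by rewrite mulr_gt0 ?exprn_gt0.
  apply: le_lt_trans (_ : 2 / (h ^+ 2 * d) < _).
    by rewrite ler_wpM2l // lef_pV2 ?posrE ?ler_peMr ?(ltW hd) // mulr_gt0 //; apply: lt_le_trans ny.
  rewrite ltr_pdivrMr // mulrCA mulrC.
  have : 32 / h ^+ 3 < d by lra.
  by rewrite ltr_pdivrMr ?exprn_gt0 // !exprS expr0 mulr1 => U; nra.
apply: K => E _ le1; rewrite distrC; apply: le_trans (ler_norm _).
have : (1 + eps) * (d / 2 * expR (- d)) * n%:R < mean d n * n%:R by rewrite ltr_pM2r.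
move: le1; rewrite /t (_ : eps = h + h); last by rewrite /h; field.
by move: (mean d n * n%:R) (mu E)%:R => a b; lra.
Qed.

Lemma mean_ge d n : (2 < n)%N -> 0 <= d <= n%:R ->
  (1 - d / n%:R) ^+ n.-1 + n.-1%:R * (d / n%:R) * (1 - d / n%:R) ^+ (n - 2) / 2 <= mean d n.
Proof.
move=> n3 /andP[d0 dn]; have n0 : 0 < n%:R :> R by rewrite ltr0n; apply: leq_trans n3.
have p01 : 0 <= d / n%:R <= 1 by rewrite divr_ge0 ?(ltW n0) //= ler_pdivrMr // mul1r.
have T3 : (2 < #|'I_n|)%N by rewrite card_ord.
have E0 := @Ex_num_degree R 'I_n (d / n%:R) 0; have E1 := @Ex_num_degree R 'I_n (d / n%:R) 1.
rewrite card_ord bin0 expr0 !mul1r subn0 in E0.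
rewrite card_ord bin1 expr1 -subn1 -subnDA addn1 in E1.
rewrite /mean ler_pdivlMr //.
have : Ex (d / n%:R) (vpairs 'I_n) (fun E => 2 * (num_degree E 0)%:R + (num_degree E 1)%:R) <=
  Ex (d / n%:R) (vpairs 'I_n) (fun E => 2 * (mu E)%:R).
  apply: le_Ex => // E sE; rewrite -[2]/(2%:R) -2!natrM -natrD ler_nat; exact: mu_low_degree.
rewrite ExDf 2!ExZl E0 E1 -[n.-1]subn1; move: (_ ^+ (n - 1)) (_ ^+ (n - 2)) (Ex _ _ _) => a b c H.
by move: H; move: (d / n%:R) (n - 1)%:R n%:R => u v w H; lra.
Qed.

Lemma pow_edge_ge d n : 0 <= d -> 2 * d < n%:R ->
  expR (- (d + 2 * d ^+ 2 / n%:R)) <= (1 - d / n%:R) ^+ n.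
Proof.
move=> d0 dn; have n0 : 0 < n%:R :> R by lra.
have x0 : 0 <= d / n%:R by rewrite divr_ge0 // ltW.
have x1 : d / n%:R <= 1 / 2 by rewrite ler_pdivrMr //; lra.
have x01 : 0 <= d / n%:R < 1 by rewrite x0; lra.
apply: le_trans (powr_expR_lower n x01); rewrite ler_expR lerN2.
have -> : d + 2 * d ^+ 2 / n%:R = n%:R * (d / n%:R + 2 * (d / n%:R) ^+ 2) by field; exact: lt0r_neq0.
rewrite ler_wpM2l ?(ltW n0) // ler_pdivrMr; last by lra.
by move: (d / n%:R) x0 x1 => z; nra.
Qed.

(** Isolated vertices alone suffice. This crude bound turns absolute errors into relative ones when
    d is bounded. *)
Lemma mean_ge_exp d n : (2 < n)%N -> 0 <= d -> 2 * d < n%:R ->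
  expR (- (2 * d)) <= mean d n.
Proof.
move=> n3 d0 dn; have n0 : 0 < n%:R :> R by lra.
have dn' : 0 <= d <= n%:R by rewrite d0; lra.
have x0 : 0 <= d / n%:R by rewrite divr_ge0 // ltW.
have x1 : d / n%:R <= 1 / 2 by rewrite ler_pdivrMr //; lra.
have y0 : 0 <= 1 - d / n%:R by lra.
apply: le_trans (mean_ge n3 dn'); apply: le_trans (_ : (1 - d / n%:R) ^+ n <= _).
  apply: le_trans (pow_edge_ge d0 dn); rewrite ler_expR lerN2 [leRHS](_ : _ = d + d); last by ring.
  by rewrite lerD2l expr2 mulrA ler_pdivrMr // [leRHS]mulrC ler_wpM2r // ltW.
rewrite -[n in (_ ^+ n)%R](@prednK n); last by apply: leq_trans n3.
apply: le_trans (_ : (1 - d / n%:R) ^+ n.-1 <= _); first by rewrite exprS ler_piMl ?exprn_ge0 //; lra.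
by rewrite lerDl divr_ge0 // mulr_ge0 ?exprn_ge0 // mulr_ge0.
Qed.

Lemma lim_mean_ge d : 0 < d -> expR (- (2 * d)) <= limn (mean d).
Proof.
move=> d0; apply: limr_ge; first exact: cvg_mean.
have [M M0 dM] := ex_nat_ge (2 * d + 1).
apply: (near_infty_ge (N := (M + 3)%N)) => n nM; apply: mean_ge_exp; rewrite ?(ltW d0) //.
  by apply: leq_trans nM; rewrite addnC.
have : M%:R <= n%:R :> R by rewrite ler_nat; apply: leq_trans nM; rewrite leq_addr.
by lra.
Qed.

Lemma mean_sparse_lower eps : 0 < eps <= 1 -> exists2 D : R, 20 <= D &
  forall d n, D <= d -> expR (2 * d) <= n%:R -> (1 - eps) * (d / 2 * expR (- d)) <= mean d n.
Proof.
move=> /andP[e0 e1]; have e4 : 0 < eps / 4 by rewrite divr_gt0.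
have [D1 d1 H1] := @exp_decay1 1 _ 0 ler01 e4.
have [D2 d2 H2] := @exp_decay1 2 _ 2 (ler0n R 2) e4.
exists (D1 + D2 + 20); first by lra.
move=> d n Dd nd; have {}H1 : expR (- d) <= eps / 4 by have := H1 d; rewrite expr0 !mul1r; apply; lra.
have {}H2 : 2 * (d ^+ 2 * expR (- d)) <= eps / 4 by apply: H2; lra.
have d0 : 0 < d by lra.
have y0 := expR_gt0 (- d).
have dn : 2 * d < n%:R by apply: lt_le_trans nd; apply: lt_le_trans (expR_ge1Dx _); lra.
have n3 : (2 < n)%N by rewrite -(ltr_nat R); apply: le_lt_trans dn; lra.
have n0 : 0 < n%:R :> R by lra.
have iN : n%:R^-1 <= expR (- d).
  rewrite expRN lef_pV2 ?posrE ?expR_gt0 //; apply: le_trans nd; rewrite ler_expR; lra.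
have d0n : 0 <= d <= n%:R by apply/andP; split; lra.
apply: le_trans (mean_ge n3 d0n).
have x0 : 0 <= d / n%:R by rewrite divr_ge0 ?(ltW d0) // ltW.
have x1 : d / n%:R <= 1 / 2 by rewrite ler_pdivrMr //; lra.
have y1 : 0 <= 1 - d / n%:R by lra.
apply: ler_wpDl; first by rewrite exprn_ge0.
have A : (1 - eps / 4) * expR (- d) <= (1 - d / n%:R) ^+ (n - 2).
  apply: le_trans (_ : (1 - d / n%:R) ^+ n <= _); last first.
    by apply: ler_wiXn2l; rewrite ?leq_subr //; lra.
  apply: le_trans (pow_edge_ge (ltW d0) dn); rewrite opprD expRD mulrC ler_wpM2l ?expR_ge0 //.
  apply: le_trans (expR_ge1Dx _); rewrite lerD2l lerN2; apply: le_trans H2.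
  by rewrite -mulrA ler_wpM2l // ler_wpM2l ?exprn_ge0 ?(ltW d0).
have B : (1 - eps / 4) * d <= n.-1%:R * (d / n%:R).
  rewrite -subn1 natrB; last by apply: ltnW (ltnW n3).
  have -> : (n%:R - 1) * (d / n%:R) = (1 - n%:R^-1) * d by field; exact: lt0r_neq0.
  by rewrite ler_wpM2r ?(ltW d0) // lerD2l lerN2 (le_trans iN).
have e40 : 0 <= 1 - eps / 4 by lra.
rewrite ler_pdivlMr //; apply: le_trans (_ : (1 - eps / 4) * d * ((1 - eps / 4) * expR (- d)) <= _).
  have z0 : 0 <= d * expR (- d) by rewrite mulr_ge0 // ltW.
  have -> : (1 - eps) * (d / 2 * expR (- d)) * 2 = (1 - eps) * (d * expR (- d)) by field.
  have -> : (1 - eps / 4) * d * ((1 - eps / 4) * expR (- d)) = (1 - eps / 4) ^+ 2 * (d * expR (- d)) by ring.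
  by rewrite ler_wpM2r // expr2; nra.
by apply: ler_pM => //; rewrite mulr_ge0 // ltW.
Qed.

(** In [main_term] the pendant vertices dominate: isolated ones are fewer by a factor of order 1 /
    d, and the rest is smaller by powers of e^-d. *)
Lemma lim_mean_sparse eps : 0 < eps <= 1 -> exists2 D : R, 20 <= D &
  forall d, D <= d -> `|limn (mean d) - d / 2 * expR (- d)| <= eps * (d / 2 * expR (- d)).
Proof.
move=> /andP[e0 e1]; have [C C0 [D0 D01 H]] := mean_expansion R.
have e8 : 0 < eps / 8 by rewrite divr_gt0.
have [D1 d1 H1] := @exp_decay1 1 _ 6 ler01 e8.
have [D2 d2 H2] := @exp_decay1 C _ 12 (ltW C0) e8.
have e3 : 0 <= 8 / eps by rewrite divr_ge0 // ltW.
exists (D0 + D1 + D2 + 8 / eps + 20); first by lra.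
move=> d Dd; have d1' : 1 <= d by lra.
have {}H1 : d ^+ 6 * expR (- d) <= eps / 8 by have := H1 d; rewrite !mul1r; apply; lra.
have {}H2 : C * (d ^+ 12 * expR (- d)) <= eps / 8 by apply: H2; lra.
have {}H : `|limn (mean d) - main_term d| <= C * (d ^+ 12 * expR (- d) ^+ 4) by apply: H; lra.
have d0 : 0 < d by lra.
have y0 := expR_gt0 (- d).
have y1 : expR (- d) <= 1 by rewrite -expR0 ler_expR; lra.
have z0 : 0 <= d * expR (- d) by rewrite mulr_ge0 // ltW.
have A1 : expR (- d) <= eps / 8 * (d * expR (- d)).
  rewrite mulrA ler_peMl ?(ltW y0) // mulrC mulrA ler_pdivlMr // mul1r -ler_pdivrMr //; lra.
have A2 : d ^+ 3 * ((1 + d) * expR (- d)) ^+ 3 / 12 <= eps / 8 * (d * expR (- d)).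
  apply: le_trans (_ : d ^+ 6 * expR (- d) * (d * expR (- d)) <= _); last by rewrite ler_wpM2r.
  apply: le_trans (_ : d ^+ 3 * (2 * d * expR (- d)) ^+ 3 / 12 <= _).
    rewrite ler_wpM2r ?invr_ge0 // ler_wpM2l ?exprn_ge0 ?(ltW d0) //; apply: lerXn2r; rewrite ?nnegrE.
    - by rewrite mulr_ge0 ?(ltW y0) //; lra.
    - by rewrite mulr_ge0 ?(ltW y0) //; lra.
    - by rewrite ler_wpM2r ?(ltW y0) //; lra.
  have -> : d ^+ 3 * (2 * d * expR (- d)) ^+ 3 / 12 = 2 / 3 * expR (- d) * (d ^+ 6 * expR (- d) * expR (- d)) by field.
  have -> : d ^+ 6 * expR (- d) * (d * expR (- d)) = d * (d ^+ 6 * expR (- d) * expR (- d)) by ring.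
  by rewrite ler_wpM2r ?mulr_ge0 ?exprn_ge0 ?(ltW d0) ?(ltW y0) //; lra.
have A3 : C * (d ^+ 12 * expR (- d) ^+ 4) <= eps / 8 * (d * expR (- d)).
  have -> : C * (d ^+ 12 * expR (- d) ^+ 4) = C * (d ^+ 12 * expR (- d)) * (expR (- d) ^+ 3) by ring.
  apply: le_trans (_ : eps / 8 * expR (- d) ^+ 3 <= _); first by rewrite ler_wpM2r ?exprn_ge0 ?(ltW y0).
  rewrite ler_wpM2l ?(ltW e8) // exprS [leRHS]mulrC ler_wpM2l ?(ltW y0) //.
  by apply: le_trans d1'; rewrite exprn_ile1 ?(ltW y0).
have A4 : 0 <= d ^+ 3 * ((1 + d) * expR (- d)) ^+ 3 / 12.
  by rewrite divr_ge0 // mulr_ge0 ?exprn_ge0 ?(ltW d0) // mulr_ge0 ?(ltW y0) //; lra.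
have A5 : 0 <= eps * (d * expR (- d)) by rewrite mulr_ge0 // ltW.
have [f fE] : exists f : R, f = limn (mean d) by exists (limn (mean d)).
move: H y0 A1 A2 A3 A4 A5; rewrite /main_term -fE !ler_norml {fE}.
have -> : d / 2 * expR (- d) = d * expR (- d) / 2 by ring.
move: (expR (- d)) (d * expR (- d)) (f) (C * (d ^+ 12 * expR (- d) ^+ 4)) (d ^+ 3 * ((1 + d) * expR (- d)) ^+ 3 / 12) => y z c b a /andP[].
have -> : eps / 8 * z = eps * z / 8 by ring.
have -> : eps * (z / 2) = eps * z / 2 by ring.
by move: (eps * z) => u; move=> *; apply/andP; split; lra.
Qed.

(** For large d the mean and its limit are both close to d e^-d / 2, so they are compared without
    any rate of convergence. *)
Lemma mean_sparse eps : 0 < eps <= 1 -> exists2 D : R, 20 <= D &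
  (forall d, D <= d -> expR (- d) <= limn (mean d)) /\
  forall d n, D <= d -> expR (2 * d) <= n%:R ->
  `|mean d n - limn (mean d)| <= eps * limn (mean d).
Proof.
move=> /andP[e0 e1]; have e4 : 0 < eps / 4 <= 1 by apply/andP; split; lra.
have [D1 d1 H1] := mean_sparse_upper e4; have [D2 d2 H2] := mean_sparse_lower e4.
have [D3 d3 H3] := lim_mean_sparse e4.
exists (D1 + D2 + D3); first by lra.
split=> [d Dd|d n Dd nd].
  have /H3 : D3 <= d by lra.
  have : 20 * expR (- d) <= d * expR (- d) by rewrite ler_wpM2r ?expR_ge0 //; lra.
  have -> : d / 2 * expR (- d) = d * expR (- d) / 2 by ring.
  rewrite ler_norml => U /andP[+ _]; have := expR_ge0 (- d).
  by move: (expR (- d)) (d * _) U (limn _) => y z U f; nra.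
have {}H1 := H1 d n _ nd; have {}H2 := H2 d n _ nd.
have s0 : 0 <= d / 2 * expR (- d) by rewrite mulr_ge0 ?expR_ge0 //; lra.
have /H1{H1} : D1 <= d by lra.
have /H2{H2} : D2 <= d by lra.
have /H3{H3} : D3 <= d by lra.
move: s0; rewrite !ler_norml; move: (d / 2 * _) (limn _) (mean d n) => s f m s0 /andP[a b] c g.
by apply/andP; split; nra.
Qed.

Lemma Ex_subset_card (E : finType) (r : R) (D : {set E}) : Ex r D (fun A => #|A|%:R) = r * #|D|%:R.
Proof.
elim/setD1_ind: D => [|D e eD IH]; first by rewrite Ex_set0 cards0 mulr0.
rewrite (ExD1 _ _ eD) [#|D|](cardsD1 e) eD natrD.
have -> : Ex r (D :\ e) (fun A => #|e |: A|%:R) = Ex r (D :\ e) (fun A => 1 + #|A|%:R).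
  apply: eq_Ex => A /subsetP sA; have eA : e \notin A by apply/negP => /sA; rewrite !inE eqxx.
  by rewrite cardsU1 eA natrD.
have -> : Ex r (D :\ e) (fun A => 1 + #|A|%:R) = 1 + r * #|D :\ e|%:R by rewrite ExDf Ex_cst IH.
by rewrite IH /=; ring.
Qed.

(** Couple the two densities by [Ex_union]: on average at most r n^2 / 2 edges are added, each
    changing the completion number by at most 1, and r <= 2 (x' - x) because x <= 1/2. *)
Lemma mean_lipschitz d d' n : (2 < n)%N -> 0 <= d -> d <= d' -> 2 * d' <= n%:R ->
  `|mean d' n - mean d n| <= d' - d.
Proof.
move=> n3 d0 dd dn; have n0 : 0 < n%:R :> R by rewrite ltr0n; apply: leq_trans n3.
have T3 : (2 < #|'I_n|)%N by rewrite card_ord.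
pose x := d / n%:R; pose x' := d' / n%:R; pose r := (x' - x) / (1 - x).
have x0 : 0 <= x by rewrite divr_ge0 // ltW.
have xx : x <= x' by rewrite ler_wpM2r // invr_ge0 ltW.
have x1 : x' <= 1 / 2 by rewrite ler_pdivrMr //; lra.
have x1' : 0 < 1 - x by move: xx x1; clearbody x x'; lra.
have r0 : 0 <= r by apply: divr_ge0; [rewrite subr_ge0|exact: ltW].
have r1 : r <= 1 by rewrite ler_pdivrMr //; move: x1; clearbody x x'; lra.
have rE : r <= 2 * (x' - x) by rewrite ler_pdivrMr //; move: xx x1 x0; clearbody x x'; nra.
have r01 : 0 <= r <= 1 by rewrite r0.
have x01 : 0 <= x <= 1 by rewrite x0; move: x1'; clearbody x; lra.
have U : 1 - (1 - r) * (1 - x) = x' by rewrite /r; field; exact: lt0r_neq0.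
pose m (E : {set {set 'I_n}}) : R := (mu E)%:R.
have key (E A : {set {set 'I_n}}) : E \subset vpairs 'I_n -> A \subset vpairs 'I_n ->
    m E - #|A|%:R <= m (A :|: E) <= m E.
  move=> sE sA; suff /andP[a b] : (mu (A :|: E) <= mu E <= mu (A :|: E) + #|A|)%N.
    by rewrite /m lerBlDr -natrD !ler_nat b.
  elim/setD1_ind: A sA => [|A e eA IH] sA; first by rewrite set0U cards0 addn0 leqnn.
  have sAe : A :\ e \subset vpairs 'I_n by apply: subset_trans sA; apply: subsetDl.
  have /andP[a b] := IH sAe; rewrite -(setD1K eA) -setUA.
  have sAE : (A :\ e) :|: E \subset vpairs 'I_n by rewrite subUset sAe.
  have /andP[c g] := mu_setU1 T3 sAE (subsetP sA _ eA).
  rewrite (leq_trans c a) /= (leq_trans b) // cardsU1 !inE eqxx /= add1n addnS -addSn leq_add2r.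
  exact: g.
have low : Ex x (vpairs 'I_n) m - r * #|vpairs 'I_n|%:R <= Ex x' (vpairs 'I_n) m <= Ex x (vpairs 'I_n) m.
  rewrite -U -Ex_union; apply/andP; split; last first.
    apply: le_Ex => // E sE; rewrite -[leRHS](Ex_cst r (vpairs 'I_n)); apply: le_Ex => // A sA.
    by have /andP[] := key E A sE sA.
  rewrite -[r * _](Ex_cst x (vpairs 'I_n)) -ExB; apply: le_Ex => // E sE.
  rewrite -Ex_subset_card -[m E](Ex_cst r (vpairs 'I_n)) -ExB; apply: le_Ex => // A sA.
  by have /andP[] := key E A sE sA.
rewrite /mean -/x -/x' -mulrBl normrM [`|_^-1|]ger0_norm ?invr_ge0 ?(ltW n0) // ler_pdivrMr //.
have V : r * #|vpairs 'I_n|%:R <= (d' - d) * n%:R.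
  apply: le_trans (_ : 2 * (x' - x) * (n%:R ^+ 2 / 2) <= _); first by apply: ler_pM; rewrite ?card_vpairs_le.
  by rewrite le_eqVlt; apply/orP; left; apply/eqP; rewrite /x /x'; field; exact: lt0r_neq0.
rewrite ler_norml; move: low V; rewrite -/(m) /m; move: (Ex x _ _) (Ex x' _ _) (r * _) => a b c /andP[A B] V.
have W : 0 <= (d' - d) * n%:R by rewrite mulr_ge0 ?subr_ge0 // ltW.
by apply/andP; split; move: A B V W; move: ((d' - d) * _) => v; lra.
Qed.

(** Pointwise convergence and the Lipschitz bound, by induction along a grid of mesh h = e / 5. *)
Lemma mean_uniform (a b e : R) : 0 < a -> 0 < e ->
  exists M : nat, forall d n, (M <= n)%N -> a <= d <= b -> `|mean d n - limn (mean d)| <= e.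
Proof.
move=> a0 e0; pose h := e / 5; have h0 : 0 < h by rewrite divr_gt0.
have [M0 M00 bM] := ex_nat_ge (2 * b).
have near_lim d : 0 < d -> exists M : nat, forall n, (M <= n)%N -> `|mean d n - limn (mean d)| <= h.
  move=> d0; have /cvgrPdist_le/(_ h h0) [M _ HM] := @cvg_mean R d d0.
  by exists M => n /HM; rewrite /= distrC.
have lip d d' n : (M0 + 3 <= n)%N -> a <= d -> d <= d' -> d' <= b -> `|mean d' n - mean d n| <= d' - d.
  move=> nM ad dd db; apply: mean_lipschitz => //; [by apply: leq_trans nM; rewrite leq_addl|lra|].
  have : M0%:R <= n%:R :> R by rewrite ler_nat; apply: leq_trans nM; rewrite leq_addr.
  by lra.
suff H k : exists M : nat, forall d n, (M <= n)%N -> a <= d <= b -> d <= a + k%:R * h ->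
    `|mean d n - limn (mean d)| <= e.
  have [k k0 kb] := ex_nat_ge ((b - a) / h); have [M HM] := H k.
  exists M => d n nM /[dup] ab /andP[_ db]; apply: HM => //.
  by move: kb; rewrite ler_pdivrMr //; lra.
elim: k => [|k [M1 HM1]].
  have [M HM] := near_lim a a0; exists M => d n nM /andP[ad _]; rewrite mul0r addr0 => da.
  have -> : d = a by apply/eqP; rewrite eq_le da.
  by apply: le_trans (HM _ nM) _; rewrite /h; lra.
pose c := a + k%:R * h; have c0 : 0 < c by rewrite ltr_wpDr // mulr_ge0 // ltW.
have ac : a <= c by rewrite lerDl mulr_ge0 // ltW.
have [M HM] := near_lim c c0.
exists (M0 + 3 + M1 + M)%N => d n nM dab dk.
case: (leP d c) => [dc|cd]; first by apply: HM1 => //; apply: leq_trans nM; rewrite addnAC leq_addl.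
have [M2 HM2] := near_lim d (lt_trans c0 cd).
have db : d <= b by case/andP: dab.
(* At [n'] the mean is close to its limit at [d] itself; going from [d] to [c] both at [n] and at
   [n'] adds up five errors of size [h]. *)
pose n' := (n + M2)%N.
have nn : (n <= n')%N by rewrite leq_addr.
have dc : d - c <= h by move: dk; rewrite -natr1 mulrDl mul1r /c; lra.
have L1 := lip c d n (leq_trans (leq_trans (leq_addr _ _) (leq_addr _ _)) nM) ac (ltW cd) db.
have L2 := lip c d n' (leq_trans (leq_trans (leq_trans (leq_addr _ _) (leq_addr _ _)) nM) nn) ac (ltW cd) db.
have L3 := HM n (leq_trans (leq_addl _ _) nM).
have L4 := HM n' (leq_trans (leq_trans (leq_addl _ _) nM) nn).
have L5 := HM2 n' (leq_addl _ _).
move: L1 L2 L3 L4 L5; rewrite !ler_norml; have -> : e = 5 * h by rewrite /h; field.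
move: (mean d n) (mean d n') (mean c n) (mean c n') (limn (mean c)) (limn (mean d)) => x1 x2 x3 x4 x5 x6.
by move=> /andP[? ?] /andP[? ?] /andP[? ?] /andP[? ?] /andP[? ?]; apply/andP; split; lra.
Qed.

End SparseMean.

(** * Concentration, uniformly in the degree *)

Section Concentration.
Import numFieldNormedType.Exports.
Local Open Scope classical_set_scope.
Local Open Scope ring_scope.
Variable R : realType.
Implicit Types (d eps : R).

Lemma mean_01 d n : (2 < n)%N -> 0 <= d <= n%:R -> 0 <= mean d n <= 1.
Proof.
move=> n3 /andP[d0 dn]; have n0 : 0 < n%:R :> R by rewrite ltr0n; apply: leq_trans n3.
have p01 : 0 <= d / n%:R <= 1 by rewrite divr_ge0 ?(ltW n0) //= ler_pdivrMr // mul1r.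
have T3 : (2 < #|'I_n|)%N by rewrite card_ord.
apply/andP; split; first by rewrite /mean divr_ge0 ?(ltW n0) // Ex_ge0.
rewrite /mean ler_pdivrMr // mul1r -[leRHS](Ex_cst (d / n%:R) (vpairs 'I_n)).
apply: le_Ex => // E sE; rewrite ler_nat -[n in (_ <= n)%N]card_ord; exact: mu_le_card.
Qed.

Lemma lim_mean_01 d : 0 < d -> 0 <= limn (mean d) <= 1.
Proof.
move=> d0; apply/andP; split; first by apply: le_trans (lim_mean_ge d0); apply: expR_ge0.
apply: limr_le; first exact: cvg_mean.
have [M M0 dM] := ex_nat_ge d.
apply: (near_infty_ge (N := (M + 3)%N)) => n nM.
have n3 : (2 < n)%N by apply: leq_trans nM; rewrite addnC.
have dn : 0 <= d <= n%:R.
  rewrite (ltW d0) (le_trans dM) // ler_nat; apply: leq_trans nM; exact: leq_addr.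
by have /andP[] := mean_01 n3 dn.
Qed.

Lemma lim_mean_lower : exists2 c : R, 0 < c & forall d, 20 <= d -> c * expR (- d) <= limn (mean d).
Proof.
have e01 : 0 < (1 : R) <= 1 by rewrite ltr01 lexx.
have [D D20 [H _]] := mean_sparse e01.
exists (expR (- (2 * D))); first exact: expR_gt0.
move=> d d20; have d0 : 0 < d by lra.
have y1 : expR (- d) <= 1 by rewrite -expR0 ler_expR; lra.
case: (leP D d) => Dd.
  apply: le_trans (H d Dd); rewrite ler_piMl ?expR_ge0 // -[leRHS]expR0 ler_expR; lra.
apply: le_trans (lim_mean_ge d0); apply: le_trans (_ : expR (- (2 * D)) <= _).
  by rewrite ler_piMr ?expR_ge0.
by rewrite ler_expR; lra.
Qed.

Lemma log_bounds d n : 20 <= d -> d <= 4 / 10 * ln n%:R :> R ->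
  [/\ (2 < n)%N, expR (2 * d) <= n%:R, d <= n%:R, 0 < ln n%:R :> R &
   d / (n%:R * expR (- d) ^+ 2) <= 40 / ln n%:R].
Proof.
move=> d20 dl; set L := ln n%:R in dl *.
have L0 : 0 < L by lra.
have n0 : 0 < n%:R :> R.
  rewrite ltr0n lt0n; apply/eqP => n0; move: L0; rewrite /L n0 ln0 ?ltxx //.
have nE : expR L = n%:R by rewrite lnK // posrE.
have n2 : expR (2 * d) <= n%:R by rewrite -nE ler_expR; lra.
have dn : d <= n%:R by apply: le_trans n2; apply: le_trans (expR_ge1Dx _); lra.
split=> //; first by rewrite -(ltr_nat R); apply: lt_le_trans dn; lra.
(* Since 1 - 2 * 0.4 = 1/5, a factor n^(1/5) is left, of which only a square of log n is used. *)
have E5 : expR (L / 5) <= n%:R * expR (- d) ^+ 2.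
  rewrite -nE expr2 -!expRD ler_expR; lra.
have q0 : 0 < (L / 10) ^+ 2 by rewrite exprn_gt0 // divr_gt0.
have E2 : (L / 10) ^+ 2 <= expR (L / 5).
  have -> : L / 5 = L / 10 + L / 10 by field.
  have u : 0 <= L / 10 by rewrite divr_ge0 // ltW.
  rewrite expRD -expr2; apply: lerXn2r; rewrite ?nnegrE ?expR_ge0 //.
  by apply: le_trans (expR_ge1Dx _); lra.
have {}E5 := le_trans E2 E5.
apply: le_trans (_ : d / (L / 10) ^+ 2 <= _).
  by rewrite ler_wpM2l ?lef_pV2 ?posrE //; [lra|apply: lt_le_trans E5].
have -> : d / (L / 10) ^+ 2 = 100 * (d / L) / L by field; exact: lt0r_neq0.
rewrite ler_wpM2r ?invr_ge0 ?(ltW L0) //.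
have : d / L <= 4 / 10 by rewrite ler_pdivrMr.
lra.
Qed.

(** Large d is [mean_sparse]; on the bounded range the limit is at least e^(- 2 D), so uniform
    convergence gives a relative error. *)
Lemma mean_close eps : 0 < eps <= 1 -> exists M : nat, forall d n, (M <= n)%N ->
  20 <= d -> d <= 4 / 10 * ln n%:R -> `|mean d n - limn (mean d)| <= eps * limn (mean d).
Proof.
move=> e01; have [e0 e1] := andP e01; have [D D20 [_ H]] := mean_sparse e01.
have w0 : 0 < eps * expR (- (2 * D)) by rewrite mulr_gt0 // expR_gt0.
have [M HM] := @mean_uniform R 20 D _ (ltr0n R 20) w0.
exists M => d n nM d20 dl; have [_ nd _ _ _] := log_bounds d20 dl.
case: (leP D d) => Dd; first exact: H.
apply: le_trans (HM d n nM _) _; first by rewrite d20 ltW.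
rewrite ler_wpM2l ?(ltW e0) //; have d0 : 0 < d by lra.
by apply: le_trans (lim_mean_ge d0); rewrite ler_expR; lra.
Qed.

(** The variance over (f n)^2 is O(d / (n e^-2d)) with a constant independent of d, which
    [log_bounds] makes O(1 / log n). *)
Lemma mu_whp eps delta : 0 < eps -> 0 < delta -> exists M : nat, forall d n, (M <= n)%N ->
  20 <= d -> d <= 4 / 10 * ln n%:R -> 1 - delta <= Pr (d / n%:R) (vpairs 'I_n)
    (fun E => `|(mu E)%:R - limn (mean d) * n%:R| <= eps * (limn (mean d) * n%:R)).
Proof.
move=> eps0 delta0; have [c c0 fc] := lim_mean_lower.
have [e [e01 e2]] : exists e : R, 0 < e <= 1 /\ 2 * e <= eps.
  by case: (leP eps 1) => h; [exists (eps / 2)|exists (1 / 2)]; split; try (apply/andP; split); lra.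
have [e0 e1] := andP e01; have [M HM] := mean_close e01.
pose B := 20 / (e ^+ 2 * c ^+ 2).
have B0 : 0 <= B by rewrite divr_ge0 // mulr_ge0 ?exprn_ge0 // ltW.
have [M1 M10 HM1] := ex_nat_ge (expR (B / delta)).
exists (M + M1)%N => d n nM d20 dl; have [n3 _ dn L0 dL] := log_bounds d20 dl.
have n0 : 0 < n%:R :> R by rewrite ltr0n; apply: leq_trans n3.
have d0 : 0 < d by lra.
have dn' : 0 <= d <= n%:R by rewrite (ltW d0).
have p01 : 0 <= d / n%:R <= 1 by rewrite divr_ge0 ?(ltW n0) ?(ltW d0) //= ler_pdivrMr // mul1r.
have {}HM := HM d n (leq_trans (leq_addr _ _) nM) d20 dl.
have := fc d d20; move: HM; set f : R := limn (mean d) => HM fy.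
have y0 := expR_gt0 (- d).
have f0 : 0 < f by apply: lt_le_trans fy; rewrite mulr_gt0.
have t0 : 0 < e * f by rewrite mulr_gt0.
have C := mu_concentrated n3 dn' t0.
have CB : d / (2 * (e * f) ^+ 2 * n%:R) <= delta.
  apply: le_trans (_ : d / (2 * (e * (c * expR (- d))) ^+ 2 * n%:R) <= _).
    have q0 : 0 < e * (c * expR (- d)) by rewrite mulr_gt0 // mulr_gt0.
    rewrite ler_wpM2l ?(ltW d0) // lef_pV2 ?posrE; last first.
    - by rewrite mulr_gt0 // mulr_gt0 // exprn_gt0.
    - by rewrite mulr_gt0 // mulr_gt0 // exprn_gt0.
    rewrite ler_wpM2r ?(ltW n0) // ler_wpM2l //; apply: lerXn2r; rewrite ?nnegrE ?(ltW q0) ?(ltW t0) //.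
    by rewrite ler_wpM2l // ltW.
  have -> : d / (2 * (e * (c * expR (- d))) ^+ 2 * n%:R) = B / 40 * (d / (n%:R * expR (- d) ^+ 2)).
    by rewrite /B; field; rewrite !lt0r_neq0.
  apply: le_trans (_ : B / 40 * (40 / ln n%:R) <= _); first by rewrite ler_wpM2l // divr_ge0.
  have -> : B / 40 * (40 / ln n%:R) = B / ln n%:R by field; rewrite lt0r_neq0.
  rewrite ler_pdivrMr // mulrC -ler_pdivrMr // -[leLHS]expRK ler_ln ?posrE ?expR_gt0 //.
  by apply: le_trans HM1 _; rewrite ler_nat; apply: leq_trans nM; apply: leq_addl.
have {C}C := le_trans C CB.
rewrite lerBlDr; apply: (@le_trans _ _ (Pr (d / n%:R) (vpairs 'I_n) (fun=> true))).
  by rewrite /Pr Ex_cst.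
apply: le_trans (_ : _ <= Pr (d / n%:R) (vpairs 'I_n) (fun E => `|(mu E)%:R - f * n%:R| <= eps * (f * n%:R)) +
  Pr (d / n%:R) (vpairs 'I_n) (fun E => e * f * n%:R <= `|(mu E)%:R - mean d n * n%:R|)) _; last by rewrite lerD2l.
apply: le_trans (Pr_or _ _ _ p01); apply: le_Pr => // E _ _.
case: (leP (e * f * n%:R) _) => h; rewrite ?orbT // orbF.
have -> : (mu E)%:R - f * n%:R = ((mu E)%:R - mean d n * n%:R) + (mean d n - f) * n%:R by ring.
apply: le_trans (ler_normD _ _) _; rewrite normrM [`|n%:R|]ger0_norm ?(ltW n0) //.
have A : `|mean d n - f| * n%:R <= e * f * n%:R by rewrite ler_wpM2r // ltW.
have Q : 0 < f * n%:R by rewrite mulr_gt0.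
apply: le_trans (_ : 2 * e * (f * n%:R) <= _); last by rewrite ler_wpM2r // ltW.
by move: A h; rewrite -2!mulrA; move: (f * n%:R) => z; move: (`|_| * n%:R) (`|(mu E)%:R - _|) => a b; lra.
Qed.

End Concentration.

From mathcomp Require Import all_classical all_reals all_analysis.

Import numFieldNormedType.Exports.
Local Open Scope classical_set_scope.
Local Open Scope ring_scope.

Theorem theorem1 (R : realType) :
  exists f : R -> R,
    [/\ forall d : R, 0 < d -> 0 <= f d <= 1,
        exists2 C : R, 0 < C & \forall d \near +oo,
          `|f d - (1 / 2 * d * expR (- d) + expR (- d)
                   + (1 / 12 * d ^+ 6 + 1 / 4 * d ^+ 5
                      + 1 / 4 * d ^+ 4 + 1 / 12 * d ^+ 3) * expR (- (3 * d)))|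
          <= C * `|d ^+ 12 * expR (- (4 * d))|
      & forall p : nat -> R,
          (\forall n \near \oo, 20 <= n%:R * p n <= 4 / 10 * ln n%:R) ->
          forall eps : R, 0 < eps ->
            gnp_prob (p n)
              (fun G : sgraph 'I_n =>
                 `|(completion_number G)%:R - f (n%:R * p n) * n%:R|
                   <= eps * (f (n%:R * p n) * n%:R))
            @[n --> \oo] --> (1 : R)].
Proof.
(* By [cvg_mean] this is a genuine limit for every d > 0; for other d [limn] may be a default value,
   about which nothing is claimed. *)
exists (fun d => limn (mean d)); split.
- exact: lim_mean_01.
- have [C C0 [D _ H]] := mean_expansion R; exists C => //.
  exists D; split; first exact: num_real.
  move=> d /ltW Dd /=.
  have e3 : expR (- (3 * d)) = expR (- d) ^+ 3 by rewrite -mulrN expRM_natl.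
  have e4 : expR (- (4 * d)) = expR (- d) ^+ 4 by rewrite -mulrN expRM_natl.
  rewrite e3 e4; apply: le_trans (_ : C * (d ^+ 12 * expR (- d) ^+ 4) <= _).
    apply: le_trans (H d Dd); rewrite le_eqVlt; apply/orP; left; apply/eqP; congr `|_ - _|.
    by rewrite /main_term; field.
  by rewrite ler_wpM2l ?(ltW C0) // ler_norm.
- move=> p [N _ HN] eps eps0; apply/cvgrPdist_le => delta delta0.
  have [M HM] := mu_whp eps0 delta0.
  apply: (near_infty_ge (N := (M + N)%N)) => n nM.
  have /andP[d20 dl] : 20 <= n%:R * p n <= 4 / 10 * ln n%:R by apply: HN; rewrite /= (leq_trans _ nM) // leq_addl.
  have [n3 _ dn _ _] := log_bounds d20 dl.
  have n0 : 0 < n%:R :> R by rewrite ltr0n; apply: leq_trans n3.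
  have pE : n%:R * p n / n%:R = p n by rewrite mulrC mulKf // lt0r_neq0.
  have := HM _ n (leq_trans (leq_addr _ _) nM) d20 dl; rewrite pE => H.
  have p01 : 0 <= p n <= 1.
    by rewrite -pE ler_pdivrMr // mul1r dn divr_ge0 // ?(ltW n0) // (le_trans _ d20).
  rewrite gnp_prob_Pr ger0_norm ?subr_ge0 ?Pr_le1 // lerBlDr addrC -lerBlDr.
  apply: le_trans H _; apply: le_Pr => // E sE; rewrite /mu.
  by case: insubP => [G _ _ //|]; rewrite sE.
Qed.
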